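(* Let $F$ be a number field with ring of integers $R$, $G$ a finite flat commutative group scheme over $\mathrm{Spec}(R)$, $\mathfrak A=\mathcal O_{G^*}$, and $\overline\psi:H^1(\mathrm{Spec}(R),G)\to\overline K_0(\mathfrak A,R^c)$ the class map. (i) The image of $\overline\psi$ lies in the subgroup $P\overline K_0(\mathfrak A,R^c)$ of primitive elements of $\overline K_0(\mathfrak A,R^c)$. (ii) If the composition series of every geometric fibre of $G\to\mathrm{Spec}(R)$ of residue characteristic $2$ does not contain a factor of local-local type, then the image of $\overline\psi$ is equal to $P\overline K_0(\mathfrak A,R^c)$.
   Context: $G^*$ is the Cartier dual, $A=\mathfrak A\otimes_RF$, $\Gamma=G(F^c)$ (so $A\otimes_FF^c=F^c[\Gamma]$), $R^c$ the integral closure of $R$ in $F^c$. Relative $K$-groups $K_0(\mathfrak A,\Lambda)$ are generated by $[L_1,L_2;\lambda]$ ($L_i$ f.g. projective $\mathfrak A$-modules, $\lambda:L_1\otimes_R\Lambda\cong L_2\otimes_R\Lambda$) modulo exact-sequence and composition relations. With $J_f(A)$ the restricted product of the $A_v^\times$ with respect to $\mathfrak M_v^\times$ ($\mathfrak M$ the maximal $R$-order of $A$), $U_f(\mathfrak A)=\prod_v\mathfrak A_v^\times$, one has a natural isomorphism $K_0(\mathfrak A,F^c)\cong(J_f(A)/U_f(\mathfrak A)\times(A\otimes_FF^c)^\times)/\{(a,a^{-1}):a\in A^\times\}$; $\overline K_0(\mathfrak A,F^c)$ is the quotient obtained by further dividing the second factor by $\Gamma$, and $\overline K_0(\mathfrak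 A,R^c)$ is the image of $K_0(\mathfrak A,R^c)$ in it under scalar extension followed by projection. For a $G$-torsor $\pi:X\to\mathrm{Spec}R$, $\mathcal L_\pi=\mathcal M_\pi\otimes\mathcal M_{\pi_0}^{-1}$ where $\mathcal M_\pi$ is $\mathcal O_X$ viewed as an invertible $\mathfrak A$-module (via its $\mathcal O_G$-comodule structure) and $\pi_0$ is the trivial torsor; a trivialisation $X\otimes_RR^c\cong G\otimes_RR^c$ induces $\xi_\pi:\mathcal L_\pi\otimes_RR^c\cong\mathfrak A\otimes_RR^c$, and $\overline\psi(\pi)$ is the class of $[\mathcal L_\pi,\mathfrak A;\xi_\pi]$ in $\overline K_0(\mathfrak A,R^c)$ (independent of choices). The same constructions apply to the Hopf algebra $\mathfrak A\otimes_R\mathfrak A=\mathcal O_{(G\times G)^*}$ (with $\Gamma\times\Gamma$ in place of $\Gamma$), and an $R$-algebra homomorphism $f:\mathfrak A\to\mathfrak B$ of such Hopf algebras induces $f_*:[L_1,L_2;\lambda]\mapsto[\mathfrak B\otimes_{\mathfrak A}L_1,\mathfrak B\otimes_{\mathfrak A}L_2;1\otimes\lambda]$ on these groups. An element $y\in\overline K_0(\mathfrak A,R^c)$ is primitive if $\Delta_*(y)=(i_1)_*(y)+(i_2)_*(y)$ in $\overline K_0(\mathfrak A\otimes_R\mathfrak A,R^c)$, where $\Delta$ is the comultiplication and $i_1(a)=a\otimes1$, $i_2(a)=1\otimes a$. *)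

(* Defs.v *)
From Stdlib Require List.
From HB Require Import structures.
From mathcomp Require Import all_boot all_order all_algebra all_field.
From mathcomp Require Import boolp functions.

Set Implicit Arguments.
Unset Strict Implicit.
Unset Printing Implicit Defensive.

Import GRing.Theory.
Local Open Scope ring_scope.
Local Open Scope quotient_scope.

Section Tensor.
Variables (R : comPzRingType) (M N : lmodType R).

Record balanced (P : zmodType) (f : M -> N -> P) : Prop := Balanced {
  balancedDl : forall x x' y, f (x + x') y = f x y + f x' y;
  balancedDr : forall x y y', f x (y + y') = f x y + f x y';
  balancedZ : forall r x y, f (r *: x) y = f x (r *: y) }.

Definition tsum (P : zmodType) (f : M -> N -> P) (s : seq (M * N)) : P :=
  \sum_(p <- s) f p.1 p.2.

(* Finite sums of pure tensors are identified when no balanced map separates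
   them, i.e. modulo the kernel of Z[M x N] -> M (x) N. *)
Definition tequiv (s t : seq (M * N)) : bool :=
  `[< forall (P : zmodType) (f : M -> N -> P),
        balanced f -> tsum f s = tsum f t >].

Lemma tequiv_refl : reflexive tequiv.
Proof. by move=> s; apply/asboolP. Qed.

Lemma tequiv_sym : symmetric tequiv.
Proof. by move=> s t; apply/asboolP/asboolP => H P f /H. Qed.

Lemma tequiv_trans : transitive tequiv.
Proof.
move=> t s u /asboolP H /asboolP H'; apply/asboolP => P f hf.
by rewrite H // H'.
Qed.

Canonical tequiv_rel := EquivRel tequiv tequiv_refl tequiv_sym tequiv_trans.

Definition tensor := {eq_quot tequiv}.
HB.instance Definition _ : EqQuotient _ tequiv tensor := EqQuotient.on tensor.
HB.instance Definition _ := Choice.on tensor.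

Definition tlift (P : zmodType) (f : M -> N -> P) (t : tensor) : P :=
  tsum f (repr t).

Lemma tlift_pi (P : zmodType) (f : M -> N -> P) s :
  balanced f -> tlift f (\pi_tensor s) = tsum f s.
Proof.
move=> hf; rewrite /tlift; have : tequiv (repr (\pi_tensor s)) s.
  by apply/eqmodP; rewrite reprK.
by move=> /asboolP; apply.
Qed.

Lemma tensorP (s t : tensor) :
  (forall (P : zmodType) (f : M -> N -> P),
     balanced f -> tlift f s = tlift f t) -> s = t.
Proof.
move=> H; rewrite -[s]reprK -[t]reprK; apply/eqmodP/asboolP.
by move=> P f /H.
Qed.

Lemma tlift_ext (P : zmodType) (f g : M -> N -> P) t :
  (forall x y, f x y = g x y) -> tlift f t = tlift g t.
Proof. by move=> fg; apply: eq_bigr. Qed.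

Lemma balanced0l (P : zmodType) (f : M -> N -> P) y : balanced f -> f 0 y = 0.
Proof. by move=> hf; apply: (addIr (f 0 y)); rewrite -(balancedDl hf) !add0r. Qed.

Lemma balancedNl (P : zmodType) (f : M -> N -> P) x y :
  balanced f -> f (- x) y = - f x y.
Proof.
move=> hf; apply/eqP; rewrite -addr_eq0 -(balancedDl hf) addNr.
by rewrite balanced0l.
Qed.

Definition tzero : tensor := \pi_tensor [::].
Definition tadd (s t : tensor) : tensor := \pi_tensor (repr s ++ repr t).
Definition topp (s : tensor) : tensor :=
  \pi_tensor [seq (- p.1, p.2) | p <- repr s].
Definition tscale (r : R) (s : tensor) : tensor :=
  \pi_tensor [seq (r *: p.1, p.2) | p <- repr s].

Lemma tlift_zero (P : zmodType) (f : M -> N -> P) :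
  balanced f -> tlift f tzero = 0.
Proof. by move=> hf; rewrite tlift_pi // /tsum big_nil. Qed.

Lemma tlift_add (P : zmodType) (f : M -> N -> P) s t :
  balanced f -> tlift f (tadd s t) = tlift f s + tlift f t.
Proof. by move=> hf; rewrite tlift_pi // /tsum big_cat. Qed.

Lemma tlift_opp (P : zmodType) (f : M -> N -> P) s :
  balanced f -> tlift f (topp s) = - tlift f s.
Proof.
move=> hf; rewrite tlift_pi // /tsum big_map /tlift /tsum -sumrN.
by apply: eq_bigr => p _; rewrite balancedNl.
Qed.

Lemma tlift_scale (P : zmodType) (f : M -> N -> P) r s :
  balanced f -> tlift f (tscale r s) = tlift (fun x y => f (r *: x) y) s.
Proof. by move=> hf; rewrite tlift_pi // /tsum big_map. Qed.

Lemma balanced_scale (P : zmodType) (f : M -> N -> P) r :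
  balanced f -> balanced (fun x y => f (r *: x) y).
Proof.
move=> hf; split=> [x x' y|x y y'|a x y].
- by rewrite scalerDr (balancedDl hf).
- by rewrite (balancedDr hf).
- by rewrite scalerA mulrC -scalerA (balancedZ hf).
Qed.

Lemma taddA : associative tadd.
Proof. by move=> s t u; apply: tensorP => P f hf; rewrite !tlift_add // addrA. Qed.
Lemma taddC : commutative tadd.
Proof. by move=> s t; apply: tensorP => P f hf; rewrite !tlift_add // addrC. Qed.
Lemma tadd0 : left_id tzero tadd.
Proof.
by move=> s; apply: tensorP => P f hf; rewrite tlift_add // tlift_zero ?add0r.
Qed.
Lemma taddN : left_inverse tzero topp tadd.
Proof.
move=> s; apply: tensorP => P f hf.
by rewrite tlift_add // tlift_opp // tlift_zero ?addNr.
Qed.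

HB.instance Definition _ := GRing.isZmodule.Build tensor taddA taddC tadd0 taddN.

Lemma tscaleA a b v : tscale a (tscale b v) = tscale (a * b) v.
Proof.
apply: tensorP => P f hf; rewrite !tlift_scale //; last exact: balanced_scale.
by apply: tlift_ext => x y; rewrite scalerA.
Qed.
Lemma tscale1 : left_id 1 tscale.
Proof.
move=> v; apply: tensorP => P f hf; rewrite !tlift_scale //.
by apply: tlift_ext => x y; rewrite scale1r.
Qed.
Lemma tscaleDr : right_distributive tscale +%R.
Proof.
move=> a u v; apply: tensorP => P f hf.
by rewrite !(tlift_scale, tlift_add) //; exact: balanced_scale.
Qed.
Lemma tscaleDl v : {morph tscale^~ v : a b / a + b}.
Proof.
move=> a b; apply: tensorP => P f hf.
rewrite tlift_add // !tlift_scale // /tlift /tsum -big_split.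
by apply: eq_bigr => p _; rewrite scalerDl (balancedDl hf).
Qed.

HB.instance Definition _ :=
  GRing.Zmodule_isLmodule.Build R tensor tscaleA tscale1 tscaleDr tscaleDl.

Definition tpure (x : M) (y : N) : tensor := \pi_tensor [:: (x, y)].

Lemma tliftE (P : zmodType) (f : M -> N -> P) x y :
  balanced f -> tlift f (tpure x y) = f x y.
Proof. by move=> hf; rewrite tlift_pi // /tsum big_seq1. Qed.

Lemma tlift0 (P : zmodType) (f : M -> N -> P) : balanced f -> tlift f 0 = 0.
Proof. exact: tlift_zero. Qed.

Lemma tliftD (P : zmodType) (f : M -> N -> P) s t :
  balanced f -> tlift f (s + t) = tlift f s + tlift f t.
Proof. exact: tlift_add. Qed.

Lemma tliftZ (P : zmodType) (f : M -> N -> P) r s :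
  balanced f -> tlift f (r *: s) = tlift (fun x y => f (r *: x) y) s.
Proof. exact: tlift_scale. Qed.

Lemma tpure_balanced : balanced tpure.
Proof.
split=> [x x' y|x y y'|r x y]; apply: tensorP => P f hf;
  rewrite ?tliftD // !tliftE //.
- exact: balancedDl.
- exact: balancedDr.
- exact: balancedZ.
Qed.

Lemma tpureZ r x y : r *: tpure x y = tpure (r *: x) y.
Proof.
apply: tensorP => P f hf; rewrite tliftZ // !tliftE //.
exact: balanced_scale.
Qed.

Lemma tensor_ind (P : tensor -> Prop) :
  P 0 -> (forall x y t, P t -> P (tpure x y + t)) -> forall t, P t.
Proof.
move=> P0 PS t; suff -> : t = \sum_(p <- repr t) tpure p.1 p.2.
  by elim: (repr t) => [|p s IH]; rewrite ?big_nil ?big_cons //; apply: PS.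
apply: tensorP => Q f hf; rewrite /tlift.
elim: (repr t) => [|p s IH].
  by rewrite /tsum !big_nil -[RHS]/(tlift f 0) tlift0.
rewrite /tsum !big_cons -[RHS]/(tlift f _) tliftD // tliftE //; congr (_ + _).
exact: IH.
Qed.

Lemma tlift_uniq (P : zmodType) (f g : tensor -> P) :
  f 0 = g 0 -> (forall s t, f (s + t) = f s + f t) ->
  (forall s t, g (s + t) = g s + g t) ->
  (forall x y, f (tpure x y) = g (tpure x y)) -> f =1 g.
Proof.
move=> fg0 fD gD fgE; apply: tensor_ind => // x y t IH.
by rewrite fD gD fgE IH.
Qed.

End Tensor.

Definition restr (S T : comPzRingType) (phi : {rmorphism S -> T})
  (L : lmodType T) : Type := L.

Section Restriction.
Variables (S T : comPzRingType) (phi : {rmorphism S -> T}) (L : lmodType T).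
Local Notation restr := (restr phi L).

HB.instance Definition _ := GRing.Zmodule.copy restr L.

Definition restr_scale (s : S) (x : restr) : restr := phi s *: (x : L).

Lemma restr_scaleA a b v : restr_scale a (restr_scale b v) = restr_scale (a * b) v.
Proof. by rewrite /restr_scale scalerA rmorphM. Qed.
Lemma restr_scale1 : left_id 1 restr_scale.
Proof. by move=> v; rewrite /restr_scale rmorph1 scale1r. Qed.
Lemma restr_scaleDr : right_distributive restr_scale +%R.
Proof. by move=> a u v; apply: scalerDr. Qed.
Lemma restr_scaleDl v : {morph restr_scale^~ v : a b / a + b}.
Proof. by move=> a b; rewrite /restr_scale rmorphD scalerDl. Qed.

HB.instance Definition _ := GRing.Zmodule_isLmodule.Build S restr
  restr_scaleA restr_scale1 restr_scaleDr restr_scaleDl.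

End Restriction.

Record algebra (R : comPzRingType) := Algebra {
  alg_ring :> comPzRingType;
  alg_str : {rmorphism R -> alg_ring} }.

Definition base_algebra (R : comPzRingType) : algebra R := Algebra (@idfun R).

Record alghom (R : comPzRingType) (A B : algebra R) := AlgHom {
  alghom_fun :> {rmorphism A -> B};
  alghom_str : forall r, alghom_fun (alg_str A r) = alg_str B r }.

Definition amod (R : comPzRingType) (A : algebra R) : lmodType R :=
  restr (alg_str A) A^o.

Definition atensor_type (R : comPzRingType) (A B : algebra R) : Type :=
  tensor (amod A) (amod B).

Section AlgTensor.
Variables (R : comPzRingType) (A B : algebra R).
Local Notation AB := (atensor_type A B).

HB.instance Definition _ := GRing.Zmodule.copy AB (tensor (amod A) (amod B)).

Definition aT (x : A) (y : B) : AB := tpure (x : amod A) (y : amod B).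

Definition amul_fun (P : Type) (f : A -> B -> P) (a : A) (b : B) x y : P :=
  f (a * x) (b * y).

Lemma balanced_amul (P : zmodType) (f : A -> B -> P) a b :
  balanced (f : amod A -> amod B -> P) ->
  balanced (amul_fun f a b : amod A -> amod B -> P).
Proof.
move=> hf; split=> [x x' y|x y y'|r x y]; rewrite /amul_fun.
- by rewrite mulrDr (balancedDl hf).
- by rewrite mulrDr (balancedDr hf).
- transitivity (f (r *: (a * x : amod A) : amod A) (b * y)).
    by congr (f _ _); apply: mulrCA.
  rewrite (balancedZ hf); congr (f _ _); exact: mulrCA.
Qed.

Lemma balanced_amulC (P : zmodType) (f : A -> B -> P) t :
  balanced (f : amod A -> amod B -> P) ->
  balanced ((fun x y => tlift (amul_fun f x y : amod A -> amod B -> P) t)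
     : amod A -> amod B -> P).
Proof.
move=> hf; split=> [x x' y|x y y'|r x y]; rewrite /tlift /tsum -?big_split;
  apply: eq_bigr => p _; rewrite /amul_fun ?mulrDl.
- exact: (balancedDl hf).
- exact: (balancedDr hf).
- transitivity (f (r *: (x * p.1 : amod A) : amod A) (y * p.2)).
    by congr (f _ _); rewrite /= -[RHS]/(_ * _) mulrA.
  by rewrite (balancedZ hf); congr (f _ _); rewrite /= -[LHS]/(_ * _) mulrA.
Qed.

Definition tone : AB := aT 1 1.
Definition tmul (s t : AB) : AB := \pi_(tensor (amod A) (amod B))
  [seq ((p.1 : A) * q.1, (p.2 : B) * q.2) | p <- repr s, q <- repr t].

Lemma tlift_mul (P : zmodType) (f : A -> B -> P) (s t : AB) :
  balanced (f : amod A -> amod B -> P) ->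
  tlift (f : amod A -> amod B -> P) (tmul s t) =
  tlift ((fun x y => tlift (amul_fun f x y : amod A -> amod B -> P) t)
     : amod A -> amod B -> P) s.
Proof. by move=> hf; rewrite tlift_pi // /tsum big_allpairs_dep. Qed.

Lemma tmulA : associative tmul.
Proof.
move=> s t u; apply: tensorP => P f hf.
rewrite !tlift_mul //; last exact: balanced_amulC.
apply: tlift_ext => x y; rewrite tlift_mul; last exact: balanced_amul.
apply: tlift_ext => x' y'; apply: tlift_ext => x'' y''.
by rewrite /amul_fun !mulrA.
Qed.

Lemma tmulC : commutative tmul.
Proof.
move=> s t; apply: tensorP => P f hf; rewrite !tlift_mul //.
rewrite /tlift /tsum exchange_big; apply: eq_bigr => p _; apply: eq_bigr => q _.
by rewrite /amul_fun mulrC [X in f _ X]mulrC.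
Qed.

Lemma tmul1 : left_id tone tmul.
Proof.
move=> s; apply: tensorP => P f hf; rewrite tlift_mul // tliftE.
  by apply: tlift_ext => x y; rewrite /amul_fun !mul1r.
exact: balanced_amulC.
Qed.

Lemma tmulDl : left_distributive tmul +%R.
Proof.
move=> s t u; apply: tensorP => P f hf.
rewrite tliftD // !tlift_mul // tliftD //; exact: balanced_amulC.
Qed.

HB.instance Definition _ :=
  GRing.Zmodule_isComPzRing.Build AB tmulA tmulC tmul1 tmulDl.

Lemma aT_balanced : balanced (aT : amod A -> amod B -> AB).
Proof. exact: tpure_balanced. Qed.

Lemma aTM x y x' y' : aT x y * aT x' y' = aT (x * x') (y * y').
Proof.
apply: tensorP => P f hf; rewrite tlift_mul // !tliftE //.
- exact: balanced_amul.
- exact: balanced_amulC.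
Qed.

Definition tinl_fun (x : A) : AB := aT x 1.
Lemma tinl_add : zmod_morphism tinl_fun.
Proof.
move=> x y; apply/eqP; rewrite eq_sym subr_eq -(balancedDl aT_balanced).
by rewrite -[(x - y : amod A) + _]/((x - y) + y : A) subrK.
Qed.
Lemma tinl_mul : monoid_morphism tinl_fun.
Proof. by split=> // x y; rewrite /tinl_fun aTM mulr1. Qed.
HB.instance Definition _ := GRing.isZmodMorphism.Build A AB tinl_fun tinl_add.
HB.instance Definition _ := GRing.isMonoidMorphism.Build A AB tinl_fun tinl_mul.

Definition tinr_fun (y : B) : AB := aT 1 y.
Lemma tinr_add : zmod_morphism tinr_fun.
Proof.
move=> x y; apply/eqP; rewrite eq_sym subr_eq -(balancedDr aT_balanced).
by rewrite -[(x - y : amod B) + _]/((x - y) + y : B) subrK.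
Qed.
Lemma tinr_mul : monoid_morphism tinr_fun.
Proof. by split=> // x y; rewrite /tinr_fun aTM mulr1. Qed.
HB.instance Definition _ := GRing.isZmodMorphism.Build B AB tinr_fun tinr_add.
HB.instance Definition _ := GRing.isMonoidMorphism.Build B AB tinr_fun tinr_mul.

Definition atensor : algebra R :=
  Algebra (tinl_fun \o alg_str A : {rmorphism R -> AB}).

Lemma aT_str r : alg_str atensor r = aT 1 (alg_str B r).
Proof.
have := balancedZ aT_balanced r (1 : A) (1 : B).
by rewrite /GRing.scale /= /restr_scale /GRing.scale /= !mulr1.
Qed.

Definition tinl : alghom A atensor :=
  AlgHom (alghom_fun := tinl_fun : {rmorphism A -> atensor}) (fun=> erefl).
Definition tinr : alghom B atensor :=
  AlgHom (alghom_fun := tinr_fun : {rmorphism B -> atensor})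
    (fun r => esym (aT_str r)).

End AlgTensor.

Notation "A \*A B" := (atensor A B) (at level 40, left associativity).

Section AlgMaps.
Variable R : comPzRingType.
Implicit Types A B C D P : algebra R.

Definition aid A : alghom A A :=
  AlgHom (alghom_fun := @idfun A : {rmorphism A -> A}) (fun=> erefl).

Lemma acomp_str A B C (g : alghom B C) (f : alghom A B) r :
  (g \o f) (alg_str A r) = alg_str C r.
Proof. by rewrite /= !alghom_str. Qed.

Definition acomp A B C (g : alghom B C) (f : alghom A B) : alghom A C :=
  AlgHom (alghom_fun := g \o f : {rmorphism A -> C}) (acomp_str g f).

Definition astr A : alghom (base_algebra R) A :=
  AlgHom (A := base_algebra R) (alghom_fun := alg_str A) (fun=> erefl).

Record rlinear A P (u : A -> P) : Prop := RLinear {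
  rlinearD : forall x y, u (x + y) = u x + u y;
  rlinearZ : forall r x, u (alg_str A r * x) = alg_str P r * u x }.

Lemma alghom_rlinear A P (u : alghom A P) : rlinear u.
Proof. by split=> [x y|r x]; rewrite ?rmorphD ?rmorphM ?alghom_str. Qed.

Definition copair A B P (u : A -> P) (v : B -> P) : A \*A B -> P :=
  tlift ((fun x y => u x * v y) : amod A -> amod B -> P).

Lemma copair_balanced A B P (u : A -> P) (v : B -> P) :
  rlinear u -> rlinear v ->
  balanced ((fun x y => u x * v y) : amod A -> amod B -> P).
Proof.
move=> hu hv; split=> [x x' y|x y y'|r x y].
- by rewrite (rlinearD hu) mulrDl.
- by rewrite (rlinearD hv) mulrDr.
- rewrite -[u _]/(u (alg_str A r * x)) -[v _ in RHS]/(v (alg_str B r * y)).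
  by rewrite (rlinearZ hu) (rlinearZ hv) mulrCA mulrA.
Qed.

Lemma copairE A B P (u : A -> P) (v : B -> P) a b :
  rlinear u -> rlinear v -> copair u v (aT a b) = u a * v b.
Proof. by move=> hu hv; rewrite /copair tliftE //; apply: copair_balanced. Qed.

Lemma copairD A B P (u : A -> P) (v : B -> P) s t :
  rlinear u -> rlinear v ->
  copair u v (s + t) = copair u v s + copair u v t.
Proof. by move=> hu hv; rewrite /copair tliftD //; apply: copair_balanced. Qed.

Lemma copair0 A B P (u : A -> P) (v : B -> P) :
  rlinear u -> rlinear v -> copair u v 0 = 0.
Proof. by move=> hu hv; rewrite /copair tlift0 //; apply: copair_balanced. Qed.

Lemma copairB A B P (u : A -> P) (v : B -> P) :
  rlinear u -> rlinear v -> zmod_morphism (copair u v).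
Proof.
move=> hu hv s t; apply/eqP; rewrite eq_sym subr_eq -copairD //.
by rewrite subrK.
Qed.

Lemma atensor_ind A B (Q : A \*A B -> Prop) :
  Q 0 -> (forall x y t, Q t -> Q (aT x y + t)) -> forall t, Q t.
Proof. exact: (@tensor_ind R (amod A) (amod B) Q). Qed.

Lemma copairM A B P (u : alghom A P) (v : alghom B P) :
  monoid_morphism (copair u v).
Proof.
have hu := alghom_rlinear u; have hv := alghom_rlinear v.
split; first by rewrite copairE // !rmorph1 mulr1.
move=> s t; elim/atensor_ind: s => [|x y s IH].
  by rewrite mul0r copair0 // mul0r.
rewrite mulrDl copairD // IH copairD // mulrDl; congr (_ + _).
clear IH; elim/atensor_ind: t => [|x' y' t IHt]; first by rewrite mulr0 copair0 // mulr0.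
rewrite mulrDr copairD // IHt copairD // mulrDr; congr (_ + _).
by rewrite aTM !copairE // !rmorphM mulrACA.
Qed.

Definition copair_rmorph A B P (u : alghom A P) (v : alghom B P) :
  {rmorphism A \*A B -> P} :=
  HB.pack (copair u v)
    (GRing.isZmodMorphism.Build _ _ (copair u v)
       (copairB (alghom_rlinear u) (alghom_rlinear v)))
    (GRing.isMonoidMorphism.Build _ _ (copair u v) (copairM u v)).

Lemma copair_str A B P (u : alghom A P) (v : alghom B P) r :
  copair_rmorph u v (alg_str (A \*A B) r) = alg_str P r.
Proof.
rewrite -[LHS]/(copair u v (aT (alg_str A r) 1)) copairE ?rmorph1 ?mulr1.
- exact: alghom_str.
- exact: alghom_rlinear.
- exact: alghom_rlinear.
Qed.

Definition acopair A B P (u : alghom A P) (v : alghom B P) :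
  alghom (A \*A B) P := AlgHom (copair_str u v).

Definition amap A B C D (f : alghom A C) (g : alghom B D) :
  alghom (A \*A B) (C \*A D) :=
  acopair (acomp (tinl C D) f) (acomp (tinr C D) g).

Definition aassoc A B C : alghom (A \*A B \*A C) (A \*A (B \*A C)) :=
  acopair
    (acopair (tinl A (B \*A C)) (acomp (tinr A (B \*A C)) (tinl B C)))
    (acomp (tinr A (B \*A C)) (tinr B C)).

Definition aswap A B : alghom (A \*A B) (B \*A A) :=
  acopair (tinr B A) (tinl B A).

Lemma acopairE A B P (u : alghom A P) (v : alghom B P) a b :
  acopair u v (aT a b) = u a * v b.
Proof.
by rewrite -[LHS]/(copair u v _) copairE //; apply: alghom_rlinear.
Qed.

Lemma amapE A B C D (f : alghom A C) (g : alghom B D) a b :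
  amap f g (aT a b) = aT (f a) (g b).
Proof.
rewrite acopairE -[LHS]/(aT (f a) 1 * aT 1 (g b)) aTM.
by rewrite mulr1 mul1r.
Qed.

End AlgMaps.

Section Hom.
Variables (S : comPzRingType) (M N : lmodType S).

Definition hom_pred : {pred (M -> N)} := fun f => `[< linear f >].

Lemma hom_pred_closed : submod_closed hom_pred.
Proof.
split=> [|a f g]; first by apply/asboolP => b x y; rewrite scaler0 addr0.
move=> /asboolP hf /asboolP hg; apply/asboolP => b x y.
rewrite -[LHS]/(a *: f (b *: x + y) + g (b *: x + y)).
rewrite -[RHS]/(b *: (a *: f x + g x) + (a *: f y + g y)).
by rewrite hf hg !scalerDr !scalerA [a * b]mulrC addrACA.
Qed.
HB.instance Definition _ :=
  GRing.isSubmodClosed.Build S (M -> N) hom_pred hom_pred_closed.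

Record hom := Hom { hom_fun :> M -> N; hom_funP : hom_fun \in hom_pred }.
HB.instance Definition _ := [isSub for hom_fun].
HB.instance Definition _ := [Choice of hom by <:].
HB.instance Definition _ := [SubChoice_isSubLmodule of hom by <:].

Lemma hom_linear (f : hom) : linear f.
Proof. by have /asboolP := hom_funP f. Qed.
HB.instance Definition _ (f : hom) :=
  GRing.isLinear.Build S M N *:%R (hom_fun f) (hom_linear f).

Definition mkhom (f : M -> N) (hf : linear f) : hom := Hom (introT (asboolP _) hf).

Lemma homP (f g : hom) : f =1 g -> f = g.
Proof. by move=> fg; apply: val_inj; apply: funext. Qed.

Lemma homDE (f g : hom) x : (f + g) x = f x + g x. Proof. by []. Qed.
Lemma homZE a (f : hom) x : (a *: f) x = a *: f x. Proof. by []. Qed.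

End Hom.

Definition bc (S T : comPzRingType) (phi : {rmorphism S -> T})
  (L : lmodType S) : Type := tensor (restr phi T^o) L.

Section BaseChange.
Variables (S T : comPzRingType) (phi : {rmorphism S -> T}).

Section Module.
Variable L : lmodType S.
Local Notation TL := (bc phi L).

HB.instance Definition _ := GRing.Zmodule.copy TL (tensor (restr phi T^o) L).

Definition bT (t : T) (x : L) : TL := tpure (t : restr phi T^o) x.

Definition bscale_fun (t s : T) (x : L) : TL := bT (t * s) x.

Lemma bT_balanced : balanced (bT : restr phi T^o -> L -> TL).
Proof. exact: tpure_balanced. Qed.

Lemma bTZ s t x : bT (phi s * t) x = bT t (s *: x).
Proof. exact: (balancedZ bT_balanced). Qed.

Lemma bTDl t t' x : bT (t + t') x = bT t x + bT t' x.
Proof. exact: (balancedDl bT_balanced). Qed.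

Lemma bTDr t x x' : bT t (x + x') = bT t x + bT t x'.
Proof. exact: (balancedDr bT_balanced). Qed.

Lemma bscale_balanced t : balanced (bscale_fun t : restr phi T^o -> L -> TL).
Proof.
split=> [s s' x|s x x'|r s x]; rewrite /bscale_fun.
- by rewrite mulrDr bTDl.
- exact: bTDr.
- by rewrite -bTZ; congr (bT _ _); apply: mulrCA.
Qed.

Definition bscale (t : T) (x : TL) : TL :=
  tlift (bscale_fun t : restr phi T^o -> L -> TL) x.

Lemma bscaleE t s x : bscale t (bT s x) = bT (t * s) x.
Proof. exact/tliftE/bscale_balanced. Qed.
Lemma bscale0 t : bscale t 0 = 0.
Proof. exact/tlift0/bscale_balanced. Qed.
Lemma bscaleDr : right_distributive bscale +%R.
Proof. by move=> t x y; apply/tliftD/bscale_balanced. Qed.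

Lemma bc_ind (Q : TL -> Prop) :
  Q 0 -> (forall t x y, Q y -> Q (bT t x + y)) -> forall y, Q y.
Proof. exact: (@tensor_ind S (restr phi T^o) L Q). Qed.

Lemma bscaleA a b v : bscale a (bscale b v) = bscale (a * b) v.
Proof.
elim/bc_ind: v => [|t x y IH]; first by rewrite !bscale0.
by rewrite !bscaleDr IH !bscaleE mulrA.
Qed.
Lemma bscale1 : left_id 1 bscale.
Proof.
move=> v; elim/bc_ind: v => [|t x y IH]; first by rewrite bscale0.
by rewrite bscaleDr IH bscaleE mul1r.
Qed.
Lemma bscaleDl v : {morph bscale^~ v : a b / a + b}.
Proof.
move=> a b; elim/bc_ind: v => [|t x y IH]; first by rewrite !bscale0 addr0.
by rewrite !bscaleDr IH !bscaleE mulrDl bTDl addrACA.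
Qed.
HB.instance Definition _ :=
  GRing.Zmodule_isLmodule.Build T TL bscaleA bscale1 bscaleDr bscaleDl.

Lemma bTE t s x : t *: bT s x = bT (t * s) x.
Proof. exact: bscaleE. Qed.

Lemma bunit_linear :
  linear ((fun x => bT 1 x) : L -> restr phi (TL : lmodType T)).
Proof.
move=> a x y; rewrite -[RHS]/(phi a *: bT 1 x + bT 1 y) bTDr; congr (_ + _).
by rewrite -bTZ bTE.
Qed.

Lemma bc_ext (P : zmodType) (f g : TL -> P) :
  f 0 = g 0 -> (forall s t, f (s + t) = f s + f t) ->
  (forall s t, g (s + t) = g s + g t) ->
  (forall t x, f (bT t x) = g (bT t x)) -> f =1 g.
Proof. exact: (@tlift_uniq S (restr phi T^o) L P). Qed.

Section Lift.
Variables (M : lmodType T) (u : {linear L -> restr phi M}).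

Definition bc_lift_fun : TL -> M :=
  tlift ((fun t x => t *: (u x : M)) : restr phi T^o -> L -> M).

Lemma bc_lift_balanced :
  balanced ((fun t x => t *: (u x : M)) : restr phi T^o -> L -> M).
Proof.
split=> [s s' x|s x x'|r s x].
- exact: scalerDl.
- rewrite raddfD; exact: scalerDr.
- rewrite linearZ -[RHS]/(s *: (phi r *: (u x : M))) scalerA mulrC.
  by rewrite -[RHS]scalerA -[LHS]/((phi r * s) *: (u x : M)) scalerA.
Qed.

Lemma bc_lift_linear : linear bc_lift_fun.
Proof.
move=> a x y; rewrite [LHS](tliftD _ _ bc_lift_balanced); congr (_ + _).
elim/bc_ind: x => [|t x z IH].
  by rewrite scaler0 [LHS](tlift0 bc_lift_balanced)
             [X in a *: X](tlift0 bc_lift_balanced) scaler0.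
rewrite scalerDr [LHS](tliftD _ _ bc_lift_balanced) IH.
rewrite [X in _ = a *: X](tliftD _ _ bc_lift_balanced) scalerDr; congr (_ + _).
rewrite bTE (tliftE _ _ bc_lift_balanced).
by rewrite [X in a *: X](tliftE _ _ bc_lift_balanced) scalerA.
Qed.

Definition bc_lift : {linear TL -> M} :=
  HB.pack bc_lift_fun (GRing.isLinear.Build _ _ _ _ bc_lift_fun bc_lift_linear).

Lemma bc_liftE t x : bc_lift (bT t x) = t *: (u x : M).
Proof. exact: (tliftE _ _ bc_lift_balanced). Qed.

End Lift.
End Module.

Section Map.
Variables (L L' : lmodType S) (u : {linear L -> L'}).

Lemma bcmap_linear :
  linear ((fun x => bT 1 (u x)) : L -> restr phi (bc phi L' : lmodType T)).
Proof. by move=> a x y; rewrite linearP bunit_linear. Qed.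

Definition bcmap : {linear bc phi L -> bc phi L'} :=
  @bc_lift L (bc phi L' : lmodType T)
    (HB.pack (fun x => bT 1 (u x))
       (GRing.isLinear.Build S L (restr phi (bc phi L' : lmodType T)) *:%R
          _ bcmap_linear)).

Lemma bcmapE t x : bcmap (bT t x) = bT t (u x).
Proof. by rewrite bc_liftE /= bTE mulr1. Qed.

End Map.
End BaseChange.

Definition fgproj (S : comPzRingType) (L : lmodType S) : Prop :=
  exists (n : nat) (i : {linear L -> 'rV[S]_n}) (p : {linear 'rV[S]_n -> L}),
    forall x, p (i x) = x.

Definition exact_at (S : comPzRingType) (L M N : lmodType S)
    (u : {linear L -> M}) (v : {linear M -> N}) : Prop :=
  forall y, v y = 0 <-> exists x, u x = y.

Definition short_exact (S : comPzRingType) (L M N : lmodType S)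
    (u : {linear L -> M}) (v : {linear M -> N}) : Prop :=
  [/\ injective u, exact_at u v & forall z, exists y, v y = z].

Definition faithfully_flat (S T : comPzRingType) (phi : {rmorphism S -> T}) :
    Prop :=
  forall (L M N : lmodType S) (u : {linear L -> M}) (v : {linear M -> N}),
    exact_at u v <-> exact_at (bcmap phi u) (bcmap phi v).

(* G = Spec(O); finite flat is read as finite locally free, i.e. O is a finitely
   generated projective R-module (the same thing over a noetherian R). *)
Record gscheme (R : comPzRingType) := GScheme {
  gO :> algebra R;
  gO_fgproj : fgproj (amod gO);
  gmul : alghom gO (gO \*A gO);
  gone : alghom gO (base_algebra R);
  ginv : alghom gO gO;
  gmulA : forall b,
    aassoc gO gO gO (amap gmul (aid gO) (gmul b)) = amap (aid gO) gmul (gmul b);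
  gmul1 : forall b, acopair (acomp (astr gO) gone) (aid gO) (gmul b) = b;
  gmulV : forall b, acopair ginv (aid gO) (gmul b) = alg_str gO (gone b);
  gmulC : forall b, aswap gO gO (gmul b) = gmul b }.

Section Contraction.
Variable R : comPzRingType.
Local Notation k := (base_algebra R).

Lemma copair_rlinear (A B P : algebra R) (u : A -> P) (v : B -> P) :
  rlinear u -> rlinear v -> rlinear (copair u v).
Proof.
move=> hu hv; split=> [s t|r s]; first exact: copairD.
elim/atensor_ind: s => [|x y s IH]; first by rewrite mulr0 copair0 // mulr0.
rewrite mulrDr copairD // IH copairD // mulrDr; congr (_ + _).
rewrite -[alg_str _ r * _]/(aT (alg_str A r) 1 * aT x y) aTM mul1r.
by rewrite !copairE // (rlinearZ hu) mulrA.
Qed.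

Lemma rlinear0 (A P : algebra R) (u : A -> P) : rlinear u -> u 0 = 0.
Proof. by move=> hu; apply: (addIr (u 0)); rewrite -(rlinearD hu) !add0r. Qed.

Lemma rlinear_comp (A B C : algebra R) (f : alghom A B) (u : B -> C) :
  rlinear u -> rlinear (u \o f).
Proof.
move=> hu; split=> [x y|r x] /=; first by rewrite rmorphD (rlinearD hu).
by rewrite rmorphM alghom_str (rlinearZ hu).
Qed.

Lemma rlinear_post (A B C : algebra R) (f : alghom B C) (u : A -> B) :
  rlinear u -> rlinear (f \o u).
Proof.
move=> hu; split=> [x y|r x] /=; first by rewrite (rlinearD hu) rmorphD.
by rewrite (rlinearZ hu) rmorphM alghom_str.
Qed.

Lemma rlinear_id (A : algebra R) : rlinear (fun x : A => x).
Proof. by split. Qed.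

Lemma rlinear_ext (A B P : algebra R) (u v : A \*A B -> P) :
  rlinear u -> rlinear v ->
  (forall x y, u (aT x y) = v (aT x y)) -> u =1 v.
Proof.
move=> hu hv E; elim/atensor_ind => [|x y s IH]; first by rewrite !rlinear0.
by rewrite (rlinearD hu) (rlinearD hv) E IH.
Qed.

Lemma rlinear_mulr (A P : algebra R) (u : A -> P) (c : P) :
  rlinear u -> rlinear (fun x => u x * c).
Proof.
by move=> hu; split=> [x y|r x]; rewrite ?(rlinearD hu) ?(rlinearZ hu)
  ?mulrDl ?mulrA.
Qed.

Lemma copair_assoc (A B C P : algebra R) (f : A -> P) (g : B -> P) (h : C -> P) :
  rlinear f -> rlinear g -> rlinear h -> forall s,
  copair f (copair g h) (aassoc A B C s) = copair (copair f g) h s.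
Proof.
move=> hf hg hh; have hgh := copair_rlinear hg hh.
have hfg := copair_rlinear hf hg.
have hF := copair_rlinear hf hgh.
apply: rlinear_ext.
- exact: (rlinear_comp (aassoc A B C) hF).
- exact: copair_rlinear.
move=> s y; rewrite copairE // [aassoc _ _ _ _]acopairE.
elim/atensor_ind: s => [|a b s IH].
  by rewrite rmorph0 mul0r !rlinear0 // mul0r.
rewrite rmorphD mulrDl (rlinearD hF) IH (rlinearD hfg) mulrDl; congr (_ + _).
rewrite acopairE copairE //.
rewrite -[X in copair f _ X]/(@aT R A (B \*A C) a 1 *
  @aT R A (B \*A C) 1 (@aT R B C b 1) * @aT R A (B \*A C) 1 (@aT R B C 1 y)).
rewrite !aTM.
by rewrite !mulr1 !mul1r !copairE // mulrA.
Qed.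

Lemma copair_amap (A B C D P : algebra R) (f : C -> P) (g : D -> P)
  (u : alghom A C) (v : alghom B D) :
  rlinear f -> rlinear g -> forall s,
  copair f g (amap u v s) = copair (f \o u) (g \o v) s.
Proof.
move=> hf hg.
have hfu := rlinear_comp u hf; have hgv := rlinear_comp v hg.
apply: rlinear_ext.
- by apply: (rlinear_comp (amap u v)); apply: copair_rlinear.
- exact: copair_rlinear.
by move=> x y; rewrite amapE !copairE.
Qed.

Lemma copair_swap (A B P : algebra R) (f : A -> P) (g : B -> P) :
  rlinear f -> rlinear g -> forall s,
  copair g f (aswap A B s) = copair f g s.
Proof.
move=> hf hg; apply: rlinear_ext.
- by apply: (rlinear_comp (aswap A B)); apply: copair_rlinear.
- exact: copair_rlinear.
move=> x y; rewrite acopairE -[X in copair g f X]/(aT 1 x * aT y 1) aTM.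
by rewrite mulr1 mul1r !copairE // mulrC.
Qed.

Lemma hom_rlinear (A : algebra R) (f : hom (amod A) R^o) :
  rlinear (f : A -> k).
Proof.
split=> [x y|r x]; first exact: (raddfD f).
by rewrite -[LHS]/(f (r *: (x : amod A))) linearZ.
Qed.

Lemma rlinear_hom (A : algebra R) (f : A -> k) :
  rlinear f -> linear (f : amod A -> R^o).
Proof.
move=> hf a x y; rewrite -[a *: x]/(alg_str A a * (x : A)).
by rewrite (rlinearD hf) (rlinearZ hf).
Qed.

End Contraction.

Definition cdual_type (R : comPzRingType) (G : gscheme R) : Type :=
  hom (amod G) R^o.

Section CartierDual.
Variables (R : comPzRingType) (G : gscheme R).
Local Notation k := (base_algebra R).
Local Notation GD := (cdual_type G).

HB.instance Definition _ := GRing.Lmodule.copy GD (hom (amod G) R^o).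

Definition dapp (f : GD) : G -> k := f.

Lemma dapp_rlinear (f : GD) : rlinear (dapp f).
Proof. exact: hom_rlinear. Qed.

Lemma dappP (f g : GD) : dapp f =1 dapp g -> f = g.
Proof. exact: (@homP R (amod G) R^o f g). Qed.

Lemma dappD (f g : GD) b : dapp (f + g) b = dapp f b + dapp g b.
Proof. by []. Qed.
Lemma dappZ a (f : GD) b : dapp (a *: f) b = a * dapp f b.
Proof. by []. Qed.
Lemma dapp0 b : dapp 0 b = 0.
Proof. by []. Qed.

Definition conv_fun (f g : GD) : G -> k := copair (dapp f) (dapp g) \o gmul G.

Lemma conv_rlinear f g : rlinear (conv_fun f g).
Proof.
by apply: rlinear_comp; apply: copair_rlinear; apply: dapp_rlinear.
Qed.

Definition conv (f g : GD) : GD := mkhom (rlinear_hom (conv_rlinear f g)).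
Definition dunit : GD := mkhom (rlinear_hom (alghom_rlinear (gone G))).

Lemma convE f g b : dapp (conv f g) b = copair (dapp f) (dapp g) (gmul G b).
Proof. by []. Qed.

Lemma convA : associative conv.
Proof.
move=> f g h; apply: dappP => b; rewrite !convE.
have hf := dapp_rlinear f; have hg := dapp_rlinear g.
have hh := dapp_rlinear h.
have hgh := copair_rlinear hg hh; have hfg := copair_rlinear hf hg.
transitivity (copair (dapp f) (copair (dapp g) (dapp h))
                (amap (aid G) (gmul G) (gmul G b))).
  by rewrite copair_amap.
by rewrite -gmulA copair_assoc // copair_amap.
Qed.

Lemma convC : commutative conv.
Proof.
move=> f g; apply: dappP => b; rewrite !convE -[in RHS]gmulC.
by rewrite copair_swap //; apply: dapp_rlinear.
Qed.

Lemma conv1 : left_id dunit conv.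
Proof.
move=> f; apply: dappP => b; rewrite convE -[in RHS](gmul1 b).
have hf := dapp_rlinear f; have he := alghom_rlinear (gone G).
move: (gmul G b); apply: rlinear_ext.
- exact: copair_rlinear.
- exact: (rlinear_comp (acopair _ _) hf).
move=> x y; rewrite [LHS]copairE //.
rewrite -[RHS]/(dapp f (acopair (acomp (astr G) (gone G)) (aid G) (aT x y))).
by rewrite acopairE [RHS](rlinearZ hf).
Qed.

Lemma convDl : left_distributive conv +%R.
Proof.
move=> f g h; apply: dappP => b; rewrite dappD !convE /copair /tlift /tsum.
by rewrite -big_split; apply: eq_bigr => p _; rewrite dappD mulrDl.
Qed.

HB.instance Definition _ :=
  GRing.Zmodule_isComPzRing.Build GD convA convC conv1 convDl.

Lemma convZl a (f g : GD) : (a *: f) * g = a *: (f * g).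
Proof.
apply: dappP => b; rewrite dappZ !convE /copair /tlift /tsum mulr_sumr.
by apply: eq_bigr => p _; rewrite dappZ mulrA.
Qed.

Definition dstr_fun (r : R) : GD := r *: (1 : GD).
Lemma dstr_add : zmod_morphism dstr_fun.
Proof. by move=> x y; rewrite /dstr_fun scalerBl. Qed.
Lemma dstr_mul : monoid_morphism dstr_fun.
Proof.
split; first exact: scale1r.
by move=> x y; rewrite /dstr_fun convZl mul1r scalerA.
Qed.
HB.instance Definition _ := GRing.isZmodMorphism.Build R GD dstr_fun dstr_add.
HB.instance Definition _ := GRing.isMonoidMorphism.Build R GD dstr_fun dstr_mul.

Definition cdual : algebra R := Algebra (dstr_fun : {rmorphism R -> GD}).

Lemma dstrM r (f : cdual) : alg_str cdual r * f = r *: (f : GD).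
Proof. by rewrite -[LHS]/((r *: (1 : GD)) * f) convZl mul1r. Qed.

Definition deval (b : G) : cdual -> k := dapp^~ b.

Lemma deval_rlinear b : rlinear (deval b).
Proof. by split=> // r f; rewrite dstrM. Qed.

Definition dpair (t : cdual \*A cdual) (b c : G) : k :=
  copair (deval b) (deval c) t.

Lemma dpairE f g b c : dpair (aT f g) b c = dapp f b * dapp g c.
Proof. by rewrite /dpair copairE //; apply: deval_rlinear. Qed.

Lemma dpair_rlinear b c : rlinear (fun t => dpair t b c).
Proof. by apply: copair_rlinear; apply: deval_rlinear. Qed.

Lemma dual_basis : exists n (e : 'I_n -> G) (phi : 'I_n -> GD),
  forall b, b = \sum_i alg_str G (dapp (phi i) b) * e i.
Proof.
have [n [i [p ip]]] := gO_fgproj G.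
have hphi (j : 'I_n) : linear ((fun b => i b 0 j) : amod G -> R^o).
  by move=> a x y; rewrite linearP !mxE.
exists n, (fun j => p (delta_mx 0 j)), (fun j => mkhom (hphi j)) => b.
rewrite -[LHS]ip [i b]row_sum_delta linear_sum.
by apply: eq_bigr => j _; rewrite linearZ.
Qed.

Local Notation aD := (@aT R cdual cdual).

Lemma dual_sum n (e : 'I_n -> G) (phi : 'I_n -> GD) :
  (forall b, b = \sum_i alg_str G (dapp (phi i) b) * e i) ->
  forall f : GD, f = \sum_i alg_str cdual (dapp f (e i)) * phi i.
Proof.
move=> dualP f; apply: dappP => b.
have hf := dapp_rlinear f.
have dsum (F : 'I_n -> GD) : dapp (\sum_i F i) b = \sum_i dapp (F i) b.
  by apply: (big_morph (fun f => dapp f b)).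
have fsum (F : 'I_n -> G) : dapp f (\sum_i F i) = \sum_i dapp f (F i).
  by apply: (big_morph (dapp f) (rlinearD hf) (rlinear0 hf)).
rewrite [b in LHS]dualP fsum dsum; apply: eq_bigr => i _.
by rewrite (rlinearZ hf) dstrM dappZ mulrC.
Qed.

Lemma dpair_inj t t' : (forall b c, dpair t b c = dpair t' b c) -> t = t'.
Proof.
have [n [e [phi dualP]]] := dual_basis.
have exp s : s = \sum_i \sum_j
    alg_str (cdual \*A cdual) (dpair s (e i) (e j)) * aD (phi i) (phi j).
  elim/atensor_ind: s => [|f g s IH].
    rewrite big1 // => i _; rewrite big1 // => j _.
    by rewrite (rlinear0 (dpair_rlinear _ _)) rmorph0 mul0r.
  rewrite {1}IH; have [pf pg] := (dual_sum dualP f, dual_sum dualP g).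
  have E : aD f g = \sum_i \sum_j
      alg_str (cdual \*A cdual) (dpair (aD f g) (e i) (e j)) *
        aD (phi i) (phi j) :> cdual \*A cdual.
    have -> : aD f g = tinl cdual cdual f * tinr cdual cdual g.
      by rewrite -[RHS]/(aD f 1 * aD 1 g) aTM mulr1 mul1r.
    rewrite {1}pf {1}pg !rmorph_sum mulr_suml.
    apply: eq_bigr => i _; rewrite mulr_sumr; apply: eq_bigr => j _.
    have -> : tinl cdual cdual f * tinr cdual cdual g = aD f g.
      by rewrite -[LHS]/(aD f 1 * aD 1 g) aTM mulr1 mul1r.
    rewrite dpairE !rmorphM !alghom_str mulrACA; congr (_ * _).
    by rewrite -[LHS]/(aD (phi i) 1 * aD 1 (phi j)) aTM mulr1 mul1r.
  rewrite {1}E -big_split; apply: eq_bigr => i _; rewrite -big_split.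
  apply: eq_bigr => j _.
  by rewrite (rlinearD (dpair_rlinear (e i) (e j))) rmorphD mulrDl.
move=> E; rewrite (exp t) (exp t'); apply: eq_bigr => i _.
by apply: eq_bigr => j _; rewrite E.
Qed.

Lemma dcomul_exists (f : cdual) :
  exists t, forall b c, dpair t b c = dapp f (b * c).
Proof.
have [n [e [phi dualP]]] := dual_basis; have hf := dapp_rlinear f.
exists (\sum_i \sum_j
    alg_str (cdual \*A cdual) (dapp f (e i * e j)) * aD (phi i) (phi j)) => b c.
have psum (F : 'I_n -> cdual \*A cdual) :
    dpair (\sum_i F i) b c = \sum_i dpair (F i) b c.
  apply: (big_morph (fun t => dpair t b c)).
    exact: (rlinearD (dpair_rlinear b c)).
  exact: (rlinear0 (dpair_rlinear b c)).
have fsum (F : 'I_n -> G) : dapp f (\sum_i F i) = \sum_i dapp f (F i).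
  by apply: (big_morph (dapp f) (rlinearD hf) (rlinear0 hf)).
rewrite [b in RHS]dualP [c in RHS]dualP mulr_suml fsum psum.
apply: eq_bigr => i _; rewrite mulr_sumr fsum psum; apply: eq_bigr => j _.
rewrite (rlinearZ (dpair_rlinear b c)) dpairE.
rewrite [in RHS]mulrACA -[in RHS]rmorphM [RHS](rlinearZ hf).
exact: mulrC.
Qed.

Definition dcomul_fun (f : cdual) : cdual \*A cdual :=
  projT1 (cid (dcomul_exists f)).

Lemma dcomulE f b c : dpair (dcomul_fun f) b c = dapp f (b * c).
Proof. exact: (projT2 (cid (dcomul_exists f))). Qed.

Lemma dpairD s t b c : dpair (s + t) b c = dpair s b c + dpair t b c.
Proof. exact: (rlinearD (dpair_rlinear b c)). Qed.

Lemma dcomul_add : zmod_morphism dcomul_fun.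
Proof.
move=> f g; apply/eqP; rewrite eq_sym subr_eq; apply/eqP.
apply: dpair_inj => b c; rewrite dpairD !dcomulE -dappD.
by rewrite subrK.
Qed.


Lemma atensor_sum (A B : algebra R) (t : A \*A B) :
  exists s : seq (A * B), t = \sum_(p <- s) aT p.1 p.2.
Proof.
elim/atensor_ind: t => [|x y t [s ->]]; first by exists [::]; rewrite big_nil.
by exists ((x, y) :: s); rewrite big_cons.
Qed.

Lemma copair_sum (A B P : algebra R) (u : A -> P) (v : B -> P)
    (s : seq (A * B)) : rlinear u -> rlinear v ->
  copair u v (\sum_(p <- s) aT p.1 p.2) = \sum_(p <- s) u p.1 * v p.2.
Proof.
move=> hu hv; have h := copair_rlinear hu hv.
rewrite (big_morph _ (rlinearD h) (rlinear0 h)).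
by apply: eq_bigr => p _; rewrite copairE.
Qed.

Lemma dpairM (s t : cdual \*A cdual) b c (u v : seq (G * G)) :
  gmul G b = \sum_(p <- u) aT p.1 p.2 -> gmul G c = \sum_(q <- v) aT q.1 q.2 ->
  dpair (s * t) b c =
  \sum_(p <- u) \sum_(q <- v) dpair s p.1 q.1 * dpair t p.2 q.2.
Proof.
move=> ub vc; have dpair0 x y : dpair 0 x y = 0.
  exact: (rlinear0 (dpair_rlinear x y)).
elim/atensor_ind: s => [|a a' s IH].
  rewrite mul0r dpair0 big1 // => p _; rewrite big1 // => q _.
  by rewrite dpair0 mul0r.
rewrite mulrDl dpairD {}IH.
under [in RHS]eq_bigr do under eq_bigr do rewrite dpairD mulrDl.
under [in RHS]eq_bigr do rewrite big_split.
rewrite big_split; congr (_ + _); elim/atensor_ind: t => [|d d' t IH].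
  rewrite mulr0 dpair0 big1 // => p _; rewrite big1 // => q _.
  by rewrite dpair0 mulr0.
rewrite mulrDr dpairD {}IH.
under [in RHS]eq_bigr do under eq_bigr do rewrite dpairD mulrDr.
under [in RHS]eq_bigr do rewrite big_split.
rewrite big_split; congr (_ + _).
rewrite aTM dpairE !convE ub vc !copair_sum; try exact: dapp_rlinear.
rewrite mulr_suml; apply: eq_bigr => p _; rewrite mulr_sumr.
by apply: eq_bigr => q _; rewrite !dpairE mulrACA.
Qed.

Lemma dcomul_mul : monoid_morphism dcomul_fun.
Proof.
split; first apply: dpair_inj => b c.
  by rewrite dcomulE dpairE -[LHS]/(gone G (b * c)) rmorphM.
move=> f g; apply: dpair_inj => b c; rewrite dcomulE convE rmorphM.
have [u ub] := atensor_sum (gmul G b); have [v vc] := atensor_sum (gmul G c).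
have [hf hg] := (dapp_rlinear f, dapp_rlinear g).
have h := copair_rlinear hf hg; rewrite (dpairM _ _ ub vc) ub vc mulr_suml.
rewrite (big_morph _ (rlinearD h) (rlinear0 h)); apply: eq_bigr => p _.
rewrite mulr_sumr (big_morph _ (rlinearD h) (rlinear0 h)).
by apply: eq_bigr => q _; rewrite aTM copairE // !dcomulE.
Qed.

HB.instance Definition _ := GRing.isZmodMorphism.Build
  cdual (cdual \*A cdual) dcomul_fun dcomul_add.
HB.instance Definition _ := GRing.isMonoidMorphism.Build
  cdual (cdual \*A cdual) dcomul_fun dcomul_mul.

Lemma dcomul_str r :
  dcomul_fun (alg_str cdual r) = alg_str (cdual \*A cdual) r.
Proof.
apply: dpair_inj => b c; rewrite dcomulE -[alg_str _ r in RHS]mulr1.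
rewrite (rlinearZ (dpair_rlinear b c)) dpairE.
by rewrite -[LHS]/(r * gone G (b * c)) rmorphM.
Qed.

(* The comultiplication of O_{G^*}, dual to the multiplication of O_G: see
   dcomulE. *)
Definition dcomul : alghom cdual (cdual \*A cdual) :=
  AlgHom (alghom_fun := dcomul_fun : {rmorphism cdual -> cdual \*A cdual})
    dcomul_str.

End CartierDual.

(* An affine R-scheme X = Spec(sO) with a right G-action. *)
Record gspace (R : comPzRingType) (G : gscheme R) := GSpace {
  sO :> algebra R;
  sact : alghom sO (sO \*A G);
  sactA : forall c, aassoc sO G G (amap sact (aid G) (sact c)) =
                    amap (aid sO) (gmul G) (sact c);
  sact1 : forall c, acopair (aid sO) (acomp (astr sO) (gone G)) (sact c) = c }.

(* A G-torsor for the fppf topology; it is affine since G is. The second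
   condition says that (x, g) |-> (x, xg) is an isomorphism X x G -> X x X. *)
Record torsor (R : comPzRingType) (G : gscheme R) := Torsor {
  tspace :> gspace G;
  torsor_flat : faithfully_flat (alg_str tspace);
  torsor_galois : bijective (acopair (tinl tspace G) (sact tspace)) }.

Section TrivialSpace.
Variables (R : comPzRingType) (G : gscheme R).

Lemma gmul1r b : acopair (aid G) (acomp (astr G) (gone G)) (gmul G b) = b.
Proof.
rewrite -[RHS]gmul1 -[in RHS]gmulC -[RHS]/(copair _ _ _).
by rewrite copair_swap //; apply: alghom_rlinear.
Qed.

Definition trivial_space : gspace G := GSpace (gmulA (g := G)) gmul1r.

End TrivialSpace.

(* O_X as a module over O_{G^*} *)
Definition comod (R : comPzRingType) (G : gscheme R) (X : gspace G) : Type := X.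

Section Comodule.
Variables (R : comPzRingType) (G : gscheme R) (X : gspace G).
Local Notation AA := (cdual G).
Local Notation M := (comod X).

HB.instance Definition _ := GRing.Zmodule.copy M X.

Definition dstrapp (P : algebra R) (a : AA) (b : G) : P := alg_str P (dapp a b).

Lemma dstrapp_rlinear P a : rlinear (dstrapp P a).
Proof.
have ha := dapp_rlinear a; split=> [x y|r x]; rewrite /dstrapp.
  by rewrite (rlinearD ha) rmorphD.
by rewrite (rlinearZ ha) rmorphM.
Qed.

(* a c = sum c_(0) a(c_(1)) *)
Definition coact (a : AA) (c : X) : X :=
  copair (fun x : X => x) (dstrapp X a) (sact X c).

Lemma coact_rlinear a : rlinear (coact a).
Proof.
apply: (rlinear_comp (sact X)); apply: copair_rlinear.
  exact: rlinear_id.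
exact: dstrapp_rlinear.
Qed.

Lemma copair_ext (A B P : algebra R) (u u' : A -> P) (v v' : B -> P) :
  u =1 u' -> v =1 v' -> copair u v =1 copair u' v'.
Proof. by move=> uu vv t; apply: eq_bigr => p _; rewrite uu vv. Qed.

Lemma coactA a b c : coact a (coact b c) = coact (a * b) c.
Proof.
have [ha hb] := (dstrapp_rlinear X a, dstrapp_rlinear X b).
have hab := copair_rlinear ha hb; have hi := rlinear_id X.
have hca := coact_rlinear a.
pose H := copair (fun x : X => x) (copair (dstrapp X a) (dstrapp X b)).
transitivity (H (aassoc X G G (amap (sact X) (aid G) (sact X c)))).
  rewrite /H copair_assoc // copair_amap //; last exact: copair_rlinear.
  rewrite [coact b c]/coact; move: (sact X c); apply: rlinear_ext.
  - split=> [x y|r x]; first by rewrite (rlinearD (copair_rlinear hi hb)) (rlinearD hca).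
    by rewrite (rlinearZ (copair_rlinear hi hb)) (rlinearZ hca).
  - exact: copair_rlinear.
  move=> x y; rewrite !copairE // [x * _]mulrC (rlinearZ hca).
  exact: mulrC.
rewrite sactA /H copair_amap //; apply: copair_ext => // x /=.
rewrite /dstrapp convE; move: (gmul G x); apply: rlinear_ext => //.
  have h := copair_rlinear (dapp_rlinear a) (dapp_rlinear b).
  split=> [y z|r y]; first by rewrite (rlinearD h) rmorphD.
  by rewrite (rlinearZ h) rmorphM.
move=> y z; rewrite !copairE //; try exact: dapp_rlinear.
by rewrite rmorphM.
Qed.

Lemma coact1 : left_id 1 coact.
Proof. exact: (sact1 (g := X)). Qed.
Lemma coactDr : right_distributive coact +%R.
Proof. by move=> a x y; apply: (rlinearD (coact_rlinear a)). Qed.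
Lemma coactDl c : {morph coact^~ c : a b / a + b}.
Proof.
move=> a b; rewrite /coact /copair /tlift /tsum -big_split.
by apply: eq_bigr => p _; rewrite /dstrapp dappD rmorphD mulrDr.
Qed.

HB.instance Definition _ := GRing.Zmodule_isLmodule.Build AA M
  coactA coact1 coactDr coactDl.

Lemma coact_str r c : coact (alg_str AA r) c = alg_str X r * c.
Proof.
rewrite -[in RHS](sact1 c) /coact; move: (sact X c).
have h := dstrapp_rlinear X (alg_str AA r); have hi := rlinear_id X.
apply: rlinear_ext.
- exact: copair_rlinear.
- split=> [x y|s x]; first by rewrite rmorphD mulrDr.
  by rewrite rmorphM alghom_str mulrCA.
move=> x y; rewrite copairE // acopairE mulrCA; congr (_ * _).
by rewrite -rmorphM.
Qed.

End Comodule.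

Definition mdual (S : comPzRingType) (M : lmodType S) : lmodType S :=
  hom M S^o.

(* L_pi = M_pi (x) M_{pi_0}^{-1} over O_{G^*}, where the inverse of an
   invertible module is its dual. *)
Definition Lmod (R : comPzRingType) (G : gscheme R) (X : gspace G) :
    lmodType (cdual G) :=
  tensor (comod X : lmodType (cdual G))
         (mdual (comod (trivial_space G) : lmodType (cdual G))).

(* An isomorphism G x Lambda -> X x Lambda of G-torsors over Lambda, given by its
   comorphism. *)
Record trivialisation (R : comPzRingType) (G : gscheme R) (X : gspace G)
    (Lam : algebra R) := Trivialisation {
  triv_map :> alghom (X \*A Lam) (G \*A Lam);
  triv_base : forall l, triv_map (aT 1 l) = aT 1 l;
  triv_bij : bijective triv_map;
  triv_act : forall c,
    amap (gmul G) (aid Lam) (triv_map (aT c 1)) =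
    acopair (acomp (amap (tinl G G) (aid Lam)) (acomp triv_map (tinl X Lam)))
            (acomp (tinl (G \*A G) Lam) (tinr G G)) (sact X c) }.

Section Xi.
Variables (R : comPzRingType) (G : gscheme R) (X : gspace G) (Lam : algebra R).
Variable tau : trivialisation X Lam.
Local Notation AA := (cdual G).
Local Notation AL := (AA \*A Lam).
Local Notation phi := (alghom_fun (tinl AA Lam)).
Local Notation M := (comod X : lmodType AA).
Local Notation M0 := (comod (trivial_space G) : lmodType AA).

Definition to_bc_fun (b : G) (l : Lam) : bc phi M0 := bT phi (aT 1 l) (b : M0).

Lemma to_bc_balanced : balanced (to_bc_fun : amod G -> amod Lam -> bc phi M0).
Proof.
split=> [x x' y|x y y'|r x y]; rewrite /to_bc_fun.
- exact: bTDr.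
- by rewrite (balancedDr (aT_balanced _ _)) bTDl.
- have -> : (r *: (x : amod G) : M0) = alg_str AA r *: (x : M0).
    exact/esym/(coact_str (X := trivial_space G)).
  rewrite -bTZ; congr (bT _ _ _).
  rewrite -[phi _]/(aT (alg_str AA r) 1) aTM mulr1 mul1r.
  have := balancedZ (@aT_balanced R AA Lam) r 1 y => <-.
  by congr (aT _ _); rewrite -[RHS]/(alg_str AA r * 1) mulr1.
Qed.

(* O_G (x)_R Lambda -> (O_{G^*} (x)_R Lambda) (x)_{O_{G^*}} M_{pi_0} *)
Definition to_bc (y : G \*A Lam) : bc phi M0 :=
  tlift (to_bc_fun : amod G -> amod Lam -> bc phi M0) y.

Lemma to_bcD y z : to_bc (y + z) = to_bc y + to_bc z.
Proof. exact: (tliftD _ _ to_bc_balanced). Qed.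
Lemma to_bc0 : to_bc 0 = 0.
Proof. exact: (tlift0 to_bc_balanced). Qed.
Lemma to_bcE b l : to_bc (aT b l) = bT phi (aT 1 l) (b : M0).
Proof. exact: (tliftE _ _ to_bc_balanced). Qed.

Definition coactL (a : AA) : G \*A Lam -> G \*A Lam :=
  copair (tinl G Lam \o coact (X := trivial_space G) a) (tinr G Lam).

Lemma tinl_coact_rlinear a :
  rlinear (tinl G Lam \o coact (X := trivial_space G) a).
Proof.
exact: (rlinear_post (tinl G Lam) (coact_rlinear (trivial_space G) a)).
Qed.

Lemma coactL_rlinear a : rlinear (coactL a).
Proof.
apply: copair_rlinear; first exact: tinl_coact_rlinear.
exact: alghom_rlinear.
Qed.

Lemma coactLE a b l :
  coactL a (aT b l) = aT (coact (X := trivial_space G) a b) l.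
Proof.
rewrite /coactL copairE //; last 1 first.
- exact: alghom_rlinear.
- by rewrite -[LHS]/(@aT R G Lam (@coact R G (trivial_space G) a b) 1 * aT 1 l) aTM mulr1 mul1r.
- exact: tinl_coact_rlinear.
Qed.

Lemma to_bc_coact a y : to_bc (coactL a y) = phi a *: to_bc y.
Proof.
have h := coactL_rlinear a.
elim/atensor_ind: y => [|b l y IH]; first by rewrite rlinear0 // to_bc0 scaler0.
rewrite (rlinearD h) !to_bcD IH scalerDr; congr (_ + _).
by rewrite coactLE !to_bcE bTE bTZ.
Qed.

Lemma triv_coact a c : tau (aT (coact a c) 1) = coactL a (tau (aT c 1)).
Proof.
have hi := rlinear_id G; have ha := dstrapp_rlinear G a.
have hia := copair_rlinear hi ha.
pose k0 := tinl G Lam \o copair (fun x : G => x) (dstrapp G a).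
have hk0 : rlinear k0 := rlinear_post (tinl G Lam) hia.
have hr := alghom_rlinear (tinr G Lam).
pose K := copair k0 (tinr G Lam).
have hK : rlinear K := copair_rlinear hk0 hr.
transitivity (K (amap (gmul G) (aid Lam) (tau (aT c 1)))); last first.
  by rewrite /K copair_amap.
rewrite triv_act /coact; move: (sact X c).
have hX := copair_rlinear (rlinear_id X) (dstrapp_rlinear X a).
apply: rlinear_ext.
- split=> [x y|r x].
    by rewrite (rlinearD hX) -[aT _ 1]/(tinl X Lam _) rmorphD rmorphD.
  by rewrite (rlinearZ hX) -[aT _ 1]/(tinl X Lam _) !rmorphM !alghom_str.
- exact: (rlinear_comp (acopair _ _) hK).
move=> x b; rewrite acopairE copairE ?rlinear_id //; last exact: dstrapp_rlinear.
rewrite /dstrapp -[aT (x * _) 1]/(tinl X Lam _) !rmorphM !alghom_str.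
rewrite -[acomp _ _ x]/(amap (tinl G G) (aid Lam) (tau (tinl X Lam x))).
move: (tau (tinl X Lam x)) => y; elim/atensor_ind: y => [|g l y IH].
  by rewrite mul0r rmorph0 mul0r rlinear0.
rewrite rmorphD !mulrDl (rlinearD hK) IH; congr (_ + _).
rewrite amapE -[acomp _ _ b]/(@aT R (G \*A G) Lam (@aT R G G 1 b) 1).
rewrite [in RHS]aTM [X in K (aT X _)]aTM !mulr1 mul1r.
rewrite [RHS]copairE // /k0 /= copairE // /dstrapp.
rewrite -[RHS]/(@aT R G Lam (g * alg_str G (dapp a b)) 1 * aT 1 l) aTM mulr1 mul1r.
by rewrite -[tinl_fun _ _]/(@aT R G Lam (alg_str G (dapp a b)) 1) aTM mulr1.
Qed.

Definition xi_fun (c : X) (f : mdual M0) : bc phi (AA^o : lmodType AA) :=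
  bcmap phi f (to_bc (tau (aT c 1))).

Lemma xi_coact a c f : xi_fun (coact a c) f = phi a *: xi_fun c f.
Proof. by rewrite /xi_fun triv_coact to_bc_coact linearZ. Qed.

Lemma xi_balanced :
  balanced (xi_fun : M -> mdual M0 -> bc phi (AA^o : lmodType AA)).
Proof.
split=> [x x' y|x y y'|a x y].
- by rewrite /xi_fun -[aT _ 1]/(tinl X Lam _) !rmorphD to_bcD linearD.
- rewrite /xi_fun; move: (to_bc _) => z.
  elim/bc_ind: z => [|t z w IH]; first by rewrite !linear0 addr0.
  by rewrite !linearD IH !bcmapE bTDr addrACA.
- rewrite -[xi_fun _ y]/(xi_fun (coact a x) y) xi_coact /xi_fun.
  move: (to_bc _) => z.
  elim/bc_ind: z => [|t z w IH]; first by rewrite !linear0.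
  rewrite [bcmap phi y _]linearD [RHS]linearD scalerDr IH !bcmapE; congr (_ + _).
  by rewrite bTE bTZ.
Qed.

Definition xi0 (z : Lmod X) : bc phi (AA^o : lmodType AA) :=
  tlift (xi_fun : M -> mdual M0 -> bc phi (AA^o : lmodType AA)) z.

Lemma xi0_linear :
  linear (xi0 : Lmod X -> restr phi (bc phi (AA^o : lmodType AA) : lmodType AL)).
Proof.
have h := xi_balanced.
move=> a z w; rewrite [LHS](tliftD _ _ h); congr (_ + _).
rewrite (tliftZ _ _ h) -[RHS]/(phi a *: xi0 z) /xi0 /tlift /tsum scaler_sumr.
by apply: eq_bigr => p _; rewrite -xi_coact.
Qed.

(* s (x) (c (x) f) |-> s . (1 (x) f)(tau c) *)
Definition xi : {linear bc phi (Lmod X) -> bc phi (AA^o : lmodType AA)} :=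
  @bc_lift _ _ phi (Lmod X) (bc phi (AA^o : lmodType AA) : lmodType AL)
    (HB.pack xi0 (GRing.isLinear.Build AA (Lmod X)
       (restr phi (bc phi (AA^o : lmodType AA) : lmodType AL)) *:%R
       xi0 xi0_linear)).

Lemma xiE s (c : X) (f : mdual M0) :
  xi (bT phi s (tpure (c : M) f)) = s *: bcmap phi f (to_bc (tau (aT c 1))).
Proof. by rewrite /xi bc_liftE /= /xi0 (tliftE _ _ xi_balanced). Qed.

End Xi.

(* The relative group of a ring morphism phi : S -> T. For an R-algebra A and
   phi : A -> A (x)_R Lam it is K_0(A, Lam), as L (x)_R Lam is the base change
   (A (x)_R Lam) (x)_A L. *)
Section RelativeK0.
Variables (S T : comPzRingType) (phi : {rmorphism S -> T}).

Record triple := Triple {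
  tsrc : lmodType S;
  ttgt : lmodType S;
  tiso : {linear bc phi tsrc -> bc phi ttgt} }.

Definition K0gen (g : triple) : Prop :=
  [/\ fgproj (tsrc g), fgproj (ttgt g) & bijective (tiso g)].

(* Formal Z-combinations of triples, the boolean being the sign (true for +).
   K_0(S, T) is the set of those that satisfy K0, with K0eq as equality. It is
   not packed as a zmodType because the triples, ranging over all S-modules, live
   in a larger universe than the carriers of zmodTypes. *)
Definition fsum := seq (bool * triple).

Definition K0 (x : fsum) : Prop := List.Forall (fun g => K0gen g.2) x.

Definition extension (g' g g'' : triple) : Prop :=
  exists (i1 : {linear tsrc g' -> tsrc g}) (p1 : {linear tsrc g -> tsrc g''})
         (i2 : {linear ttgt g' -> ttgt g}) (p2 : {linear ttgt g -> ttgt g''}),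
    [/\ short_exact i1 p1, short_exact i2 p2,
        forall x, tiso g (bcmap phi i1 x) = bcmap phi i2 (tiso g' x) &
        forall x, tiso g'' (bcmap phi p1 x) = bcmap phi p2 (tiso g x)].

Inductive K0eq : fsum -> fsum -> Prop :=
| K0eq_refl x : K0eq x x
| K0eq_sym x y : K0eq x y -> K0eq y x
| K0eq_trans x y z : K0eq x y -> K0eq y z -> K0eq x z
| K0eq_cat x x' y y' : K0eq x x' -> K0eq y y' -> K0eq (x ++ y) (x' ++ y')
| K0eq_comm x y : K0eq (x ++ y) (y ++ x)
| K0eq_opp g : K0eq [:: (true, g); (false, g)] [::]
| K0eq_ext g' g g'' :
    K0gen g' -> K0gen g -> K0gen g'' -> extension g' g g'' ->
    K0eq [:: (true, g)] [:: (true, g'); (true, g'')]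
| K0eq_comp (L1 L2 L3 : lmodType S)
    (lam : {linear bc phi L1 -> bc phi L2})
    (mu : {linear bc phi L2 -> bc phi L3}) :
    K0gen (Triple lam) -> K0gen (Triple mu) ->
    K0eq [:: (true, Triple (mu \o lam))] [:: (true, Triple lam); (true, Triple mu)].

Lemma bmul_linear (L : lmodType T) (t : T) : linear ( *:%R t : L -> L).
Proof. by move=> a x y; rewrite scalerDr !scalerA mulrC. Qed.

(* [S, S; t] *)
Definition unit_triple (t : T) : triple :=
  @Triple (S^o : lmodType S) (S^o : lmodType S)
    (HB.pack ( *:%R t : bc phi (S^o : lmodType S) -> bc phi (S^o : lmodType S))
       (GRing.isLinear.Build T _ _ *:%R _ (bmul_linear (L := bc phi S^o) t))).

End RelativeK0.

Section Push.
Variables (S T S' T' : comPzRingType).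
Variables (phi : {rmorphism S -> T}) (phi' : {rmorphism S' -> T'}).
Variables (f : {rmorphism S -> S'}) (h : {rmorphism T -> T'}).
Hypothesis comm : forall s, h (phi s) = phi' (f s).

Section Kappa.
Variable L : lmodType S.
Local Notation M := (bc phi' (bc f L : lmodType S') : lmodType T').

Lemma kappa_linear : linear ((fun x => bT phi' 1 (bT f 1 x)) :
  L -> restr phi (restr h M : lmodType T)).
Proof.
move=> a x y.
rewrite -[RHS]/(h (phi a) *: bT phi' 1 (bT f 1 x) + bT phi' 1 (bT f 1 y)).
by rewrite comm !bTDr bTE bTZ bTE bTZ.
Qed.

Definition kappa : {linear bc phi L -> restr h M} :=
  @bc_lift _ _ phi L (restr h M : lmodType T)
    (HB.pack (fun x => bT phi' 1 (bT f 1 x))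
      (GRing.isLinear.Build S L (restr phi (restr h M : lmodType T)) *:%R
        _ kappa_linear)).

(* T (x)_S L -> T' (x)_S' (S' (x)_S L) *)
Lemma kappaE t x : kappa (bT phi t x) = bT phi' (h t) (bT f 1 x).
Proof.
by rewrite /kappa bc_liftE /= -[LHS]/(h t *: bT phi' 1 (bT f 1 x)) bTE mulr1.
Qed.

End Kappa.

Section Iso.
Variables (L1 L2 : lmodType S) (lam : {linear bc phi L1 -> bc phi L2}).
Local Notation M := (bc phi' (bc f L2 : lmodType S') : lmodType T').

Lemma push_linear : linear ((fun x => kappa L2 (lam (bT phi 1 x))) :
  L1 -> restr f (restr phi' M : lmodType S')).
Proof.
move=> a x y; rewrite -[RHS]/(phi' (f a) *: (kappa L2 (lam (bT phi 1 x)) : M)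
  + kappa L2 (lam (bT phi 1 y))).
have -> : bT phi 1 (a *: x + y) = phi a *: bT phi 1 x + bT phi 1 y.
  by rewrite bTDr bTE bTZ.
by rewrite !linearP -comm.
Qed.

(* 1 (x) lam, as a map T' (x)_S' (S' (x)_S L1) -> T' (x)_S' (S' (x)_S L2) *)
Definition push_iso : {linear bc phi' (bc f L1 : lmodType S') -> M} :=
  @bc_lift _ _ phi' (bc f L1) M
    (@bc_lift _ _ f L1 (restr phi' M : lmodType S')
      (HB.pack (fun x => kappa L2 (lam (bT phi 1 x)))
        (GRing.isLinear.Build S L1 (restr f (restr phi' M : lmodType S')) *:%R
          _ push_linear))).

Lemma push_isoE x :
  push_iso (bT phi' 1 (bT f 1 x)) = kappa L2 (lam (bT phi 1 x)).
Proof. by rewrite /push_iso !bc_liftE /= !scale1r. Qed.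

End Iso.

Definition push_triple (g : triple phi) : triple phi' :=
  @Triple _ _ phi' (bc f (tsrc g)) (bc f (ttgt g)) (push_iso (tiso g)).

(* K_0(S, T) -> K_0(S', T'), [L1, L2; lam] |-> [S' (x) L1, S' (x) L2; 1 (x) lam] *)
Definition push (x : fsum phi) : fsum phi' :=
  [seq (g.1, push_triple g.2) | g <- x].

End Push.

Section IntegralClosure.
Variables (A B : comNzRingType) (u : {rmorphism A -> B}).

Definition integral_pred : {pred B} := fun x => `[< integralOver u x >].

Lemma integral_pred_closed : subring_closed integral_pred.
Proof.
split=> [|x y /asboolP hx /asboolP hy|x y /asboolP hx /asboolP hy].
- exact/asboolP/integral1.
- exact/asboolP/integral_sub.
- exact/asboolP/integral_mul.
Qed.
HB.instance Definition _ :=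
  GRing.isSubringClosed.Build B integral_pred integral_pred_closed.

Record integral_closure := IntegralClosure {
  ic_val :> B; ic_valP : ic_val \in integral_pred }.
HB.instance Definition _ := [isSub for ic_val].
HB.instance Definition _ := [Choice of integral_closure by <:].
HB.instance Definition _ := [SubChoice_isSubComNzRing of integral_closure by <:].

End IntegralClosure.

Section NumberField.
Variables (F : fieldExtType rat) (Fc : closedFieldType) (iota : {rmorphism F -> Fc}).

Definition ring_of_integers : comNzRingType :=
  integral_closure (intr : {rmorphism int -> F}).
Local Notation R := ring_of_integers.

Definition R_to_Fc : {rmorphism R -> Fc} := iota \o (val : {rmorphism R -> F}).

Definition Fc_alg : algebra R := Algebra (alg_ring := Fc) R_to_Fc.

Definition Rc_type : comNzRingType := integral_closure R_to_Fc.

Definition R_to_Rc_fun (r : R) : Rc_type :=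
  IntegralClosure (introT (asboolP _) (integral_id R_to_Fc r)).

Lemma R_to_Rc_add : zmod_morphism R_to_Rc_fun.
Proof. by move=> x y; apply: val_inj; rewrite rmorphB /= rmorphB. Qed.
Lemma R_to_Rc_mul : monoid_morphism R_to_Rc_fun.
Proof.
split; first by apply: val_inj; rewrite rmorph1 /= rmorph1.
by move=> x y; apply: val_inj; rewrite rmorphM /= rmorphM.
Qed.
HB.instance Definition _ :=
  GRing.isZmodMorphism.Build R Rc_type R_to_Rc_fun R_to_Rc_add.
HB.instance Definition _ :=
  GRing.isMonoidMorphism.Build R Rc_type R_to_Rc_fun R_to_Rc_mul.

Definition Rc : algebra R := Algebra (R_to_Rc_fun : {rmorphism R -> Rc_type}).

Definition Rc_to_Fc : alghom Rc Fc_alg :=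
  AlgHom (A := Rc) (B := Fc_alg)
    (alghom_fun := (val : {rmorphism Rc_type -> Fc})) (fun=> erefl).

End NumberField.

Section Classes.
Variables (R : comPzRingType) (Rc Fc : algebra R) (j : alghom Rc Fc).

Section K0bar.
Variables (A : algebra R) (Gam : A \*A Fc -> Prop).

Lemma ext_comm s : amap (aid A) j (tinl A Rc s) = tinl A Fc (@idfun A s).
Proof. by rewrite -[tinl A Rc s]/(aT s 1) amapE rmorph1. Qed.

Definition ext (x : fsum (tinl A Rc)) : fsum (tinl A Fc) := push ext_comm x.

(* Equality in K_0(A, Fc) modulo the image of the group Gam under
   t |-> [A, A; t]. In the idelic description of K_0(A, Fc) the class [A, A; t]
   is that of (1, t), up to the choice of sign of the isomorphism. *)
Definition K0bar_Fc_eq (x y : fsum (tinl A Fc)) : Prop :=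
  exists t : A \*A Fc,
    Gam t /\ K0eq x (y ++ [:: (true, unit_triple (tinl A Fc) t)]).

(* The image of K_0(A, Rc) in the previous quotient: its elements are represented
   by those of K_0(A, Rc), and compared in the quotient. *)
Definition K0bar_eq (x y : fsum (tinl A Rc)) : Prop :=
  K0bar_Fc_eq (ext x) (ext y).

End K0bar.

Section Push.
Variables (A B : algebra R) (f : alghom A B).

Lemma fstar_comm s : amap f (aid Rc) (tinl A Rc s) = tinl B Rc (f s).
Proof. by rewrite -[tinl A Rc s]/(aT s 1) amapE rmorph1. Qed.

Definition fstar (x : fsum (tinl A Rc)) : fsum (tinl B Rc) := push fstar_comm x.

End Push.

Variable G : gscheme R.
Local Notation AA := (cdual G).

(* G(Fc), inside AA (x) Fc = Hom_R(O_G, Fc) *)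
Definition Gamma (t : AA \*A Fc) : Prop :=
  exists g : alghom G Fc, forall b,
    g b = copair (fun a : AA => alg_str Fc (dapp a b)) (fun l : Fc => l) t.

(* Gamma x Gamma *)
Definition Gamma2 (t : AA \*A AA \*A Fc) : Prop :=
  exists t1 t2, [/\ Gamma t1, Gamma t2 &
    t = amap (tinl AA AA) (aid Fc) t1 * amap (tinr AA AA) (aid Fc) t2].

Definition primitive (x : fsum (tinl AA Rc)) : Prop :=
  K0 x /\ K0bar_eq Gamma2 (fstar (dcomul G) x)
            (fstar (tinl AA AA) x ++ fstar (tinr AA AA) x).

(* [L_pi, AA; xi_pi] *)
Definition class (X : torsor G) (tau : trivialisation X Rc) :
    fsum (tinl AA Rc) :=
  [:: (true, @Triple _ _ (tinl AA Rc) (Lmod X) (AA^o : lmodType AA) (xi tau))].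

End Classes.

Section CompositionSeries.
Variable k : comPzRingType.

Definition gs_comorphism (H K : gscheme k) (f : alghom K H) : Prop :=
  forall b, gmul H (f b) = amap f f (gmul K b).

Definition gs_closed (H' H : gscheme k) (i : alghom H H') : Prop :=
  gs_comorphism i /\ forall b, exists c, i c = b.

(* 0 -> H' -> H -> H'' -> 0 : p is faithfully flat and i is the kernel of p,
   cut out by the ideal that p generates from the augmentation ideal. *)
Definition gs_exact (H' H H'' : gscheme k) (i : alghom H H') (p : alghom H'' H) :
    Prop :=
  [/\ gs_closed i, gs_comorphism p, faithfully_flat p &
      forall b, i b = 0 <-> exists (n : nat) (c : 'I_n -> H) (x : 'I_n -> H''),
        (forall m, gone H'' (x m) = 0) /\ b = \sum_m c m * p (x m)].

Definition gs_trivial (H : gscheme k) : Prop :=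
  forall b : H, b = alg_str H (gone H b).

Definition gs_simple (H : gscheme k) : Prop :=
  ~ gs_trivial H /\
  forall (H' : gscheme k) (i : alghom H H'),
    gs_closed i -> gs_trivial H' \/ injective i.

(* l lists the factors of a composition series of H *)
Inductive comp_series : gscheme k -> seq (gscheme k) -> Prop :=
| comp_series0 H : gs_trivial H -> comp_series H [::]
| comp_seriesS H' H Q i p l :
    @gs_exact H' H Q i p -> gs_simple Q -> comp_series H' l ->
    comp_series H (Q :: l).

Definition is_unit (A : comPzRingType) (x : A) : Prop := exists y, x * y = 1.

Definition local_ring (A : comPzRingType) : Prop :=
  (1 : A) <> 0 /\ forall x y : A, is_unit (x + y) -> is_unit x \/ is_unit y.

Definition local_local (H : gscheme k) : Prop :=
  local_ring H /\ local_ring (cdual H).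

End CompositionSeries.

Section Fibre.
Variables (R k : comPzRingType) (s : {rmorphism R -> k}).

Definition alg_restr (A : algebra k) : algebra R :=
  Algebra (alg_str A \o s : {rmorphism R -> A}).

Lemma alghom_restr_str (A B : algebra k) (f : alghom A B) r :
  f (alg_str (alg_restr A) r) = alg_str (alg_restr B) r.
Proof. exact: alghom_str. Qed.

Definition alghom_restr (A B : algebra k) (f : alghom A B) :
    alghom (alg_restr A) (alg_restr B) :=
  AlgHom (A := alg_restr A) (B := alg_restr B) (alghom_restr_str f).

(* The group scheme H is G x_{Spec R} Spec k along s, with projection h. *)
Definition is_fibre (G : gscheme R) (H : gscheme k) (h : alghom G (alg_restr H)) :
    Prop :=
  bijective (acopair h (alghom_restr (astr H)) :
    G \*A alg_restr (base_algebra k) -> alg_restr H) /\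
  forall b, gmul H (h b) =
    acopair (acomp (alghom_restr (tinl H H)) h)
            (acomp (alghom_restr (tinr H H)) h) (gmul G b).

End Fibre.

(* No geometric fibre of G of residue characteristic 2 has a composition factor
   of local-local type. *)
Definition no_local_local_at_2 (R : comPzRingType) (G : gscheme R) : Prop :=
  forall (k : closedFieldType) (s : {rmorphism R -> k})
         (H : gscheme k) (h : alghom G (alg_restr s H)) (l : seq (gscheme k)),
    2%N \in [pchar k] -> is_fibre h -> comp_series H l ->
    List.Forall (fun Q => ~ local_local Q) l.

(* Main.v *)
Require Import Defs.
From HB Require Import structures.
From mathcomp Require Import all_boot all_order all_algebra all_field.
From mathcomp Require Import perm boolp ring zify.

Set Implicit Arguments.
Unset Strict Implicit.
Unset Printing Implicit Defensive.

Import GRing.Theory.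
Local Open Scope ring_scope.

(** A triple [L1, L2; lam] has a determinant Phi: the invertible S-submodule of T
    spanned by the maximal minors of a matrix of lam in a presentation of L2. When S
    is integral over Z, nonzero integers are units of T and T is pi-regular, Phi is
    injective on K_0(S, T): Serre's splitting theorem and stable range reduce every
    class to one with a source of rank 1, so that an equality in K_0 can be tested on
    fractional ideals.

    For a torsor X with a trivialisation tau, let J in A (x) Lam be the dual lattice
    of tau(O_X) in O_G (x) Lam. Then J is inverse to Phi of the class of X. As O_X is
    a ring and X x G = X x X, one has Delta(J) A2 = (J (x) 1)(1 (x) J) A2, where
    A2 = A (x) A, which is the primitivity of the class. Conversely, if J is invertible
    and satisfies this identity, then the y in O_G (x) Lam with <J, y> in R form a
    subring and a subcomodule, which is the ring of a torsor with dual lattice J. For a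
    primitive class the identity holds up to an element of Gamma x Gamma, and the
    counit shows that the latter is a unit of A2. *)

(** * Fractional ideals *)

(** Classes are compared over [Fc], while torsors are trivialised over [Rc]. Injectivity of [Phi] is
    used over [Fc], where A (x) Fc is finite over a field; the identity on lattices is obtained
    there and brought back to [Rc] by [epush_inj]. The dual lattice is preferred to tau(O_X) because
    it lies in the ring A (x) Lam, where products, inverses and the comultiplication make sense.
    Nothing is localised. Submodules are predicates, so that equal ideals can be rewritten, and an
    invertible ideal enters through a finite identity 1 = sum i_m j_m, from which dual bases,
    splittings and inverse maps are read off. In the same spirit the denominators in Serre's theorem
    are positive integers, and no dimension theory enters. The integrals of A form a module over R
    that need not be free, so none can be taken as a generator. A finite family of integrals with
    the partition of unity [integral_counit] replaces it; the projectivity of a torsor and the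
    invertibility of its lattice both come from that identity. *)

Lemma pred_ext (X : Type) (I J : X -> Prop) : (forall t, I t <-> J t) -> I = J.
Proof. by move=> IJ; apply: funext => t; apply: propext. Qed.

Section Span.
Variables (S T : comPzRingType) (phi : {rmorphism S -> T}) (V : lmodType T).

Inductive rspan (X : V -> Prop) : V -> Prop :=
| rspan_zero : rspan X 0
| rspan_step s x t : X x -> rspan X t -> rspan X (phi s *: x + t).

Record is_sub (I : V -> Prop) : Prop := IsSub {
  sub0 : I 0;
  subD : forall x y, I x -> I y -> I (x + y);
  subZ : forall s x, I x -> I (phi s *: x) }.

Lemma rspan_is_sub X : is_sub (rspan X).
Proof.
split=> [|x y Hx Hy|s x]; first exact: rspan_zero.
  by elim: Hx => [|s z t Xz _ IH]; rewrite ?add0r // -addrA; apply: rspan_step.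
elim=> [|r z t Xz _ IH]; first by rewrite scaler0; apply: rspan_zero.
by rewrite scalerDr scalerA -rmorphM; apply: rspan_step.
Qed.

Lemma rspan_in X x : X x -> rspan X x.
Proof.
move=> Xx; rewrite -[x]addr0 -[x]scale1r -(rmorph1 phi).
by apply: rspan_step => //; apply: rspan_zero.
Qed.

Lemma rspan_least X I : is_sub I -> (forall x, X x -> I x) ->
  forall x, rspan X x -> I x.
Proof.
move=> [I0 ID IZ] XI x; elim=> // s y t Xy _ It.
by apply: ID => //; apply/IZ/XI.
Qed.

Lemma sub_sum I (J : Type) (r : seq J) (P : pred J) (F : J -> V) : is_sub I ->
  (forall i, P i -> I (F i)) -> I (\sum_(i <- r | P i) F i).
Proof. by move=> hI HF; elim/big_rec: _ => [|i x /HF Fi]; [apply: sub0|apply: subD]. Qed.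

End Span.

Section Ideals.
Variables (S T : comPzRingType) (phi : {rmorphism S -> T}).
Implicit Types I J K : T -> Prop.
Notation isub := (@is_sub S T phi T^o).
Notation ispan := (@rspan S T phi T^o).

Lemma isubM I s x : isub I -> I x -> I (phi s * x).
Proof. by move=> hI; apply: (subZ hI). Qed.

Definition sunit : T -> Prop := fun t => exists s, t = phi s.

Definition sprod I J : T -> Prop :=
  ispan (fun t => exists a b, [/\ I a, J b & t = a * b]).

Lemma sunit_sub : isub sunit.
Proof.
split=> [|x y [s ->] [s' ->]|s x [s' ->]]; first by exists 0; rewrite rmorph0.
  by exists (s + s'); rewrite rmorphD.
by exists (s * s'); rewrite rmorphM.
Qed.

Lemma sunit1 : sunit 1. Proof. by exists 1; rewrite rmorph1. Qed.

Lemma sprod_sub I J : isub (sprod I J).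
Proof. exact: rspan_is_sub. Qed.

Lemma sprod_in I J a b : I a -> J b -> sprod I J (a * b).
Proof. by move=> Ia Jb; apply: rspan_in; exists a, b. Qed.

Lemma sprod_least I J K : isub K -> (forall a b, I a -> J b -> K (a * b)) ->
  forall t, sprod I J t -> K t.
Proof. by move=> hK H t It; apply: (rspan_least hK _ It) => _ [a [b [Ia Jb ->]]]; apply: H. Qed.

Lemma mul_sub I t : isub I -> isub (fun x => I (t * x)).
Proof.
move=> hI; split=> [|x y Ix Iy|s x Ix]; first by rewrite mulr0; apply: (sub0 hI).
  by rewrite mulrDr; apply: (subD hI).
by rewrite -[_ *: _]/(_ * _) mulrCA; apply: isubM.
Qed.

Lemma sprodC I J : sprod I J = sprod J I.
Proof.
apply: pred_ext => t; split; apply: sprod_least => [|a b ? ?]; try exact: sprod_sub;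
  by rewrite mulrC; apply: sprod_in.
Qed.

Lemma sprodA I J K : sprod I (sprod J K) = sprod (sprod I J) K.
Proof.
have H I' J' K' t : sprod I' (sprod J' K') t -> sprod (sprod I' J') K' t.
  apply: sprod_least => [|a b Ia]; first exact: sprod_sub.
  move: b; apply: sprod_least => [|b c Jb Kc]; first exact/mul_sub/sprod_sub.
  by rewrite mulrA; apply: sprod_in => //; apply: sprod_in.
apply: pred_ext => t; split; first exact: H.
by rewrite [sprod I (sprod _ _)]sprodC [sprod (sprod _ _) _]sprodC [sprod I J]sprodC
  [sprod J K]sprodC; apply: H.
Qed.

Lemma sprod1 I : isub I -> sprod sunit I = I.
Proof.
move=> hI; apply: pred_ext => t; split.
  by apply: sprod_least => // _ b [s ->] Ib; apply: isubM.
by move=> It; rewrite -[t]mul1r; apply: sprod_in => //; apply: sunit1.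
Qed.

Lemma sprodr1 I : isub I -> sprod I sunit = I.
Proof. by rewrite sprodC; apply: sprod1. Qed.

Lemma sprodCA I J K : sprod I (sprod J K) = sprod J (sprod I K).
Proof. by rewrite !sprodA [sprod I J]sprodC. Qed.

Lemma sprodACA I J K L :
  sprod (sprod I J) (sprod K L) = sprod (sprod I K) (sprod J L).
Proof. by rewrite -!sprodA [sprod J (sprod _ _)]sprodCA. Qed.

Definition sdual I : T -> Prop := fun t => forall a, I a -> sunit (t * a).

Lemma sdual_sub I : isub (sdual I).
Proof.
split=> [a Ia|x y Hx Hy a Ia|s x Hx a Ia]; first by rewrite mul0r; apply: (sub0 sunit_sub).
  by rewrite mulrDl; apply: (subD sunit_sub); [apply: Hx|apply: Hy].
by rewrite -[_ *: _]/(_ * _) -mulrA; apply/(isubM _ sunit_sub)/Hx.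
Qed.

(** If 1 = sum a b with a in I and b in J, then any t with t I inside S is sum (t a) b, an element
    of J. An inverse is thus determined by I, and inversion becomes a function of ideals. *)
Lemma sdual_uniq I J : isub J -> sprod I J = sunit -> J = sdual I.
Proof.
move=> hJ IJ; apply: pred_ext => t; split=> [Jt a Ia|Ht].
  by rewrite mulrC -IJ; apply: sprod_in.
have : sprod I J 1 by rewrite IJ; apply: sunit1.
rewrite -[t]mulr1; move: 1; apply: (@sprod_least _ _ (fun x => J (t * x))); first exact: mul_sub.
by move=> a b /Ht [s ts] Jb; rewrite mulrA ts; apply: isubM.
Qed.

Definition sprin (t : T) : T -> Prop := fun u => exists s, u = phi s * t.

Lemma sprin_sub t : isub (sprin t).
Proof.
split=> [|x y [s ->] [s' ->]|s x [s' ->]]; first by exists 0; rewrite rmorph0 mul0r.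
  by exists (s + s'); rewrite rmorphD mulrDl.
by exists (s * s'); rewrite rmorphM -mulrA.
Qed.

Lemma sprinM t u : sprod (sprin t) (sprin u) = sprin (t * u).
Proof.
apply: pred_ext => x; split.
  apply: sprod_least; first exact: sprin_sub.
  by move=> a b [s ->] [s' ->]; exists (s * s'); rewrite rmorphM mulrACA.
move=> [s ->]; apply: isubM; first exact: sprod_sub.
by apply: sprod_in; exists 1; rewrite rmorph1 mul1r.
Qed.

Lemma sprin1 : sprin 1 = sunit.
Proof. by apply: pred_ext => x; split=> [] [s ->]; exists s; rewrite mulr1. Qed.

End Ideals.

Definition spush (T S' T' : comPzRingType) (phi' : {rmorphism S' -> T'})
  (h : T -> T') (I : T -> Prop) : T' -> Prop :=
  @rspan S' T' phi' T'^o (fun t => exists2 a, I a & t = h a).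

Section Spush.
Variables (S T S' T' : comPzRingType).
Variables (phi : {rmorphism S -> T}) (phi' : {rmorphism S' -> T'}).
Variables (f : {rmorphism S -> S'}) (h : {rmorphism T -> T'}).
Hypothesis comm : forall s, h (phi s) = phi' (f s).
Implicit Types I J : T -> Prop.

Lemma spush_sub I : @is_sub _ _ phi' T'^o (spush phi' h I).
Proof. exact: rspan_is_sub. Qed.

Lemma spush_in I a : I a -> spush phi' h I (h a).
Proof. by move=> Ia; apply: rspan_in; exists a. Qed.

Lemma spush_least I K : @is_sub _ _ phi' T'^o K -> (forall a, I a -> K (h a)) ->
  forall t, spush phi' h I t -> K t.
Proof. by move=> hK H t It; apply: (rspan_least hK _ It) => _ [a Ia ->]; apply: H. Qed.

Lemma hpre_sub (K : T' -> Prop) : @is_sub _ _ phi' T'^o K ->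
  @is_sub _ _ phi T^o (fun x => K (h x)).
Proof.
move=> hK; split=> [|x y Kx Ky|s x Kx]; first by rewrite rmorph0; apply: (sub0 hK).
  by rewrite rmorphD; apply: (subD hK).
by rewrite -[_ *: _]/(_ * _) rmorphM comm; apply: (subZ hK (f s) Kx).
Qed.

Lemma spush_sprod I J :
  spush phi' h (sprod phi I J) = sprod phi' (spush phi' h I) (spush phi' h J).
Proof.
apply: pred_ext => t; split.
  apply: spush_least; first exact: sprod_sub.
  apply: sprod_least; first exact/hpre_sub/sprod_sub.
  by move=> a b Ia Jb; rewrite rmorphM; apply: sprod_in; apply: spush_in.
apply: sprod_least; first exact: spush_sub.
move=> a b Ia; move: b; apply: spush_least; first exact/mul_sub/spush_sub.
move=> b Jb; move: a Ia; apply: (@spush_least _ (fun a => spush phi' h (sprod phi I J) (a * h b))).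
  have := mul_sub (h b) (spush_sub (sprod phi I J)).
  by congr is_sub; apply: funext => x; rewrite mulrC.
by move=> a Ia; rewrite -rmorphM; apply/spush_in/sprod_in.
Qed.

Lemma spush_sunit : spush phi' h (sunit phi) = sunit phi'.
Proof.
apply: pred_ext => t; split.
  by apply: spush_least; [apply: sunit_sub|move=> _ [s ->]; exists (f s)].
move=> [s ->]; rewrite -[phi' s]mulr1 -(rmorph1 h); apply: isubM.
  exact: spush_sub.
exact/spush_in/sunit1.
Qed.

End Spush.

(** * Determinants of lattices in T^n *)

Lemma row_lsubmx (R : Type) m n1 n2 (A : 'M[R]_(m, n1 + n2)) i :
  row i (lsubmx A) = lsubmx (row i A).
Proof. by apply/rowP => j; rewrite !mxE. Qed.

Lemma row_rsubmx (R : Type) m n1 n2 (A : 'M[R]_(m, n1 + n2)) i :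
  row i (rsubmx A) = rsubmx (row i A).
Proof. by apply/rowP => j; rewrite !mxE. Qed.

Section Det.
Variables (S T : comPzRingType) (phi : {rmorphism S -> T}).
Notation isub := (@is_sub S T phi T^o).

Definition Det n (W : 'rV[T]_n -> Prop) : T -> Prop :=
  @rspan S T phi T^o (fun t => exists2 M : 'M_n, forall k, W (row k M) & t = \det M).

Lemma Det_sub n (W : 'rV[T]_n -> Prop) : isub (Det W).
Proof. exact: rspan_is_sub. Qed.

Lemma Det_in n (W : 'rV[T]_n -> Prop) (M : 'M_n) :
  (forall k, W (row k M)) -> Det W (\det M).
Proof. by move=> HM; apply: rspan_in; exists M. Qed.

Lemma Det_least n (W : 'rV[T]_n -> Prop) (I : T -> Prop) : isub I ->
  (forall M : 'M_n, (forall k, W (row k M)) -> I (\det M)) ->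
  forall t, Det W t -> I t.
Proof. by move=> hI H t; apply: (rspan_least hI) => _ [M WM ->]; apply: H. Qed.

Definition upd_row n (M : 'M[T]_n) (j : 'I_n) (v : 'rV[T]_n) : 'M[T]_n :=
  \matrix_(i, k) (if i == j then v 0 k else M i k).

Lemma row_upd n (M : 'M[T]_n) j v k :
  row k (upd_row M j v) = if k == j then v else row k M.
Proof. by apply/rowP => i; rewrite !mxE; case: ifP => // _; rewrite !mxE. Qed.

Lemma det_upd n (M : 'M[T]_n) j s (x y : 'rV[T]_n) :
  \det (upd_row M j (s *: x + y)) =
  s * \det (upd_row M j x) + \det (upd_row M j y).
Proof.
rewrite -[\det (upd_row M j y)]mul1r; apply: (determinant_multilinear (i0 := j)).
- by rewrite !row_upd eqxx scale1r.
- by apply/row_matrixP => i; rewrite !row'Esub !row_rowsub !row_upd eq_sym (negbTE (neq_lift _ _)).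
- by apply/row_matrixP => i; rewrite !row'Esub !row_rowsub !row_upd eq_sym (negbTE (neq_lift _ _)).
Qed.

Lemma det_upd0 n (M : 'M[T]_n) j : \det (upd_row M j 0) = 0.
Proof.
apply: (addrI (\det (upd_row M j 0))); rewrite addr0.
by rewrite -[X in X + _ = _]mul1r -det_upd scaler0 addr0.
Qed.

Lemma det_rspan n (X : 'rV[T]_n -> Prop) (I : T -> Prop) : isub I ->
  (forall M : 'M_n, (forall k, X (row k M)) -> I (\det M)) ->
  forall M : 'M_n, (forall k, rspan phi X (row k M)) -> I (\det M).
Proof.
move=> hI HX.
(* The rows are expanded one at a time: at stage j only the first j rows may be arbitrary elements
   of the span. *)
suff H j : (j <= n)%N -> forall M : 'M_n,
    (forall k : 'I_n, if (k < j)%N then rspan phi X (row k M) else X (row k M)) ->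
    I (\det M).
  by move=> M HM; apply: (H n) => // k; rewrite ltn_ord.
elim: j => [|j IH] jn M HM; first by apply: HX => k; apply: HM.
pose j0 := Ordinal jn.
have -> : M = upd_row M j0 (row j0 M).
  by apply/row_matrixP => i; rewrite row_upd; case: eqP => // ->.
have := HM j0; rewrite /= ltnSn; elim=> [|s x y Xx _ IHy].
  by rewrite det_upd0; apply: (sub0 hI).
rewrite det_upd; apply: (subD hI) => //; apply: isubM => //.
apply: IH => [|k]; first exact: ltnW.
rewrite row_upd; case: ifP => kj.
  case: eqP => [k0|_]; first by rewrite k0 /= ltnn in kj.
  by have := HM k; rewrite ltnS ltnW.
case: eqP => // /eqP kj0; have := HM k; rewrite ltnS leq_eqVlt kj orbF.
by have -> : (k == j :> nat) = false by apply/negbTE.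
Qed.

Lemma Det_mul n (W W' : 'rV[T]_n -> Prop) (M : 'M_n) : \det M = 1 ->
  (forall w, W w -> W' (w *m M)) -> forall t, Det W t -> Det W' t.
Proof.
move=> dM H; apply: Det_least => [|N WN]; first exact: Det_sub.
rewrite -[\det N]mulr1 -dM -det_mulmx; apply: Det_in => k.
by rewrite row_mul; apply: H.
Qed.

Lemma Det_int n : Det (fun w : 'rV[T]_n => exists v, w = map_mx phi v) = sunit phi.
Proof.
apply: pred_ext => t; split.
  apply: Det_least; first exact: sunit_sub.
  move=> M /choice [v Mv]; exists (\det (\matrix_k v k)); rewrite -det_map_mx.
  by congr (\det _); apply/row_matrixP => k; rewrite Mv -map_row rowK.
move=> [s ->]; rewrite -[phi s]mulr1 -(det1 T n); apply: isubM.
  exact: Det_sub.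
apply: Det_in => k; exists (row k 1%:M).
by rewrite map_row map_mx1.
Qed.

Lemma Det1 (W : 'rV[T]_1 -> Prop) : is_sub phi W ->
  Det W = (fun t => W t%:M).
Proof.
move=> hW; apply: pred_ext => t; split.
  move=> Wt; pose I (t : T) := W t%:M; apply: (@Det_least _ _ I _ _ _ Wt).
    split=> [|x y Ix Iy|s x Ix]; rewrite /I ?raddf0 ?raddfD /=.
    - exact: (sub0 hW).
    - exact: (subD hW).
    - by rewrite -[_ *: _]/(_ * _) -scale_scalar_mx; apply: (subZ hW).
  move=> M /(_ 0); rewrite det_mx11 /I; congr W.
  by rewrite [M in LHS]mx11_scalar; apply/rowP => i; rewrite !mxE.
move=> Wt; have -> : t = \det (t%:M : 'M_1) by rewrite det_scalar1.
apply: Det_in => k.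
have -> : row k (t%:M : 'M_1) = t%:M; last by [].
by apply/rowP => i; rewrite !ord1 !mxE.
Qed.

(** By multilinearity each row may be taken in W1 (+) 0 or in 0 (+) W2. If exactly n rows are of the
    first kind, a permutation makes the matrix block diagonal; otherwise its determinant
    vanishes. *)
Lemma Det_sum n m (W1 : 'rV[T]_n -> Prop) (W2 : 'rV[T]_m -> Prop) :
  is_sub phi W1 -> is_sub phi W2 ->
  Det (fun w : 'rV_(n + m) => W1 (lsubmx w) /\ W2 (rsubmx w)) =
  sprod phi (Det W1) (Det W2).
Proof.
move=> h1 h2; apply: pred_ext => t; split; last first.
  move=> Ht; apply: (@sprod_least _ _ phi _ _ _ (Det_sub _) _ _ Ht) => a b.
  move=> Da; move: b.
  apply: Det_least; first exact/mul_sub/Det_sub.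
  move=> Q WQ; move: a Da; apply: (@Det_least n W1 (fun a => Det _ (a * \det Q))).
    have := mul_sub (\det Q) (Det_sub (fun w : 'rV_(n + m) => W1 (lsubmx w) /\ W2 (rsubmx w))).
    by congr is_sub; apply: funext => x; rewrite mulrC.
  move=> P WP; rewrite -(det_ublock P 0 Q); apply: Det_in => k.
  rewrite -[k]splitK; case: (split k) => i /=.
    by rewrite -row_usubmx /block_mx col_mxKu row_row_mx row_mxKl row_mxKr row0; split=> //; apply: (sub0 h2).
  by rewrite -row_dsubmx /block_mx col_mxKd row_row_mx row_mxKl row_mxKr row0; split=> //; apply: (sub0 h1).
pose X (w : 'rV[T]_(n + m)) := exists b : bool,
  if b then exists2 v, W1 v & w = row_mx v 0 else exists2 v, W2 v & w = row_mx 0 v.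
move=> Ht; apply: (Det_least _ _ Ht); first exact: sprod_sub.
move=> M HM; apply: (@det_rspan _ X); first exact: sprod_sub; last first.
  move=> k; have [W1k W2k] := HM k.
  rewrite -[row k M]hsubmxK -[lsubmx _]addr0 -[rsubmx _]add0r -add_row_mx.
  apply: (subD (rspan_is_sub _ _)); apply: rspan_in; [exists true|exists false].
    by exists (lsubmx (row k M)).
  by exists (rsubmx (row k M)).
clear M HM => M /choice [c Hc].
have [[s Hs]|nos] := pselect (exists s : 'S_(n + m), forall k, c k = (s k < n)%N).
  have -> : \det M = phi ((-1) ^+ s) * \det (row_perm s^-1 M).
    rewrite row_permE det_mulmx det_perm odd_permV mulrA rmorphXn rmorphN1.
    by rewrite -signr_addb addbb mul1r.
  apply: isubM; first exact: sprod_sub.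
  have HN k : row k (row_perm s^-1 M) = row (s^-1 k)%g M.
    by apply/rowP => i; rewrite !mxE.
  have Hu i : exists2 v, W1 v & row (lshift m i) (row_perm s^-1 M) = row_mx v 0.
    by have := Hc (s^-1 (lshift m i))%g; rewrite Hs permKV /= ltn_ord HN.
  have Hd i : exists2 v, W2 v & row (rshift n i) (row_perm s^-1 M) = row_mx 0 v.
    have := Hc (s^-1 (rshift n i))%g; rewrite Hs permKV /= HN.
    by rewrite ltnNge leq_addr.
  move: (row_perm _ _) Hu Hd => N Hu Hd.
  have ur : ursubmx N = 0.
    apply/row_matrixP => i; have [v _ E] := Hu i.
    by rewrite /ursubmx row_rsubmx row_usubmx E row_mxKr row0.
  have dl : dlsubmx N = 0.
    apply/row_matrixP => i; have [v _ E] := Hd i.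
    by rewrite /dlsubmx row_lsubmx row_dsubmx E row_mxKl row0.
  rewrite -[N]submxK ur dl det_lblock; apply: sprod_in; apply: Det_in => i.
    by have [v Wv E] := Hu i; rewrite /ulsubmx row_lsubmx row_usubmx E row_mxKl.
  by have [v Wv E] := Hd i; rewrite /drsubmx row_rsubmx row_dsubmx E row_mxKr.
suff -> : \det M = 0.
  by have := sub0 (sprod_sub phi (Det W1) (Det W2)).
(* Every permutation sends some row to a column of the other block, where that row is zero. *)
rewrite /determinant big1 // => s _.
have [k ck] : exists k, c k != (s k < n)%N.
  apply: contrapT => H; apply: nos; exists s => k; apply/eqP.
  by apply: contrapT => /negP ck; apply: H; exists k.
rewrite (bigD1 k) //=.
have -> : M k (s k) = 0; last by rewrite mul0r mulr0.
have -> : M k (s k) = row k M 0 (s k) by rewrite mxE.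
have := Hc k; move: ck; case: (c k) => ck [v _ ->].
  rewrite -[s k]splitK; case: splitP => j sk /=; first by rewrite sk ltn_ord in ck.
  by rewrite row_mxEr mxE.
rewrite -[s k]splitK; case: splitP => j sk /=; first by rewrite row_mxEl mxE.
by rewrite sk ltnNge leq_addr in ck.
Qed.

End Det.

Definition mklin (S : comPzRingType) (U V : lmodType S) (f : U -> V)
  (hf : linear f) : {linear U -> V} :=
  HB.pack f (GRing.isLinear.Build S U V *:%R f hf).

Lemma linZ (S : comPzRingType) (U V : lmodType S) (f : {linear U -> V}) a x :
  f (a *: x) = a *: f x.
Proof. exact: linearZ. Qed.

Lemma linear_inv (S : comPzRingType) (U V : lmodType S) (f : {linear U -> V}) :
  bijective f -> exists g : {linear V -> U}, cancel f g /\ cancel g f.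
Proof.
move=> [g fK gK]; have lg : linear g.
  by move=> a x y; apply: (can_inj fK); rewrite linearP !gK.
by exists (mklin lg).
Qed.

(** * The determinant of a triple *)

Section Presentations.
Variable S : comPzRingType.

Record pres (L : lmodType S) := Pres {
  prank : nat;
  pinj : {linear L -> 'rV[S]_prank};
  pprj : {linear 'rV[S]_prank -> L};
  pprjK : cancel pinj pprj }.

Lemma fgproj_pres (L : lmodType S) : fgproj L -> inhabited (pres L).
Proof. by move=> [n [i [p ip]]]; exists; apply: (Pres ip). Qed.

Lemma pres_fgproj (L : lmodType S) : pres L -> fgproj L.
Proof. by case=> n i p ip; exists n, i, p. Qed.

Definition free_pres n : pres ('rV[S]_n : lmodType S) :=
  @Pres ('rV[S]_n : lmodType S) n (idfun : {linear 'rV[S]_n -> 'rV[S]_n})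
    (idfun : {linear 'rV[S]_n -> 'rV[S]_n}) (fun=> erefl).

Lemma rV_ext n (L : lmodType S) (f g : {linear 'rV[S]_n -> L}) :
  (forall j, f (delta_mx 0 j) = g (delta_mx 0 j)) -> f =1 g.
Proof.
move=> fg v; rewrite [v]row_sum_delta !linear_sum.
by apply: eq_bigr => j _; rewrite !linearZ fg.
Qed.

Lemma rV_lift_linear n (L : lmodType S) (y : 'I_n -> L) :
  linear (fun v : 'rV[S]_n => \sum_j v 0 j *: y j).
Proof.
move=> a u v; rewrite scaler_sumr -big_split; apply: eq_bigr => j _.
by rewrite !mxE scalerDl scalerA.
Qed.

Lemma rV_liftE n (L : lmodType S) (y : 'I_n -> L) j :
  mklin (rV_lift_linear y) (delta_mx 0 j) = y j.
Proof.
rewrite /= (bigD1 j) //= mxE !eqxx scale1r big1 ?addr0 // => k kj.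
by rewrite mxE eqxx (negbTE kj) scale0r.
Qed.

Lemma fgproj_lift (L M N : lmodType S) (v : {linear M -> N}) (f : {linear L -> N}) :
  fgproj L -> (forall z, exists y, v y = z) ->
  exists g : {linear L -> M}, forall x, v (g x) = f x.
Proof.
move=> [n [i [p ip]]] /choice [s vs].
pose h := mklin (rV_lift_linear (fun j => s (f (p (delta_mx 0 j))))).
exists (h \o i : {linear L -> M}) => x.
rewrite -[in RHS](ip x); apply: (rV_ext (f := v \o h) (g := f \o p)) => j.
by rewrite /= -[X in v X]/(h _) rV_liftE vs.
Qed.

Lemma short_exact_split (L M N : lmodType S) (u : {linear L -> M})
  (v : {linear M -> N}) : fgproj N -> short_exact u v ->
  exists (s : {linear N -> M}) (r : {linear M -> L}),
    [/\ cancel s v, cancel u r, forall x, r (s x) = 0 & forall y, u (r y) + s (v y) = y].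
Proof.
move=> pN [uI uv vS]; have [s vs] := fgproj_lift (idfun : {linear N -> N}) pN vS.
have vu x : v (u x) = 0 by apply/uv; exists x.
have /choice [r ur] y : exists x, u x = y - s (v y).
  by apply/uv; rewrite linearB vs subrr.
have lr : linear r.
  move=> a x y; apply: uI; rewrite linearP !ur linearP [s _]linearP.
  by rewrite opprD addrACA scalerBr.
exists s, (mklin lr); split=> //=.
- by move=> x; apply: uI; rewrite ur vu linear0 subr0.
- by move=> x; apply: uI; rewrite ur vs linear0 subrr.
- by move=> y; rewrite ur subrK.
Qed.

End Presentations.

Section Frames.
Variables (S T : comPzRingType) (phi : {rmorphism S -> T}).
Notation rV n := ('rV[T]_n : lmodType T).

Lemma map_lin n (L : lmodType S) (i : {linear L -> 'rV[S]_n}) :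
  linear ((fun x => map_mx phi (i x)) : L -> restr phi (rV n)).
Proof.
by move=> a x y; rewrite linearP; apply/rowP => j; rewrite !mxE rmorphD rmorphM.
Qed.

Definition iT n (L : lmodType S) (i : {linear L -> 'rV[S]_n}) :
  {linear bc phi L -> rV n} := @bc_lift _ _ phi L (rV n) (mklin (map_lin i)).

Arguments iT : simpl never.

Lemma iTE n (L : lmodType S) (i : {linear L -> 'rV[S]_n}) t x :
  iT i (bT phi t x) = t *: map_mx phi (i x).
Proof. exact: bc_liftE. Qed.

Lemma iT1 n (L : lmodType S) (i : {linear L -> 'rV[S]_n}) x :
  iT i (bT phi 1 x) = map_mx phi (i x).
Proof. by rewrite iTE scale1r. Qed.

Definition pT n (L : lmodType S) (p : {linear 'rV[S]_n -> L}) :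
  {linear rV n -> bc phi L} :=
  mklin (rV_lift_linear (fun j => bT phi 1 (p (delta_mx 0 j)))).

Arguments pT : simpl never.

Lemma bT0 t (L : lmodType S) : bT phi t (0 : L) = 0.
Proof. by apply: (addrI (bT phi t 0)); rewrite -bTDr !addr0. Qed.

Lemma bT1Z (L : lmodType S) s (x : L) : bT phi 1 (s *: x) = phi s *: bT phi 1 x.
Proof. by rewrite -bTZ bTE. Qed.

Lemma bT1N (L : lmodType S) (x : L) : bT phi 1 (- x) = - bT phi 1 x.
Proof. by rewrite -scaleN1r bT1Z rmorphN1 scaleN1r. Qed.

Lemma pT_map n (L : lmodType S) (p : {linear 'rV[S]_n -> L}) v :
  pT p (map_mx phi v) = bT phi 1 (p v).
Proof.
rewrite [v in RHS]row_sum_delta linear_sum.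
rewrite (big_morph _ (bTDr _ _) (bT0 _ _)).
by apply: eq_bigr => j _; rewrite mxE linearZ bT1Z.
Qed.

Lemma bc_linear_ext (L : lmodType S) (M : lmodType T) (f g : {linear bc phi L -> M}) :
  (forall x, f (bT phi 1 x) = g (bT phi 1 x)) -> f =1 g.
Proof.
move=> fg; apply: bc_ext; first by rewrite !linear0.
- by move=> s t; rewrite linearD.
- by move=> s t; rewrite linearD.
by move=> t x; rewrite -[t]mulr1 -bTE !linearZ fg.
Qed.

Lemma pTK n (L : lmodType S) (i : {linear L -> 'rV[S]_n}) (p : {linear 'rV[S]_n -> L}) :
  cancel i p -> cancel (iT i) (pT p).
Proof.
move=> ip; apply: (bc_linear_ext (f := pT p \o iT i) (g := idfun)) => x.
by rewrite -[LHS]/(pT p (iT i (bT phi 1 x))) iT1 pT_map ip.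
Qed.

Section Comp.
Variables (L1 L2 L3 : lmodType S).

(* The lattice of L1 (+) ker p in T^n, for L2 a summand of S^n with projection p. *)
Definition W L L' (Q : pres L') (lam : {linear bc phi L -> bc phi L'}) :
  'rV[T]_(prank Q) -> Prop := fun w =>
  exists x v, pprj Q v = 0 /\ w = iT (pinj Q) (lam (bT phi 1 x)) + map_mx phi v.

Arguments W {L L'} Q lam _.

Lemma W_sub L L' (Q : pres L') (lam : {linear bc phi L -> bc phi L'}) :
  is_sub phi (W Q lam).
Proof.
split=> [|_ _ [x [v [pv ->]]] [x' [v' [pv' ->]]]|s _ [x [v [pv ->]]]].
- exists 0, 0; rewrite linear0 bT0 !linear0 add0r; split=> //.
  by apply/rowP => j; rewrite !mxE rmorph0.
- exists (x + x'), (v + v'); rewrite linearD pv pv' addr0; split=> //.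
  by rewrite bTDr !linearD map_mxD addrACA.
- exists (s *: x), (s *: v); rewrite linZ pv scaler0; split=> //.
  by rewrite bT1Z !linZ map_mxZ scalerDr.
Qed.

Definition D0 L L' (Q : pres L') (lam : {linear bc phi L -> bc phi L'}) :=
  Det phi (W Q lam).

Lemma D0_sub L L' (Q : pres L') (lam : {linear bc phi L -> bc phi L'}) :
  @is_sub _ _ phi T^o (D0 Q lam).
Proof. exact: Det_sub. Qed.

Lemma D0_ext L L' (Q : pres L') (lam lam' : {linear bc phi L -> bc phi L'}) :
  lam =1 lam' -> D0 Q lam = D0 Q lam'.
Proof.
move=> E; congr (Det phi _); apply: pred_ext => w.
by split=> [] [x [v [pv ->]]]; exists x, v; rewrite E.
Qed.

Lemma int_sub n : is_sub phi (fun w : 'rV[T]_n => exists v, w = map_mx phi v).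
Proof.
split=> [|_ _ [v ->] [v' ->]|s _ [v ->]].
- by exists 0; apply/rowP => j; rewrite !mxE rmorph0.
- by exists (v + v'); rewrite map_mxD.
- by exists (s *: v); rewrite map_mxZ.
Qed.

(** Whitehead's lemma. Once the lattice S^n, whose determinant is S, is added on the left, both
    sides are determinants of lattices in T^(n + m), and a matrix of determinant 1 carries one
    lattice to the other. *)
Lemma D0_comp (Q2 : pres L2) (Q3 : pres L3) (lam : {linear bc phi L1 -> bc phi L2})
  (mu : {linear bc phi L2 -> bc phi L3}) : bijective mu ->
  D0 Q3 (mu \o lam) = sprod phi (D0 Q2 lam) (D0 Q3 mu).
Proof.
move=> /linear_inv [mu' [muK mu'K]].
rewrite -[LHS](sprod1 (D0_sub _ _)) -(Det_int phi (prank Q2)) /D0.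
rewrite -!Det_sum; try exact: W_sub; last exact: int_sub.
set n := prank Q2; set m := prank Q3.
pose X := lin1_mx (iT (pinj Q3) \o (mu \o pT (pprj Q2))).
pose Y := lin1_mx (iT (pinj Q2) \o (mu' \o pT (pprj Q3))).
have XE a : a *m X = iT (pinj Q3) (mu (pT (pprj Q2) a)) by rewrite mul_rV_lin1.
have YE a : a *m Y = iT (pinj Q2) (mu' (pT (pprj Q3) a)) by rewrite mul_rV_lin1.
have [K2 K3] := (pTK (@pprjK _ _ Q2), pTK (@pprjK _ _ Q3)).
(* For X and Y inverse to each other this is the block matrix with rows (0, X) and (-Y, 0). Its
   inverse is [M (- X) (- Y)], which serves for the reverse inclusion. *)
pose M (X : 'M[T]_(n, m)) (Y : 'M_(m, n)) : 'M_(n + m) :=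
  block_mx 1%:M X 0 1%:M *m block_mx 1%:M 0 (- Y) 1%:M *m block_mx 1%:M X 0 1%:M.
have detM A B : \det (M A B) = 1.
  by rewrite !det_mulmx !det_ublock det_lblock !det1 !mulr1.
have mulM A B (a : 'rV_n) (b : 'rV_m) : row_mx a b *m M A B =
    row_mx (a - (a *m A *m B + b *m B))
      ((a - (a *m A *m B + b *m B)) *m A + (a *m A + b)).
  rewrite !mulmxA !mul_row_block !mulmx1 !mulmx0 !addr0 ?add0r.
  by rewrite mulmxN !(mulmxDl, mulNmx).
apply: pred_ext => t; split.
  apply: (Det_mul (M := M X Y)) => // w [[z wl] [x [v [pv wr]]]].
  rewrite -[w]hsubmxK wl wr mulM row_mxKl row_mxKr; clear w wl wr.
  have aX : map_mx phi z *m X = iT (pinj Q3) (mu (bT phi 1 (pprj Q2 z))).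
    by rewrite XE pT_map.
  have bY : (iT (pinj Q3) (mu (lam (bT phi 1 x))) + map_mx phi v) *m Y =
      iT (pinj Q2) (lam (bT phi 1 x)).
    by rewrite YE [pT _ _]linearD pT_map pv bT0 addr0 K3 muK.
  rewrite aX bY YE K3 muK iT1.
  set c := _ - _; have cE : c = iT (pinj Q2) (lam (bT phi 1 (- x))) +
      map_mx phi (z - pinj Q2 (pprj Q2 z)).
    by rewrite bT1N !linearN map_mxB /c opprD addrA addrC.
  have cX : c *m X = - iT (pinj Q3) (mu (lam (bT phi 1 x))).
    rewrite cE XE [pT _ _]linearD K2 pT_map linearB pprjK subrr bT0 addr0.
    by rewrite bT1N !linearN.
  rewrite cX; split; first by exists (- x), (z - pinj Q2 (pprj Q2 z)); rewrite linearB pprjK subrr.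
  exists (pprj Q2 z), v; split=> //.
  by rewrite [X in - X + _]/= addrCA addKr.
apply: (Det_mul (M := M (- X) (- Y))) => // w [[x [v [pv wl]]] [y [u [pu wr]]]].
rewrite -[w]hsubmxK wl wr mulM row_mxKl row_mxKr; clear w wl wr.
rewrite !mulmxN !mulNmx !opprK.
have aX : (iT (pinj Q2) (lam (bT phi 1 x)) + map_mx phi v) *m X =
    iT (pinj Q3) (mu (lam (bT phi 1 x))).
  by rewrite XE [pT _ _]linearD pT_map pv bT0 addr0 K2.
have bY : (iT (pinj Q3) (mu (bT phi 1 y)) + map_mx phi u) *m Y = map_mx phi (pinj Q2 y).
  by rewrite YE [pT _ _]linearD pT_map pu bT0 addr0 K3 muK iT1.
rewrite aX bY YE K3 muK.
set c := _ - _; have cE : c = map_mx phi (v + pinj Q2 y).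
  by rewrite /c map_mxD opprB [_ + map_mx _ v]addrC addrACA subrr addr0.
have cX : c *m X = iT (pinj Q3) (mu (bT phi 1 y)).
  by rewrite cE XE pT_map linearD pv add0r pprjK.
rewrite cX cE; split; first by exists (v + pinj Q2 y).
exists (- x), u; split=> //.
by rewrite bT1N !linearN /= addrCA addKr.
Qed.

End Comp.
End Frames.

Arguments W {S T phi L L'} Q lam _.
Section Invariant.
Variables (S T : comPzRingType) (phi : {rmorphism S -> T}).
Notation rV n := ('rV[T]_n : lmodType T).

Lemma D0_id (L : lmodType S) (Q : pres L) :
  D0 Q (idfun : {linear bc phi L -> bc phi L}) = sunit phi.
Proof.
rewrite -(Det_int phi (prank Q)); congr (Det phi _); apply: pred_ext => w; split.
  by move=> [x [v [_ ->]]]; exists (pinj Q x + v); rewrite iT1 map_mxD.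
move=> [v ->]; exists (pprj Q v), (v - pinj Q (pprj Q v)).
by rewrite linearB pprjK subrr iT1 -map_mxD addrC subrK.
Qed.

(** Composing with the identity, presented by Q' and of determinant S, turns multiplicativity into
    independence of the presentation. *)
Lemma D0_indep (L L' : lmodType S) (Q Q' : pres L')
  (lam : {linear bc phi L -> bc phi L'}) : D0 Q lam = D0 Q' lam.
Proof.
have bi : bijective (idfun : bc phi L' -> bc phi L') by exists idfun.
rewrite -[LHS](sprodr1 (D0_sub Q lam)).
by rewrite -(D0_id Q') -D0_comp.
Qed.

Lemma D0_inv (L L' : lmodType S) (Q : pres L) (Q' : pres L')
  (lam : {linear bc phi L -> bc phi L'}) (lam' : {linear bc phi L' -> bc phi L}) :
  cancel lam lam' -> cancel lam' lam -> sprod phi (D0 Q' lam) (D0 Q lam') = sunit phi.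
Proof.
move=> lK lK'; rewrite -D0_comp; last by exists lam.
by rewrite -(D0_id Q); apply: D0_ext => x /=; rewrite lK.
Qed.

Section Sum.
Variables (L L' L'' : lmodType S) (Q' : pres L') (Q'' : pres L'').
Variables (u : {linear L' -> L}) (v : {linear L -> L''}).
Variables (s : {linear L'' -> L}) (r : {linear L -> L'}).
Hypotheses (sv : cancel s v) (ur : cancel u r).
Hypothesis uv : forall y, u (r y) + s (v y) = y.

Lemma sum_inj_linear :
  linear (fun y => row_mx (pinj Q' (r y)) (pinj Q'' (v y))).
Proof.
move=> a x y; rewrite !linearP scale_row_mx add_row_mx.
by [].
Qed.

Lemma sum_prj_linear :
  linear (fun w : 'rV_(prank Q' + prank Q'') =>
    u (pprj Q' (lsubmx w)) + s (pprj Q'' (rsubmx w))).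
Proof.
move=> a x y; rewrite (linearP lsubmx) (linearP rsubmx) !linearP.
by rewrite scalerDr addrACA.
Qed.

Lemma sum_prjK : cancel (mklin sum_inj_linear) (mklin sum_prj_linear).
Proof. by move=> y; rewrite /= row_mxKl row_mxKr !pprjK uv. Qed.

Definition sum_pres : pres L := Pres sum_prjK.

End Sum.

Lemma bcmap1 (L L' : lmodType S) (f : {linear L -> L'}) x :
  bcmap phi f (bT phi 1 x) = bT phi 1 (f x).
Proof. exact: bcmapE. Qed.

(** Both sequences split, so lam becomes block triangular with diagonal blocks lam' and lam''. The
    remaining block is removed by a shear of determinant 1. *)
Lemma D0_short_exact (L1' L1 L1'' L2' L2 L2'' : lmodType S)
  (Q' : pres L2') (Q : pres L2) (Q'' : pres L2'')
  (lam' : {linear bc phi L1' -> bc phi L2'}) (lam : {linear bc phi L1 -> bc phi L2})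
  (lam'' : {linear bc phi L1'' -> bc phi L2''})
  (u1 : {linear L1' -> L1}) (v1 : {linear L1 -> L1''})
  (u2 : {linear L2' -> L2}) (v2 : {linear L2 -> L2''}) :
  fgproj L1'' -> bijective lam'' -> short_exact u1 v1 -> short_exact u2 v2 ->
  (forall x, lam (bcmap phi u1 x) = bcmap phi u2 (lam' x)) ->
  (forall x, lam'' (bcmap phi v1 x) = bcmap phi v2 (lam x)) ->
  D0 Q lam = sprod phi (D0 Q' lam') (D0 Q'' lam'').
Proof.
move=> p1 /linear_inv [lami [lamK lamK']] e1 e2 c1 c2.
have [s1 [r1 [s1v u1r _ uv1]]] := short_exact_split p1 e1.
have [s2 [r2 [s2v u2r rs2 uv2]]] := short_exact_split (pres_fgproj Q'') e2.
have v2u2 x : v2 (u2 x) = 0 by case: e2 => _ /(_ (u2 x)) [_ H] _; apply: H; exists x.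
pose P := sum_pres Q' Q'' uv2.
rewrite (D0_indep Q P) /D0 -Det_sum; try exact: W_sub.
(* The off-diagonal block, normalised by the inverse of lam'': go back to L1'', lift by s1, apply
   lam and keep the component in L2'. *)
pose H := lin1_mx (iT phi (pinj Q') \o (bcmap phi r2 \o (lam \o
  (bcmap phi s1 \o (lami \o pT phi (pprj Q'')))))).
have HE a : a *m H = iT phi (pinj Q') (bcmap phi r2 (lam (bcmap phi s1
    (lami (pT phi (pprj Q'') a))))) by rewrite mul_rV_lin1.
pose M (H : 'M[T]_(prank Q'', prank Q')) : 'M_(prank Q' + prank Q'') := block_mx 1%:M 0 H 1%:M.
have detM A : \det (M A) = 1 by rewrite det_lblock !det1 mulr1.
have mulM A a b : row_mx a b *m M A = row_mx (a + b *m A) b.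
  by rewrite mul_row_block !mulmx1 mulmx0 add0r.
have iTP y : iT phi (pinj P) y =
    row_mx (iT phi (pinj Q') (bcmap phi r2 y)) (iT phi (pinj Q'') (bcmap phi v2 y)).
  elim/bc_ind: y => [|t x y IH]; first by rewrite !linear0 row_mx0.
  rewrite !linearD IH !bcmapE !iTE -add_row_mx; congr (_ + _).
  by rewrite -scale_row_mx -map_row_mx.
have tot x' x'' : bcmap phi v2 (lam (bT phi 1 (u1 x' + s1 x''))) = lam'' (bT phi 1 x'').
  rewrite -c2 bcmap1 linearD s1v; congr (lam'' (bT phi 1 _)).
  rewrite -[RHS]add0r; congr (_ + _).
  by case: e1 => _ /(_ (u1 x')) [_ E] _; apply: E; exists x'.
have tot' x' x'' : bcmap phi r2 (lam (bT phi 1 (u1 x' + s1 x''))) =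
    lam' (bT phi 1 x') + bcmap phi r2 (lam (bT phi 1 (s1 x''))).
  rewrite bTDr !linearD; congr (_ + _).
  rewrite -bcmap1 c1; move: (lam' _) => y.
  elim/bc_ind: y => [|t x y IH]; first by rewrite !linear0.
  by rewrite !linearD IH !bcmapE u2r.
have Hx x'' w : pprj Q'' w = 0 ->
    (iT phi (pinj Q'') (lam'' (bT phi 1 x'')) + map_mx phi w) *m H =
    iT phi (pinj Q') (bcmap phi r2 (lam (bT phi 1 (s1 x'')))).
  move=> pw; rewrite HE [pT _ _ _]linearD (pTK (@pprjK _ _ Q'')) pT_map pw.
  by rewrite bT0 addr0 lamK bcmap1.
apply: pred_ext => t; split.
  apply: (Det_mul (M := M (- H))) => // w [x [z [pz ->]]].
  have -> : x = u1 (r1 x) + s1 (v1 x) by rewrite uv1.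
  have [pz1 pz2] : pprj Q' (lsubmx z) = 0 /\ pprj Q'' (rsubmx z) = 0.
    have pz2 : pprj Q'' (rsubmx z) = 0.
      by have := congr1 v2 pz; rewrite /= linearD v2u2 s2v add0r linear0.
    split=> //; have := congr1 r2 pz.
    by rewrite /= pz2 linear0 addr0 u2r linear0.
  rewrite iTP -[z]hsubmxK map_row_mx add_row_mx mulM row_mxKl row_mxKr tot tot'.
  rewrite mulmxN Hx //; split; last by exists (v1 x), (rsubmx z).
  exists (r1 x), (lsubmx z); split=> //.
  by rewrite linearD addrAC addrK.
apply: (Det_mul (M := M H)) => // w [[x' [z' [pz' wl]]] [x'' [z'' [pz'' wr]]]].
exists (u1 x' + s1 x''), (row_mx z' z''); split.
  by rewrite /= row_mxKl row_mxKr pz' pz'' !linear0 addr0.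
rewrite -[w]hsubmxK wl wr mulM Hx // iTP map_row_mx add_row_mx tot tot'.
by congr (row_mx _ _); rewrite linearD addrAC.
Qed.

Lemma D0_extension (g' g g'' : triple phi) (Q' : pres (ttgt g'))
  (Q : pres (ttgt g)) (Q'' : pres (ttgt g'')) : fgproj (tsrc g'') ->
  bijective (tiso g'') -> extension g' g g'' ->
  D0 Q (tiso g) = sprod phi (D0 Q' (tiso g')) (D0 Q'' (tiso g'')).
Proof.
move=> p1 b1 [u1 [v1 [u2 [v2 [e1 e2 c1 c2]]]]].
exact: (D0_short_exact Q' Q Q'' p1 b1 e1 e2 c1 c2).
Qed.

Lemma bcself_linear : linear ((phi : S -> T) : (S^o : lmodType S) -> restr phi (T^o : lmodType T)).
Proof. by move=> a x y; rewrite rmorphD rmorphM. Qed.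

Definition bcself : {linear bc phi (S^o : lmodType S) -> (T^o : lmodType T)} :=
  @bc_lift _ _ phi (S^o) (T^o : lmodType T) (mklin bcself_linear).

Lemma bcselfE t s : bcself (bT phi t (s : S^o)) = t * phi s.
Proof. exact: bc_liftE. Qed.

Lemma bcself_bij : bijective bcself.
Proof.
exists (fun t : T => bT phi t (1 : S^o)) => [x|t]; last by rewrite bcselfE rmorph1 mulr1.
elim/bc_ind: x => [|t x y IH].
  have := linear0 bcself => /= ->.
  by apply: (addrI (bT phi 0 (1 : S^o))); rewrite -bTDl !addr0.
rewrite linearD bTDl IH bcselfE mulrC bTZ; congr (bT _ _ _ + _).
exact: mulr1.
Qed.

Lemma self_inj_linear : linear (fun x : (S^o : lmodType S) => (x : S)%:M : 'rV[S]_1).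
Proof. by move=> a x y; apply/rowP => j; rewrite !ord1 !mxE. Qed.
Lemma self_prj_linear : linear ((fun v : 'rV[S]_1 => v 0 0) : _ -> (S^o : lmodType S)).
Proof. by move=> a x y; rewrite !mxE. Qed.
Lemma self_prjK : cancel (mklin self_inj_linear) (mklin self_prj_linear).
Proof. by move=> x; rewrite /= mxE. Qed.
Definition self_pres : pres (S^o : lmodType S) := Pres self_prjK.

Lemma D0_self (L : lmodType S) (Q : pres (S^o : lmodType S))
  (lam : {linear bc phi L -> bc phi (S^o : lmodType S)}) :
  D0 Q lam = (fun t => exists x, t = bcself (lam (bT phi 1 x))).
Proof.
rewrite (D0_indep Q self_pres) /D0 (@Det1 _ _ phi (W self_pres lam) (@W_sub _ _ phi _ _ self_pres lam)).
have iTself y : iT phi (pinj self_pres) y = (bcself y : T)%:M.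
  elim/bc_ind: y => [|t x y IH]; first by rewrite !linear0 raddf0.
  rewrite !linearD IH raddfD; congr (_ + _).
  rewrite iTE bcselfE; apply/rowP => j; rewrite !ord1 !mxE /=.
  by rewrite !mulr1n.
apply: pred_ext => t; split.
  move=> [x [v [pv]]]; have -> : v = 0.
    by apply/rowP => j; rewrite ord1 mxE; apply: pv.
  rewrite map_mx0 addr0 iTself => /rowP /(_ 0); rewrite !mxE /= !mulr1n => ->.
  by exists x.
move=> [x ->]; exists x, 0; rewrite linear0 map_mx0 addr0 iTself; split=> //.
Qed.

End Invariant.

(** * The invariant [Phi] of a formal sum *)

Section Phi.
Variables (S T : comPzRingType) (phi : {rmorphism S -> T}).
Notation isub := (@is_sub S T phi T^o).

(** The relations [K0eq_opp] and [K0eq_cat] also involve triples that are not generators; giving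
    these the unit ideal makes [gD] invertible everywhere. The presentation is quantified instead of
    chosen, the value being independent of it. *)
Definition gD (g : triple phi) : T -> Prop := fun t =>
  (K0gen g -> exists Q : pres (ttgt g), D0 Q (tiso g) t) /\
  (~ K0gen g -> sunit phi t).

Lemma gDE (g : triple phi) (Q : pres (ttgt g)) : K0gen g -> gD g = D0 Q (tiso g).
Proof.
move=> hg; apply: pred_ext => t; split=> [[/(_ hg) [Q'] + _]|Dt].
  by rewrite (D0_indep Q' Q).
by split=> // _; exists Q.
Qed.

Lemma gD_pres (g : triple phi) : K0gen g -> inhabited (pres (ttgt g)).
Proof. by case=> _ /fgproj_pres. Qed.

Lemma gD_not (g : triple phi) : ~ K0gen g -> gD g = sunit phi.
Proof. by move=> hg; apply: pred_ext => t; split=> [[_ /(_ hg)]|ut]; last split. Qed.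

Lemma gD_sub (g : triple phi) : isub (gD g).
Proof.
have [hg|hg] := pselect (K0gen g); last by rewrite gD_not //; apply: sunit_sub.
by have [Q] := gD_pres hg; rewrite (gDE Q) //; apply: D0_sub.
Qed.

Lemma gD_inv (g : triple phi) : sprod phi (gD g) (sdual phi (gD g)) = sunit phi.
Proof.
have [hg|hg] := pselect (K0gen g); last first.
  rewrite gD_not // -(@sdual_uniq _ _ phi _ (sunit phi)); first 1 last.
  - exact: sunit_sub.
  - by rewrite sprod1 //; apply: sunit_sub.
  by rewrite sprod1 //; apply: sunit_sub.
have [Q'] := gD_pres hg; have [/fgproj_pres [Q] _ /linear_inv [g' [gK gK']]] := hg.
rewrite (gDE Q') // -(@sdual_uniq _ _ phi _ (D0 Q g')); first exact: D0_inv.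
  exact: D0_sub.
exact: D0_inv.
Qed.

Definition sgD (p : bool * triple phi) : T -> Prop :=
  if p.1 then gD p.2 else sdual phi (gD p.2).

Definition Phi (x : fsum phi) : T -> Prop :=
  foldr (fun p => sprod phi (sgD p)) (sunit phi) x.

Lemma sgD_sub p : isub (sgD p).
Proof. by rewrite /sgD; case: p.1; [apply: gD_sub|apply: sdual_sub]. Qed.

Lemma Phi_sub x : isub (Phi x).
Proof. by case: x => [|p x]; [apply: sunit_sub|apply: sprod_sub]. Qed.

Lemma Phi_cat x y : Phi (x ++ y) = sprod phi (Phi x) (Phi y).
Proof.
elim: x => [|p x IH] /=; first by rewrite sprod1 //; apply: Phi_sub.
by rewrite IH sprodA.
Qed.

Lemma Phi1 p : Phi [:: p] = sgD p.
Proof. by rewrite /= sprodr1 //; apply: sgD_sub. Qed.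

Lemma Phi_K0eq x y : K0eq x y -> Phi x = Phi y.
Proof.
elim=> //.
- by move=> ? ? ? _ -> _ ->.
- by move=> ? ? ? ? _ IH1 _ IH2; rewrite !Phi_cat IH1 IH2.
- by move=> ? ?; rewrite !Phi_cat sprodC.
- by move=> g; rewrite -cat1s Phi_cat !Phi1 gD_inv.
- move=> g' g g'' hg' hg hg'' e; rewrite -[[:: _; _]]cat1s Phi_cat !Phi1 /sgD /=.
  have [[Q'] [Q] [Q'']] := And3 (gD_pres hg') (gD_pres hg) (gD_pres hg'').
  rewrite (gDE Q') // (gDE Q) // (gDE Q'') //.
  by case: hg'' => p1 _ b; apply: (D0_extension Q' Q Q'' p1 b e).
- move=> L1 L2 L3 lam mu hl hm; rewrite -[[:: _; _]]cat1s Phi_cat !Phi1 /sgD /=.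
  have hml : K0gen (Triple (mu \o lam)).
    by case: hl hm => [? ? bl] [? ? bm]; split=> //; apply: bij_comp.
  have [[Q2] [Q3]] := conj (gD_pres hl) (gD_pres hm).
  rewrite (gDE (g := Triple lam) Q2) // (gDE (g := Triple mu) Q3) //.
  rewrite (gDE (g := Triple (mu \o lam)) Q3) //=.
  by rewrite (D0_comp Q2) //; case: hm.
Qed.

Definition fneg (x : fsum phi) : fsum phi := [seq (~~ p.1, p.2) | p <- x].

Lemma Phi_neg x : sprod phi (Phi x) (Phi (fneg x)) = sunit phi.
Proof.
elim: x => [|[b g] x IH] /=; first by rewrite sprod1 //; apply: sunit_sub.
rewrite sprodACA IH sprodr1 /sgD; last exact: sprod_sub.
by case: b => /=; last rewrite sprodC; rewrite gD_inv.
Qed.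

Lemma Phi_self L (lam : {linear bc phi L -> bc phi (S^o : lmodType S)}) :
  K0gen (Triple lam) ->
  Phi [:: (true, Triple lam)] = (fun t => exists x, t = bcself phi (lam (bT phi 1 x))).
Proof.
by move=> h; rewrite Phi1 /sgD /= (gDE (g := Triple lam) (self_pres S)) // D0_self.
Qed.

Lemma fgproj_rV n : fgproj ('rV[S]_n : lmodType S).
Proof. exact: (pres_fgproj (free_pres S n)). Qed.

Lemma fgproj_self : fgproj (S^o : lmodType S).
Proof. exact: (pres_fgproj (self_pres S)). Qed.

Lemma unit_triple_gen t u : t * u = 1 -> K0gen (unit_triple phi t).
Proof.
move=> tu; split; try exact: fgproj_self.
exists (fun x : bc phi (S^o : lmodType S) => u *: x) => x; rewrite /= scalerA ?tu.
  by rewrite mulrC tu scale1r.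
by rewrite scale1r.
Qed.

Lemma Phi_unit t u : t * u = 1 -> Phi [:: (true, unit_triple phi t)] = sprin phi t.
Proof.
move=> tu; rewrite Phi_self; last exact: (unit_triple_gen tu).
have E (s : S) : bcself phi (t *: bT phi 1 (s : S^o)) = phi s * t.
  by rewrite linZ bcselfE mul1r mulrC.
by apply: pred_ext => z; split=> [[s ->]|[s ->]]; exists s; rewrite -E.
Qed.

End Phi.

(** * Base change of [Phi] *)

Section PhiPush.
Variables (S T S' T' : comPzRingType).
Variables (phi : {rmorphism S -> T}) (phi' : {rmorphism S' -> T'}).
Variables (f : {rmorphism S -> S'}) (h : {rmorphism T -> T'}).
Hypothesis comm : forall s, h (phi s) = phi' (f s).

Definition bc_pres (L : lmodType S) (Q : pres L) : pres (bc f L : lmodType S') :=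
  Pres (pTK (phi := f) (@pprjK _ _ Q)).

Lemma fgproj_bc (L : lmodType S) : fgproj L -> fgproj (bc f L : lmodType S').
Proof. by move=> /fgproj_pres [Q]; apply: (pres_fgproj (bc_pres Q)). Qed.

Lemma push_kappa (L1 L2 : lmodType S) (lam : {linear bc phi L1 -> bc phi L2}) y :
  push_iso comm lam (kappa comm L1 y) = kappa comm L2 (lam y).
Proof.
elim/bc_ind: y => [|t x y IH]; first by rewrite !linear0.
rewrite !linearD IH; congr (_ + _).
rewrite kappaE -[h t]mulr1 -bTE linZ push_isoE -[t in RHS]mulr1 -bTE linZ.
by rewrite [RHS]linearZ.
Qed.

Lemma bc2_ext (L : lmodType S) (M : lmodType T')
  (F G : {linear bc phi' (bc f L : lmodType S') -> M}) :
  (forall x, F (bT phi' 1 (bT f 1 x)) = G (bT phi' 1 (bT f 1 x))) -> F =1 G.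
Proof.
move=> FG; apply: bc_linear_ext => w; elim/bc_ind: w => [|s x w IH].
  by rewrite bT0 !linear0.
by rewrite bTDr !linearD IH -[s]mulr1 -bTE bT1Z !linZ FG.
Qed.

Lemma push_bij (L1 L2 : lmodType S) (lam : {linear bc phi L1 -> bc phi L2}) :
  bijective lam -> bijective (push_iso comm lam).
Proof.
move=> /linear_inv [mu [lK mK]]; exists (push_iso comm mu).
  apply: (bc2_ext (F := push_iso comm mu \o push_iso comm lam) (G := idfun)) => x.
  rewrite -[LHS]/(push_iso comm mu (push_iso comm lam _)) push_isoE push_kappa lK.
  by rewrite kappaE rmorph1.
apply: (bc2_ext (F := push_iso comm lam \o push_iso comm mu) (G := idfun)) => x.
rewrite -[LHS]/(push_iso comm lam (push_iso comm mu _)) push_isoE push_kappa mK.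
by rewrite kappaE rmorph1.
Qed.

Lemma push_gen (g : triple phi) : K0gen g -> K0gen (push_triple comm g).
Proof. by case=> p1 p2 b; split; [apply: fgproj_bc|apply: fgproj_bc|apply: push_bij]. Qed.

Lemma K0_push (x : fsum phi) : K0 x -> K0 (push comm x).
Proof.
by elim=> [|p {}x hp _ IH]; [apply: List.Forall_nil|apply: List.Forall_cons => //=; apply: push_gen].
Qed.

Lemma map_comm m n (A : 'M[S]_(m, n)) : map_mx h (map_mx phi A) = map_mx phi' (map_mx f A).
Proof. by apply/matrixP => i j; rewrite !mxE comm. Qed.

Lemma iT_kappa (L : lmodType S) (Q : pres L) y :
  iT phi' (pinj (bc_pres Q)) (kappa comm L y) = map_mx h (iT phi (pinj Q) y).
Proof.
elim/bc_ind: y => [|t x y IH].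
  by rewrite !linear0; apply/rowP => j; rewrite !mxE rmorph0.
rewrite !linearD map_mxD IH; congr (_ + _).
rewrite kappaE (iTE phi' (iT f (pinj Q))) (iTE phi) iT1.
by rewrite map_mxZ map_comm.
Qed.

(** The lattice of the pushed triple is the S'-span of the image of the original lattice, so by
    multilinearity its determinants are combinations of determinants with rows in that image. *)
Lemma D0_push (L1 L2 : lmodType S) (Q : pres L2)
  (lam : {linear bc phi L1 -> bc phi L2}) :
  D0 (bc_pres Q) (push_iso comm lam) = spush phi' h (D0 Q lam).
Proof.
have WW w : W Q lam w -> W (bc_pres Q) (push_iso comm lam) (map_mx h w).
  move=> [x [v [pv ->]]]; exists (bT f 1 x), (map_mx f v).
  split; first by have := pT_map f (pprj Q) v; rewrite pv bT0.
  by rewrite map_mxD push_isoE iT_kappa map_comm.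
apply: pred_ext => t; split; last first.
  move=> Ht; apply: (spush_least _ _ Ht); first exact: D0_sub.
  apply: Det_least; first exact: (hpre_sub comm (D0_sub _ _)).
  move=> M HM; rewrite -det_map_mx; apply: Det_in => k.
  by rewrite -map_row; apply: WW.
move=> Ht; apply: (Det_least _ _ Ht); first exact: spush_sub.
pose X (w' : 'rV[T']_(prank Q)) := exists2 w, W Q lam w & w' = map_mx h w.
move=> M HM; apply: (@det_rspan _ _ phi' _ X); first exact: spush_sub.
  move=> {HM}M HM; have /choice [w Hw] k : exists w, W Q lam w /\ row k M = map_mx h w.
    by have [w] := HM k; exists w.
  have -> : M = map_mx h (\matrix_k w k).
    by apply/row_matrixP => k; have [_ ->] := Hw k; rewrite -map_row rowK.
  rewrite det_map_mx; apply/spush_in/Det_in => k.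
  by rewrite rowK; case: (Hw k).
move=> k; have [z [v [pv ->]]] := HM k.
have hX := rspan_is_sub phi' X.
apply: (subD hX).
  elim/bc_ind: z => [|s x z IH]; first by rewrite bT0 !linear0; apply: (sub0 hX).
  rewrite bTDr !linearD; apply: (subD hX) => //.
  rewrite -[s]mulr1 -bTE bT1Z !linZ push_isoE iT_kappa; apply/(subZ hX)/rspan_in.
  exists (iT phi (pinj Q) (lam (bT phi 1 x))) => //.
  by exists x, 0; rewrite linear0 map_mx0 addr0.
(* As v is killed by the projection p of the presentation, with injection i, it equals v - i p v, a
   combination of the vectors e_j - i p e_j, which are defined over S. *)
have -> : v = \sum_j v 0 j *: map_mx f (delta_mx 0 j - pinj Q (pprj Q (delta_mx 0 j))).
  transitivity (v - iT f (pinj Q) (pT f (pprj Q) v)).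
    by rewrite [pT _ _ v]pv linear0 subr0.
  rewrite {1 2}[v]row_sum_delta (linear_sum (pT f (pprj Q))).
  rewrite (linear_sum (iT f (pinj Q))) -sumrB; apply: eq_bigr => j _.
  rewrite (linZ (pT f (pprj Q))) (linZ (iT f (pinj Q))). rewrite -scalerBr; congr (_ *: _); rewrite map_mxB map_delta_mx.
  by rewrite -[delta_mx 0 j in X in _ = X]/(delta_mx 0 j) -(map_delta_mx f) pT_map iT1.
rewrite raddf_sum.
apply: (@sub_sum _ _ phi' _ _ _ _ _ _ hX) => j _; rewrite /= map_mxZ; apply/(subZ hX)/rspan_in.
exists (map_mx phi (delta_mx 0 j - pinj Q (pprj Q (delta_mx 0 j)))).
  exists 0, (delta_mx 0 j - pinj Q (pprj Q (delta_mx 0 j))).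
  by rewrite linearB pprjK subrr bT0 !linear0 add0r.
by rewrite map_comm.
Qed.

Lemma gD_push (g : triple phi) : K0gen g -> gD (push_triple comm g) = spush phi' h (gD g).
Proof.
move=> hg; have [Q] := gD_pres hg; rewrite (gDE Q) //.
rewrite (gDE (g := push_triple comm g) (bc_pres Q)); last exact: push_gen.
exact: D0_push.
Qed.

Lemma Phi_push (x : fsum phi) : K0 x -> Phi (push comm x) = spush phi' h (Phi x).
Proof.
elim=> [|[b g] {}x /= hg _ IH] /=; first by rewrite (spush_sunit comm).
rewrite IH (spush_sprod comm); congr sprod; rewrite /sgD /=.
case: b => /=; rewrite gD_push //.
apply/esym/sdual_uniq; first exact: spush_sub.
by rewrite -(spush_sprod comm) gD_inv (spush_sunit comm).
Qed.

End PhiPush.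

(** * Injectivity of the determinant *)

Section Horner.
Variables (k S : comPzRingType) (psi : {rmorphism k -> S}).

(** Polynomials are lists of coefficients, a monic one being [rcons s 1]. Integrality then makes
    sense over the zero ring too, which the quotients taken below may be. *)
Fixpoint hev (s : seq k) (a : S) : S := if s is c :: s' then psi c + a * hev s' a else 0.

Definition integral_elt (a : S) : Prop := exists s, hev (rcons s 1) a = 0.

Lemma hev_sub s a b : exists w, hev s a - hev s b = (a - b) * w.
Proof.
elim: s => [|c s [w IH]] /=; first by exists 0; rewrite subrr mulr0.
exists (hev s a + b * w); have -> : hev s a = hev s b + (a - b) * w by rewrite -IH addrC subrK.
ring.
Qed.

Lemma hev_order s a j : has (fun c => c != 0) s -> a ^+ j * hev s a = 0 ->
  exists n m r, m != 0 /\ a ^+ n * (psi m + a * r) = 0.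
Proof.
elim: s j => //= c s IH j; case: eqP => [->|/eqP c0] /= hs.
  by rewrite rmorph0 add0r mulrA -exprSr; apply: IH.
by move=> E; exists j, c, (hev s a).
Qed.

End Horner.

(** Here m is the lowest nonzero coefficient of a monic equation of a, and n its index. *)
Lemma integral_order (k S : comPzRingType) (psi : {rmorphism k -> S}) a :
  (1 : k) != 0 -> integral_elt psi a ->
  exists n m r, m != 0 /\ a ^+ n * (psi m + a * r) = 0.
Proof.
move=> k1 [s E]; apply: (@hev_order _ _ psi (rcons s 1) a 0); last by rewrite E mulr0.
by rewrite has_rcons k1.
Qed.

Lemma hev_int (S : comPzRingType) (s : seq int) (z : int) :
  hev (intr : {rmorphism int -> S}) s z%:~R = (hev (idfun : {rmorphism int -> int}) s z)%:~R.
Proof. by elim: s => //= c s ->; rewrite rmorphD rmorphM. Qed.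

Lemma hev_poly (s : seq int) (z : int) :
  hev (idfun : {rmorphism int -> int}) s z = (Poly s).[z].
Proof.
by elim: s => [|c s IH] /=; rewrite ?horner0 // horner_cons -IH addrC mulrC.
Qed.

(** A nonzero polynomial p has finitely many roots, so p(-tN) is nonzero for some t; and a + tN
    divides p(a) - p(-tN) = - p(-tN). *)
Lemma integral_generic (S : comPzRingType) (a : S) (N : int) : N != 0 ->
  integral_elt (intr : {rmorphism int -> S}) a ->
  exists (t m : int) (w : S), m != 0 /\ (a + (t * N)%:~R) * w = m%:~R.
Proof.
move=> N0 [s E]; pose p := Poly (rcons s 1 : seq int).
have p0 : p != 0.
  rewrite -lead_coef_eq0 /lead_coef.
  have -> : p = rcons s 1 :> seq _.
    by apply: (@PolyK _ 0); rewrite last_rcons.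
  by rewrite nth_last last_rcons.
have [t pt] : exists t : nat, p.[- (t%:Z * N)] != 0.
  apply: contrapT => H.
  have p_0 t : p.[- (t%:Z * N)] = 0.
    by apply/eqP; apply: contrapT => /negP pt; apply: H; exists t.
  pose rs := [seq - (i%:Z * N) | i <- iota 0 (size p)].
  suff : (size rs < size p)%N by rewrite size_map size_iota ltnn.
  apply: max_poly_roots => //; first by apply/allP => _ /mapP [t _ ->]; apply/eqP.
  rewrite map_inj_uniq ?iota_uniq // => t t' /oppr_inj /(mulIf N0).
  by case.
exists t, (p.[- (t%:Z * N)]).
have [w Hw] := hev_sub (intr : {rmorphism int -> S}) (rcons s 1) a (- (t%:Z * N))%:~R.
exists (- w); split=> //.
move: Hw; rewrite E hev_int hev_poly -/p sub0r rmorphN opprK mulrN => <-.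
by rewrite opprK.
Qed.

(** * Pi-regularity up to a multiplicative set *)

Section Preg.
Variable S : comPzRingType.

(** For [Mset] reduced to 1 this is pi-regularity: the idempotent e = a c splits the ring into a
    factor where a is a unit and one where a is nilpotent. For a ring integral over Z it is obtained
    up to a positive integer m, the idempotent being e / m. *)
Definition preg (Mset : S -> Prop) : Prop := forall a : S, exists c m n,
  [/\ Mset m, (a * c) * (a * c) = m * (a * c) & (m - a * c) * a ^+ n = 0].

(** The element u = - a r acts as m on a^n, and u^n is a multiple of a^n. Hence u^(n+1), a multiple
    of a, squares to m^(n+1) times itself. *)
Lemma preg_order (Mset : S -> Prop) : (forall x y, Mset x -> Mset y -> Mset (x * y)) ->
  Mset 1 -> (forall a, exists n m r, Mset m /\ a ^+ n * (m + a * r) = 0) -> preg Mset.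
Proof.
move=> MM M1 H a; have [n [m [r [Mm E]]]] := H a.
have MX i : Mset (m ^+ i) by elim: i => [|i IH]; rewrite ?expr0 // exprS; apply: MM.
pose u := - (a * r).
have au : a ^+ n * u = a ^+ n * m.
  by apply/eqP; rewrite -subr_eq0 -mulrBr -opprD mulrN [_ + m]addrC E oppr0.
have aui i : a ^+ n * u ^+ i = a ^+ n * m ^+ i.
  elim: i => // i IH; rewrite exprSr mulrA IH -mulrA [_ * u]mulrC mulrA au -mulrA.
  by rewrite exprS.
exists (- r * u ^+ n), (m ^+ n.+1), n.
have -> : a * (- r * u ^+ n) = u ^+ n.+1 by rewrite mulrA mulrN exprS.
split; first exact: MX.
  have un : u ^+ n = (- r) ^+ n * a ^+ n by rewrite -exprMn mulNr mulrC.
  have E1 i : u ^+ (n + i) = (- r) ^+ n * (a ^+ n * m ^+ i).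
    by rewrite exprD un -mulrA aui.
  have E2 : u ^+ n.+1 = (- r) ^+ n * (a ^+ n * m) by rewrite -addn1 E1 expr1.
  rewrite -exprD addSnnS E1 E2 !exprS; ring.
by rewrite mulrBl ![_ * a ^+ n]mulrC aui subrr.
Qed.

Section Unimodular.
Variables (k l : nat) (E : 'M[S]_(k, l)) (Mset : S -> Prop).
Hypotheses (MM : forall x y, Mset x -> Mset y -> Mset (x * y)) (M1 : Mset 1).
Hypothesis pr : preg Mset.

Definition bval (x : 'rV[S]_k) (y : 'cV[S]_l) : S := (x *m E *m y) 0 0.

Lemma bvalDl x x' y : bval (x + x') y = bval x y + bval x' y.
Proof. by rewrite /bval !mulmxDl mxE. Qed.
Lemma bvalDr x y y' : bval x (y + y') = bval x y + bval x y'.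
Proof. by rewrite /bval mulmxDr mxE. Qed.
Lemma bvalZl c x y : bval (c *: x) y = c * bval x y.
Proof. by rewrite /bval -!scalemxAl mxE. Qed.
Lemma bvalZr c x y : bval x (c *: y) = c * bval x y.
Proof. by rewrite /bval -scalemxAr mxE. Qed.

(** The invariant of an induction over the entries of E: the value e = x E y behaves as m times an
    idempotent, off which the partial sum s is nilpotent. *)
Definition unim_inv (s : S) : Prop := exists x y m n,
  [/\ Mset m, bval x y * bval x y = m * bval x y & (m - bval x y) * s ^+ n = 0].

Lemma MX m i : Mset m -> Mset (m ^+ i).
Proof. by move=> Mm; elim: i => [|i IH]; rewrite ?expr0 // exprS; apply: MM. Qed.

Lemma kill_add (d s a : S) n n' : d * s ^+ n = 0 -> d * a ^+ n' = 0 ->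
  d * (s + a) ^+ (n + n') = 0.
Proof.
move=> ds da; have kill x j j' : d * x ^+ j = 0 -> (j <= j')%N -> d * x ^+ j' = 0.
  by move=> dx le; rewrite -(subnKC le) exprD mulrA dx mul0r.
rewrite exprDn mulr_sumr big1 // => i _; rewrite mulrnAr.
have [le|lt] := leqP n' i.
  by rewrite mulrCA (kill _ n') // mulr0 mul0rn.
by rewrite mulrA (kill _ n) ?mul0r ?mul0rn // -addnBA ?leq_addr // ltnW.
Qed.

(** Pi-regularity of (m - e) a produces e' with e e' = 0. The cross terms between the old pair and
    the new one then vanish, and the value is a combination of e and e' only. *)
Lemma unim_step s z w : unim_inv s -> unim_inv (s + bval z w).
Proof.
move=> [x [y [m [n [Mm H1 H0]]]]]; set e := bval x y in H1 H0; set a := bval z w.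
have [c [m' [n' [Mm' H2 H3]]]] := pr ((m - e) * a).
set e' := (m - e) * a * c in H2 H3.
have ee : e * e' = 0 by rewrite /e' !mulrA mulrBr H1 [e * m]mulrC subrr !mul0r.
(* Since (m - e)^2 = m (m - e), the factor m^n' turns m - e into (m - e)^(n'+1), which is what lets
   m' - e' kill the power of a. The exponents 3 below give both summands the common factor m^2
   m'^2. *)
pose q := m ^+ n'.
exists (e *: x + e' *: z), ((e * m' ^+ 3 * q) *: y + (e' * m * c * m ^+ 3 * q) *: w).
exists (m ^+ 3 * m' ^+ 3 * q), (n + n')%N.
have -> : bval (e *: x + e' *: z) ((e * m' ^+ 3 * q) *: y + (e' * m * c * m ^+ 3 * q) *: w)
    = m ^+ 2 * m' ^+ 2 * q * (m' * e + m * e').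
  rewrite bvalDl !bvalDr !bvalZl !bvalZr -/e -/a.
  have -> : e' * (e' * m * c * m ^+ 3 * q * a) = m ^+ 3 * q * (e' * e') * (e' + e * a * c).
    by rewrite /e'; ring.
  transitivity (m' ^+ 3 * q * e * (e * e) + (e * e') * (m * c * m ^+ 3 * q * bval x w
    + m' ^+ 3 * q * bval z y + m ^+ 3 * q * e' * a * c) + m ^+ 3 * q * e' * (e' * e')); first by ring.
  rewrite ee mul0r addr0 H1 H2.
  transitivity (m' ^+ 3 * q * m * (e * e) + m ^+ 3 * q * m' * (e' * e')); first by ring.
  rewrite H1 H2; ring.
split; first by apply: MM; [apply: MM|]; apply: MX.
  transitivity ((m ^+ 2 * m' ^+ 2 * q) ^+ 2 * (m' ^+ 2 * (e * e) + m ^+ 2 * (e' * e')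
    + 2%:R * m * m' * (e * e'))); first by ring.
  rewrite ee H1 H2; ring.
have -> : m ^+ 3 * m' ^+ 3 * q - m ^+ 2 * m' ^+ 2 * q * (m' * e + m * e') =
    m ^+ 2 * m' ^+ 2 * (m ^+ n' * ((m - e) * (m' - e') - e * e')) by rewrite /q; ring.
rewrite ee subr0; apply: kill_add.
  transitivity (m ^+ 2 * m' ^+ 2 * q * (m' - e') * ((m - e) * s ^+ n)); first by rewrite /q; ring.
  by rewrite H0 mulr0.
have sq : (m - e) * (m - e) = m * (m - e).
  transitivity (m * m - 2%:R * m * e + e * e); first by ring.
  rewrite H1; ring.
have mei i : (m - e) ^+ i.+1 = m ^+ i * (m - e).
  elim: i => [|i IH]; first by rewrite mul1r.
  by rewrite exprS IH mulrCA sq mulrCA exprS mulrA.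
transitivity (m ^+ 2 * m' ^+ 2 * (m ^+ n' * (m - e)) * ((m' - e') * a ^+ n')); first by ring.
rewrite -mei [(m - e) ^+ _]exprSr.
transitivity (m ^+ 2 * m' ^+ 2 * (m - e) * ((m' - e') * ((m - e) * a) ^+ n')).
  rewrite exprMn; move: ((m - e) ^+ n') => X; ring.
by rewrite H3 mulr0.
Qed.

Lemma unim_inv0 : unim_inv 0.
Proof.
exists 0, 0, 1, 1%N; have -> : bval 0 0 = 0 by rewrite /bval mulmx0 mxE.
by split=> //; rewrite ?mulr0 // expr1 mulr0.
Qed.

(** Passes from a linear combination of the entries to a single bilinear value. At the end s is in
    [Mset], and (m - e) s^n = 0 gives the value s^n e = m s^n. *)
Lemma unimodular_pair (C : 'M[S]_(k, l)) : Mset (\sum_i \sum_j C i j * E i j) ->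
  exists x y m, Mset m /\ bval x y = m.
Proof.
set s := \sum_i _ => Ms; have : unim_inv s.
  rewrite /s pair_bigA; elim/big_rec: _ => [|[i j] x _ IH]; first exact: unim_inv0.
  rewrite /= addrC; have -> : C i j * E i j = bval (C i j *: delta_mx 0 i) (delta_mx j 0).
    by rewrite bvalZl /bval -rowE -colE !mxE.
  exact: unim_step.
move=> [x [y [m [n [Mm _ /eqP]]]]]; rewrite mulrBl subr_eq0 => /eqP E0.
exists (s ^+ n *: x), y, (m * s ^+ n); split; first by apply: MM => //; apply: MX.
by rewrite bvalZl mulrC -E0.
Qed.

End Unimodular.
End Preg.

Section QuotientRing.
Variable S : comPzRingType.

Record ideal := Ideal {
  ideal_pred :> S -> Prop;
  ideal0 : ideal_pred 0;
  idealB : forall x y, ideal_pred x -> ideal_pred y -> ideal_pred (x - y);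
  idealM : forall a x, ideal_pred x -> ideal_pred (a * x) }.

Variable J : ideal.

Lemma idealN x : J x -> J (- x).
Proof. by rewrite -[- x]sub0r; apply/idealB/ideal0. Qed.
Lemma idealD x y : J x -> J y -> J (x + y).
Proof. by move=> Jx /idealN Jy; rewrite -[y]opprK; apply: idealB. Qed.

Definition qequiv (x y : S) : bool := `[< J (x - y) >].
Lemma qequiv_refl : reflexive qequiv.
Proof. by move=> x; apply/asboolP; rewrite subrr; apply: ideal0. Qed.
Lemma qequiv_sym : symmetric qequiv.
Proof. by move=> x y; apply/asboolP/asboolP => /idealN; rewrite opprB. Qed.
Lemma qequiv_trans : transitive qequiv.
Proof.
move=> y x z /asboolP xy /asboolP yz; apply/asboolP.
by rewrite -(subrK y x) -addrA; apply: idealD.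
Qed.
Canonical qequiv_rel := EquivRel qequiv qequiv_refl qequiv_sym qequiv_trans.

Local Open Scope quotient_scope.
Definition quot := {eq_quot qequiv}.
HB.instance Definition _ : EqQuotient _ qequiv quot := EqQuotient.on quot.
HB.instance Definition _ := Choice.on quot.

Definition qpi (x : S) : quot := \pi_quot x.

Lemma qpiP x y : qpi x = qpi y <-> J (x - y).
Proof. by split=> [/eqmodP /asboolP|Jxy] //; apply/eqmodP/asboolP. Qed.

Lemma qpi_repr (u : quot) : qpi (generic_quotient.repr u) = u. Proof. exact: reprK. Qed.

Lemma repr_qpi x : J (generic_quotient.repr (qpi x) - x).
Proof. by apply/qpiP; rewrite qpi_repr. Qed.

Definition qadd (u v : quot) := qpi (generic_quotient.repr u + generic_quotient.repr v).
Definition qopp (u : quot) := qpi (- generic_quotient.repr u).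
Definition qmul (u v : quot) := qpi (generic_quotient.repr u * generic_quotient.repr v).

Lemma qaddE x y : qadd (qpi x) (qpi y) = qpi (x + y).
Proof. by apply/qpiP; rewrite opprD addrACA; apply: idealD; apply: repr_qpi. Qed.
Lemma qoppE x : qopp (qpi x) = qpi (- x).
Proof. by apply/qpiP; rewrite -opprD; apply/idealN/repr_qpi. Qed.
Lemma qmulE x y : qmul (qpi x) (qpi y) = qpi (x * y).
Proof.
apply/qpiP; have -> : forall x' y', x' * y' - x * y = y' * (x' - x) + x * (y' - y).
  by move=> x' y'; ring.
by apply: idealD; apply/idealM/repr_qpi.
Qed.

Lemma quot_ind (P : quot -> Prop) : (forall x, P (qpi x)) -> forall u, P u.
Proof. by move=> H u; rewrite -[u]qpi_repr. Qed.

Lemma qaddA : associative qadd.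
Proof. by do 3!elim/quot_ind => ?; rewrite !qaddE addrA. Qed.
Lemma qaddC : commutative qadd.
Proof. by do 2!elim/quot_ind => ?; rewrite !qaddE addrC. Qed.
Lemma qadd0 : left_id (qpi 0) qadd.
Proof. by elim/quot_ind => ?; rewrite !qaddE add0r. Qed.
Lemma qaddN : left_inverse (qpi 0) qopp qadd.
Proof. by elim/quot_ind => ?; rewrite qoppE !qaddE addNr. Qed.
HB.instance Definition _ := GRing.isZmodule.Build quot qaddA qaddC qadd0 qaddN.

Lemma qmulA : associative qmul.
Proof. by do 3!elim/quot_ind => ?; rewrite !qmulE mulrA. Qed.
Lemma qmulC : commutative qmul.
Proof. by do 2!elim/quot_ind => ?; rewrite !qmulE mulrC. Qed.
Lemma qmul1 : left_id (qpi 1) qmul.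
Proof. by elim/quot_ind => ?; rewrite !qmulE mul1r. Qed.
Lemma qmulDl : left_distributive qmul +%R.
Proof. by do 3!elim/quot_ind => ?; rewrite -[RHS]/(qadd _ _) -[X in qmul X _ = _]/(qadd _ _) qaddE !qmulE qaddE mulrDl. Qed.
HB.instance Definition _ :=
  GRing.Zmodule_isComPzRing.Build quot qmulA qmulC qmul1 qmulDl.

Lemma qpi_add : zmod_morphism qpi.
Proof. by move=> x y; rewrite -qaddE -qoppE. Qed.
Lemma qpi_mul : monoid_morphism qpi.
Proof. by split=> // x y; rewrite -qmulE. Qed.
HB.instance Definition _ := GRing.isZmodMorphism.Build S quot qpi qpi_add.
HB.instance Definition _ := GRing.isMonoidMorphism.Build S quot qpi qpi_mul.

Lemma qpi0P x : qpi x = 0 <-> J x.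
Proof. by rewrite -[0]/(qpi 0) qpiP subr0. Qed.

End QuotientRing.

(** * Pi-regularity of integral rings, and ideals *)

Section FinitePowers.
Variables (S : comPzRingType) (N : nat).
Hypotheses (N0 : (0 < N)%N) (NS : N%:R = 0 :> S).

Lemma nat_modN n : (n %% N)%:R = n%:R :> S.
Proof. by rewrite {2}(divn_eq n N) natrD natrM NS mulr0 add0r. Qed.

Lemma int_nat_mod (z : int) : exists n : nat, z%:~R = n%:R :> S.
Proof.
case: z => n; first by exists n.
exists (n.+1 * N.-1)%N; rewrite NegzE rmorphN /=.
apply/eqP; rewrite eq_sym -subr_eq0 opprK natrM -[X in _ + X]mulr1 -mulrDr.
by rewrite -[1]/(1%:R) -natrD addn1 prednK // NS mulr0.
Qed.

Lemma power_repr (a : S) (s : seq int) : hev (intr : {rmorphism int -> S}) (rcons s 1) a = 0 ->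
  forall t, exists c : {ffun 'I_(size s) -> 'I_N}, a ^+ t = \sum_i (c i)%:R * a ^+ i.
Proof.
have hevE u : hev (intr : {rmorphism int -> S}) u a = \sum_(i < size u) (u`_i)%:~R * a ^+ i.
  elim: u => [|c u IH]; first by rewrite big_ord0.
  rewrite big_ord_recl /= mulr1 IH mulr_sumr; congr (_ + _).
  by apply: eq_bigr => i _; rewrite exprS mulrCA.
rewrite hevE size_rcons big_ord_recr /= nth_rcons ltnn eqxx mul1r => Es.
set n := size s in Es *.
have [b Eb] : exists b : nat -> nat, a ^+ n = \sum_(i < n) (b i)%:R * a ^+ i.
  have /choice [b Hb] i : exists m : nat, (- s`_i)%:~R = m%:R :> S by apply: int_nat_mod.
  exists b; apply/eqP; rewrite -subr_eq0 -sumrN addrC -[X in _ == X]Es; apply/eqP.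
  congr (_ + _); apply: eq_bigr => i _.
  by rewrite -Hb rmorphN mulNr opprK nth_rcons ltn_ord.
suff H t : exists c : nat -> nat, a ^+ t = \sum_(i < n) (c i)%:R * a ^+ i.
  move=> t; have [c ->] := H t.
  exists [ffun i : 'I_n => Ordinal (ltn_pmod (c i) N0)].
  by apply: eq_bigr => i _; rewrite ffunE /= nat_modN.
elim: t => [|t [c IH]].
  have [n0|n0] := posnP n; last first.
    exists (fun i => (i == 0)%N); rewrite (bigD1 (Ordinal n0)) //= mul1r big1 ?addr0 //.
    by move=> i; rewrite -val_eqE /= => /negbTE ->; rewrite mul0r.
  by exists b; rewrite -Eb n0.
clear Es; clearbody n; case: n b Eb c IH => [|n] b Eb c IH.
  by exists c; rewrite exprS IH !big_ord0 mulr0.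
exists (fun i => (if i is j.+1 then c j else 0) + c n * b i)%N.
under [RHS]eq_bigr do rewrite natrD mulrDl natrM -mulrA.
rewrite big_split -mulr_sumr -Eb exprS IH big_ord_recr mulrDr mulrCA -exprS; congr (_ + _).
rewrite [RHS]big_ord_recl /= mul0r add0r mulr_sumr.
by apply: eq_bigr => i _ /=; rewrite exprS mulrCA.
Qed.

(** The powers of a are combinations of boundedly many of them with coefficients below N. They take
    finitely many values, so the sequence of powers is eventually periodic. *)
Lemma finite_preg : (forall a : S, integral_elt (intr : {rmorphism int -> S}) a) ->
  preg (fun m : S => m = 1).
Proof.
move=> Sint a; have [s Es] := Sint a.
have /choice [c Hc] := power_repr Es.
have [i [j [ij Eij]]] : exists i j, (i < j)%N /\ a ^+ i = a ^+ j.
  pose F := {ffun 'I_(size s) -> 'I_N}; pose g (t : 'I_(#|{: F}|.+1)) := c t.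
  have : ~ injective g by move=> /leq_card; rewrite card_ord ltnn.
  move=> /existsNP [x /existsNP [y H]]; have [gxy xy] : g x = g y /\ x <> y.
    by split=> [|E]; apply: contrapT => E'; apply: H => // ?.
  have E : a ^+ x = a ^+ y by rewrite !Hc -/(g x) -/(g y) gxy.
  have [lt|lt|/val_inj //] := ltngtP x y; first by exists x, y.
  by exists y, x.
pose d := (j - i)%N; have d0 : (0 < d)%N by rewrite subn_gt0.
have per n : (i <= n)%N -> a ^+ (n + d) = a ^+ n.
  move=> le; have -> : (n + d = j + (n - i))%N by rewrite /d; lia.
  by rewrite exprD -Eij -exprD subnKC.
have pers n l : (i <= n)%N -> a ^+ (n + l * d) = a ^+ n.
  move=> le; elim: l => [|l IH]; first by rewrite addn0.
  by rewrite mulSn addnCA addnC per // (leq_trans le) ?leq_addr.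
(* A positive multiple of the period d that is at least i, so that a^(2n) = a^n. *)
pose n := (i.+1 * d)%N.
have n0 : (0 < n)%N by rewrite muln_gt0.
have le_in : (i <= n)%N by rewrite (leq_trans (leqnSn i)) // leq_pmulr.
exists (a ^+ n.-1), 1, i; rewrite -exprS prednK //; split=> //.
  by rewrite -exprD pers // mul1r.
by rewrite mulrBl mul1r -exprD addnC pers // subrr.
Qed.

End FinitePowers.

Lemma integral_preg (S : comPzRingType) :
  (forall a : S, integral_elt (intr : {rmorphism int -> S}) a) ->
  preg (fun m : S => exists2 n, (0 < n)%N & m = n%:R).
Proof.
move=> Sint; apply: preg_order.
- by move=> _ _ [n n0 ->] [m m0 ->]; exists (n * m)%N; rewrite ?muln_gt0 ?n0 ?natrM.
- by exists 1%N.
move=> a; have [n [m [r [m0 E]]]] := integral_order (oner_neq0 int) (Sint a).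
(* The integer m may be negative; its square is a positive natural number. *)
exists n, (m%:~R * m%:~R), (r * m%:~R); split; last first.
  by rewrite mulrA -mulrDl mulrA E mul0r.
exists (`|m| * `|m|)%N; first by rewrite muln_gt0 absz_gt0 m0.
rewrite -rmorphM -[RHS]/((`|m| * `|m|)%N%:Z%:~R); congr (_ %:~R).
by rewrite PoszM !abszE -Num.Theory.normrM -expr2 Num.Theory.ger0_norm // Num.Theory.sqr_ge0.
Qed.

Lemma finite_dim_preg (k : fieldType) (T : comPzRingType) (psi : {rmorphism k -> T}) :
  (forall a, integral_elt psi a) -> preg (fun m : T => m = 1).
Proof.
move=> Tint; apply: preg_order => // [_ _ -> ->|a]; first by rewrite mulr1.
have [n [m [r [m0 E]]]] := integral_order (oner_neq0 k) (Tint a).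
exists n, 1, (r * psi m^-1); split=> //.
have -> : 1 = psi m * psi m^-1 by rewrite -rmorphM divff // rmorph1.
by rewrite mulrA -mulrDl mulrA E mul0r.
Qed.

Lemma det_sylvester (S : comPzRingType) m n (A : 'M[S]_(m, n)) (B : 'M_(n, m)) :
  \det (1%:M + A *m B) = \det (1%:M + B *m A).
Proof.
have E1 : block_mx (1%:M + A *m B) A 0 1%:M *m block_mx 1%:M 0 (- B) 1%:M = block_mx 1%:M A (- B) 1%:M.
  by rewrite mulmx_block !(mulmx1, mulmx0, mul0mx, mul1mx, add0r, addr0) mulmxN addrK.
have E2 : block_mx 1%:M 0 (- B) 1%:M *m block_mx 1%:M A 0 (1%:M + B *m A) = block_mx 1%:M A (- B) 1%:M.
  by rewrite mulmx_block !(mulmx1, mulmx0, mul0mx, mul1mx, add0r, addr0) mulNmx addrCA addNr addr0.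
have := congr1 determinant (etrans E1 (esym E2)).
by rewrite !det_mulmx !det_ublock !det_lblock !det1 !mulr1 !mul1r.
Qed.

Lemma det_cong (S : comPzRingType) (J : ideal S) n (A B : 'M[S]_n) :
  (forall i j, J (A i j - B i j)) -> J (\det A - \det B).
Proof.
move=> AB; apply/qpiP; rewrite -!det_map_mx; congr (\det _).
by apply/matrixP => i j; rewrite !mxE; apply/qpiP.
Qed.

Section EntryIdeal.
Variables (S : comPzRingType) (k l : nat) (E : 'M[S]_(k, l)).
Definition entry_pred (x : S) : Prop := exists C : 'M[S]_(k, l), x = \sum_i \sum_j C i j * E i j.
Lemma entry0 : entry_pred 0.
Proof. by exists 0; rewrite big1 // => i _; rewrite big1 // => j _; rewrite mxE mul0r. Qed.
Lemma entryB x y : entry_pred x -> entry_pred y -> entry_pred (x - y).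
Proof.
move=> [C ->] [C' ->]; exists (C - C'); rewrite -sumrB; apply: eq_bigr => i _.
by rewrite -sumrB; apply: eq_bigr => j _; rewrite !mxE mulrBl.
Qed.
Lemma entryM a x : entry_pred x -> entry_pred (a * x).
Proof.
move=> [C ->]; exists (a *: C); rewrite mulr_sumr; apply: eq_bigr => i _.
by rewrite mulr_sumr; apply: eq_bigr => j _; rewrite !mxE mulrA.
Qed.
Definition entry_ideal := Ideal entry0 entryB entryM.
Lemma entry_in i j : entry_ideal (E i j).
Proof.
exists (delta_mx i j); rewrite (bigD1 i) //= (bigD1 j) //= mxE !eqxx mul1r.
rewrite !big1 ?addr0 // => [i' ne|j' ne]; last by rewrite mxE (negbTE ne) andbF mul0r.
by rewrite big1 // => j' _; rewrite mxE (negbTE ne) mul0r.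
Qed.
End EntryIdeal.

Section MulIdeal.
Variables (S : comPzRingType) (m : S).
Lemma mulI0 : exists z, 0 = m * z. Proof. by exists 0; rewrite mulr0. Qed.
Lemma mulIB (x y : S) : (exists z, x = m * z) -> (exists z, y = m * z) -> exists z, x - y = m * z.
Proof. by move=> [z ->] [z' ->]; exists (z - z'); rewrite mulrBr. Qed.
Lemma mulIM (a x : S) : (exists z, x = m * z) -> exists z, a * x = m * z.
Proof. by move=> [z ->]; exists (a * z); rewrite mulrCA. Qed.
Definition mul_ideal := Ideal mulI0 mulIB mulIM.
End MulIdeal.

Lemma coprime_split (m N : nat) : (0 < m)%N ->
  exists m0 m1 c, [/\ m = (m0 * m1)%N, (m0 %| N ^ c)%N & coprime N m1].
Proof.
elim/ltn_ind: m => m IH m0.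
have [co|nco] := boolP (coprime N m).
  by exists 1%N, m, 0%N; rewrite mul1n dvd1n.
have [g [gN gm g1]] : exists g, [/\ g %| N, g %| m & 1 < g]%N.
  exists (gcdn N m); rewrite dvdn_gcdl dvdn_gcdr; split=> //.
  by rewrite ltn_neqAle eq_sym nco gcdn_gt0 m0 orbT.
have q0 : (0 < m %/ g)%N by rewrite divn_gt0 ?(ltnW g1) // dvdn_leq.
have [||m0' [m1 [c [E d co]]]] := IH (m %/ g)%N; first by rewrite ltn_Pdiv.
  exact: q0.
exists (g * m0')%N, m1, c.+1; split=> //.
  by rewrite -mulnA -E mulnC divnK.
by rewrite expnS dvdn_mul.
Qed.

Lemma hev_map (S S' : comPzRingType) (f : {rmorphism S -> S'}) (s : seq int) a :
  f (hev (intr : {rmorphism int -> S}) s a) = hev (intr : {rmorphism int -> S'}) s (f a).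
Proof. by elim: s => [|c s IH] /=; rewrite ?rmorph0 // rmorphD rmorphM IH rmorph_int. Qed.

(** * Serre's splitting theorem in rank at least 2 *)

Section Serre.
Variables (S T : comPzRingType) (phi : {rmorphism S -> T}).
Hypothesis phi_inj : injective phi.
Hypothesis Sint : forall a : S, integral_elt (intr : {rmorphism int -> S}) a.
Hypothesis Tchar : forall n : nat, (0 < n)%N -> exists u : T, n%:R * u = 1.

Variables (k n : nat) (e : 'M[S]_k) (L : 'M[T]_(k, n)) (L' : 'M[T]_(n, k)).
Hypotheses (ee : e *m e = e) (eL : map_mx phi e = L *m L') (LL : L' *m L = 1%:M).
Hypothesis n2 : (1 < n)%N.

(** Modulo the entries det(1 - e) is 1, while over T it equals det(1 - L' L) = det 0 = 0, a
    determinant of size n. *)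
Lemma entries_unit : entry_ideal e 1.
Proof.
have J1 : entry_ideal e (\det (1%:M : 'M_k) - \det (1%:M - e)).
  apply: det_cong => i j; rewrite !mxE opprB addrCA subrr addr0.
  exact: entry_in.
suff d0 : \det (1%:M - e) = 0 by rewrite d0 det1 subr0 in J1.
apply: phi_inj; rewrite -det_map_mx map_mxB map_mx1 eL -mulmxN det_sylvester.
rewrite mulNmx LL subrr rmorph0; case: (n) n2 => // n' _.
by rewrite det0.
Qed.

(** The module is the row space of e, and the functional y sends x e to 1. A pair of integral value
    M > 0 exists by [unimodular_pair]. Off the rank one summand it defines, up to M, rank n - 1 > 0
    remains, which leaves room to adjust x modulo M and modulo an integer prime to M separately. *)
Lemma serre : exists (x : 'rV[S]_k) (y : 'cV[S]_k), x *m e *m y = 1%:M.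
Proof.
have [C1 C1E] := entries_unit.
pose Mset (m : S) := exists2 i, (0 < i)%N & m = i%:R.
have MM x y : Mset x -> Mset y -> Mset (x * y).
  by move=> [i i0 ->] [j j0 ->]; exists (i * j)%N; rewrite ?muln_gt0 ?i0 ?natrM.
have M1 : Mset 1 by exists 1%N.
have [|x1 [y1 [_ [[M M0 ->] v1]]]] :=
  unimodular_pair (E := e) MM M1 (integral_preg Sint) (C := C1); first by rewrite -C1E.
pose r := x1 *m e; pose c := e *m y1.
have re : r *m e = r by rewrite /r -mulmxA ee.
have ec : e *m c = c by rewrite /c mulmxA ee.
have rc : r *m c = M%:R%:M.
  by rewrite /c mulmxA re [LHS]mx11_scalar -/(bval e x1 y1) v1.
(* M times the projection onto the complement of the summand spanned by r; hence its square is M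
   times itself. *)
pose e' := M%:R *: e - c *m r.
have e'e : e' *m e = e' by rewrite mulmxBl -scalemxAl ee -mulmxA re.
have re' : r *m e' = 0.
  by rewrite mulmxBr -scalemxAr re mulmxA rc mul_scalar_mx subrr.
have e'e' : e' *m e' = M%:R *: e'.
  rewrite {1}/e' mulmxBl -mulmxA re' mulmx0 subr0 -scalemxAl /e' mulmxBr.
  by rewrite -scalemxAr ee mulmxA ec.
(* Modulo the entries of e', M e and c r agree, hence so do det(M + M e) and det(M + c r). As e has
   rank n and c r / M rank 1 over T, these are M^k 2^n and M^k 2, which differ because n > 1. *)
have Jint : entry_ideal e' (M ^ k * (2 ^ n - 2))%N%:R.
  pose A := M%:R%:M + M%:R *: e; pose B := M%:R%:M + c *m r.
  have [u Mu] := Tchar M0.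
  have dA : \det A = (M ^ k * 2 ^ n)%:R.
    apply: phi_inj; rewrite -det_map_mx rmorph_nat map_mxD map_scalar_mx map_mxZ eL.
    rewrite rmorph_nat -scalemx1 -scalerDr detZ det_sylvester LL.
    have -> : 1%:M + 1%:M = 2%:R%:M :> 'M[T]_n by rewrite -[2%:R]/(1 + 1) raddfD.
    by rewrite det_scalar natrM !natrX.
  have dB : \det B = (M ^ k * 2)%:R.
    apply: phi_inj; rewrite -det_map_mx rmorph_nat map_mxD map_scalar_mx map_mxM.
    rewrite rmorph_nat; set c' := map_mx phi c; set r' := map_mx phi r.
    have rc' : r' *m c' = M%:R%:M by rewrite -map_mxM rc map_scalar_mx rmorph_nat.
    have -> : M%:R%:M + c' *m r' = M%:R *: (1%:M + (u *: c') *m r').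
      by rewrite scalerDr scalemx1 -scalemxAl scalerA Mu scale1r.
    rewrite detZ det_sylvester -scalemxAr rc' scale_scalar_mx [u * _]mulrC Mu.
    have -> : 1%:M + 1%:M = 2%:R%:M :> 'M[T]_1 by rewrite -[2%:R]/(1 + 1) raddfD.
    by rewrite det_scalar1 natrM natrX.
  rewrite mulnBr natrB; last by rewrite leq_mul2l -[X in (X <= _)%N]expn1 leq_exp2l // ltnW ?orbT.
  rewrite -dA -dB; apply: det_cong => i j.
  have -> : A i j - B i j = e' i j by rewrite !mxE; ring.
  exact: entry_in.
have [C2 C2E] := Jint.
have [|x2 [y2 [_ [[M2 M20 ->] v2]]]] :=
  unimodular_pair (E := e') MM M1 (integral_preg Sint) (C := C2).
  rewrite -C2E; exists (M ^ k * (2 ^ n - 2))%N => //.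
  by rewrite muln_gt0 expn_gt0 M0 subn_gt0 -[X in (X < _)%N]expn1 ltn_exp2l.
pose b2 := x2 *m e'; pose h2 := e' *m y2.
have b2h : b2 *m h2 = (M * M2)%N%:R%:M.
  rewrite /b2 /h2 -mulmxA [e' *m _]mulmxA e'e' -scalemxAl -scalemxAr mulmxA.
  by rewrite [x2 *m e' *m y2]mx11_scalar -/(bval e' x2 y2) v2 scale_scalar_mx natrM.
have rh : r *m h2 = 0 by rewrite /h2 mulmxA re' mul0mx.
(* Modulo M the ring has positive characteristic, so pi-regularity holds without denominators and
   the value 1 is reached. *)
pose Q := quot (mul_ideal (M%:R : S)).
have QM : M%:R = 0 :> Q.
  by rewrite -(rmorph_nat (qpi _)); apply/qpi0P; exists 1; rewrite mulr1.
have Qint (a : Q) : integral_elt (intr : {rmorphism int -> Q}) a.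
  elim/quot_ind: a => a; have [s Es] := Sint a; exists s.
  by rewrite -hev_map Es rmorph0.
have [|||x0' [y0' [_ [-> v0]]]] := unimodular_pair (E := map_mx (qpi (mul_ideal M%:R)) e)
    _ _ (finite_preg M0 QM Qint) (C := map_mx (qpi (mul_ideal M%:R)) C1).
- by move=> _ _ -> ->; rewrite mulr1.
- by [].
- rewrite -(rmorph1 (qpi (mul_ideal M%:R))) C1E rmorph_sum; apply: eq_bigr => i _.
  by rewrite rmorph_sum; apply: eq_bigr => j _; rewrite !mxE rmorphM.
pose x0 : 'rV[S]_k := map_mx (fun u : Q => generic_quotient.repr u) x0'.
pose y0 : 'cV[S]_k := map_mx (fun u : Q => generic_quotient.repr u) y0'.
have [z0 z0E] : exists z, bval e x0 y0 - 1 = M%:R * z.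
  apply/(qpiP (mul_ideal M%:R)); rewrite rmorph1 -v0 /bval.
  have -> : x0' = map_mx (qpi _) x0 by apply/matrixP => i j; rewrite !mxE qpi_repr.
  have -> : y0' = map_mx (qpi _) y0 by apply/matrixP => i j; rewrite !mxE qpi_repr.
  by rewrite -!map_mxM [RHS]mxE.
have MMM : (M * M * M2)%N%:Z != 0 by rewrite -lt0n !muln_gt0 M0 M20.
(* Adding a multiple of M b2 to x0 e does not change it modulo M. The multiple is chosen so that the
   value on h2 divides a nonzero integer. *)
have [t [m [w' [m0 Ew']]]] := integral_generic MMM (Sint ((x0 *m e *m h2) 0 0)).
pose y := x0 *m e + (M%:R * t%:~R) *: b2.
pose Y1 := (y *m c) 0 0; pose Y2 := (y *m h2) 0 0.
pose mm := (`|m| * `|m|)%N; pose w := w' * m%:~R.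
have Y2E : Y2 * w = mm%:R.
  have -> : Y2 = (x0 *m e *m h2) 0 0 + (t * (M * M * M2)%N)%:~R.
    rewrite /Y2 /y mulmxDl mxE -scalemxAl b2h scale_scalar_mx; congr (_ + _).
    rewrite mxE mulr1n intrM -pmulrn !natrM; ring.
  rewrite /w mulrA Ew' -rmorphM -[RHS]/(mm%:Z%:~R); congr (_ %:~R).
  by rewrite PoszM !abszE -Num.Theory.normrM -expr2 Num.Theory.ger0_norm // Num.Theory.sqr_ge0.
have mm0 : (0 < mm)%N by rewrite muln_gt0 absz_gt0 m0.
have [m0' [m1 [cc [mmE /dvdnP [d dE] co]]]] := coprime_split M mm0.
have [q [l ql]] : exists q l, (q * (M * M) = 1 + l * m1)%N.
  have co2 : coprime (M * M) m1 by rewrite coprimeMl co.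
  have [|q' q'E] := coprimeP m1 _ co2; first by rewrite muln_gt0 M0.
  by exists q'.1, q'.2; lia.
have qlR : q%:R * (M%:R * M%:R) = 1 + l%:R * m1%:R :> S by rewrite -!natrM ql natrD.
(* The factor M leaves x unchanged modulo M, and q M^2 = 1 modulo m1 makes x c equal to 1 modulo
   m1. *)
pose s := M%:R * q%:R * (1 - Y1).
pose x := s *: r + y.
have xe : x *m e = x.
  rewrite mulmxDl -scalemxAl re; congr (_ + _).
  by rewrite /y mulmxDl -mulmxA ee -scalemxAl -mulmxA e'e.
have xc : (x *m c) 0 0 = 1 + m1%:R * (l%:R * (1 - Y1)).
  rewrite mulmxDl -scalemxAl rc mxE -/Y1 !mxE mulr1n /s.
  transitivity (q%:R * (M%:R * M%:R) * (1 - Y1) + Y1); first by ring.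
  rewrite qlR; ring.
have xh : (x *m h2) 0 0 = Y2 by rewrite mulmxDl -scalemxAl rh scaler0 add0r.
(* On x, c has the value 1 + m1 l (1 - Y1) and h2 the value Y2, with Y2 w = m0' m1; the error terms
   cancel and x F = m0'. *)
pose F := m0'%:R *: c - (l%:R * (1 - Y1) * w) *: h2.
have vZ (v : 'rV[S]_k) a (f : 'cV[S]_k) : (v *m (a *: f)) 0 0 = a * (v *m f) 0 0.
  by rewrite -scalemxAr mxE.
have vD (v : 'rV[S]_k) (f g : 'cV[S]_k) : (v *m (f + g)) 0 0 = (v *m f) 0 0 + (v *m g) 0 0.
  by rewrite mulmxDr mxE.
have vDl (v v' : 'rV[S]_k) (f : 'cV[S]_k) : ((v + v') *m f) 0 0 = (v *m f) 0 0 + (v' *m f) 0 0.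
  by rewrite mulmxDl mxE.
have vZl (v : 'rV[S]_k) a (f : 'cV[S]_k) : ((a *: v) *m f) 0 0 = a * (v *m f) 0 0.
  by rewrite -scalemxAl mxE.
have xF : (x *m F) 0 0 = m0'%:R.
  rewrite /F -scaleNr vD !vZ xc xh.
  transitivity (m0'%:R + l%:R * (1 - Y1) * (m0'%:R * m1%:R - Y2 * w)); first by ring.
  by rewrite Y2E mmE natrM subrr mulr0 addr0.
have [z xy] : exists z, (x *m y0) 0 0 = 1 + M%:R * z.
  exists (q%:R * (1 - Y1) * (r *m y0) 0 0 + z0 + t%:~R * (b2 *m y0) 0 0).
  have -> : (x *m y0) 0 0 = s * (r *m y0) 0 0 + (bval e x0 y0 + M%:R * t%:~R * (b2 *m y0) 0 0).
    by rewrite /x /y !vDl !vZl.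
  have -> : bval e x0 y0 = 1 + M%:R * z0 by rewrite -z0E addrC subrK.
  rewrite /s; ring.
(* Now x y0 = 1 - u, and u^cc is a multiple of m0' = x F because m0' divides M^cc. The geometric
   series in u supplies 1 - u^cc, and F the missing u^cc. *)
pose u := - (M%:R * z).
exists x, ((\sum_(i < cc) u ^+ i) *: y0 + ((- z) ^+ cc * d%:R) *: F).
rewrite xe [LHS]mx11_scalar vD !vZ xy xF; congr (_%:M).
have -> : (- z) ^+ cc * d%:R * m0'%:R = u ^+ cc.
  by rewrite -mulrA -natrM -dE natrX -exprMn mulNr mulrC.
have -> : 1 + M%:R * z = - (u - 1) by rewrite /u opprB opprK addrC.
by rewrite mulrN mulrC -subrX1 opprB subrK.
Qed.

End Serre.

(** * Stable range one and elementary matrices *)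

Section StableRange.
Variable T : comPzRingType.
Hypothesis Tpreg : preg (fun m : T => m = 1).

(** On the factor of the idempotent e = a c, a has the inverse c and nothing is added. On the other
    factor a is nilpotent, and a + b q = 1 + a (1 - p) is inverted by a geometric series. *)
Lemma stable_range (a b p q : T) : a * p + b * q = 1 ->
  exists z u, (a + b * z) * u = 1.
Proof.
move=> E; have [c [_ [n [-> idem nil]]]] := Tpreg a.
set e := a * c in idem nil; rewrite mul1r in idem.
pose x := - (a * (1 - p)); pose G : T := \sum_(i < n) x ^+ i.
have xn : (1 - e) * x ^+ n = 0.
  have -> : x = a * - (1 - p) by rewrite mulrN.
  by rewrite exprMn mulrA nil mul0r.
exists ((1 - e) * q), (e * c + (1 - e) * G).
have -> : b * ((1 - e) * q) = (1 - e) * (1 - a * p) by rewrite -E; ring.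
have Gx : (1 - x) * G = 1 - x ^+ n by rewrite -[1 - x]opprB mulNr -subrX1 opprB.
transitivity (e * (a * c) + (1 - e) * ((1 - x) * G)
   + (e - e * e) * (c * (1 - a * p) + (a - 1 + x) * G)).
  rewrite /x; ring.
have idem2 : e * e = e := idem.
rewrite -/e [in X in _ + X]idem2 subrr mul0r addr0 Gx mulrBr mulr1 xn subr0 idem.
by rewrite addrC subrK.
Qed.

Inductive elementary m : 'M[T]_(1 + m) -> Prop :=
| elementary1 : elementary 1%:M
| elementary_u E X : elementary E -> elementary (E *m block_mx 1%:M X 0 1%:M)
| elementary_l E Y : elementary E -> elementary (E *m block_mx 1%:M 0 Y 1%:M).

Lemma elementary_U m X : elementary (block_mx 1%:M X 0 1%:M : 'M[T]_(1 + m)).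
Proof. by rewrite -[block_mx _ _ _ _]mul1mx; apply/elementary_u/elementary1. Qed.
Lemma elementary_L m Y : elementary (block_mx 1%:M 0 Y 1%:M : 'M[T]_(1 + m)).
Proof. by rewrite -[block_mx _ _ _ _]mul1mx; apply/elementary_l/elementary1. Qed.

Lemma elementary_unit m (E : 'M[T]_(1 + m)) : elementary E ->
  exists F, E *m F = 1%:M /\ F *m E = 1%:M.
Proof.
elim=> [|{}E X _ [F [EF FE]]|{}E Y _ [F [EF FE]]]; first by exists 1%:M; rewrite mulmx1.
  exists (block_mx 1%:M (- X) 0 1%:M *m F); split.
    rewrite -mulmxA [block_mx _ X _ _ *m _]mulmxA mulmx_block.
    by rewrite !(mulmx1, mul1mx, mulmx0, mul0mx, addr0, add0r) addNr -scalar_mx_block mul1mx.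
  rewrite -mulmxA [F *m _]mulmxA FE mul1mx mulmx_block.
  by rewrite !(mulmx1, mul1mx, mulmx0, mul0mx, addr0, add0r) subrr -scalar_mx_block.
exists (block_mx 1%:M 0 (- Y) 1%:M *m F); split.
  rewrite -mulmxA [block_mx _ 0 Y _ *m _]mulmxA mulmx_block.
  by rewrite !(mulmx1, mul1mx, mulmx0, mul0mx, addr0, add0r) subrr -scalar_mx_block mul1mx.
rewrite -mulmxA [F *m _]mulmxA FE mul1mx mulmx_block.
by rewrite !(mulmx1, mul1mx, mulmx0, mul0mx, addr0, add0r) addNr -scalar_mx_block.
Qed.

(** Two vectors are moved at once. When u has become the first basis row, u w = 1 forces the first
    entry of the transformed w to be 1, and a lower unipotent matrix, which fixes that row, clears
    the rest. *)
Lemma elementary_move m (u : 'rV[T]_(1 + m.+1)) (w : 'cV[T]_(1 + m.+1)) :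
  u *m w = 1%:M -> exists E : 'M[T]_(1 + m.+1),
    [/\ elementary E, u *m E = row_mx 1%:M 0 & w = E *m col_mx 1%:M 0].
Proof.
move=> uw.
suff [E hE uE] : exists2 E : 'M[T]_(1 + m.+1), elementary E & u *m E = row_mx 1%:M 0.
  have [F [EF FE]] := elementary_unit hE.
  have [w2 Fw] : exists w2, F *m w = col_mx 1%:M w2.
    exists (dsubmx (F *m w)); rewrite -[LHS]vsubmxK; congr col_mx.
    have : row_mx 1%:M 0 *m (F *m w) = 1%:M by rewrite -uE -mulmxA [E *m _]mulmxA EF mul1mx.
    by rewrite -{1}[F *m w]vsubmxK mul_row_col mul1mx mul0mx addr0.
  exists (E *m block_mx 1%:M 0 w2 1%:M); split.
  - exact: elementary_l.
  - by rewrite mulmxA uE mul_row_block !(mulmx1, mul1mx, mulmx0, mul0mx, addr0, add0r).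
  - rewrite -mulmxA mul_block_col !(mulmx1, mul1mx, mulmx0, mul0mx, addr0, add0r) -Fw.
    by rewrite mulmxA EF mul1mx.
pose a := lsubmx u; pose b := rsubmx u.
have uE : u = row_mx a b by rewrite hsubmxK.
have mulU (a' : 'rV_1) (b' : 'rV_m.+1) X : row_mx a' b' *m block_mx 1%:M X 0 1%:M = row_mx a' (a' *m X + b').
  by rewrite mul_row_block !(mulmx1, mul1mx, mulmx0, mul0mx, addr0, add0r).
have mulL (a' : 'rV_1) (b' : 'rV_m.+1) Y : row_mx a' b' *m block_mx 1%:M 0 Y 1%:M = row_mx (a' + b' *m Y) b'.
  by rewrite mul_row_block !(mulmx1, mul1mx, mulmx0, mul0mx, addr0, add0r).
have [Y [v abv]] : exists Y v, (a + b *m Y) *m v = 1%:M :> 'M_1.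
  have : a 0 0 * usubmx w 0 0 + (b *m dsubmx w) 0 0 * 1 = 1.
    have E1 : a *m usubmx w + b *m dsubmx w = 1%:M by rewrite -mul_row_col -uE vsubmxK.
    have := congr1 (fun A : 'M_1 => A 0 0) E1.
    by rewrite mxE [X in X + _]mxE big_ord1 [RHS]mxE eqxx mulr1n mulr1.
  move=> /stable_range [z [v abv]]; exists (z *: dsubmx w), v%:M.
  apply/matrixP => i j; rewrite !ord1 -scalemxAr mul_mx_scalar.
  rewrite [LHS]mxE [X in _ * X]mxE [X in _ * (_ + X)]mxE mulrC [z * _]mulrC abv.
  by rewrite mxE.
(* The unit a + b Y serves to replace the tail by c, whose first entry is what a + b Y lacks to be
   1. *)
pose c : 'rV[T]_m.+1 := (1%:M - (a + b *m Y)) *m delta_mx 0 0.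
exists (block_mx 1%:M 0 Y 1%:M *m block_mx 1%:M (v *m (c - b)) 0 1%:M
   *m block_mx 1%:M 0 (delta_mx 0 0) 1%:M *m block_mx 1%:M (- c) 0 1%:M).
  apply: elementary_u; apply: elementary_l; apply: elementary_u; exact: elementary_L.
rewrite uE !mulmxA mulL mulU mulmxA abv mul1mx subrK mulL mulU.
have -> : a + b *m Y + c *m delta_mx 0 0 = 1%:M.
  rewrite /c -mulmxA mul_delta_mx.
  have -> : delta_mx 0 0 = 1%:M :> 'M[T]_1.
    by apply/matrixP => i j; rewrite !ord1 !mxE.
  by rewrite mulmx1 addrC subrK.
by rewrite mul1mx addNr.
Qed.

End StableRange.

Section Kernel.
Variables (S : comPzRingType) (L M : lmodType S) (p : {linear L -> M}).

Definition ker_pred : {pred L} := fun x => p x == 0.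
Lemma ker_pred_closed : submod_closed ker_pred.
Proof.
split=> [|a x y /eqP px /eqP py]; first by apply/eqP; rewrite linear0.
by apply/eqP; rewrite linearP px py scaler0 addr0.
Qed.
HB.instance Definition _ :=
  GRing.isSubmodClosed.Build S L ker_pred ker_pred_closed.

Record kermod := Kermod { ker_val : L; ker_valP : ker_val \in ker_pred }.
HB.instance Definition _ := [isSub for ker_val].
HB.instance Definition _ := [Choice of kermod by <:].
HB.instance Definition _ := [SubChoice_isSubLmodule of kermod by <:].

Lemma ker_val_linear : linear (ker_val : kermod -> L).
Proof. by []. Qed.
Definition kerval : {linear kermod -> L} := mklin ker_val_linear.

Lemma kervalP x : p (kerval x) = 0.
Proof. exact/eqP/ker_valP. Qed.
Lemma kerval_inj : injective kerval.
Proof. exact: val_inj. Qed.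

Section Lift.
Variables (N : lmodType S) (f : {linear N -> L}) (pf : forall x, p (f x) = 0).
Definition kerlift_fun x : kermod := Kermod (introT eqP (pf x)).
Lemma kerlift_linear : linear kerlift_fun.
Proof. by move=> a x y; apply: kerval_inj; rewrite /= linearP. Qed.
Definition kerlift : {linear N -> kermod} := mklin kerlift_linear.
Lemma kerliftK x : kerval (kerlift x) = f x. Proof. by []. Qed.
End Lift.
End Kernel.

Lemma fgproj_retract (S : comPzRingType) (L M : lmodType S) (i : {linear L -> M})
  (p : {linear M -> L}) : cancel i p -> fgproj M -> fgproj L.
Proof.
move=> ip [n [j [q jq]]]; exists n, (j \o i : {linear L -> 'rV_n}), (p \o q : {linear 'rV_n -> L}).
by move=> x /=; rewrite jq ip.
Qed.

(** * Formal consequences of the relations of K_0 *)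

Section Calculus.
Variables (S T : comPzRingType) (phi : {rmorphism S -> T}).
Notation rV n := ('rV[T]_n : lmodType T).
Notation "[+ g ]" := [:: (true, g)] (at level 0).

Lemma K0eq_neg (x : fsum phi) : K0eq (x ++ fneg x) [::].
Proof.
elim: x => [|[b g] x IH]; first exact: K0eq_refl.
have H : K0eq [:: (b, g); (~~ b, g)] [::].
  by case: b => /=; [|apply: (K0eq_trans (K0eq_comm [:: (false, g)] [:: (true, g)]))]; apply: K0eq_opp.
apply: (K0eq_trans (y := [:: (b, g); (~~ b, g)] ++ (x ++ fneg x))); last first.
  exact: (K0eq_cat H IH).
rewrite /= -cat1s -[X in K0eq _ X]cat1s; apply: K0eq_cat; first exact: K0eq_refl.
rewrite -cat1s catA -[X in K0eq _ X]cat1s [X in K0eq _ X]catA.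
by apply: K0eq_cat; [apply: K0eq_comm|apply: K0eq_refl].
Qed.

Lemma K0eq_cancel (x y z : fsum phi) : K0eq (x ++ z) (y ++ z) -> K0eq x y.
Proof.
have H w : K0eq w ((w ++ z) ++ fneg z).
  rewrite -catA -[X in K0eq X _]cats0.
  by apply: K0eq_cat; [apply: K0eq_refl|apply/K0eq_sym/K0eq_neg].
move=> E; apply: K0eq_trans (H x) _; apply: K0eq_trans _ (K0eq_sym (H y)).
by apply: K0eq_cat => //; apply: K0eq_refl.
Qed.

Definition ztriple : triple phi :=
  @Triple _ _ phi ('rV[S]_0 : lmodType S) ('rV[S]_0 : lmodType S) idfun.

Lemma rV0_eq (R : comPzRingType) (x y : 'rV[R]_0) : x = y.
Proof. by rewrite [x]thinmx0 [y]thinmx0. Qed.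

Lemma bc_rV0 (x y : bc phi ('rV[S]_0 : lmodType S)) : x = y.
Proof.
rewrite -[x](pTK (phi := phi) (@pprjK _ _ (free_pres S 0))).
rewrite -[y](pTK (phi := phi) (@pprjK _ _ (free_pres S 0))).
by congr (pT _ _ _); apply: rV0_eq.
Qed.

Lemma ztriple_gen : K0gen ztriple.
Proof. by split; [apply: fgproj_rV|apply: fgproj_rV|exists idfun]. Qed.

Lemma zero_linear (R : comPzRingType) (U V : lmodType R) : linear (fun _ : U => 0 : V).
Proof. by move=> a x y; rewrite scaler0 addr0. Qed.

Lemma exact_iso (U V : lmodType S) (a : {linear U -> V}) : bijective a ->
  short_exact a (mklin (@zero_linear S V ('rV[S]_0))).
Proof.
move=> [b ab ba]; split; first exact: can_inj ab.
  by move=> y; split=> // _; exists (b y).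
by move=> z; exists 0; apply: rV0_eq.
Qed.

(** No relation identifies isomorphic triples directly, so an exact sequence with zero quotient is
    used. It leaves the class of [ztriple], which vanishes by the same statement applied to
    [ztriple] itself. *)
Lemma K0eq_iso0 (g g' : triple phi) (a : {linear tsrc g -> tsrc g'})
    (b : {linear ttgt g -> ttgt g'}) : K0gen g -> K0gen g' -> bijective a -> bijective b ->
    (forall x, tiso g' (bcmap phi a x) = bcmap phi b (tiso g x)) ->
  K0eq [+ g'] ([+ g] ++ [+ ztriple]).
Proof.
move=> hg hg' ba bb c; apply: K0eq_ext => //; first exact: ztriple_gen.
exists a, (mklin (@zero_linear S _ _)), b, (mklin (@zero_linear S _ _)).
by split=> //; [apply: exact_iso|apply: exact_iso|move=> x; apply: bc_rV0].
Qed.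

Lemma ztriple_eq0 : K0eq [+ ztriple] [::].
Proof.
apply: (@K0eq_cancel _ _ [+ ztriple]); apply: K0eq_sym.
apply: (@K0eq_iso0 ztriple ztriple (idfun : {linear 'rV[S]_0 -> 'rV[S]_0})
  (idfun : {linear 'rV[S]_0 -> 'rV[S]_0})); try exact: ztriple_gen.
- by exists idfun.
- by exists idfun.
- by move=> x; apply: bc_rV0.
Qed.

Lemma K0eq_iso (g g' : triple phi) (a : {linear tsrc g -> tsrc g'})
    (b : {linear ttgt g -> ttgt g'}) : K0gen g -> K0gen g' -> bijective a -> bijective b ->
    (forall x, tiso g' (bcmap phi a x) = bcmap phi b (tiso g x)) ->
  K0eq [+ g'] [+ g].
Proof.
move=> hg hg' ba bb c; apply: (K0eq_trans (K0eq_iso0 hg hg' ba bb c)).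
rewrite -[X in K0eq _ X]cats0.
by apply: K0eq_cat; [apply: K0eq_refl|apply: ztriple_eq0].
Qed.

Lemma bcmap_id (L : lmodType S) x : bcmap phi (idfun : {linear L -> L}) x = x.
Proof.
elim/bc_ind: x => [|t x y IH]; first by rewrite linear0.
by rewrite linearD IH bcmapE.
Qed.

(** Triples contain bundled maps, and pointwise equal maps may be different terms; the resulting
    triples are isomorphic through identities. *)
Lemma K0eq_pointwise (L L' : lmodType S) (lam lam' : {linear bc phi L -> bc phi L'}) :
  lam =1 lam' -> K0gen (Triple lam) -> K0gen (Triple lam') /\
  K0eq [+ Triple lam'] [+ Triple lam].
Proof.
move=> E hl; have hl' : K0gen (Triple lam').
  by case: hl => ? ? b; split=> //; apply: (eq_bij b).
split=> //; apply: (K0eq_iso (g := Triple lam) (g' := Triple lam')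
  (a := (idfun : {linear L -> L})) (b := (idfun : {linear L' -> L'}))) => //.
- by exists idfun.
- by exists idfun.
- by move=> x; rewrite !bcmap_id -[LHS]/(lam' x) -E.
Qed.

(** The composite of lam with itself is pointwise lam, so the class equals its double. *)
Lemma K0eq_id (L : lmodType S) (lam : {linear bc phi L -> bc phi L}) :
  fgproj L -> lam =1 id -> K0gen (Triple lam) /\ K0eq [+ Triple lam] [::].
Proof.
move=> pL E; have hl : K0gen (Triple lam).
  by split=> //; exists id => x; rewrite E.
split=> //; have [_ H] := @K0eq_pointwise _ _ lam (lam \o lam) (fun x => congr1 lam (esym (E x))) hl.
have H' := K0eq_comp hl hl.
apply: (@K0eq_cancel _ _ [+ Triple lam]); apply: (K0eq_trans (K0eq_sym H')).
apply: (K0eq_trans H); exact: K0eq_refl.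
Qed.

Lemma K0eq_inv (L L' : lmodType S) (lam : {linear bc phi L -> bc phi L'})
  (mu : {linear bc phi L' -> bc phi L}) :
  K0gen (Triple lam) -> cancel lam mu -> cancel mu lam ->
  K0gen (Triple mu) /\ K0eq [:: (false, Triple lam)] [+ Triple mu].
Proof.
move=> hl lm ml; have hm : K0gen (Triple mu).
  by case: hl => ? ? _; split=> //; exists lam.
split=> //; apply: (@K0eq_cancel _ _ [+ Triple lam]).
apply: (K0eq_trans (y := [::])).
  apply: (K0eq_trans (K0eq_comm _ _)); exact: K0eq_opp.
apply: K0eq_sym; apply: (K0eq_trans (K0eq_comm _ _)).
apply: (K0eq_trans (K0eq_sym (K0eq_comp hl hm))).
by have [_] := @K0eq_id L (mu \o lam) (let: And3 p _ _ := hl in p) lm.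
Qed.

End Calculus.

Notation "[+ g ]" := [:: (true, g)] (at level 0).

(** * Triples with free target *)

Section Framed.
Variables (S T : comPzRingType) (phi : {rmorphism S -> T}).
Notation rV n := ('rV[T]_n : lmodType T).

Definition pI n : {linear rV n -> bc phi ('rV[S]_n : lmodType S)} :=
  pT phi (idfun : {linear 'rV[S]_n -> 'rV[S]_n}).
Definition iI n : {linear bc phi ('rV[S]_n : lmodType S) -> rV n} :=
  iT phi (idfun : {linear 'rV[S]_n -> 'rV[S]_n}).
Arguments pI : clear implicits.
Arguments iI : clear implicits.

Lemma iIK n : cancel (iI n) (pI n).
Proof. exact: pTK. Qed.

Lemma pI_map n v : pI n (map_mx phi v) = bT phi 1 v.
Proof. exact: pT_map. Qed.

Lemma pIK n : cancel (pI n) (iI n).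
Proof.
apply: (rV_ext (f := iI n \o pI n) (g := idfun)) => j.
rewrite -[LHS]/(iI n (pI n (delta_mx 0 j))) -[in LHS](map_delta_mx phi) pI_map /iI iT1.
by rewrite map_delta_mx.
Qed.

Definition ilift n (P : lmodType S) (l : {linear P -> restr phi (rV n)}) :
  {linear bc phi P -> rV n} := @bc_lift _ _ phi P (rV n) l.

Lemma ilift1 n (P : lmodType S) (l : {linear P -> restr phi (rV n)}) x :
  ilift l (bT phi 1 x) = l x.
Proof. by rewrite /ilift bc_liftE scale1r. Qed.

(** A triple with free target amounts to a map from P to T^n; this form allows row operations, with
    [pI] and [iI] identifying T^n and the base change of S^n. *)
Definition fr n (P : lmodType S) (l : {linear P -> restr phi (rV n)}) : triple phi :=
  @Triple _ _ phi P ('rV[S]_n : lmodType S) (pI n \o ilift l).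

Definition framed n (P : lmodType S) (l : {linear P -> restr phi (rV n)}) : Prop :=
  fgproj P /\ bijective (ilift l).

Lemma fr_gen n (P : lmodType S) (l : {linear P -> restr phi (rV n)}) :
  framed l -> K0gen (fr l).
Proof.
case=> pP bl; split=> //; first exact: fgproj_rV.
by apply: bij_comp => //; exists (iI n); [apply: pIK|apply: iIK].
Qed.

Lemma bcmap_pI a b (u : {linear 'rV[S]_a -> 'rV[S]_b}) (uT : {linear rV a -> rV b}) w :
  (forall v, uT (map_mx phi v) = map_mx phi (u v)) ->
  bcmap phi u (pI a w) = pI b (uT w).
Proof.
move=> uuT; move: w; apply: (rV_ext (f := bcmap phi u \o pI a) (g := pI b \o uT)) => j.
rewrite -[LHS]/(bcmap phi u (pI a (delta_mx 0 j))) -[RHS]/(pI b (uT (delta_mx 0 j))).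
by rewrite -(map_delta_mx phi) uuT !pI_map bcmap1.
Qed.

Lemma inl_linear (R : comPzRingType) a b : linear (fun v : 'rV[R]_a => row_mx v 0 : 'rV_(a + b)).
Proof. by move=> c x y; rewrite scale_row_mx add_row_mx scaler0 addr0. Qed.
Lemma inr_linear (R : comPzRingType) a b : linear (fun v : 'rV[R]_b => row_mx 0 v : 'rV_(a + b)).
Proof. by move=> c x y; rewrite scale_row_mx add_row_mx scaler0 addr0. Qed.
Lemma lsub_linear (R : comPzRingType) a b : linear (fun v : 'rV[R]_(a + b) => lsubmx v).
Proof. by move=> c x y; apply/rowP => i; rewrite !mxE. Qed.
Lemma rsub_linear (R : comPzRingType) a b : linear (fun v : 'rV[R]_(a + b) => rsubmx v).
Proof. by move=> c x y; apply/rowP => i; rewrite !mxE. Qed.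

Lemma fr_lower a b (P' P P'' : lmodType S)
  (l' : {linear P' -> restr phi (rV b)}) (l : {linear P -> restr phi (rV (a + b))})
  (l'' : {linear P'' -> restr phi (rV a)}) (u : {linear P' -> P}) (v : {linear P -> P''}) :
  framed l' -> framed l -> framed l'' -> short_exact u v ->
  (forall x, l (u x) = row_mx 0 (l' x : rV b) :> rV (a + b)) ->
  (forall y, lsubmx (l y : rV (a + b)) = l'' (v y) :> rV a) ->
  K0eq [+ fr l] ([+ fr l'] ++ [+ fr l'']).
Proof.
move=> h' h h'' uv c1 c2; apply: K0eq_ext; try exact: fr_gen.
exists u, v, (mklin (@inr_linear S a b)), (mklin (@lsub_linear S a b)); split=> //.
- split=> [x y /eq_row_mx []|y|z] //=.
    split=> [y0|[x <-]]; last by rewrite row_mxKl.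
    by exists (rsubmx y); rewrite -{2}[y]hsubmxK y0.
  by exists (row_mx z 0); rewrite row_mxKl.
- apply: (bc_linear_ext (f := tiso (fr l) \o bcmap phi u)
    (g := bcmap phi (mklin (@inr_linear S a b)) \o tiso (fr l'))) => x.
  rewrite -[LHS]/(pI _ (ilift l (bcmap phi u (bT phi 1 x)))).
  rewrite -[RHS]/(bcmap phi _ (pI _ (ilift l' (bT phi 1 x)))).
  rewrite bcmap1 !ilift1 c1 (@bcmap_pI _ _ _ (mklin (@inr_linear T a b))) // => w.
  by rewrite /= map_row_mx map_mx0.
- apply: (bc_linear_ext (f := tiso (fr l'') \o bcmap phi v)
    (g := bcmap phi (mklin (@lsub_linear S a b)) \o tiso (fr l))) => x.
  rewrite -[LHS]/(pI _ (ilift l'' (bcmap phi v (bT phi 1 x)))).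
  rewrite -[RHS]/(bcmap phi _ (pI _ (ilift l (bT phi 1 x)))).
  rewrite bcmap1 !ilift1 -c2 (@bcmap_pI _ _ _ (mklin (@lsub_linear T a b))) // => w.
  by apply/rowP => i; rewrite !mxE.
Qed.

Lemma fr_upper a b (P' P P'' : lmodType S)
  (l' : {linear P' -> restr phi (rV a)}) (l : {linear P -> restr phi (rV (a + b))})
  (l'' : {linear P'' -> restr phi (rV b)}) (u : {linear P' -> P}) (v : {linear P -> P''}) :
  framed l' -> framed l -> framed l'' -> short_exact u v ->
  (forall x, l (u x) = row_mx (l' x : rV a) 0 :> rV (a + b)) ->
  (forall y, rsubmx (l y : rV (a + b)) = l'' (v y) :> rV b) ->
  K0eq [+ fr l] ([+ fr l'] ++ [+ fr l'']).
Proof.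
move=> h' h h'' uv c1 c2; apply: K0eq_ext; try exact: fr_gen.
exists u, v, (mklin (@inl_linear S a b)), (mklin (@rsub_linear S a b)); split=> //.
- split=> [x y /eq_row_mx []|y|z] //=.
    split=> [y0|[x <-]]; last by rewrite row_mxKr.
    by exists (lsubmx y); rewrite -{2}[y]hsubmxK y0.
  by exists (row_mx 0 z); rewrite row_mxKr.
- apply: (bc_linear_ext (f := tiso (fr l) \o bcmap phi u)
    (g := bcmap phi (mklin (@inl_linear S a b)) \o tiso (fr l'))) => x.
  rewrite -[LHS]/(pI _ (ilift l (bcmap phi u (bT phi 1 x)))).
  rewrite -[RHS]/(bcmap phi _ (pI _ (ilift l' (bT phi 1 x)))).
  rewrite bcmap1 !ilift1 c1 (@bcmap_pI _ _ _ (mklin (@inl_linear T a b))) // => w.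
  by rewrite /= map_row_mx map_mx0.
- apply: (bc_linear_ext (f := tiso (fr l'') \o bcmap phi v)
    (g := bcmap phi (mklin (@rsub_linear S a b)) \o tiso (fr l))) => x.
  rewrite -[LHS]/(pI _ (ilift l'' (bcmap phi v (bT phi 1 x)))).
  rewrite -[RHS]/(bcmap phi _ (pI _ (ilift l (bT phi 1 x)))).
  rewrite bcmap1 !ilift1 -c2 (@bcmap_pI _ _ _ (mklin (@rsub_linear T a b))) // => w.
  by apply/rowP => i; rewrite !mxE.
Qed.

Lemma mat_linear n (E : 'M[T]_n) :
  linear ((fun v => map_mx phi v *m E) : 'rV[S]_n -> restr phi (rV n)).
Proof.
move=> a x y; rewrite map_mxD map_mxZ mulmxDl -scalemxAl.
by [].
Qed.
Definition lmat n (E : 'M[T]_n) : {linear 'rV[S]_n -> restr phi (rV n)} := mklin (mat_linear E).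

Lemma ilift_lmat n (E : 'M[T]_n) w : ilift (lmat E) w = iI n w *m E.
Proof.
elim/bc_ind: w => [|t x y IH]; first by rewrite !linear0 mul0mx.
rewrite !linearD IH mulmxDl; congr (_ + _).
by rewrite /ilift bc_liftE /iI iTE -scalemxAl.
Qed.

Lemma framed_lmat n (E F : 'M[T]_n) : E *m F = 1%:M -> F *m E = 1%:M -> framed (lmat E).
Proof.
move=> EF FE; split; first exact: fgproj_rV.
exists (fun w => pI n (w *m F)) => w.
  by rewrite ilift_lmat -mulmxA EF mulmx1 iIK.
by rewrite ilift_lmat pIK -mulmxA FE mulmx1.
Qed.

Lemma lmat1 n : framed (lmat (1%:M : 'M[T]_n)) /\ K0eq [+ fr (lmat (1%:M : 'M[T]_n))] [::].
Proof.
split; first by apply: (framed_lmat (F := 1%:M)); rewrite mul1mx.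
have [] // := @K0eq_id _ _ phi ('rV[S]_n) (pI n \o ilift (lmat (1%:M : 'M[T]_n))).
  exact: fgproj_rV.
by move=> w; rewrite -[LHS]/(pI n (ilift _ w)) ilift_lmat mulmx1 iIK.
Qed.

Lemma exact_lower a b : short_exact (mklin (@inr_linear S a b)) (mklin (@lsub_linear S a b)).
Proof.
split=> [x y /eq_row_mx []|y|z] //=; last by exists (row_mx z 0); rewrite row_mxKl.
split=> [y0|[x <-]]; last by rewrite row_mxKl.
by exists (rsubmx y); rewrite -{2}[y]hsubmxK y0.
Qed.
Lemma exact_upper a b : short_exact (mklin (@inl_linear S a b)) (mklin (@rsub_linear S a b)).
Proof.
split=> [x y /eq_row_mx []|y|z] //=; last by exists (row_mx 0 z); rewrite row_mxKr.
split=> [y0|[x <-]]; last by rewrite row_mxKr.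
by exists (lsubmx y); rewrite -{2}[y]hsubmxK y0.
Qed.

Lemma K0eq_nil2 (g g' : triple phi) : K0eq [+ g] [::] -> K0eq [+ g'] [::] ->
  K0eq ([+ g] ++ [+ g']) [::].
Proof. by move=> h h'; apply: (K0eq_cat h h'). Qed.

(** A unipotent block matrix is an extension of an identity by an identity, and the classes of
    identities vanish. *)
Lemma lmat_U a b X : K0eq [+ fr (lmat (block_mx 1%:M X 0 1%:M : 'M[T]_(a + b)))] [::].
Proof.
have [fa ea] := lmat1 a; have [fb eb] := lmat1 b.
apply: K0eq_trans (K0eq_nil2 eb ea).
have FU : framed (lmat (block_mx 1%:M X 0 1%:M : 'M[T]_(a + b))).
  apply: (framed_lmat (F := block_mx 1%:M (- X) 0 1%:M)); rewrite mulmx_block;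
  by rewrite !(mulmx1, mul1mx, mulmx0, mul0mx, addr0, add0r) ?addNr ?subrr -scalar_mx_block.
apply: (fr_lower fb FU fa (exact_lower a b)) => [x|y] /=.
  by rewrite map_row_mx map_mx0 mul_row_block !(mulmx1, mul0mx, mulmx0, addr0, add0r).
rewrite -{1}[y]hsubmxK map_row_mx mul_row_block row_mxKl.
by rewrite !(mulmx1, mul0mx, mulmx0, addr0, add0r).
Qed.

Lemma lmat_L a b Y : K0eq [+ fr (lmat (block_mx 1%:M 0 Y 1%:M : 'M[T]_(a + b)))] [::].
Proof.
have [fa ea] := lmat1 a; have [fb eb] := lmat1 b.
apply: K0eq_trans (K0eq_nil2 ea eb).
have FU : framed (lmat (block_mx 1%:M 0 Y 1%:M : 'M[T]_(a + b))).
  apply: (framed_lmat (F := block_mx 1%:M 0 (- Y) 1%:M)); rewrite mulmx_block;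
  by rewrite !(mulmx1, mul1mx, mulmx0, mul0mx, addr0, add0r) ?addNr ?subrr -scalar_mx_block.
apply: (fr_upper fa FU fb (exact_upper a b)) => [x|y] /=.
  by rewrite map_row_mx map_mx0 mul_row_block !(mulmx1, mul0mx, mulmx0, addr0, add0r).
rewrite -{1}[y]hsubmxK map_row_mx mul_row_block row_mxKr.
by rewrite !(mulmx1, mul0mx, mulmx0, addr0, add0r).
Qed.

Lemma lmul_linear n (P : lmodType S) (l : {linear P -> restr phi (rV n)}) (E : 'M[T]_n) :
  linear ((fun x => (l x : rV n) *m E) : P -> restr phi (rV n)).
Proof. by move=> a x y; rewrite linearP mulmxDl -scalemxAl. Qed.
Definition lmul n (P : lmodType S) (l : {linear P -> restr phi (rV n)}) E :
  {linear P -> restr phi (rV n)} := mklin (lmul_linear l E).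

Lemma ilift_lmul n (P : lmodType S) (l : {linear P -> restr phi (rV n)}) E w :
  ilift (lmul l E) w = ilift l w *m E.
Proof.
elim/bc_ind: w => [|t x y IH]; first by rewrite !linear0 mul0mx.
rewrite !linearD IH mulmxDl; congr (_ + _).
by rewrite /ilift !bc_liftE -scalemxAl.
Qed.

Lemma framed_lmul n (P : lmodType S) (l : {linear P -> restr phi (rV n)}) E F :
  E *m F = 1%:M -> F *m E = 1%:M -> framed l -> framed (lmul l E).
Proof.
move=> EF FE [pP [g lg gl]]; split=> //; exists (fun w => g (w *m F)) => w.
  by rewrite ilift_lmul -mulmxA EF mulmx1 lg.
by rewrite ilift_lmul gl -mulmxA FE mulmx1.
Qed.

Lemma K0eq_lmul n (P : lmodType S) (l : {linear P -> restr phi (rV n)}) E F :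
  E *m F = 1%:M -> F *m E = 1%:M -> framed l -> K0eq [+ fr (lmat E)] [::] ->
  K0eq [+ fr l] [+ fr (lmul l E)].
Proof.
move=> EF FE hl E0; have hE := framed_lmat EF FE.
have hc := K0eq_comp (fr_gen hl) (fr_gen hE).
apply: K0eq_sym; apply: (K0eq_trans (y := [+ fr l] ++ [+ fr (lmat E)])); last first.
  rewrite -[X in K0eq _ X]cats0; apply: K0eq_cat => //; exact: K0eq_refl.
apply: K0eq_trans hc; apply: K0eq_sym.
have [] // := @K0eq_pointwise _ _ phi _ _ (pI n \o ilift (lmul l E))
  ((pI n \o ilift (lmat E)) \o (pI n \o ilift l)).
  move=> w; rewrite -[LHS]/(pI n (ilift _ w)) -[RHS]/(pI n (ilift _ (pI n (ilift l w)))).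
  by rewrite ilift_lmul ilift_lmat pIK.
exact: (fr_gen (framed_lmul EF FE hl)).
Qed.

Lemma K0eq_elementary m (P : lmodType S) (l : {linear P -> restr phi (rV (1 + m))}) E :
  elementary E -> framed l -> framed (lmul l E) /\ K0eq [+ fr l] [+ fr (lmul l E)].
Proof.
move=> hE hl; have [F [EF FE]] := elementary_unit hE.
split; first exact: (framed_lmul EF FE hl).
apply: (K0eq_lmul EF FE hl); clear P l hl F EF FE.
elim: hE => [|{}E X hE IH|{}E Y hE IH]; first by case: (lmat1 (1 + m)).
  have hU := elementary_U X; have [F [EF FE]] := elementary_unit hE.
  have [G [UG GU]] := elementary_unit hU.
  have H := K0eq_lmul UG GU (framed_lmat EF FE) (lmat_U X).
  apply: K0eq_trans (K0eq_trans (K0eq_sym H) IH).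
  have [] // := @K0eq_pointwise _ _ phi _ _ (pI _ \o ilift (lmul (lmat E) (block_mx 1%:M X 0 1%:M)))
   (pI _ \o ilift (lmat (E *m block_mx 1%:M X 0 1%:M))).
    move=> w; rewrite -[LHS]/(pI _ (ilift _ w)) -[RHS]/(pI _ (ilift _ w)).
    by rewrite ilift_lmul !ilift_lmat mulmxA.
  exact: (fr_gen (framed_lmul UG GU (framed_lmat EF FE))).
have hU := elementary_L Y; have [F [EF FE]] := elementary_unit hE.
have [G [UG GU]] := elementary_unit hU.
have H := K0eq_lmul UG GU (framed_lmat EF FE) (lmat_L Y).
apply: K0eq_trans (K0eq_trans (K0eq_sym H) IH).
have [] // := @K0eq_pointwise _ _ phi _ _ (pI _ \o ilift (lmul (lmat E) (block_mx 1%:M 0 Y 1%:M)))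
 (pI _ \o ilift (lmat (E *m block_mx 1%:M 0 Y 1%:M))).
  move=> w; rewrite -[LHS]/(pI _ (ilift _ w)) -[RHS]/(pI _ (ilift _ w)).
  by rewrite ilift_lmul !ilift_lmat mulmxA.
exact: (fr_gen (framed_lmul UG GU (framed_lmat EF FE))).
Qed.

End Framed.

Section PairLinear.
Variables (S : comPzRingType) (L M : lmodType S).
Notation LM := ((L * M)%type : lmodType S).
Lemma pfst_linear : linear (fst : LM -> L). Proof. by []. Qed.
Lemma psnd_linear : linear (snd : LM -> M). Proof. by []. Qed.
Lemma pinl_linear : linear ((fun x => (x, 0)) : L -> LM).
Proof. by move=> a x y; congr (_, _); rewrite /= scaler0 addr0. Qed.
Lemma pinr_linear : linear ((fun y => (0, y)) : M -> LM).
Proof. by move=> a x y; congr (_, _); rewrite /= scaler0 addr0. Qed.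

Lemma fgproj_prod : fgproj L -> fgproj M -> fgproj LM.
Proof.
move=> [n [i [p ip]]] [m [j [q jq]]].
have h1 : linear ((fun z => row_mx (i z.1) (j z.2)) : LM -> 'rV[S]_(n + m)).
  by move=> a x y; rewrite !linearP scale_row_mx add_row_mx.
have h2 : linear ((fun v => (p (lsubmx v), q (rsubmx v))) : 'rV[S]_(n + m) -> LM).
  by move=> a x y; rewrite (lsub_linear a x y) (rsub_linear a x y) !linearP.
exists (n + m)%N, (mklin h1), (mklin h2) => -[x y] /=.
by rewrite row_mxKl row_mxKr ip jq.
Qed.

Lemma exact_prod : short_exact (mklin pinl_linear) (mklin psnd_linear).
Proof.
split=> [x y [] //|[x y]|z]; last by exists (0, z).
by split=> /= [->|[? [_ <-]]] //; exists x.
Qed.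
End PairLinear.

(** * Reduction of a class to one triple with free target *)

Section Reduction.
Variables (S T : comPzRingType) (phi : {rmorphism S -> T}).
Notation rV n := ('rV[T]_n : lmodType T).

Section Normal.
Variables (L1 L2 : lmodType S) (lam : {linear bc phi L1 -> bc phi L2}) (Q : pres L2).
Let i := pinj Q.
Let p := pprj Q.
Let n := prank Q.
Let K := (kermod p : lmodType S).
Let P := ((L1 * K)%type : lmodType S).

(** The target L2 is completed to S^n by the kernel K of its projection, and lam by the identity of
    K, whose class is zero. *)
Lemma normal_linear : linear
  ((fun z => iT phi i (lam (bT phi 1 z.1)) + map_mx phi (kerval p z.2)) : P -> restr phi (rV n)).
Proof.
move=> a x y.
have E1 : iT phi i (lam (bT phi 1 (a *: x + y).1)) =
    phi a *: iT phi i (lam (bT phi 1 x.1)) + iT phi i (lam (bT phi 1 y.1)).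
  by rewrite -[(a *: x + y).1]/(a *: x.1 + y.1) bTDr bT1Z !linearD !linZ.
have E2 : map_mx phi (kerval p (a *: x + y).2) =
   phi a *: map_mx phi (kerval p x.2) + map_mx phi (kerval p y.2).
  by rewrite -[(a *: x + y).2]/(a *: x.2 + y.2) linearP map_mxD map_mxZ.
rewrite E1 E2 addrACA -scalerDr.
by [].
Qed.
Definition lnormal : {linear P -> restr phi (rV n)} := mklin normal_linear.

Lemma lnormalE x q :
  lnormal (x, q) = iT phi i (lam (bT phi 1 x)) + map_mx phi (kerval p q) :> rV n.
Proof. by []. Qed.

Lemma kproj_linear : linear (fun v : 'rV[S]_n => v - i (p v)).
Proof. by move=> a x y; rewrite [p _]linearP [i _]linearP opprD addrACA scalerBr. Qed.
Lemma kprojP v : p (mklin kproj_linear v) = 0.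
Proof. by rewrite /= linearB pprjK subrr. Qed.
Definition kproj : {linear 'rV[S]_n -> K} := kerlift kprojP.

Lemma kprojK x : kproj (kerval p x) = x.
Proof. by apply: kerval_inj; rewrite kerliftK /= (kervalP x) linear0 subr0. Qed.
Lemma kproj_i x : kproj (i x) = 0.
Proof. by apply: kerval_inj; rewrite kerliftK [kerval p 0]linear0 /= pprjK subrr. Qed.

Lemma pI_iT y : pI phi n (iT phi i y) = bcmap phi i y.
Proof.
apply: (bc_linear_ext (f := pI phi n \o iT phi i) (g := bcmap phi i)) => x.
by rewrite -[LHS]/(pI phi n (iT phi i (bT phi 1 x))) iT1 pI_map bcmap1.
Qed.

Lemma bcmap_kproj_i y : bcmap phi kproj (bcmap phi i y) = 0.
Proof.
elim/bc_ind: y => [|t x y IH]; first by rewrite !linear0.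
by rewrite !linearD IH !bcmapE kproj_i addr0 -[t]mulr1 -bTE bT0 scaler0.
Qed.

Lemma normal_snd z : bcmap phi (mklin (@psnd_linear S L1 K)) z = bcmap phi kproj (pI phi n (ilift lnormal z)).
Proof.
apply: (bc_linear_ext (f := bcmap phi (mklin (@psnd_linear S L1 K)))
  (g := bcmap phi kproj \o (pI phi n \o ilift lnormal))) => -[x q].
rewrite bcmap1 -[RHS]/(bcmap phi kproj (pI phi n (ilift lnormal (bT phi 1 (x, q))))).
rewrite ilift1 lnormalE linearD pI_map pI_iT linearD bcmap_kproj_i add0r bcmap1.
by rewrite kprojK.
Qed.

Lemma normal_fst y : ilift lnormal (bcmap phi (mklin (@pinl_linear S L1 K)) y) = iT phi i (lam y).
Proof.
apply: (bc_linear_ext (f := ilift lnormal \o bcmap phi (mklin (@pinl_linear S L1 K)))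
  (g := iT phi i \o lam)) => x.
rewrite -[LHS]/(ilift lnormal (bcmap phi _ (bT phi 1 x))) bcmap1 ilift1.
by rewrite -[mklin _ x]/(x, 0) lnormalE linear0 map_mx0 addr0.
Qed.

Lemma normal_inr y : ilift lnormal (bcmap phi (mklin (@pinr_linear S L1 K)) y) = iT phi (kerval p) y.
Proof.
apply: (bc_linear_ext (f := ilift lnormal \o bcmap phi (mklin (@pinr_linear S L1 K)))
  (g := iT phi (kerval p))) => x.
rewrite -[LHS]/(ilift lnormal (bcmap phi _ (bT phi 1 x))) bcmap1 ilift1.
by rewrite -[mklin _ x]/(0, x) lnormalE bT0 !linear0 add0r iT1.
Qed.

Lemma framed_normal : fgproj L1 -> bijective lam -> framed lnormal.
Proof.
move=> p1 /linear_inv [mu [lK mK]]; split.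
  apply: fgproj_prod => //; apply: (fgproj_retract (i := kerval p) (p := kproj)).
    exact: kprojK.
  exact: fgproj_rV.
pose h := fun w : 'rV[T]_n => bcmap phi (mklin (@pinl_linear S L1 K)) (mu (pT phi p w))
  + bcmap phi (mklin (@pinr_linear S L1 K)) (bcmap phi kproj (pI phi n w)).
exists h => z.
  rewrite /h -normal_snd.
  elim/bc_ind: z => [|t [x q] z IH]; first by rewrite !linear0 addr0.
  rewrite [ilift _ _]linearD [pT _ _ _]linearD [mu _]linearD.
  rewrite [bcmap _ _ (mu _ + _)]linearD [bcmap _ (mklin (@psnd_linear S L1 K)) _]linearD.
  rewrite [bcmap _ (mklin (@pinr_linear S L1 K)) (_ + _)]linearD addrACA IH.
  congr (_ + _); rewrite -[t]mulr1 -bTE !linZ -scalerDr; congr (t *: _).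
  rewrite !bcmap1 ilift1 lnormalE linearD pT_map (kervalP q) bT0 addr0.
  rewrite (pTK (@pprjK _ _ Q)) lK bcmap1 -bTDr; congr (bT _ _ _).
  by congr (_, _); rewrite /= ?addr0 ?add0r.
rewrite /h linearD normal_fst normal_inr mK.
apply: (rV_ext (g := idfun)
  (f := (iT phi i \o pT phi p) \+ (iT phi (kerval p) \o (bcmap phi kproj \o pI phi n)))) => j.
rewrite -[LHS]/(iT phi i (pT phi p (delta_mx 0 j))
  + iT phi (kerval p) (bcmap phi kproj (pI phi n (delta_mx 0 j)))).
rewrite -(map_delta_mx phi) pT_map pI_map bcmap1 !iT1 kerliftK -map_mxD /=.
by rewrite addrC subrK.
Qed.

Lemma K0eq_normal : K0gen (Triple lam) -> K0eq [+ Triple lam] [+ fr lnormal].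
Proof.
move=> hg; have hn : framed lnormal by case: hg => ? ? ?; apply: framed_normal.
have pK : fgproj K.
  apply: (fgproj_retract (i := kerval p) (p := kproj)); first exact: kprojK.
  exact: fgproj_rV.
have [hK eK] := K0eq_id (phi := phi) (L := K) (lam := idfun) pK (fun=> erefl).
apply: K0eq_sym; apply: (K0eq_trans (y := [+ Triple lam] ++ [+ Triple (idfun : {linear bc phi K -> bc phi K})])).
  apply: K0eq_ext => //; first exact: fr_gen.
  exists (mklin (@pinl_linear S L1 K)), (mklin (@psnd_linear S L1 K)), i, kproj; split.
  - exact: exact_prod.
  - split=> [x y|y|z].
    + exact: (can_inj (@pprjK _ _ Q)).
    + split=> [y0|[x <-]]; last exact: kproj_i.
      exists (p y); apply/eqP; rewrite eq_sym -subr_eq0; apply/eqP.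
      by have := congr1 (kerval p) y0; rewrite kerliftK linear0.
    + by exists (kerval p z); rewrite kprojK.
  - move=> y; rewrite -[LHS]/(pI phi n (ilift lnormal (bcmap phi _ y))).
    by rewrite normal_fst pI_iT.
  - by move=> z; rewrite -[LHS]/(bcmap phi _ z) normal_snd.
rewrite -[X in K0eq _ X]cats0; apply: K0eq_cat => //; exact: K0eq_refl.
Qed.

End Normal.

Section FrSum.
Variables (n m : nat) (P1 P2 : lmodType S).
Variables (l1 : {linear P1 -> restr phi (rV n)}) (l2 : {linear P2 -> restr phi (rV m)}).
Notation P12 := ((P1 * P2)%type : lmodType S).

Lemma lsum_linear : linear
  ((fun z => row_mx (l1 z.1 : rV n) (l2 z.2 : rV m)) : P12 -> restr phi (rV (n + m))).
Proof.
move=> a x y; rewrite linearP [l2 _]linearP.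
by rewrite -[RHS]/(phi a *: row_mx _ _ + row_mx _ _) scale_row_mx add_row_mx.
Qed.
Definition lsum : {linear P12 -> restr phi (rV (n + m))} := mklin lsum_linear.

Lemma ilift_lsum z : ilift lsum z = row_mx (ilift l1 (bcmap phi (mklin (@pfst_linear S P1 P2)) z))
   (ilift l2 (bcmap phi (mklin (@psnd_linear S P1 P2)) z)).
Proof.
elim/bc_ind: z => [|t x y IH]; first by rewrite !linear0 row_mx0.
rewrite !linearD IH -add_row_mx; congr (_ + _).
by rewrite !bcmapE /ilift !bc_liftE -scale_row_mx.
Qed.

Lemma framed_lsum : framed l1 -> framed l2 -> framed lsum.
Proof.
move=> [p1 /linear_inv [g1 [lg1 gl1]]] [p2 /linear_inv [g2 [lg2 gl2]]].
split; first exact: fgproj_prod.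
exists (fun w => bcmap phi (mklin (@pinl_linear S P1 P2)) (g1 (lsubmx w))
  + bcmap phi (mklin (@pinr_linear S P1 P2)) (g2 (rsubmx w))) => z.
  rewrite ilift_lsum row_mxKl row_mxKr lg1 lg2.
  elim/bc_ind: z => [|t [x q] z IH]; first by rewrite !linear0 addr0.
  rewrite !linearD addrACA IH; congr (_ + _); rewrite !bcmapE -bTDr; congr (bT _ _ _).
  by congr (_, _); rewrite /= ?addr0 ?add0r.
rewrite linearD !ilift_lsum.
have E1 y : bcmap phi (mklin (@pfst_linear S P1 P2)) (bcmap phi (mklin (@pinl_linear S P1 P2)) y) = y.
  by elim/bc_ind: y => [|t x y IH]; rewrite ?linear0 // !linearD IH !bcmapE.
have E2 y : bcmap phi (mklin (@psnd_linear S P1 P2)) (bcmap phi (mklin (@pinl_linear S P1 P2)) y) = 0.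
  elim/bc_ind: y => [|t x y IH]; rewrite ?linear0 // !linearD IH !bcmapE addr0 /=.
  by rewrite -[t]mulr1 -bTE bT0 scaler0.
have E3 y : bcmap phi (mklin (@pfst_linear S P1 P2)) (bcmap phi (mklin (@pinr_linear S P1 P2)) y) = 0.
  elim/bc_ind: y => [|t x y IH]; rewrite ?linear0 // !linearD IH !bcmapE addr0 /=.
  by rewrite -[t]mulr1 -bTE bT0 scaler0.
have E4 y : bcmap phi (mklin (@psnd_linear S P1 P2)) (bcmap phi (mklin (@pinr_linear S P1 P2)) y) = y.
  by elim/bc_ind: y => [|t x y IH]; rewrite ?linear0 // !linearD IH !bcmapE.
by rewrite E1 E2 E3 E4 gl1 gl2 !linear0 add_row_mx addr0 add0r hsubmxK.
Qed.

Lemma K0eq_lsum : framed l1 -> framed l2 -> K0eq [+ fr lsum] ([+ fr l1] ++ [+ fr l2]).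
Proof.
move=> h1 h2; apply: (fr_upper h1 (framed_lsum h1 h2) h2 (exact_prod _ _)) => //= [x|y].
  by rewrite linear0.
by rewrite row_mxKr.
Qed.

End FrSum.

(** A negative triple is replaced by that of the inverse map, and a sum of triples by their direct
    sum. *)
Lemma K0_framed (x : fsum phi) : K0 x ->
  exists n (P : lmodType S) (l : {linear P -> restr phi (rV n)}), framed l /\ K0eq x [+ fr l].
Proof.
have norm (g : triple phi) : K0gen g ->
    exists n (P : lmodType S) (l : {linear P -> restr phi (rV n)}), framed l /\ K0eq [+ g] [+ fr l].
  case: g => L1 L2 lam hg; have [p1 /fgproj_pres [Q] b] := hg.
  exists (prank Q), _, (lnormal lam Q); split; first exact: framed_normal.
  exact: K0eq_normal.
elim=> [|[b g] {}x /= hg _ [n [P [l [hl el]]]]].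
  exists 0%N, _, (lmat phi 1%:M); have [f e] := lmat1 phi 0; split=> //.
  exact: K0eq_sym.
have [m [P' [l' [hl' el']]]] : exists m (P' : lmodType S) (l' : {linear P' -> restr phi (rV m)}),
    framed l' /\ K0eq [:: (b, g)] [+ fr l'].
  case: b; first exact: norm.
  case: g hg => L1 L2 lam hg; have [_ _ /linear_inv [mu [lm ml]]] := hg.
  have [hm em] := K0eq_inv hg lm ml; have [m [P' [l' [hl' el']]]] := norm _ hm.
  by exists m, P', l'; split=> //; apply: K0eq_trans em el'.
exists (m + n)%N, _, (lsum l' l); split; first exact: framed_lsum.
rewrite -cat1s; apply: K0eq_trans (K0eq_cat el' el) _.
exact/K0eq_sym/K0eq_lsum.
Qed.

End Reduction.

(** * Injectivity of [Phi] *)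

Section Injectivity.
Variables (S T : comPzRingType) (phi : {rmorphism S -> T}).
Hypothesis phi_inj : injective phi.
Hypothesis Sint : forall a : S, integral_elt (intr : {rmorphism int -> S}) a.
Hypothesis Tchar : forall n : nat, (0 < n)%N -> exists u : T, n%:R * u = 1.
Hypothesis Tpreg : preg (fun m : T => m = 1).
Notation rV n := ('rV[T]_n : lmodType T).

Lemma bT1_inj (P : lmodType S) : fgproj P -> injective (fun x : P => bT phi 1 x).
Proof.
move=> [n [i [p ip]]] x y /(congr1 (iT phi i)); rewrite !iT1 => /rowP E.
apply: (can_inj ip); apply/rowP => j; apply: phi_inj.
by have := E j; rewrite !mxE.
Qed.

Lemma framed_inj n (P : lmodType S) (l : {linear P -> restr phi (rV n)}) :
  framed l -> injective l.
Proof.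
move=> [pP [g lg _]] x y lxy; apply: (bT1_inj pP); apply: (can_inj lg).
by rewrite !ilift1.
Qed.

(** By [serre] there are x0 in P and a functional f with f x0 = 1. Over T they become a row u and a
    column w with u w = 1. An elementary matrix, which preserves the class, makes them the first
    basis vector and the first coordinate. Then l is triangular for P = S x0 (+) ker f, and the
    quotient is the triple of an identity. *)
Lemma framed_step m (P : lmodType S) (l : {linear P -> restr phi (rV (1 + m.+1))}) :
  framed l -> exists (P' : lmodType S) (l' : {linear P' -> restr phi (rV m.+1)}),
    framed l' /\ K0eq [+ fr l] [+ fr l'].
Proof.
move=> hl; have [pP /linear_inv [g [lg gl]]] := hl; have [[k i p ip]] := fgproj_pres pP.
pose e := lin1_mx (i \o p).
have eE v : v *m e = i (p v) by rewrite mul_rV_lin1.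
pose L := lin1_mx (ilift l \o pT phi p); pose L' := lin1_mx (iT phi i \o g).
have LE v : v *m L = ilift l (pT phi p v) by rewrite mul_rV_lin1.
have L'E v : v *m L' = iT phi i (g v) by rewrite mul_rV_lin1.
have [||||x [y exy]] := serre phi_inj Sint Tchar (e := e) (L := L) (L' := L') _ _ _ (n := (1 + m.+1)%N).
- by apply/row_matrixP => j; rewrite row_mul !rowE !eE ip.
- apply/row_matrixP => j; rewrite row_mul [row j L]rowE LE L'E lg.
  by rewrite -map_row rowE eE -(map_delta_mx phi) pT_map iT1.
- apply/row_matrixP => j; rewrite row_mul [row j L']rowE L'E LE (pTK ip) gl.
  by rewrite rowE mulmx1.
- by [].
pose x0 := p x.
have fl : linear ((fun z => (i z *m y) 0 0) : P -> (S^o : lmodType S)).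
  by move=> a z z'; rewrite linearP mulmxDl -scalemxAl !mxE.
pose f := mklin fl.
have fx0 : f x0 = 1 by rewrite /= /x0 -eE exy mxE.
have fZ (a : S) : f (a *: x0) = a by rewrite linZ fx0; apply: mulr1.
pose u : rV (1 + m.+1) := l x0; pose w : 'cV[T]_(1 + m.+1) := L' *m map_mx phi y.
have lw z : (l z : rV (1 + m.+1)) *m w = (phi (f z))%:M.
  rewrite /w mulmxA L'E -ilift1 lg iT1 -map_mxM.
  by rewrite [i z *m y]mx11_scalar map_scalar_mx.
have uw : u *m w = 1%:M by rewrite lw fx0 rmorph1.
have [E [hE uE wE]] := elementary_move Tpreg uw.
have [hl1 eq1] := K0eq_elementary hE hl.
set l1 := lmul l E in hl1 eq1.
have l1x0 : l1 x0 = row_mx 1%:M 0 :> rV _ by [].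
have l1l z : lsubmx (l1 z : rV (1 + m.+1)) = (phi (f z))%:M.
  rewrite -lw wE mulmxA -[_ *m E]/(l1 z : rV (1 + m.+1)) -{2}[l1 z : rV _]hsubmxK.
  by rewrite mul_row_col mulmx1 mulmx0 addr0.
pose Q := (kermod f : lmodType S).
have kpl : linear (fun z => z - (f z : S) *: x0).
  move=> a z z'; rewrite linearP scalerBr addrACA; congr (_ + _).
  by rewrite scalerDl opprD scalerA.
have kpP z : f (mklin kpl z) = 0.
  by rewrite -[mklin kpl z]/(z - (f z : S) *: x0) linearB fZ subrr.
pose kp : {linear P -> Q} := kerlift kpP.
have kpK : cancel (kerval f) kp.
  move=> q; apply: kerval_inj; rewrite kerliftK.
  by rewrite -[mklin kpl _]/(kerval f q - (f (kerval f q) : S) *: x0) (kervalP q) scale0r subr0.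
have l'l : linear ((fun q => rsubmx (l1 (kerval f q) : rV (1 + m.+1))) : Q -> restr phi (rV m.+1)).
  move=> a q q'; rewrite [kerval f _]linearP [l1 _]linearP.
  exact: (rsub_linear (phi a)).
pose l' : {linear Q -> restr phi (rV m.+1)} := mklin l'l.
have l1ker q : l1 (kerval f q) = row_mx 0 (l' q : rV m.+1) :> rV (1 + m.+1).
  rewrite -[LHS]hsubmxK; congr row_mx.
  by rewrite l1l (kervalP q) rmorph0 raddf0.
have hl' : framed l'.
  have [_ [g1 lg1 gl1]] := hl1; split; first exact: (fgproj_retract kpK).
  exists (fun v => bcmap phi kp (g1 (row_mx 0 v))) => z.
    have <- : ilift l1 (bcmap phi (kerval f) z) = row_mx 0 (ilift l' z).
      elim/bc_ind: z => [|t q z IH]; first by rewrite !linear0 row_mx0.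
      rewrite !linearD IH -[0 in RHS]addr0 -add_row_mx; congr (_ + _).
      by rewrite bcmapE /ilift !bc_liftE l1ker scale_row_mx scaler0.
    rewrite lg1; elim/bc_ind: z => [|t q z IH]; first by rewrite !linear0.
    by rewrite !linearD IH !bcmapE kpK.
  have E1 v : ilift l' (bcmap phi kp v) = rsubmx (ilift l1 v).
    elim/bc_ind: v => [|t q v IH]; first by rewrite !linear0.
    rewrite !linearD IH; congr (_ + _).
    rewrite bcmapE /ilift !bc_liftE.
    transitivity (t *: rsubmx (l1 q : rV (1 + m.+1))); last first.
      by apply/rowP => j; rewrite !mxE.
    congr (t *: _); rewrite -[l' _]/(rsubmx (l1 (q - (f q : S) *: x0) : rV (1 + m.+1))).
    have -> : l1 (q - (f q : S) *: x0) =
        (l1 q : rV (1 + m.+1)) - phi (f q) *: (l1 x0 : rV (1 + m.+1)) :> rV (1 + m.+1).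
      by rewrite linearB linZ.
    rewrite l1x0 scale_row_mx scaler0 -[l1 q : rV _](@hsubmxK _ 1 1 m.+1).
    by rewrite opp_row_mx add_row_mx !row_mxKr oppr0 addr0.
  by rewrite E1 gl1 row_mxKr.
exists Q, l'; split=> //; apply: (K0eq_trans eq1).
have [h1 e1] := lmat1 phi 1.
have vl : linear (fun z => (f z : S)%:M : 'rV[S]_1).
  by move=> a z z'; rewrite linearP; apply/rowP => j; rewrite !ord1 !mxE.
apply: (K0eq_trans (fr_lower (u := kerval f) (v := mklin vl) hl' hl1 h1 _ _ _)).
- split=> [|z|c]; first exact: kerval_inj.
    split=> [/rowP /(_ 0)|[q <-]]; last first.
      by rewrite -[mklin vl _]/((f (kerval f q) : S)%:M) (kervalP q) raddf0.
    rewrite !mxE mulr1n => fz; exists (kp z); rewrite kerliftK.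
    by rewrite -[mklin kpl z]/(z - (f z : S) *: x0) fz scale0r subr0.
  exists (c 0 0 *: x0); rewrite -[mklin vl _]/((f (c 0 0 *: x0) : S)%:M) fZ.
  by apply/rowP => j; rewrite !ord1 mxE.
- exact: l1ker.
- move=> z; rewrite l1l -[RHS]/(map_mx phi ((f z : S)%:M) *m 1%:M) mulmx1.
  by rewrite map_scalar_mx.
rewrite -[X in K0eq _ X]cats0; apply: K0eq_cat => //; exact: K0eq_refl.
Qed.

Lemma Phi_fr n (P : lmodType S) (l : {linear P -> restr phi (rV n)}) : framed l ->
  Phi [+ fr l] = Det phi (fun w => exists x, w = l x).
Proof.
move=> hl; rewrite Phi1 /sgD /= (gDE (g := fr l) (free_pres S n)); last exact: fr_gen.
congr (Det phi _); apply: pred_ext => w.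
have E x : iT phi (pinj (free_pres S n)) (tiso (fr l) (bT phi 1 x)) = l x.
  rewrite -[LHS]/(iI phi n (pI phi n (ilift l (bT phi 1 x)))) pIK.
  exact: ilift1.
split=> [[x [v [pv ->]]]|[x ->]].
  exists x; rewrite E; have -> : v = 0 by exact: pv.
  by rewrite map_mx0 addr0.
by exists x, 0; rewrite linear0 E map_mx0 addr0.
Qed.

(** In rank one the determinant is the lattice l(P) itself; if it equals S, the element x1 with l x1
    = 1 is a basis of P. *)
Lemma framed_trivial m (P : lmodType S) (l : {linear P -> restr phi (rV m.+1)}) :
  framed l -> Phi [+ fr l] = sunit phi -> K0eq [+ fr l] [::].
Proof.
elim: m P l => [|m IH] P l hl Dl; last first.
  have [P' [l' [hl' e']]] := framed_step hl.
  by apply: (K0eq_trans e'); apply: IH => //; rewrite -(Phi_K0eq e').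
have li := framed_inj hl.
have lE t : (exists x, t%:M = l x :> rV 1) <-> sunit phi t.
  rewrite -Dl Phi_fr // Det1; first by split=> [] [x ->]; exists x.
  split=> [|_ _ [x ->] [y ->]|s _ [x ->]]; first by exists 0; rewrite linear0.
    by exists (x + y); rewrite linearD.
  by exists (s *: x); rewrite linZ.
have [x1 lx1] := (lE 1).2 (sunit1 phi).
have al : linear (fun v : 'rV[S]_1 => v 0 0 *: x1).
  by move=> a v v'; rewrite !mxE scalerDl scalerA.
have lx v : l (mklin al v) = map_mx phi v :> rV 1.
  rewrite -[mklin al v]/(v 0 0 *: x1) linZ -[LHS]/(phi (v 0 0) *: (l x1 : rV 1)) -lx1.
  by apply/rowP => j; rewrite !ord1 !mxE mulr1.
have [h1 e1] := lmat1 phi 1; apply: (K0eq_trans _ e1).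
apply: (K0eq_iso (g := fr (lmat phi 1%:M)) (g' := fr l) (a := mklin al)
  (b := (idfun : {linear 'rV[S]_1 -> 'rV[S]_1}))); try exact: fr_gen.
- have /choice [s ls] z : exists s, l z = map_mx phi (s%:M : 'rV_1) :> rV 1.
    have [|s sE] := (lE ((l z : rV 1) 0 0)).1.
      by exists z; apply/rowP => j; rewrite !ord1 mxE.
    by exists s; apply/rowP => j; rewrite !ord1 !mxE sE.
  exists (fun z => (s z)%:M).
    move=> v; have := ls (mklin al v); rewrite lx => /rowP E.
    by apply/rowP => j; have := E j; rewrite !ord1 !mxE => /phi_inj ->.
  by move=> z; apply: li; rewrite lx ls.
- by exists idfun.
- apply: (bc_linear_ext (f := tiso (fr l) \o bcmap phi (mklin al))
    (g := bcmap phi idfun \o tiso (fr (lmat phi 1%:M)))) => v.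
  rewrite -[LHS]/(pI phi 1 (ilift l (bcmap phi (mklin al) (bT phi 1 v)))).
  rewrite -[RHS]/(bcmap phi idfun (pI phi 1 (ilift (lmat phi 1%:M) (bT phi 1 v)))).
  rewrite bcmap_id bcmap1 !ilift1 lx -[lmat phi 1%:M v]/(map_mx phi v *m 1%:M).
  by rewrite mulmx1.
Qed.

Theorem Phi_inj (x : fsum phi) : K0 x -> Phi x = sunit phi -> K0eq x [::].
Proof.
move=> hx Dx; have [[|n] [P [l [hl e]]]] := K0_framed hx; last first.
  by apply: (K0eq_trans e); apply: framed_trivial => //; rewrite -(Phi_K0eq e).
(* In rank zero P embeds into T^0, hence vanishes. *)
apply: (K0eq_trans e); apply: K0eq_trans (ztriple_eq0 phi).
apply: (K0eq_iso (g := ztriple phi) (g' := fr l) (a := mklin (@zero_linear S _ P))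
  (b := (idfun : {linear 'rV[S]_0 -> 'rV[S]_0}))).
- exact: ztriple_gen.
- exact: fr_gen.
- exists (fun=> 0) => z; first exact: rV0_eq.
  by apply: (framed_inj hl); apply: rV0_eq.
- by exists idfun.
- by move=> z; apply: bc_rV0.
Qed.

Corollary Phi_inj2 (x y : fsum phi) : K0 x -> K0 y -> Phi x = Phi y -> K0eq x y.
Proof.
move=> hx hy Dxy; apply: (@K0eq_cancel _ _ _ _ _ (fneg y)).
apply: K0eq_trans (K0eq_sym (K0eq_neg y)); apply: Phi_inj; last first.
  by rewrite Phi_cat Dxy Phi_neg.
apply/List.Forall_app; split=> //.
by rewrite /fneg; clear Dxy; elim: hy => [|p {}y hp _ IH]; [apply: List.Forall_nil|apply: List.Forall_cons].
Qed.

End Injectivity.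

(** * Integrality of finite algebras *)

Section Integrality.

Lemma hev_sum (k S : comPzRingType) (psi : {rmorphism k -> S}) (s : seq k) a :
  hev psi s a = \sum_(i < size s) psi s`_i * a ^+ i.
Proof.
elim: s => [|c s IH]; first by rewrite big_ord0.
rewrite big_ord_recl /= mulr1 IH mulr_sumr; congr (_ + _).
by apply: eq_bigr => i _; rewrite exprS mulrCA.
Qed.

Lemma monic_integral (k S : comNzRingType) (psi : {rmorphism k -> S}) (p : {poly k}) a :
  p \is monic -> (map_poly psi p).[a] = 0 -> integral_elt psi a.
Proof.
move=> /monicP pm pa; have : hev psi p a = 0.
  rewrite hev_sum -[RHS]pa (horner_coef_wide _ (size_poly _ _)).
  by apply: eq_bigr => i _; rewrite coef_map.
move: pm; rewrite /lead_coef; case/lastP: (polyseq p) => [|s c].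
  by move=> /eqP; rewrite eq_sym oner_eq0.
by rewrite size_rcons nth_rcons ltnn eqxx => -> H; exists s.
Qed.

Lemma zero_ring_integral (k S : comPzRingType) (psi : {rmorphism k -> S}) a :
  1 = 0 :> S -> integral_elt psi a.
Proof. by move=> E; exists [::]; rewrite /= rmorph1 E mulr0 addr0. Qed.

(** Characteristic polynomials are taken over rings with 1 != 0; the zero ring is dealt with apart
    by [zero_ring_integral]. *)
Lemma nz_pack (S : comPzRingType) : (1 : S) != 0 -> {S' : comNzRingType | S = S' :> comPzRingType}.
Proof.
move=> S1; unshelve eexists.
  exact: (HB.pack_for comNzRingType S (GRing.PzSemiRing_isNonZero.Build S S1)).
by case: S S1.
Qed.

(** The determinant trick: multiplication by a has the matrix N on the generators, so det(a - N)
    kills each of them, hence also 1. *)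
Lemma span_charpoly (k S : comNzRingType) (psi : {rmorphism k -> S}) n (e : 'I_n -> S) :
  (forall x, exists c, x = \sum_j psi (c j) * e j) ->
  forall a, exists N : 'M[k]_n, (map_poly psi (char_poly N)).[a] = 0.
Proof.
move=> espan a; have /choice [c ce] := fun i => espan (a * e i).
pose N : 'M[k]_n := \matrix_(i, j) c i j; exists N.
pose v : 'cV[S]_n := \col_i e i; pose M : 'M[S]_n := a%:M - map_mx psi N.
have Mv : M *m v = 0.
  rewrite mulmxBl mul_scalar_mx; apply/colP => i; rewrite !mxE ce -sumrB big1 // => j _.
  by rewrite !mxE subrr.
have dv : \det M *: v = 0 by rewrite -mul_scalar_mx -mul_adj_mx -mulmxA Mv mulmx0.
have dM : \det M = 0.
  have [d d1] := espan 1; rewrite -[LHS]mulr1 d1 mulr_sumr big1 // => j _.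
  rewrite mulrCA; have /colP /(_ j) := dv; rewrite !mxE => ->.
  by rewrite mulr0.
rewrite -[RHS]dM -[LHS]/(horner_eval a (map_poly psi (char_poly N))) -!det_map_mx.
congr (\det _); apply/matrixP => i j; rewrite !mxE /= /horner_eval.
rewrite rmorphB /= map_polyC /= hornerD hornerN hornerC.
by rewrite rmorphMn /= map_polyX hornerMn hornerX.
Qed.

Lemma span_integral (k : comNzRingType) (S : comPzRingType) (psi : {rmorphism k -> S}) n (e : 'I_n -> S) :
  (forall x, exists c, x = \sum_j psi (c j) * e j) -> forall a, integral_elt psi a.
Proof.
have [S1|S1] := eqVneq (1 : S) 0; first by move=> _ a; apply: zero_ring_integral.
have [S' E] := nz_pack S1; subst S => espan a.
have [N Na] := span_charpoly espan a; exact: monic_integral (char_poly_monic N) Na.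
Qed.

(** Transitivity of integrality, through the coefficients of the characteristic polynomial. *)
Lemma span_integral_int (k : comNzRingType) (S : comPzRingType) (psi : {rmorphism k -> S}) n (e : 'I_n -> S) :
  (forall x, exists c, x = \sum_j psi (c j) * e j) ->
  (forall x : k, integralOver (intr : {rmorphism int -> k}) x) ->
  forall a, integral_elt (intr : {rmorphism int -> S}) a.
Proof.
have [S1|S1] := eqVneq (1 : S) 0; first by move=> _ _ a; apply: zero_ring_integral.
have [S' E] := nz_pack S1; subst S => espan kint a.
have [N Na] := span_charpoly espan a.
have [p pm pr] : integralOver (intr : {rmorphism int -> S'}) a.
  apply: (integral_root_monic (p := map_poly psi (char_poly N))).
  - by rewrite monic_map // char_poly_monic.
  - by apply/rootP.
  apply/integral_poly => i; rewrite coef_map /=.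
  have [p pm pr] := kint (char_poly N)`_i; exists p => //.
  have -> : map_poly (intr : {rmorphism int -> S'}) p = map_poly psi (map_poly (intr : {rmorphism int -> k}) p).
    by apply/polyP => j; rewrite !coef_map /= rmorph_int.
  by move: pr; rewrite /root horner_map /= => /eqP ->; rewrite rmorph0.
by apply: (monic_integral pm); apply/eqP.
Qed.

End Integrality.

(** * Convolution and integrals *)

Section Convolution.
Variables (R : comPzRingType) (G : gscheme R).
Implicit Types P : algebra R.

Definition cv P (f g : G -> P) : G -> P := fun b => copair f g (gmul G b).
Definition sv (X : gspace G) P (f : X -> P) (g : G -> P) : X -> P :=
  fun c => copair f g (sact X c).
Definition ceps P : G -> P := fun b => alg_str P (gone G b).

Lemma cv_rlinear P (f g : G -> P) : rlinear f -> rlinear g -> rlinear (cv f g).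
Proof. by move=> hf hg; apply/rlinear_comp/copair_rlinear. Qed.
Lemma ceps_rlinear P : rlinear (ceps P).
Proof. exact: (rlinear_post (astr P) (alghom_rlinear (gone G))). Qed.

Lemma cv_ext P (f f' g g' : G -> P) : f =1 f' -> g =1 g' -> cv f g =1 cv f' g'.
Proof. by move=> ff gg b; apply: copair_ext. Qed.
Lemma sv_ext (X : gspace G) P (f f' : X -> P) (g g' : G -> P) : f =1 f' -> g =1 g' -> sv f g =1 sv f' g'.
Proof. by move=> ff gg b; apply: copair_ext. Qed.

Lemma copair_mull (A B P : algebra R) (u : A -> P) (v : B -> P) c : rlinear u -> rlinear v ->
  forall z, copair (fun x => c * u x) v z = c * copair u v z.
Proof.
move=> hu hv z; rewrite /copair /tlift /tsum mulr_sumr; apply: eq_bigr => p _.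
by rewrite mulrA.
Qed.

Lemma svA (X : gspace G) P (f : X -> P) (g h : G -> P) : rlinear f -> rlinear g -> rlinear h ->
  sv (sv f g) h =1 sv f (cv g h).
Proof.
move=> hf hg hh c; rewrite /sv.
transitivity (copair f (copair g h) (amap (aid X) (gmul G) (sact X c))); last first.
  by rewrite copair_amap //; apply: copair_rlinear.
rewrite -sactA copair_assoc // copair_amap //; exact: copair_rlinear.
Qed.

Lemma cvA P (f g h : G -> P) : rlinear f -> rlinear g -> rlinear h ->
  cv (cv f g) h =1 cv f (cv g h).
Proof. exact: (@svA (trivial_space G)). Qed.

Lemma cvC P (f g : G -> P) : rlinear f -> rlinear g -> cv f g =1 cv g f.
Proof. by move=> hf hg b; rewrite /cv -[in RHS]gmulC copair_swap. Qed.

Lemma sv1 (X : gspace G) P (f : X -> P) : rlinear f -> sv f (ceps P) =1 f.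
Proof.
move=> hf c; rewrite -[in RHS](sact1 c) /sv; move: (sact X c).
have he := ceps_rlinear P; apply: rlinear_ext.
- exact: copair_rlinear.
- exact: (rlinear_comp (acopair (aid X) (acomp (astr X) (gone G))) hf).
move=> x b; rewrite copairE // acopairE /ceps [x * _]mulrC.
by rewrite -[acomp _ _ b]/(alg_str X (gone G b)) (rlinearZ hf) mulrC.
Qed.

Lemma cv1 P (f : G -> P) : rlinear f -> cv f (ceps P) =1 f.
Proof. exact: (@sv1 (trivial_space G)). Qed.

Lemma sv_post (X : gspace G) P P' (w : alghom P P') (f : X -> P) (g : G -> P) :
  rlinear f -> rlinear g -> forall c, w (sv f g c) = sv (w \o f) (w \o g) c.
Proof.
move=> hf hg c; rewrite /sv; move: (sact X c); apply: rlinear_ext.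
- exact: (rlinear_post w (copair_rlinear hf hg)).
- by apply: copair_rlinear; apply: rlinear_post.
by move=> x b; rewrite !copairE //; [rewrite rmorphM|apply: rlinear_post|apply: rlinear_post].
Qed.

Lemma cv_post P P' (w : alghom P P') (f : G -> P) (g : G -> P) :
  rlinear f -> rlinear g -> forall c, w (cv f g c) = cv (w \o f) (w \o g) c.
Proof. exact: (@sv_post (trivial_space G)). Qed.

Lemma cvV P (u : alghom G P) : cv (u \o ginv G) u =1 ceps P.
Proof.
move=> b; transitivity (u (acopair (ginv G) (aid G) (gmul G b))).
  rewrite -[acopair _ _ _]/(cv (ginv G) (aid G) b).
  by rewrite (cv_post u (alghom_rlinear _) (alghom_rlinear _)).
by rewrite gmulV alghom_str.
Qed.

(** A group scheme comes with a one-sided inverse axiom only. That the antipode is an involution and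
    commutes with the comultiplication follows from this uniqueness, in [ginvK] and [gmul_ginv]. *)
Lemma cv_inv_uniq P (u v w : G -> P) : rlinear u -> rlinear v -> rlinear w ->
  cv v u =1 ceps P -> cv w u =1 ceps P -> v =1 w.
Proof.
move=> hu hv hw vu wu b.
have he := ceps_rlinear P.
rewrite -(cv1 hv b) -(cv1 hw b).
transitivity (cv v (cv u w) b).
  by apply: cv_ext => // c; rewrite cvC // wu.
rewrite -cvA // (cv_ext vu (fun=> erefl)) cvC //.
Qed.

Notation S := (ginv G).

Lemma ginvK b : S (S b) = b.
Proof.
apply: (@cv_inv_uniq G S (acomp S S) id); try exact: alghom_rlinear.
- exact: rlinear_id.
- exact: (@cvV G S).
- move=> c; rewrite cvC; [exact: (@cvV G (aid G))|exact: rlinear_id|exact: alghom_rlinear].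
Qed.

Lemma cvACA P (a b c d : G -> P) : rlinear a -> rlinear b -> rlinear c -> rlinear d ->
  cv (cv a b) (cv c d) =1 cv (cv a c) (cv b d).
Proof.
move=> ha hb hc hd x; have [hab hcd] := (cv_rlinear ha hb, cv_rlinear hc hd).
have hbd := cv_rlinear hb hd; have hbc := cv_rlinear hb hc.
rewrite !cvA //; apply: cv_ext => // y; rewrite -!cvA //.
by apply: cv_ext => // z; apply: cvC.
Qed.

Lemma copair_id (A B : algebra R) (z : A \*A B) : copair (tinl A B) (tinr A B) z = z.
Proof.
move: z; apply: rlinear_ext; first by apply: copair_rlinear; apply: alghom_rlinear.
  exact: rlinear_id.
move=> x y; rewrite copairE; try exact: alghom_rlinear.
by rewrite -[LHS]/(aT x 1 * aT 1 y) aTM mulr1 mul1r.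
Qed.

Lemma gmul_ginv b : gmul G (S b) = amap S S (gmul G b).
Proof.
pose inl := tinl G G; pose inr := tinr G G.
have [hl hr] : rlinear inl /\ rlinear inr by split; apply: alghom_rlinear.
have [hlS hrS] : rlinear (inl \o S) /\ rlinear (inr \o S) by split; apply: rlinear_post (alghom_rlinear _).
apply: (@cv_inv_uniq _ (gmul G) (acomp (gmul G) S) (acomp (amap S S) (gmul G)));
  try exact: alghom_rlinear; first exact: cvV.
move=> c; have he := ceps_rlinear (G \*A G).
transitivity (cv (cv (inl \o S) (inr \o S)) (cv inl inr) c).
  by apply: cv_ext => x //; rewrite /cv copair_id.
rewrite cvACA //; transitivity (cv (ceps (G \*A G)) (ceps (G \*A G)) c); last exact: cv1.
by apply: cv_ext => x; apply: cvV.
Qed.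

End Convolution.

Lemma rlinear_sum (R : comPzRingType) (A P : algebra R) (u : A -> P) (I : Type) (r : seq I)
  (F : I -> A) : rlinear u -> u (\sum_(i <- r) F i) = \sum_(i <- r) u (F i).
Proof. by move=> hu; apply: (big_morph u (rlinearD hu) (rlinear0 hu)). Qed.

Lemma rlinear_compose (R : comPzRingType) (A B P : algebra R) (u : A -> B) (v : B -> P) :
  rlinear u -> rlinear v -> rlinear (fun x => v (u x)).
Proof.
move=> hu hv; split=> [x y|r x]; first by rewrite (rlinearD hu) (rlinearD hv).
by rewrite (rlinearZ hu) (rlinearZ hv).
Qed.

Lemma rlinear_mull (R : comPzRingType) (A P : algebra R) (u : A -> P) (c : P) :
  rlinear u -> rlinear (fun x => c * u x).
Proof.
by move=> hu; split=> [x y|r x]; rewrite ?(rlinearD hu) ?(rlinearZ hu) ?mulrDr // mulrCA.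
Qed.

(** * Integrals of the Cartier dual *)

Section Integrals.
Variables (R : comPzRingType) (G : gscheme R).
Notation AA := (cdual G).
Notation k := (base_algebra R).
Notation S := (ginv G).
Implicit Types (a f t : AA) (b c d x y : G).

Definition mkdual (f : G -> k) (hf : rlinear f) : AA := mkhom (rlinear_hom hf).
Lemma mkdualE (f : G -> k) (hf : rlinear f) b : dapp (mkdual hf) b = f b.
Proof. by []. Qed.

Lemma dapp_sum (I : Type) (r : seq I) (F : I -> AA) b :
  dapp (\sum_(i <- r) F i : AA) b = \sum_(i <- r) dapp (F i) b.
Proof. by apply: (big_morph (fun f : AA => dapp f b)). Qed.

Lemma dapp_str r b : dapp (alg_str AA r) b = r * gone G b.
Proof. by []. Qed.

Lemma dappM_str f r b : dapp f (alg_str G r * b) = r * dapp f b.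
Proof. exact: (rlinearZ (dapp_rlinear f)). Qed.

Lemma cvVr b : cv id S b = alg_str G (gone G b).
Proof.
rewrite (cvC (rlinear_id G) (alghom_rlinear S)).
exact: (cvV (aid G)).
Qed.

Definition co a b : G := coact (X := trivial_space G) a b.

Lemma coE a b : co a b = cv id (dstrapp G a) b. Proof. by []. Qed.
Lemma co_rlinear a : rlinear (co a). Proof. exact: (coact_rlinear (trivial_space G)). Qed.
Lemma coA a a' b : co a (co a' b) = co (a * a') b.
Proof. exact: (coactA (X := trivial_space G)). Qed.
Lemma co_str r b : co (alg_str AA r) b = alg_str G r * b.
Proof. exact: (coact_str (X := trivial_space G)). Qed.
Lemma co_suml (I : Type) (r : seq I) (F : I -> AA) b :
  co (\sum_(i <- r) F i) b = \sum_(i <- r) co (F i) b.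
Proof.
apply: (big_morph (fun a => co a b)) => [a a'|].
  exact: (coactDl (X := trivial_space G)).
by have := co_str 0 b; rewrite !rmorph0 mul0r.
Qed.

Lemma dapp_co f a b : dapp f (co a b) = dapp (f * a) b.
Proof.
have [hf ha] := (dapp_rlinear f, dapp_rlinear a).
have hi := rlinear_id G; have hs := dstrapp_rlinear G a.
rewrite coE /cv [RHS]convE; move: (gmul G b); apply: rlinear_ext.
- exact: (rlinear_compose (copair_rlinear hi hs) hf).
- exact: copair_rlinear.
by move=> x y; rewrite !copairE // mulrC dappM_str mulrC.
Qed.

Lemma dapp_inj x y : (forall f, dapp f x = dapp f y) -> x = y.
Proof.
have [n [e [phi dualP]]] := dual_basis G; move=> H.
by rewrite [x]dualP [y]dualP; apply: eq_bigr => i _; rewrite H.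
Qed.

Lemma dS_rlinear a : rlinear (fun b => dapp a (S b)).
Proof. exact: (rlinear_compose (alghom_rlinear S) (dapp_rlinear a)). Qed.
Definition dS a : AA := mkdual (dS_rlinear a).
Lemma dtrans_rlinear a c : rlinear (fun b => dapp a (c * b)).
Proof. exact: (rlinear_compose (rlinear_mull c (rlinear_id G)) (dapp_rlinear a)). Qed.
Definition dtrans a c : AA := mkdual (dtrans_rlinear a c).

Lemma dpair_sum (s : seq (AA * AA)) b c :
  Defs.dpair (\sum_(p <- s) aT p.1 p.2 : AA \*A AA) b c = \sum_(p <- s) dapp p.1 b * dapp p.2 c.
Proof. by rewrite /Defs.dpair copair_sum //; apply: deval_rlinear. Qed.

Section Key.
Variables (a : AA) (s : seq (AA * AA)).
Hypothesis sE : dcomul G a = \sum_(p <- s) aT p.1 p.2.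

Lemma comul_sum b c : dapp a (b * c) = \sum_(p <- s) dapp p.1 b * dapp p.2 c.
Proof. by rewrite -dpair_sum -sE -[RHS]/(Defs.dpair (dcomul_fun a) b c) dcomulE. Qed.

(** The Hopf identity sum a1 S(a2) = eps(a), with a1 replaced by the translated functional a1(c
    -). *)
Lemma antipode_sum c : \sum_(p <- s) dtrans p.1 c * dS p.2 = alg_str AA (dapp a c).
Proof.
apply: dappP => b; rewrite dapp_sum dapp_str.
have [u ub] := atensor_sum (gmul G b).
transitivity (\sum_(p <- s) \sum_(q <- u) dapp p.1 (c * q.1) * dapp p.2 (S q.2)).
  apply: eq_bigr => p _; rewrite convE ub copair_sum //; apply: dapp_rlinear.
rewrite exchange_big /=.
transitivity (\sum_(q <- u) dapp a (c * q.1 * S q.2)).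
  by apply: eq_bigr => q _; rewrite comul_sum.
rewrite -(rlinear_sum _ _ (dapp_rlinear a)).
have -> : \sum_(q <- u) c * q.1 * S q.2 = alg_str G (gone G b) * c.
  rewrite -cvVr /cv ub copair_sum; [|exact: rlinear_id|exact: alghom_rlinear].
  by rewrite mulr_suml; apply: eq_bigr => q _; rewrite -mulrA mulrC.
by rewrite dappM_str mulrC.
Qed.

End Key.

Lemma co_translate a d y (u : seq (G * G)) : gmul G d = \sum_(m <- u) aT m.1 m.2 ->
  co a (d * y) = \sum_(m <- u) m.1 * co (dtrans a m.2) y.
Proof.
move=> ud; rewrite coE /cv rmorphM ud mulr_suml.
have hc := copair_rlinear (rlinear_id G) (dstrapp_rlinear G a).
rewrite (rlinear_sum _ _ hc); apply: eq_bigr => m _; rewrite coE /cv.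
have hc' := copair_rlinear (rlinear_id G) (dstrapp_rlinear G (dtrans a m.2)).
move: (gmul G y); apply: rlinear_ext.
- exact: (rlinear_compose (rlinear_mull _ (rlinear_id (G \*A G))) hc).
- exact: rlinear_mull.
move=> x z; rewrite aTM !copairE ?mulrA //; try exact: rlinear_id; exact: dstrapp_rlinear.
Qed.

(** For a group element g it reads g(d) x = g(d g^-1(x)). In general the antipode cancels the second
    factor of the comultiplication by [antipode_sum]. *)
Lemma co_shift a (s : seq (AA * AA)) d x : dcomul G a = \sum_(p <- s) aT p.1 p.2 ->
  co a d * x = \sum_(p <- s) co p.1 (d * co (dS p.2) x).
Proof.
move=> sE; have [u ud] := atensor_sum (gmul G d).
transitivity (\sum_(m <- u) m.1 * (alg_str G (dapp a m.2) * x)).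
  rewrite coE /cv ud copair_sum; [|exact: rlinear_id|exact: dstrapp_rlinear].
  by rewrite mulr_suml; apply: eq_bigr => m _; rewrite mulrA.
transitivity (\sum_(p <- s) \sum_(m <- u) m.1 * co (dtrans p.1 m.2 * dS p.2) x); last first.
  apply: eq_bigr => p _; rewrite (co_translate _ _ ud); apply: eq_bigr => m _.
  by rewrite coA.
rewrite exchange_big; apply: eq_bigr => m _ /=; rewrite -mulr_sumr; congr (_ * _).
by rewrite -co_suml (antipode_sum sE) co_str.
Qed.

(** By [dapp_co] this says t a = eps(a) t in the dual, eps being evaluation at 1. *)
Definition is_integral t : Prop := forall a d, dapp t (co a d) = dapp a 1 * dapp t d.

Lemma integral_co t d : is_integral t -> co t d = alg_str G (dapp t d).
Proof.
move=> ht; apply: dapp_inj => f; rewrite dapp_co [f * t]mulrC -dapp_co ht.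
by rewrite -[alg_str G _]mulr1 dappM_str mulrC.
Qed.

Lemma co_ginv a c : co (dS a) (S c) = S (co a c).
Proof.
have hS := alghom_rlinear S; have ha := dstrapp_rlinear G a.
have hd := dstrapp_rlinear G (dS a).
rewrite !coE (cv_post S (rlinear_id G) ha) /cv gmul_ginv copair_amap //.
  apply: copair_ext => x; first by [].
  rewrite -[LHS]/(alg_str G (dapp a (S (S x)))) ginvK.
  by rewrite -[RHS]/(S (alg_str G (dapp a x))) alghom_str.
Qed.

(** Makes c |-> t(S(c) -) linear over the dual, which produces elements of the module dual to
    M_{pi_0} ([antipode_linear]). It is the invariance of an integral under translation, combined
    with [co_shift]. *)
Lemma integral_functional t a c d : is_integral t ->
  dapp t (S (co a c) * d) = dapp t (S c * co a d).
Proof.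
move=> ht; have [s sE] := atensor_sum (dcomul G a).
rewrite [S c * _]mulrC (co_shift _ _ sE) (rlinear_sum _ _ (dapp_rlinear t)).
transitivity (dapp t (d * \sum_(p <- s) co (dS (alg_str AA (dapp p.1 1) * p.2)) (S c))).
  rewrite [S _ * d]mulrC; congr (dapp t (d * _)).
  transitivity (S (\sum_(p <- s) co (alg_str AA (dapp p.1 1) * p.2) c)).
    rewrite -co_suml; congr (S (co _ c)); apply: dappP => b.
    rewrite dapp_sum -[b in LHS]mul1r (comul_sum sE); apply: eq_bigr => p _.
    by rewrite dstrM dappZ.
  by rewrite rmorph_sum; apply: eq_bigr => p _; rewrite co_ginv.
rewrite mulr_sumr (rlinear_sum _ _ (dapp_rlinear t)); apply: eq_bigr => p _.
rewrite ht -dappM_str; congr (dapp t _).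
have -> : dS (alg_str AA (dapp p.1 1) * p.2) = alg_str AA (dapp p.1 1) * dS p.2.
  by apply: dappP => b; rewrite mkdualE !dstrM !dappZ.
by rewrite -coA co_str mulrCA.
Qed.

Section Trace.
Variables (n : nat) (e : 'I_n -> G) (phi : 'I_n -> AA).
Hypothesis dualP : forall b, b = \sum_i alg_str G (dapp (phi i) b) * e i.

Definition htr (F : G -> G) : k := \sum_i dapp (phi i) (F (e i)).

Lemma htrC (F K : G -> G) : rlinear F -> rlinear K ->
  htr (fun x => F (K x)) = htr (fun x => K (F x)).
Proof.
have H (F' K' : G -> G) : rlinear F' ->
    htr (fun x => F' (K' x)) = \sum_i \sum_j dapp (phi j) (K' (e i)) * dapp (phi i) (F' (e j)).
  move=> hF; apply: eq_bigr => i _; rewrite {1}[K' (e i)]dualP (rlinear_sum _ _ hF).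
  rewrite (rlinear_sum _ _ (dapp_rlinear _)); apply: eq_bigr => j _.
  by rewrite (rlinearZ hF) dappM_str.
move=> hF hK; rewrite H // [RHS]H // exchange_big; apply: eq_bigr => i _.
by apply: eq_bigr => j _; rewrite mulrC.
Qed.

Lemma htr_sum (I : Type) (r : seq I) (F : I -> G -> G) :
  htr (fun x => \sum_(j <- r) F j x) = \sum_(j <- r) htr (F j).
Proof.
rewrite /htr exchange_big; apply: eq_bigr => i _.
exact: (rlinear_sum _ _ (dapp_rlinear _)).
Qed.

Lemma eq_htr (F K : G -> G) : F =1 K -> htr F = htr K.
Proof. by move=> E; apply: eq_bigr => i _; rewrite E. Qed.

(* The trace of x |-> d (f x); taking traces turns any f into an integral. *)
Lemma tint_rlinear (f : AA) : rlinear (fun d => htr (fun x => d * co f x) : k).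
Proof.
split=> [d d'|r d]; rewrite /htr.
  rewrite -big_split; apply: eq_bigr => i _ /=.
  by rewrite mulrDl (rlinearD (dapp_rlinear _)).
rewrite mulr_sumr; apply: eq_bigr => i _.
by rewrite -mulrA dappM_str.
Qed.
Definition tint (f : AA) : AA := mkdual (tint_rlinear f).

(** After [co_shift], cyclicity of the trace brings a1 next to S(a2), and [antipode_sum] leaves the
    factor eps(a). *)
Lemma tint_integral f : is_integral (tint f).
Proof.
move=> a d; rewrite !mkdualE; have [s sE] := atensor_sum (dcomul G a).
transitivity (htr (fun x => \sum_(p <- s) co p.1 (d * co (dS p.2) (co f x)))).
  by apply: eq_htr => x; apply: co_shift.
rewrite htr_sum.
transitivity (\sum_(p <- s) htr (fun x => d * co (dS p.2 * f * p.1) x)).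
  apply: eq_bigr => p _.
  rewrite (htrC (F := co p.1) (K := fun x => d * co (dS p.2) (co f x))).
  - by apply: eq_htr => x; rewrite !coA.
  - exact: co_rlinear.
  - apply: rlinear_mull.
    exact: (rlinear_compose (co_rlinear f) (co_rlinear _)).
rewrite -htr_sum.
transitivity (htr (fun x => alg_str G (dapp a 1) * (d * co f x))).
  apply: eq_htr => x; rewrite -mulr_sumr -co_suml mulrCA; congr (d * _).
  have -> : \sum_(p <- s) dS p.2 * f * p.1 = alg_str AA (dapp a 1) * f.
    rewrite -(antipode_sum sE) mulr_suml; apply: eq_bigr => p _.
    have -> : dtrans p.1 1 = p.1 by apply: dappP => b; rewrite mkdualE mul1r.
    by rewrite [LHS]mulrC [LHS]mulrA.
  by rewrite -coA co_str.
rewrite /htr mulr_sumr; apply: eq_bigr => i _; exact: dappM_str.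
Qed.

(** The counit of O_G is the unit of the dual, so the translated integrals t_j(S(e_j) -) form a
    partition of unity in A. *)
Lemma integral_counit d : \sum_j dapp (tint (phi j)) (S (e j) * d) = gone G d.
Proof.
transitivity (\sum_i dapp (phi i) (\sum_j S (e j) * d * co (phi j) (e i))).
  rewrite exchange_big /=; apply: eq_bigr => i _.
  by rewrite (rlinear_sum _ _ (dapp_rlinear _)).
have E i : \sum_j S (e j) * d * co (phi j) (e i) = alg_str G (gone G (e i)) * d.
  have [u ue] := atensor_sum (gmul G (e i)).
  transitivity (\sum_j \sum_(q <- u) S (e j) * d * (q.1 * alg_str G (dapp (phi j) q.2))).
    apply: eq_bigr => j _; rewrite -mulr_sumr; congr (_ * _).
    rewrite coE /cv ue copair_sum //; exact: dstrapp_rlinear.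
  rewrite exchange_big /= -cvVr /cv ue copair_sum; [|exact: rlinear_id|exact: alghom_rlinear].
  rewrite mulr_suml; apply: eq_bigr => q _.
  rewrite [q.2 in RHS]dualP rmorph_sum mulr_sumr mulr_suml; apply: eq_bigr => j _.
  by rewrite rmorphM alghom_str; ring.
under eq_bigr do rewrite E dappM_str.
transitivity (gone G (\sum_i alg_str G (dapp (phi i) d) * e i)).
  rewrite rmorph_sum; apply: eq_bigr => i _; rewrite rmorphM alghom_str mulrC.
  by [].
by rewrite -dualP.
Qed.

End Trace.

End Integrals.

(** * The lattice of a torsor *)

Section SpaceFacts.
Variables (R : comPzRingType) (G : gscheme R) (X : gspace G).
Notation AA := (cdual G).

Lemma rlinear_linear (A B : algebra R) (f : A -> B) : rlinear f -> linear (f : amod A -> amod B).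
Proof. by move=> hf a x y; rewrite (rlinearD hf) (rlinearZ hf). Qed.

Lemma rlinear_str (A B : algebra R) (f : A -> B) r : rlinear f -> f (alg_str A r) = alg_str B r * f 1.
Proof. by move=> hf; rewrite -(rlinearZ hf) mulr1. Qed.

Definition shear : alghom (X \*A X) (X \*A G) := acopair (tinl X G) (sact X).

Lemma sact_coact (t : AA) (y : X) :
  sact X (coact t y) = copair (tinl X G) (tinr X G \o co t) (sact X y).
Proof.
have [hi hd] := (rlinear_id X, dstrapp_rlinear X t).
have hd2 := dstrapp_rlinear (X \*A G) t; have hg := dstrapp_rlinear G t.
have [h1 h2] := (alghom_rlinear (tinl X G), alghom_rlinear (tinr X G)).
rewrite -[coact t y]/(sv id (dstrapp X t) y) (sv_post (sact X) hi hd).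
transitivity (sv (sact X) (dstrapp (X \*A G) t) y).
  by apply: sv_ext => // b; apply: alghom_str.
transitivity (sv (sv (tinl X G) (tinr X G)) (dstrapp (X \*A G) t) y).
  by apply: sv_ext => // b; rewrite /sv copair_id.
rewrite svA // /sv; apply: copair_ext => // b.
rewrite -[RHS]/(tinr X G (co t b)) coE (cv_post (tinr X G) (rlinear_id G) hg).
by apply: cv_ext => // c; rewrite -[RHS]/(tinr X G (alg_str G _)) alghom_str.
Qed.

(** Acting by t on the second factor of X x X becomes, on X x G, evaluating t on the second factor.
    The case of interest is that of z with shear 1 (x) h. *)
Lemma shear_trace z (t : AA) b :
  copair (fun x : X => x) (fun y => coact t (y * b)) z =
  copair (fun x : X => x) (dstrapp X t) (shear z * sact X b).
Proof.
have [hi hd] := (rlinear_id X, dstrapp_rlinear X t); have hc := coact_rlinear X t.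
have hb : rlinear (fun y : X => coact t (y * b)).
  exact: (rlinear_compose (rlinear_mulr b (rlinear_id X)) hc).
have hid := copair_rlinear hi hd.
move: z; apply: rlinear_ext.
- exact: copair_rlinear.
- apply: (rlinear_compose _ hid).
  exact: (rlinear_mulr _ (alghom_rlinear shear)).
move=> x y; rewrite copairE // /shear acopairE -mulrA -rmorphM.
rewrite [coact _ _]/coact; move: (sact X (y * b)); apply: rlinear_ext.
- exact: rlinear_mull.
- apply: (rlinear_compose _ hid).
  exact: (rlinear_mull _ (rlinear_id (X \*A G))).
move=> c g; rewrite copairE // -[tinl X G x]/(aT x 1) aTM mul1r copairE //.
by rewrite mulrA.
Qed.

Lemma copair_shift (t : AA) h w :
  copair (fun x : X => x) (dstrapp X t) (aT 1 h * w) =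
  copair (fun x : X => x) (dstrapp X (dtrans t h)) w.
Proof.
have [hi hd] := (rlinear_id X, dstrapp_rlinear X t); have hid := copair_rlinear hi hd.
move: w; apply: rlinear_ext.
- apply: (rlinear_compose _ hid).
  exact: (rlinear_mull _ (rlinear_id (X \*A G))).
- by apply: copair_rlinear => //; apply: dstrapp_rlinear.
by move=> c g; rewrite aTM !copairE ?mul1r //; apply: dstrapp_rlinear.
Qed.

End SpaceFacts.

(** * Descent along a torsor *)

Section TorsorFacts.
Variables (R : comPzRingType) (G : gscheme R) (X : torsor G).
Notation AA := (cdual G).
Notation k := (base_algebra R).
Notation M := (amod X : lmodType R).

Notation psi := (alg_str X).

Lemma str_linear : linear (psi : (R^o : lmodType R) -> M).
Proof. by move=> a x y; rewrite rmorphD rmorphM. Qed.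

Lemma zero_map_linear (L M' : lmodType R) : linear (fun _ : L => 0 : M').
Proof. by move=> a x y; rewrite scaler0 addr0. Qed.

(** After base change to X, multiplication is a retraction of the structure map; faithful flatness
    descends the injectivity. *)
Lemma torsor_inj : injective psi.
Proof.
have [_ ff] := torsor_flat X (mklin (@zero_map_linear 'rV[R]_0 R^o)) (mklin str_linear).
have H : exact_at (mklin (@zero_map_linear 'rV[R]_0 R^o)) (mklin str_linear).
  apply: ff => y; split=> [|[x <-]]; last first.
    elim/bc_ind: x => [|t x y0 IH]; first by rewrite !linear0.
    by rewrite !linearD IH !bcmapE linear0 -[t]mulr1 -bTE bT0 scaler0 addr0.
  move=> E; exists 0; rewrite linear0; apply/esym.
  have bi := bcself_bij psi; apply: (bij_inj bi); rewrite linear0.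
  have mult_lin : linear ((fun x => x) : M -> restr psi (X^o : lmodType X)).
    by [].
  have Em z : bc_lift (mklin mult_lin) (bcmap psi (mklin str_linear) z) = bcself psi z.
    elim/bc_ind: z => [|t r z IH]; first by rewrite !linear0.
    rewrite !linearD IH bcmapE bc_liftE bcselfE.
    by [].
  by rewrite -Em E linear0.
move=> x y xy; apply/eqP; rewrite -subr_eq0; apply/eqP.
suff /(H (x - y)).1 [z <-] : mklin str_linear (x - y) = 0 by [].
by rewrite -[LHS]/(psi (x - y)) rmorphB xy subrr.
Qed.

Lemma diag_rlinear : rlinear (fun b : X => aT 1 b - aT b 1 : X \*A X).
Proof.
have [h1 h2] := (alghom_rlinear (tinl X X), alghom_rlinear (tinr X X)).
split=> [x y|r x].
  rewrite -[aT 1 (x + y)]/(tinr X X _) -[aT (x + y) 1]/(tinl X X _).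
  by rewrite (rlinearD h1) (rlinearD h2) opprD addrACA.
rewrite -[aT 1 (_ * x)]/(tinr X X _) -[aT (_ * x) 1]/(tinl X X _).
by rewrite (rlinearZ h1) (rlinearZ h2) -mulrBr.
Qed.

Lemma amitsur (b : X) : aT 1 b = aT b 1 :> X \*A X -> exists r, b = psi r.
Proof.
pose v := mklin (rlinear_linear diag_rlinear).
have [_ ff] := torsor_flat X (mklin str_linear) v.
have H : exact_at (mklin str_linear) v.
  apply: ff => y; split=> [Ey|[z <-]]; last first.
    elim/bc_ind: z => [|t r z IH]; first by rewrite !linear0.
    have d0 : v (mklin str_linear r) = 0.
      rewrite -[LHS]/((aT 1 (psi r) : X \*A X) - aT (psi r) 1).
      by apply/eqP; rewrite subr_eq0; apply/eqP/esym/(@aT_str R X X).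
    by rewrite !linearD IH addr0 !bcmapE d0 -[t]mulr1 -bTE bT0 scaler0.
  pose q (z : X \*A X) : bc psi M := z.
  have qT s c : q (aT s c) = bT psi s (c : M) by [].
  have ql : linear (q : amod (X \*A X) -> restr psi (bc psi M : lmodType X)).
    move=> a z z'; rewrite -[RHS]/(psi a *: (q z : bc psi M) + (q z' : bc psi M)).
    rewrite -[LHS]/(q (alg_str (X \*A X) a * z) + q z'); congr (_ + _).
    elim/atensor_ind: z => [|s c z IH]; first by rewrite mulr0 scaler0.
    rewrite mulrDr -[LHS]/(q (_ * aT s c) + q (_ * z)) IH.
    rewrite -[q (aT s c + z)]/(q (aT s c) + q z) scalerDr; congr (_ + _).
    by rewrite -[alg_str _ a]/(aT (psi a) 1) aTM mul1r !qT bTE.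
  (* Multiplying the first two factors of X (x) (X (x) X) contracts the complex. *)
  pose w := bc_lift (mklin ql).
  have [x Hx] : exists x, w (bcmap psi v y) = y - bcmap psi (mklin str_linear) x.
    elim/bc_ind: y {Ey} => [|t c y [x IH]].
      by exists 0; rewrite !linear0 addr0.
    exists (bT psi (t * c) (1 : R^o) + x); rewrite !linearD IH [RHS]addrACA; congr (_ + _).
    rewrite bcmapE /w bc_liftE -[mklin ql _]/(q (aT 1 c) - q (aT c 1)) !qT.
    rewrite scalerBr !bTE mulr1 bcmapE.
    by rewrite -[mklin str_linear 1]/(psi 1) rmorph1.
  by exists x; apply/eqP; rewrite eq_sym -subr_eq0 -Hx Ey linear0.
move=> E; suff /(H b).1 [r <-] : v b = 0 by exists r.
rewrite -[LHS]/((aT 1 b : X \*A X) - aT b 1).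
by rewrite E; apply/eqP; rewrite subr_eq0.
Qed.

Lemma shear_inj : injective (shear X).
Proof. by have [g gK _] := torsor_galois X; apply: can_inj gK. Qed.

(** The shear sends 1 (x) b to the coaction of b and b (x) 1 to itself, so the hypothesis says that
    these two tensors agree. *)
Lemma coinvariant (b : X) : sact X b = aT b 1 -> exists r, b = psi r.
Proof.
move=> E; apply: amitsur; apply: shear_inj.
rewrite /shear !acopairE rmorph1 mul1r E.
by rewrite rmorph1 mulr1.
Qed.

Lemma kappa_exists h : exists z, shear X z = aT 1 h.
Proof. by have [g _ gK] := torsor_galois X; exists (g (aT 1 h)); apply: gK. Qed.
Definition kap h : X \*A X := projT1 (cid (kappa_exists h)).
Lemma kapE h : shear X (kap h) = aT 1 h.
Proof. exact: (projT2 (cid (kappa_exists h))). Qed.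

Lemma integral_coact (t : AA) (y : X) : is_integral t -> exists r, coact t y = psi r.
Proof.
move=> ht; apply: coinvariant; rewrite sact_coact.
have h1 := alghom_rlinear (tinl X G); have h2 : rlinear (tinr X G \o co t).
  exact: (rlinear_compose (co_rlinear t) (alghom_rlinear _)).
have hc := coact_rlinear X t.
rewrite [in RHS]/coact; move: (sact X y); apply: rlinear_ext.
- exact: copair_rlinear.
- exact: (rlinear_compose (copair_rlinear (rlinear_id X) (dstrapp_rlinear X t)) h1).
move=> x g; rewrite !copairE //; try exact: dstrapp_rlinear.
rewrite -[(_ \o _) g]/(tinr X G (co t g)) integral_co // alghom_str.
by rewrite -[RHS]/(tinl X G (x * alg_str X (dapp t g))) rmorphM alghom_str.
Qed.

Lemma trace_functional (t : AA) (y : X) : is_integral t ->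
  exists nu : {nu : X -> k | rlinear nu}, forall b, coact t (y * b) = psi (sval nu b).
Proof.
move=> ht; have /choice [nu nuE] b := integral_coact (y * b) ht.
have hc := coact_rlinear X t.
have hnu : rlinear (nu : X -> k).
  split=> [b c|r b]; apply: torsor_inj.
    by rewrite rmorphD -!nuE mulrDr (rlinearD hc).
  by rewrite rmorphM -!nuE mulrCA (rlinearZ hc).
by exists (exist _ _ hnu).
Qed.

(** By [integral_counit], b is the sum of the actions on it of t_i(S(e_i) -). If 1 (x) S(e_i) is the
    shear of sum x (x) y, then [shear_trace] makes the i-th term sum x t_i(y b), where t_i(y b) lies
    in R because t_i is an integral. *)
Lemma torsor_basis : exists n (x : 'I_n -> X) (nu : 'I_n -> X -> k),
  (forall i, rlinear (nu i)) /\ forall b, b = \sum_i psi (nu i b) * x i.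
Proof.
have [n [e [phi dualP]]] := dual_basis G.
have /choice [z zE] i := atensor_sum (kap (ginv G (e i))).
have /choice [N NE] (iy : 'I_n * X) := trace_functional iy.2 (tint_integral dualP (phi iy.1)).
pose s := flatten [seq [seq (p.1, N (i, p.2)) | p <- z i] | i <- enum 'I_n].
exists (size s), (fun j => (tnth (in_tuple s) j).1), (fun j => sval (tnth (in_tuple s) j).2).
split=> [j|b]; first exact: (svalP (tnth (in_tuple s) j).2).
rewrite -(big_tnth _ _ s xpredT (fun q => psi (sval q.2 b) * q.1)) big_flatten big_map big_enum /=.
transitivity (coact (\sum_i dtrans (tint e phi (phi i)) (ginv G (e i))) b).
  have -> : \sum_i dtrans (tint e phi (phi i)) (ginv G (e i)) = 1.
    by apply: dappP => d; rewrite dapp_sum; apply: integral_counit.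
  by rewrite (coact1 (X := X)).
have cD : {morph (fun a : AA => coact a b) : a a' / a + a'} := coactDl b.
have c0 : coact (0 : AA) b = 0.
  by have := coact_str 0 b; rewrite !rmorph0 mul0r.
rewrite (big_morph (fun a : AA => coact a b) cD c0); apply: eq_bigr => i _.
rewrite -[LHS]copair_shift -kapE -shear_trace zE copair_sum.
- by rewrite big_map; apply: eq_bigr => p _; rewrite -(NE (i, p.2)) mulrC.
- exact: rlinear_id.
- exact: (rlinear_compose (rlinear_mulr b (rlinear_id X)) (coact_rlinear X _)).
Qed.

(** As 1 = sum nu_i(1) x_i, the ideal generated by the nu_i(1) becomes the unit ideal over X, hence
    is the unit ideal of R. *)
Lemma torsor_retract : exists nu : X -> k, rlinear nu /\ nu 1 = 1.
Proof.
have [n [x [nu [hnu xE]]]] := torsor_basis.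
have ul : linear ((fun v : 'rV[R]_n => \sum_i v 0 i * nu i 1) : 'rV[R]_n -> (R^o : lmodType R)).
  move=> a v w; rewrite scaler_sumr -big_split; apply: eq_bigr => i _.
  by rewrite !mxE mulrDl -mulrA.
have [_ ff] := torsor_flat X (mklin ul) (mklin (@zero_map_linear R^o 'rV[R]_0)).
have H : exact_at (mklin ul) (mklin (@zero_map_linear R^o 'rV[R]_0)).
  apply: ff => y; split=> [_|_]; last first.
    elim/bc_ind: y => [|t r y IH]; first by rewrite linear0.
    by rewrite linearD IH bcmapE -[t]mulr1 -bTE bT0 scaler0 addr0.
  exists (\sum_i bT psi (bcself psi y * x i) (delta_mx 0 i : 'rV[R]_n)).
  rewrite linear_sum; apply: (bij_inj (bcself_bij psi)).
  rewrite linear_sum -[RHS]mulr1 [1 in RHS]xE mulr_sumr.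
  apply: eq_bigr => i _; rewrite bcmapE bcselfE -mulrA; congr (_ * _).
  rewrite mulrC; congr (psi _ * _).
  rewrite -[LHS]/(\sum_j delta_mx 0 i 0 j * nu j 1) (bigD1 i) //= mxE !eqxx mul1r big1 ?addr0 //.
  by move=> j ji; rewrite mxE eqxx (negbTE ji) mul0r.
have [v vE] := (H 1).1 erefl.
exists (fun b => \sum_i v 0 i * nu i b); split; last exact: vE.
split=> [b c|r b].
  rewrite -big_split; apply: eq_bigr => i _.
  by rewrite (rlinearD (hnu i)) mulrDr.
rewrite mulr_sumr; apply: eq_bigr => i _.
by rewrite (rlinearZ (hnu i)) mulrCA.
Qed.

End TorsorFacts.

(** * The pairing of A (x) Lam with O_G (x) Lam *)

Section Pairing.
Variables (R : comPzRingType) (G : gscheme R) (Lam : algebra R).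
Notation AA := (cdual G).
Notation k := (base_algebra R).
Notation AL := (AA \*A Lam).
Notation HL := (G \*A Lam).
Notation A2 := (AA \*A AA).
Notation str := (alg_str Lam).

(** Semilinearity along c. Two such maps agree as soon as they do on the elements z (x) 1
    ([llin_ext]), which reduces the identities below to ones over R. *)
Definition llin (Z P : algebra R) (c : Lam -> P) (u : Z \*A Lam -> P) : Prop :=
  (forall x y, u (x + y) = u x + u y) /\ (forall l z, u (aT 1 l * z) = c l * u z).

Lemma llin0 (Z P : algebra R) (c : Lam -> P) (u : Z \*A Lam -> P) : llin c u -> u 0 = 0.
Proof. by case=> uD _; apply: (addIr (u 0)); rewrite -uD !add0r. Qed.

Lemma aT_split (Z : algebra R) (z : Z) (l : Lam) : aT z l = aT 1 l * aT z 1.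
Proof. by rewrite aTM mul1r mulr1. Qed.

Lemma llin_ext (Z P : algebra R) (c : Lam -> P) (u v : Z \*A Lam -> P) : llin c u -> llin c v ->
  (forall z, u (aT z 1) = v (aT z 1)) -> u =1 v.
Proof.
move=> hu hv E; elim/atensor_ind => [|x l t IH]; first by rewrite !(@llin0 _ _ c).
by rewrite aT_split hu.1 hv.1 IH hu.2 hv.2 E.
Qed.

Lemma copair_llin (Z P : algebra R) (f : Z -> P) (g : alghom Lam P) : rlinear f ->
  llin g (copair f g).
Proof.
move=> hf; have hg := alghom_rlinear g; split=> [x y|l z]; first exact: copairD.
elim/atensor_ind: z => [|x m t IH]; first by rewrite mulr0 copair0 // mulr0.
by rewrite mulrDr !copairD // mulrDr IH aTM mul1r !copairE // rmorphM mulrCA.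
Qed.

Lemma copair1 (Z P : algebra R) (f : Z -> P) (g : alghom Lam P) z : rlinear f ->
  copair f g (aT z 1) = f z.
Proof. by move=> hf; rewrite copairE ?rmorph1 ?mulr1 //; apply: alghom_rlinear. Qed.

Lemma llin_rlinear (Z P : algebra R) (c : alghom Lam P) (u : Z \*A Lam -> P) : llin c u -> rlinear u.
Proof.
by move=> hu; split=> [x y|r x]; [exact: hu.1|rewrite aT_str hu.2 alghom_str].
Qed.

Lemma llin_comp (Z P : algebra R) (c : Lam -> P) (u : Z \*A Lam -> P) (Z' : algebra R)
  (w : Z' \*A Lam -> Z \*A Lam) : llin c u -> llin (tinr Z Lam) w -> llin c (fun x => u (w x)).
Proof.
move=> hu hw; split=> [x y|l x]; first by rewrite hw.1 hu.1.
by rewrite hw.2 -[tinr Z Lam l]/(aT 1 l) hu.2.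
Qed.

Lemma llin_mull (Z P : algebra R) (c : Lam -> P) (u : Z \*A Lam -> P) p :
  llin c u -> llin c (fun x => p * u x).
Proof.
by move=> hu; split=> [x y|l x]; rewrite ?hu.1 ?mulrDr // hu.2 mulrCA.
Qed.

Lemma llin_mulr (Z P : algebra R) (c : Lam -> P) (u : Z \*A Lam -> P) p :
  llin c u -> llin c (fun x => u x * p).
Proof.
by move=> hu; split=> [x y|l x]; rewrite ?hu.1 ?mulrDl // hu.2 mulrA.
Qed.

Lemma llin_shift (Z P : algebra R) (c : Lam -> P) (u : Z \*A Lam -> P) p :
  llin c u -> llin c (fun x => u (p * x)).
Proof.
by move=> hu; split=> [x y|l x]; rewrite ?mulrDr ?hu.1 // mulrCA hu.2.
Qed.

Lemma llin_sum (Z P : algebra R) (c : Lam -> P) (u : Z \*A Lam -> P) (I : Type) (r : seq I)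
  (F : I -> Z \*A Lam) : llin c u -> u (\sum_(i <- r) F i) = \sum_(i <- r) u (F i).
Proof. by move=> hu; apply: (big_morph u hu.1 (llin0 hu)). Qed.

Lemma llin_suml (Z P : algebra R) (c : Lam -> P) (I : Type) (r : seq I) (u : I -> Z \*A Lam -> P) :
  (forall i, llin c (u i)) -> llin c (fun x => \sum_(i <- r) u i x).
Proof.
move=> hu; split=> [x y|l x].
  by rewrite -big_split; apply: eq_bigr => i _; rewrite (hu i).1.
by rewrite mulr_sumr; apply: eq_bigr => i _; rewrite (hu i).2.
Qed.

Lemma strdapp_rlinear h : rlinear (fun a : AA => str (dapp a h)).
Proof. exact: (rlinear_compose (deval_rlinear h) (alghom_rlinear (astr Lam))). Qed.

Definition ev (t : AL) (h : G) : Lam := copair (fun a : AA => str (dapp a h)) (aid Lam) t.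

Lemma ev_llin h : llin id (ev^~ h).
Proof. exact: (copair_llin (aid Lam) (strdapp_rlinear h)). Qed.

Lemma ev1 a h : ev (aT a 1) h = str (dapp a h).
Proof. exact: (copair1 (aid Lam) a (strdapp_rlinear h)). Qed.

Lemma ev_rlinear t : rlinear (ev t).
Proof.
split=> [x y|r x].
- move: t; apply: (@llin_ext _ _ id) => [||a]; first exact: ev_llin.
    have [hx hy] := (ev_llin x, ev_llin y).
    split=> [s t|l t]; first by rewrite hx.1 hy.1 addrACA.
    by rewrite hx.2 hy.2 mulrDr.
  by rewrite !ev1 (rlinearD (dapp_rlinear a)) rmorphD.
- move: t; apply: (@llin_ext _ _ id) => [||a]; first exact: ev_llin.
    exact/llin_mull/ev_llin.
  by rewrite !ev1 (rlinearZ (dapp_rlinear a)) rmorphM.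
Qed.

Definition pr (t : AL) (y : HL) : Lam := copair (ev t) (aid Lam) y.

Lemma pr_llinr t : llin id (pr t).
Proof. exact: (copair_llin (aid Lam) (ev_rlinear t)). Qed.

Lemma pr1 t h : pr t (aT h 1) = ev t h.
Proof. exact: (copair1 (aid Lam) h (ev_rlinear t)). Qed.

Lemma pr_llinl y : llin id (pr^~ y).
Proof.
split=> [s t|l t].
- move: y; apply: (@llin_ext _ _ id) => [||h]; first exact: pr_llinr.
    have [hs ht] := (pr_llinr s, pr_llinr t).
    split=> [x y|l y]; first by rewrite hs.1 ht.1 addrACA.
    by rewrite hs.2 ht.2 mulrDr.
  by rewrite !pr1 (ev_llin h).1.
- move: y; apply: (@llin_ext _ _ id) => [||h]; first exact: pr_llinr.
    exact/llin_mull/pr_llinr.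
  by rewrite !pr1 (ev_llin h).2.
Qed.

Lemma pr11 a h : pr (aT a 1) (aT h 1) = str (dapp a h).
Proof. by rewrite pr1 ev1. Qed.

Lemma prD t y z : pr t (y + z) = pr t y + pr t z. Proof. exact: (pr_llinr t).1. Qed.
Lemma prl t l y : pr t (aT 1 l * y) = l * pr t y. Proof. exact: (pr_llinr t).2. Qed.
Lemma pr_lt t l y : pr (aT 1 l * t) y = l * pr t y. Proof. exact: (pr_llinl y).2. Qed.

Lemma pr_str t r y : pr t (alg_str HL r * y) = str r * pr t y.
Proof. by rewrite aT_str prl. Qed.

Lemma coactL_llin a : llin (tinr G Lam) (coactL (Lam := Lam) a).
Proof. exact: (copair_llin (tinr G Lam) (tinl_coact_rlinear Lam a)). Qed.

Lemma coactL1 a h : coactL a (aT h 1) = aT (co a h) 1 :> HL.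
Proof. exact: (coactLE a h 1). Qed.

Lemma coactL_rlinearl y : rlinear (fun a : AA => coactL (Lam := Lam) a y).
Proof.
split=> [a b|r a].
- move: y; apply: (@llin_ext _ _ (tinr G Lam)) => [||h]; first exact: coactL_llin.
    have [hs ht] := (coactL_llin a, coactL_llin b).
    split=> [x y|l y]; first by rewrite hs.1 ht.1 addrACA.
    by rewrite hs.2 ht.2 mulrDr.
  rewrite !coactL1 -[RHS](balancedDl (@aT_balanced R G Lam)); congr (aT _ _).
  exact: (coactDl (X := trivial_space G)).
- move: y; apply: (@llin_ext _ _ (tinr G Lam)) => [||h]; first exact: coactL_llin.
    exact/llin_mull/coactL_llin.
  rewrite !coactL1 -coA co_str -[alg_str HL r]/(@aT R G Lam (alg_str G r) 1).
  by rewrite aTM mulr1.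
Qed.

(** The action of A (x) Lam that extends [co]; by [pr_act] it is adjoint to multiplication. *)
Definition actL (i : AL) (y : HL) : HL := copair (fun a : AA => coactL (Lam := Lam) a y) (tinr G Lam) i.

Lemma actL_llinl y : llin (tinr G Lam) (actL^~ y).
Proof. exact: (copair_llin _ (coactL_rlinearl y)). Qed.

Lemma actL1 a y : actL (aT a 1) y = coactL a y.
Proof. exact: (copair1 _ a (coactL_rlinearl y)). Qed.

Lemma actL_llinr i : llin (tinr G Lam) (actL i).
Proof.
split=> [x y|l y].
- move: i; apply: (@llin_ext _ _ (tinr G Lam)) => [||a]; first exact: actL_llinl.
    have [hs ht] := (actL_llinl x, actL_llinl y).
    split=> [s t|l t]; first by rewrite hs.1 ht.1 addrACA.
    by rewrite hs.2 ht.2 mulrDr.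
  by rewrite !actL1 (coactL_llin a).1.
- move: i; apply: (@llin_ext _ _ (tinr G Lam)) => [||a]; first exact: actL_llinl.
    exact/llin_mull/actL_llinl.
  by rewrite !actL1 (coactL_llin a).2.
Qed.

Lemma pr_coactL t a y : pr t (coactL a y) = pr (t * aT a 1) y.
Proof.
move: y; apply: (@llin_ext _ _ id) => [||h].
- exact: (llin_comp (pr_llinr t) (coactL_llin a)).
- exact: pr_llinr.
rewrite coactL1 !pr1; move: t; apply: (@llin_ext _ _ id) => [||f].
- exact: ev_llin.
- split=> [s t|l t]; first by rewrite mulrDl (ev_llin h).1.
  by rewrite -mulrA (ev_llin h).2.
by rewrite aTM mulr1 !ev1 dapp_co.
Qed.

Lemma pr_act t i y : pr t (actL i y) = pr (t * i) y.
Proof.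
move: i; apply: (@llin_ext _ _ id) => [||a].
- exact: (llin_comp (pr_llinr t) (actL_llinl y)).
- exact: (llin_shift t (pr_llinl y)).
by rewrite actL1 pr_coactL.
Qed.

Lemma pr_inj s t : (forall h, pr s (aT h 1) = pr t (aT h 1)) -> s = t.
Proof.
have [n [e [phi dualP]]] := dual_basis G.
pose exp (t : AL) := \sum_m aT (phi m : AA) (pr t (aT (e m) 1)) : AL.
have expE u : u = exp u.
  move: u; apply: (@llin_ext _ _ (tinr AA Lam)) => [||a].
  - by [].
  - apply: llin_suml => m; split=> [x y|l z].
      by rewrite (pr_llinl _).1 (balancedDr (@aT_balanced R AA Lam)).
    by rewrite pr_lt -[tinr _ _ l]/(aT 1 l) aTM mul1r.
  rewrite {1}[a](dual_sum dualP) -[LHS]/(tinl AA Lam (\sum_i alg_str AA (dapp a (e i)) * phi i)) rmorph_sum; apply: eq_bigr => m _.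
  by rewrite rmorphM alghom_str aT_str -[tinl _ _ _]/(aT _ 1) -aT_split pr11.
by move=> E; rewrite [s]expE [t]expE; apply: eq_bigr => m _; rewrite E.
Qed.

Lemma pr_span n (e : 'I_n -> G) (phi : 'I_n -> AA) :
  (forall b, b = \sum_i alg_str G (dapp (phi i) b) * e i) ->
  forall y, y = \sum_m aT (e m) (pr (aT (phi m : AA) 1) y).
Proof.
move=> dualP; apply: (@llin_ext _ _ (tinr G Lam)) => [||h].
- by [].
- apply: llin_suml => m; split=> [x y|l z].
    by rewrite prD (balancedDr (@aT_balanced R G Lam)).
  by rewrite prl -[tinr _ _ l]/(aT 1 l) aTM mul1r.
rewrite {1}[h]dualP -[LHS]/(tinl G Lam _) rmorph_sum; apply: eq_bigr => m _.
by rewrite rmorphM alghom_str aT_str -[tinl _ _ _]/(aT _ 1) -aT_split pr11.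
Qed.

Lemma pr_injr y z : (forall t, pr t y = pr t z) -> y = z.
Proof.
have [n [e [phi dualP]]] := dual_basis G; move=> E.
by rewrite [y](pr_span dualP) [z](pr_span dualP); apply: eq_bigr => m _; rewrite E.
Qed.

Lemma actL_mul i j y : actL (i * j) y = actL i (actL j y).
Proof. by apply: pr_injr => t; rewrite !pr_act mulrA. Qed.

Lemma actL_1 y : actL 1 y = y.
Proof. by apply: pr_injr => t; rewrite pr_act mulr1. Qed.

Lemma prtinl_rlinear y : rlinear (fun a : AA => pr (aT a 1) y).
Proof. exact: (rlinear_compose (alghom_rlinear (tinl AA Lam)) (@llin_rlinear _ _ (aid Lam) _ (pr_llinl y))). Qed.

Definition pr20 (w : A2) (y z : HL) : Lam :=
  copair (fun a : AA => pr (aT a 1) y) (fun a : AA => pr (aT a 1) z) w.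

Lemma pr20_rlinear y z : rlinear (fun w => pr20 w y z).
Proof. exact: (copair_rlinear (prtinl_rlinear y) (prtinl_rlinear z)). Qed.

Lemma pr20E a b y z : pr20 (aT a b) y z = pr (aT a 1) y * pr (aT b 1) z.
Proof. exact: (copairE _ _ (prtinl_rlinear y) (prtinl_rlinear z)). Qed.

(** For this pairing of A (x) A (x) Lam with pairs, the comultiplication of A is adjoint to the
    product of O_G ([pr2_dcomul]), and by [pr2_inj] identities can be tested on pairs. *)
Definition pr2 (z : A2 \*A Lam) (y y' : HL) : Lam := copair (fun w => pr20 w y y') (aid Lam) z.

Lemma pr2_llin y y' : llin id (fun z => pr2 z y y').
Proof. exact: (copair_llin (aid Lam) (pr20_rlinear y y')). Qed.

Lemma pr21 w y y' : pr2 (aT w 1) y y' = pr20 w y y'.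
Proof. exact: (copair1 (aid Lam) w (pr20_rlinear y y')). Qed.

Lemma pr20_llin1 w y' : llin id (fun y => pr20 w y y').
Proof.
elim/atensor_ind: w => [|a b w [IH1 IH2]].
  split=> [x y|l y]; rewrite !(rlinear0 (pr20_rlinear _ _)) ?addr0 ?mulr0 //.
split=> [x y|l y].
  by rewrite !(rlinearD (pr20_rlinear _ _)) !pr20E prD IH1 mulrDl addrACA.
by rewrite !(rlinearD (pr20_rlinear _ _)) !pr20E prl IH2 mulrDr mulrA.
Qed.

Lemma pr20_llin2 w y : llin id (fun y' => pr20 w y y').
Proof.
elim/atensor_ind: w => [|a b w [IH1 IH2]].
  split=> [x z|l z]; rewrite !(rlinear0 (pr20_rlinear _ _)) ?addr0 ?mulr0 //.
split=> [x z|l z].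
  by rewrite !(rlinearD (pr20_rlinear _ _)) !pr20E prD IH1 mulrDr addrACA.
by rewrite !(rlinearD (pr20_rlinear _ _)) !pr20E prl IH2 mulrDr mulrCA.
Qed.

Lemma pr2_llin1 z y' : llin id (fun y => pr2 z y y').
Proof.
split=> [x y|l y].
- move: z; apply: (@llin_ext _ _ id) => [||w]; first exact: pr2_llin.
    have [hs ht] := (pr2_llin x y', pr2_llin y y').
    split=> [s t|l t]; first by rewrite hs.1 ht.1 addrACA.
    by rewrite hs.2 ht.2 mulrDr.
  by rewrite !pr21 (pr20_llin1 w y').1.
- move: z; apply: (@llin_ext _ _ id) => [||w]; first exact: pr2_llin.
    exact/llin_mull/pr2_llin.
  by rewrite !pr21 (pr20_llin1 w y').2.
Qed.

Lemma pr2_llin2 z y : llin id (fun y' => pr2 z y y').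
Proof.
split=> [x x'|l x].
- move: z; apply: (@llin_ext _ _ id) => [||w]; first exact: pr2_llin.
    have [hs ht] := (pr2_llin y x, pr2_llin y x').
    split=> [s t|l t]; first by rewrite hs.1 ht.1 addrACA.
    by rewrite hs.2 ht.2 mulrDr.
  by rewrite !pr21 (pr20_llin2 w y).1.
- move: z; apply: (@llin_ext _ _ id) => [||w]; first exact: pr2_llin.
    exact/llin_mull/pr2_llin.
  by rewrite !pr21 (pr20_llin2 w y).2.
Qed.

Notation i1 := (amap (tinl AA AA) (aid Lam)).
Notation i2 := (amap (tinr AA AA) (aid Lam)).
Notation dL := (amap (dcomul G) (aid Lam)).

Lemma amap_l (Z Z' : algebra R) (f : alghom Z Z') l z :
  amap f (aid Lam) (aT 1 l * z) = aT 1 l * amap f (aid Lam) z.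
Proof. by rewrite rmorphM amapE rmorph1. Qed.

Lemma amap_llin (Z Z' : algebra R) (f : alghom Z Z') : llin (tinr Z' Lam) (amap f (aid Lam)).
Proof. by split=> [x y|l x]; [rewrite rmorphD|exact: amap_l]. Qed.

Lemma pr2_prod t s y y' : pr2 (i1 t * i2 s) y y' = pr t y * pr s y'.
Proof.
move: t; apply: (@llin_ext _ _ id) => [||a].
- split=> [x z|l z]; first by rewrite rmorphD mulrDl (pr2_llin _ _).1.
  by rewrite amap_l -mulrA (pr2_llin _ _).2.
- exact/llin_mulr/pr_llinl.
move: s; apply: (@llin_ext _ _ id) => [||b].
- split=> [x z|l z]; first by rewrite rmorphD mulrDr (pr2_llin _ _).1.
  by rewrite amap_l mulrCA (pr2_llin _ _).2.
- exact/llin_mull/pr_llinl.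
rewrite !amapE !rmorph1 aTM mulr1 pr21 -pr20E; congr (pr20 _ _ _).
by rewrite -[LHS]/(aT a 1 * aT 1 b) aTM mulr1 mul1r.
Qed.

Lemma pr20_dpair w h h' : pr20 w (aT h 1) (aT h' 1) = str (Defs.dpair w h h').
Proof.
elim/atensor_ind: w => [|a b w IH].
  by rewrite (rlinear0 (pr20_rlinear _ _)) (rlinear0 (dpair_rlinear _ _)) rmorph0.
by rewrite (rlinearD (pr20_rlinear _ _)) dpairD rmorphD -IH pr20E dpairE rmorphM !pr11.
Qed.

Lemma pr2_dcomul t y y' : pr2 (dL t) y y' = pr t (y * y').
Proof.
move: t; apply: (@llin_ext _ _ id) => [||a].
- exact: (llin_comp (pr2_llin y y') (amap_llin _)).
- exact: pr_llinl.
rewrite amapE rmorph1 pr21.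
move: y; apply: (@llin_ext _ _ id) => [||h]; first exact: pr20_llin1.
  split=> [x z|l z]; first by rewrite mulrDl prD.
  by rewrite -mulrA prl.
move: y'; apply: (@llin_ext _ _ id) => [||h']; first exact: pr20_llin2.
  exact/llin_shift/pr_llinr.
rewrite pr20_dpair -[dcomul G a]/(dcomul_fun a) dcomulE aTM mulr1.
by rewrite pr11.
Qed.

Lemma pr2_shift z a y y' : pr2 (z * aT (tinr AA AA a) 1) y y' = pr2 z y (coactL a y').
Proof.
move: z; apply: (@llin_ext _ _ id) => [||w].
- split=> [x z|l z]; first by rewrite mulrDl (pr2_llin _ _).1.
  by rewrite -mulrA (pr2_llin _ _).2.
- exact: pr2_llin.
rewrite aTM mulr1 !pr21; move: w; apply: rlinear_ext.
- split=> [x x'|r x]; first by rewrite mulrDl (rlinearD (pr20_rlinear _ _)).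
  by rewrite -mulrA (rlinearZ (pr20_rlinear _ _)).
- exact: pr20_rlinear.
by move=> f g; rewrite -[tinr _ _ a]/(aT 1 a) aTM mulr1 !pr20E pr_coactL aTM mulr1.
Qed.

Lemma pr2_shiftl z a y y' : pr2 (z * aT (tinl AA AA a) 1) y y' = pr2 z (coactL a y) y'.
Proof.
move: z; apply: (@llin_ext _ _ id) => [||w].
- split=> [x z|l z]; first by rewrite mulrDl (pr2_llin _ _).1.
  by rewrite -mulrA (pr2_llin _ _).2.
- exact: pr2_llin.
rewrite aTM mulr1 !pr21; move: w; apply: rlinear_ext.
- split=> [x x'|r x]; first by rewrite mulrDl (rlinearD (pr20_rlinear _ _)).
  by rewrite -mulrA (rlinearZ (pr20_rlinear _ _)).
- exact: pr20_rlinear.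
by move=> f g; rewrite -[tinl _ _ a]/(aT a 1) aTM mulr1 !pr20E pr_coactL aTM mulr1.
Qed.

Lemma pr2_inj z z' : (forall h h', pr2 z (aT h 1) (aT h' 1) = pr2 z' (aT h 1) (aT h' 1)) -> z = z'.
Proof.
have [n [e [phi dualP]]] := dual_basis G.
have expE : forall u : A2 \*A Lam,
    u = \sum_i \sum_j @aT R A2 Lam (@aT R AA AA (phi i) (phi j)) (pr2 u (aT (e i) 1) (aT (e j) 1)).
  apply: (@llin_ext _ _ (tinr A2 Lam)) => [||w].
  - by [].
  - apply: llin_suml => i; apply: llin_suml => j; split=> [x y|l x].
      by rewrite (pr2_llin _ _).1 (balancedDr (@aT_balanced R A2 Lam)).
    by rewrite (pr2_llin _ _).2 -[tinr _ _ l]/(aT 1 l) aTM mul1r.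
  transitivity (tinl A2 Lam (\sum_i \sum_j
      alg_str A2 (Defs.dpair w (e i) (e j)) * aT (phi i : AA) (phi j : AA))).
    congr (tinl A2 Lam _); apply: dpair_inj => b c.
    have hp := dpair_rlinear b c.
    rewrite (rlinear_sum _ _ hp); under eq_bigr do rewrite (rlinear_sum _ _ hp).
    elim/atensor_ind: w => [|f g w IH].
      rewrite (rlinear0 hp) big1 // => i _; rewrite big1 // => j _.
      by rewrite (rlinear0 (dpair_rlinear _ _)) rmorph0 mul0r (rlinear0 hp).
    under eq_bigr do under eq_bigr do
      rewrite dpairD rmorphD mulrDl (rlinearD hp).
    under eq_bigr do rewrite big_split.
    rewrite big_split (rlinearD hp) IH; congr (_ + _).
    rewrite dpairE {1}[f](dual_sum dualP) {1}[g](dual_sum dualP).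
    rewrite !dapp_sum mulr_suml; apply: eq_bigr => i _; rewrite mulr_sumr.
    by apply: eq_bigr => j _; rewrite (rlinearZ hp) !dstrM !dappZ !dpairE mulrACA.
  rewrite rmorph_sum; apply: eq_bigr => i _; rewrite rmorph_sum; apply: eq_bigr => j _.
  by rewrite rmorphM alghom_str pr21 pr20_dpair aT_str -[tinl _ _ _]/(aT _ 1) -aT_split.
move=> E; rewrite [z]expE [z']expE; apply: eq_bigr => i _.
by apply: eq_bigr => j _; rewrite E.
Qed.

End Pairing.

Lemma dual_basis_fgproj (S : comPzRingType) (L : lmodType S) n (x : 'I_n -> L)
  (g : L -> 'I_n -> S) : (forall a y z k, g (a *: y + z) k = a * g y k + g z k) ->
  (forall z, z = \sum_k g z k *: x k) -> fgproj L.
Proof.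
move=> gl zE; have il : linear (fun z => \row_k g z k).
  by move=> a y z; apply/rowP => k; rewrite !mxE gl.
have pl : linear (fun v : 'rV[S]_n => \sum_k v 0 k *: x k).
  move=> a v w; rewrite scaler_sumr -big_split; apply: eq_bigr => k _ /=.
  by rewrite !mxE scalerDl scalerA.
exists n, (mklin il), (mklin pl) => z; rewrite [RHS]zE; apply: eq_bigr => k _.
by rewrite mxE.
Qed.

Section LatticeTriple.
Variables (S T : comPzRingType) (phi : {rmorphism S -> T}) (L : lmodType S).
Variable lam : {linear bc phi L -> bc phi (S^o : lmodType S)}.

Definition lval (z : L) : T := bcself phi (lam (bT phi 1 z)).

Lemma lvalD y z : lval (y + z) = lval y + lval z.
Proof. by rewrite /lval bTDr !linearD. Qed.

Lemma lvalZ a z : lval (a *: z) = phi a * lval z.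
Proof. by rewrite /lval -bTZ -bTE !linZ. Qed.

Lemma lval0 : lval 0 = 0.
Proof. by rewrite -(scale0r (0 : L)) lvalZ rmorph0 mul0r. Qed.

Lemma lval_sum (I : Type) (r : seq I) (F : I -> L) : lval (\sum_(k <- r) F k) = \sum_(k <- r) lval (F k).
Proof. by apply: (big_morph lval lvalD lval0). Qed.

(** The i_k and j_k form a dual basis, z being the sum of the i_k with the coefficients z j_k in S.
    The same formula over T inverts lam. *)
Lemma lattice_triple n (i : 'I_n -> L) (j : 'I_n -> T) : injective phi -> injective lval ->
  \sum_k lval (i k) * j k = 1 -> (forall z k, sunit phi (lval z * j k)) -> K0gen (Triple lam).
Proof.
move=> phiI DI D1 Du.
have /choice [g gE] z : exists g : 'I_n -> S, forall k, lval z * j k = phi (g k).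
  by have /choice [g gE] := Du z; exists g.
have zE z : z = \sum_k g z k *: i k.
  apply: DI; rewrite lval_sum -[LHS]mulr1 -D1 mulr_sumr; apply: eq_bigr => k _.
  by rewrite lvalZ -gE mulrCA mulrC.
have bj := bcself_bij phi.
have lamE t z : bcself phi (lam (bT phi t z)) = t * lval z.
  by rewrite -[t in LHS]mulr1 -bTE !linZ.
split; last 1 first.
- pose h (y : bc phi (S^o : lmodType S)) := \sum_k bT phi (bcself phi y * j k) (i k).
  exists h => [x|y]; last first.
    apply: (bij_inj bj); rewrite /h !linear_sum -[RHS]mulr1 -D1 mulr_sumr.
    by apply: eq_bigr => k _; rewrite lamE mulrAC mulrA mulrAC.
  elim/bc_ind: x => [|t z x IH].
    rewrite /h !linear0 big1 // => k _.
    by rewrite mul0r -(mul0r 0) -bTE scale0r.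
  rewrite !linearD -[in RHS]IH /h; set y := lam x.
  transitivity (\sum_k bT phi (bcself phi (lam (bT phi t z)) * j k) (i k)
    + \sum_k bT phi (bcself phi y * j k) (i k)).
    by rewrite -big_split; apply: eq_bigr => k _; rewrite linearD mulrDl bTDl.
  congr (_ + _); rewrite [z in RHS]zE.
  transitivity (\sum_k bT phi t (g z k *: i k)).
    by apply: eq_bigr => k _; rewrite lamE -mulrA gE mulrC bTZ.
  by apply/esym; apply: (big_morph (bT phi t)) => [u v|]; [exact: bTDr|exact: bT0].
- apply: (@dual_basis_fgproj _ _ n i g) => [a y z k|//].
  by apply: phiI; rewrite rmorphD rmorphM -!gE lvalD lvalZ mulrDl mulrA.
- exact: fgproj_self.
Qed.

End LatticeTriple.

(** * The dual of M_{pi_0} *)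

Section DualFunctionals.
Variables (R : comPzRingType) (G : gscheme R) (Lam : algebra R).
Notation AA := (cdual G).
Notation AL := (AA \*A Lam).
Notation HL := (G \*A Lam).
Notation M0 := (comod (trivial_space G) : lmodType AA).

Definition mapp (f : mdual M0) (b : G) : AA := f (b : M0).

Lemma mappD f b c : mapp f (b + c) = mapp f b + mapp f c.
Proof. exact: (linearD f). Qed.

Lemma mapp_sum (I : Type) (r : seq I) (F : I -> mdual M0) b :
  mapp (\sum_(i <- r) F i) b = \sum_(i <- r) mapp (F i) b.
Proof. by apply: (big_morph (fun f : mdual M0 => mapp f b)). Qed.

Lemma mappZ a (f : mdual M0) b : mapp (a *: f) b = a * mapp f b.
Proof. exact: (@homZE AA M0 AA^o). Qed.

Lemma mapp_co f a b : mapp f (co a b) = a * mapp f b.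
Proof. exact: (linZ f). Qed.

Lemma mapp_rlinear f : rlinear (mapp f).
Proof. by split=> [x y|r x]; [exact: mappD|exact: etrans (congr1 (mapp f) (esym (co_str r x))) (mapp_co f _ x)]. Qed.

Lemma aeval_rlinear f x : rlinear (fun y => dapp (mapp f y) x : base_algebra R).
Proof. exact: (rlinear_compose (mapp_rlinear f) (deval_rlinear x)). Qed.

(* y |-> f(y)(x); by aeval_co it acts on y as f(y) acts on x. *)
Definition aeval f x : AA := mkdual (aeval_rlinear f x).

Lemma aevalE f x y : dapp (aeval f x) y = dapp (mapp f y) x. Proof. by []. Qed.

Lemma aeval_co f x y : co (aeval f x) y = co (mapp f y) x.
Proof.
apply: dapp_inj => a; by rewrite dapp_co mulrC -dapp_co aevalE mapp_co dapp_co.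
Qed.

(** A rank one phenomenon. Together with 1 = sum f_i(e_i) it expands every functional g as sum
    ([aeval g] e_i) f_i. *)
Lemma mapp_swap (f g : mdual M0) x y : mapp g y * mapp f x = aeval g x * mapp f y.
Proof. by rewrite -!mapp_co aeval_co. Qed.

Definition fL (f : mdual M0) (y : HL) : AL := copair (tinl AA Lam \o mapp f) (tinr AA Lam) y.

Lemma fL_rl f : rlinear (tinl AA Lam \o mapp f).
Proof. exact: (rlinear_post _ (mapp_rlinear f)). Qed.

Lemma fL_llin f : llin (tinr AA Lam) (fL f).
Proof. exact: (copair_llin (tinr AA Lam) (fL_rl f)). Qed.

Lemma fL1 f h : fL f (aT h 1) = aT (mapp f h) 1.
Proof. exact: (copair1 (tinr AA Lam) h (fL_rl f)). Qed.

Lemma fLE (f : mdual M0) y : bcself (tinl AA Lam) (bcmap (tinl AA Lam) f (to_bc y)) = fL f y.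
Proof.
elim/atensor_ind: y => [|h l y IH].
  by rewrite to_bc0 !linear0 (llin0 (fL_llin f)).
rewrite to_bcD !linearD IH (fL_llin f).1; congr (_ + _).
rewrite to_bcE bcmapE bcselfE [in RHS]aT_split (fL_llin f).2 fL1.
by [].
Qed.

Lemma actL_fL f x y : actL (fL f y) (aT x 1) = coactL (aeval f x) y.
Proof.
move: y; apply: (@llin_ext _ _ _ _ (tinr G Lam)) => [||h].
- split=> [y z|l z]; first by rewrite (fL_llin f).1 (actL_llinl _).1.
  by rewrite (fL_llin f).2 -[tinr AA Lam l]/(aT 1 l) (actL_llinl _).2.
- exact: coactL_llin.
by rewrite fL1 actL1 !coactL1 aeval_co.
Qed.

Lemma sunit_test z : (forall h, exists r, pr z (aT h 1) = alg_str Lam r) ->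
  sunit (tinl AA Lam) z.
Proof.
move=> /choice [r rE]; have [n [e [phi dualP]]] := dual_basis G.
exists (\sum_m alg_str AA (r (e m)) * phi m).
apply: pr_inj => h; rewrite -[tinl AA Lam _]/(aT _ 1) pr11.
rewrite dapp_sum (rmorph_sum (alg_str Lam)) {1}[h]dualP.
rewrite -[aT (\sum_i _) 1]/(tinl G Lam _) rmorph_sum (llin_sum _ _ (pr_llinr z)).
apply: eq_bigr => m _; rewrite rmorphM alghom_str aT_str prl -[tinl _ _ (e m)]/(aT _ 1).
by rewrite rE dstrM dappZ -rmorphM mulrC.
Qed.

Lemma pr_surj (U : HL -> Lam) : llin id U -> exists t : AL, forall y, pr t y = U y.
Proof.
move=> hU; have [n [e [phi dualP]]] := dual_basis G.
exists (\sum_m aT (phi m : AA) (U (aT (e m) 1))).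
apply: (@llin_ext _ _ _ _ id) => [||h]; [exact: pr_llinr|exact: hU|].
rewrite (llin_sum _ _ (pr_llinl _)) {2}[h]dualP.
rewrite -[aT (\sum_i _) 1]/(tinl G Lam _) rmorph_sum (llin_sum _ _ hU).
apply: eq_bigr => m _; rewrite rmorphM alghom_str aT_str hU.2 aT_split pr_lt pr11.
by rewrite mulrC.
Qed.

End DualFunctionals.

(** * The dual lattice and the class of a torsor *)

Section TorsorLattice.
Variables (R : comPzRingType) (G : gscheme R) (Lam : algebra R) (X : torsor G).
Variable tau : trivialisation X Lam.
Hypothesis strI : injective (alg_str Lam).
Notation AA := (cdual G).
Notation k := (base_algebra R).
Notation AL := (AA \*A Lam).
Notation HL := (G \*A Lam).
Notation A2 := (AA \*A AA).
Notation phi := (tinl AA Lam).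
Notation M := (comod X : lmodType AA).
Notation M0 := (comod (trivial_space G) : lmodType AA).

Definition tb (b : X) : HL := tau (aT b 1).

Lemma tbD b c : tb (b + c) = tb b + tb c.
Proof. by rewrite /tb -[aT (b + c) 1]/(tinl X Lam _) !rmorphD. Qed.
Lemma tbM b c : tb (b * c) = tb b * tb c.
Proof. by rewrite /tb -[aT (b * c) 1]/(tinl X Lam _) !rmorphM. Qed.
Lemma tb_str r : tb (alg_str X r) = alg_str HL r.
Proof. by rewrite /tb -[aT _ 1]/(tinl X Lam _) !alghom_str. Qed.
Lemma tb0 : tb 0 = 0.
Proof. by apply: (addrI (tb 0)); rewrite -tbD !addr0. Qed.
Lemma tb_sum (I : Type) (r : seq I) (F : I -> X) : tb (\sum_(i <- r) F i) = \sum_(i <- r) tb (F i).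
Proof. by apply: (big_morph tb tbD tb0). Qed.
Lemma tb_coact a b : tb (coact a b) = coactL a (tb b).
Proof. exact: triv_coact. Qed.

Lemma tb_ext (P : algebra R) (c : Lam -> P) (u v : HL -> P) : llin c u -> llin c v ->
  (forall b, u (tb b) = v (tb b)) -> u =1 v.
Proof.
move=> hu hv E y; have [g _ gK] := triv_bij tau; rewrite -[y]gK.
elim/atensor_ind: (g y) => [|b l t IH]; first by rewrite rmorph0 (llin0 hu) (llin0 hv).
by rewrite rmorphD hu.1 hv.1 IH aT_split rmorphM triv_base hu.2 hv.2 E.
Qed.

Lemma tb_inj : injective tb.
Proof.
have [n [x [nu [hnu xE]]]] := torsor_basis X.
move=> b c /(bij_inj (triv_bij tau)) bc.
rewrite [b]xE [c]xE; apply: eq_bigr => i _; congr (alg_str X _ * _); apply: strI.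
have hs : rlinear (fun x => alg_str Lam (nu i x)) := rlinear_post (astr Lam) (hnu i).
by rewrite -(copair1 (aid Lam) b hs) bc (copair1 (aid Lam) c hs).
Qed.

(* The dual lattice of tau(O_X). *)
Definition tlat (t : AL) : Prop := forall b, exists r, pr t (tb b) = alg_str Lam r.

Lemma tlat_fun t : tlat t -> exists nu : X -> k, rlinear nu /\
  forall b, pr t (tb b) = alg_str Lam (nu b).
Proof.
move=> /choice [nu nuE]; exists nu; split=> //; split=> [b c|r b]; apply: strI.
  by rewrite rmorphD -!nuE tbD prD.
by rewrite rmorphM -!nuE tbM tb_str pr_str.
Qed.

Lemma fun_tlat (nu : X -> k) : rlinear nu -> exists t : AL,
  tlat t /\ forall b, pr t (tb b) = alg_str Lam (nu b).
Proof.
move=> hnu; have [g gK' gK] := triv_bij tau.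
have hs : rlinear (fun x => alg_str Lam (nu x)) := rlinear_post (astr Lam) hnu.
have hc := copair_llin (aid Lam) hs.
have gl l y : g (aT 1 l * y) = aT 1 l * g y.
  by apply: (can_inj gK'); rewrite gK rmorphM triv_base gK.
have gD y z : g (y + z) = g y + g z.
  by apply: (can_inj gK'); rewrite rmorphD !gK.
have hU : llin id (fun y => copair (fun x => alg_str Lam (nu x)) (aid Lam) (g y)).
  by split=> [y z|l y]; rewrite ?gD ?gl ?hc.1 ?hc.2.
have [t tE] := pr_surj hU; exists t.
have E b : pr t (tb b) = alg_str Lam (nu b).
  by rewrite tE gK' (copair1 (aid Lam) b hs).
by split=> [b|//]; exists (nu b).
Qed.

Notation i1 := (amap (tinl AA AA) (aid Lam)).
Notation i2 := (amap (tinr AA AA) (aid Lam)).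
Notation dL := (amap (dcomul G) (aid Lam)).
Notation phi2 := (tinl A2 Lam).

Lemma pr2_tb_inj z z' : (forall b b', pr2 z (tb b) (tb b') = pr2 z' (tb b) (tb b')) -> z = z'.
Proof.
move=> E; apply: pr2_inj => h h'; move: (aT h 1) (aT h' 1) => y y'.
move: y; apply: (tb_ext (pr2_llin1 _ _) (pr2_llin1 _ _)) => b.
by move: y'; apply: (tb_ext (pr2_llin2 _ _) (pr2_llin2 _ _)) => b'.
Qed.

(** Elements of the lattice are the R-linear functionals on O_X. The product of O_X expands nu(b b')
    as sum nu_i(b) nu(x_i b'), which is one inclusion. For the other, the torsor isomorphism writes
    nu(b) nu'(b') as sum nu_i(b (a_i b')) with a_i in A. *)
Lemma tlat_comul : spush phi2 dL tlat = sprod phi2 (spush phi2 i1 tlat) (spush phi2 i2 tlat).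
Proof.
have [n [x [nu [hnu xE]]]] := torsor_basis X.
have /choice [t tE] i := fun_tlat (hnu i).
apply: pred_ext => w; split.
  apply: spush_least; first exact: sprod_sub.
  move=> s /tlat_fun [nus [hs sE]].
  have /choice [t' tE'] i : exists t' : AL, tlat t' /\
      forall b, pr t' (tb b) = alg_str Lam (nus (x i * b)).
    by apply: (fun_tlat (rlinear_compose (rlinear_mull _ (rlinear_id X)) hs)).
  have -> : dL s = \sum_i i1 (t i) * i2 (t' i).
    apply: pr2_tb_inj => b b'; rewrite pr2_dcomul -tbM sE (llin_sum _ _ (pr2_llin _ _)).
    rewrite [b in LHS]xE mulr_suml (rlinear_sum _ _ hs) (rmorph_sum (alg_str Lam)).
    apply: eq_bigr => i _; rewrite pr2_prod (tE i).2 (tE' i).2 -rmorphM.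
    by rewrite -mulrA (rlinearZ hs).
  apply: (@sub_sum _ _ phi2 (A2 \*A Lam)^o _ _ _ _ _ (sprod_sub _ _ _)) => i _; apply: sprod_in; apply: spush_in.
    exact: (tE i).1.
  exact: (tE' i).1.
apply: sprod_least; first exact: spush_sub.
move=> u v hu; move: v; apply: spush_least; first exact/mul_sub/spush_sub.
move=> s Js; rewrite mulrC; move: u hu; apply: spush_least; first exact/mul_sub/spush_sub.
move=> u Ju; rewrite mulrC; have [nuu [huu uE]] := tlat_fun Ju; have [nus [hus sE]] := tlat_fun Js.
have [g gK gK'] := torsor_galois X.
(* The tensor product of the two functionals on X x X, transported to X x G. *)
pose N (z : X \*A G) : k := copair nuu nus (g z).
have gD y z : g (y + z) = g y + g z.
  by apply: (can_inj gK); rewrite rmorphD !gK'.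
have gM y z : g (y * z) = g y * g z.
  by apply: (can_inj gK); rewrite rmorphM !gK'.
have gst r : g (alg_str _ r) = alg_str _ r.
  by apply: (can_inj gK); rewrite gK' alghom_str.
have hN : rlinear N.
  split=> [y z|r y]; rewrite /N ?gD ?gM ?gst.
    exact: (rlinearD (copair_rlinear huu hus)).
  exact: (rlinearZ (copair_rlinear huu hus)).
have hNx i : rlinear (fun h => N (aT (x i) h)).
  split=> [h h'|r h]; first by rewrite (balancedDr (@aT_balanced R X G)) (rlinearD hN).
  rewrite -(rlinearZ hN); congr N.
  by rewrite aT_str aTM mul1r.
(* The X-variable of N is expanded in the dual basis; each N(x_i (x) -) is a functional on O_G, that
   is an element of A, and acts on b'. *)
have E b b' : nuu b * nus b' = \sum_i nu i (b * coact (mkdual (hNx i)) b').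
  have -> : nuu b * nus b' = N (tinl X G b * sact X b').
    rewrite /N -(@acopairE _ _ _ _ (tinl X G) (sact X)) gK copairE //.
  rewrite -[RHS]/(\sum_i nu i (b * copair (fun x : X => x) (dstrapp X (mkdual (hNx i))) (sact X b'))).
  move: (sact X b'); apply: rlinear_ext.
  - exact: (rlinear_compose (rlinear_mull _ (rlinear_id (X \*A G))) hN).
  - have h i : rlinear (fun z => nu i (b * copair (fun x => x) (dstrapp X (mkdual (hNx i))) z)).
      apply: (rlinear_compose _ (hnu i)); apply: rlinear_mull.
      exact: (copair_rlinear (rlinear_id X) (dstrapp_rlinear X _)).
    split=> [y z|r y].
      by rewrite -big_split; apply: eq_bigr => i _; rewrite (rlinearD (h i)).
    by rewrite mulr_sumr; apply: eq_bigr => i _; rewrite (rlinearZ (h i)).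
  move=> c h; rewrite -[tinl X G b]/(aT b 1) aTM mul1r.
  transitivity (\sum_i nu i (b * c) * N (aT (x i) h)).
    rewrite {1}[b * c]xE -[aT _ h]/(@aT R X G _ h).
    rewrite -[h in LHS]mul1r -[_ * h in LHS]mul1r.
    have -> : aT (\sum_i alg_str X (nu i (b * c)) * x i) (1 * (1 * h)) =
      \sum_i alg_str (X \*A G) (nu i (b * c)) * aT (x i) h.
      have -> : aT (\sum_i alg_str X (nu i (b * c)) * x i) (1 * (1 * h)) =
        tinl X G (\sum_i alg_str X (nu i (b * c)) * x i) * aT 1 h.
        by rewrite -[tinl X G _]/(aT _ 1) aTM mulr1 !mul1r.
      rewrite rmorph_sum mulr_suml; apply: eq_bigr => i _.
      by rewrite rmorphM alghom_str -mulrA -[tinl X G (x i)]/(aT _ 1) aTM mulr1 mul1r.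
    rewrite (rlinear_sum _ _ hN); apply: eq_bigr => i _; exact: (rlinearZ hN).
  apply: eq_bigr => i _; rewrite copairE; [|exact: rlinear_id|exact: dstrapp_rlinear].
  by rewrite [b * (c * _)]mulrA [b * c * _]mulrC (rlinearZ (hnu i)) mulrC.
have -> : i1 u * i2 s = \sum_i dL (t i) * aT (tinr AA AA (mkdual (hNx i))) 1.
  apply: pr2_tb_inj => b b'; rewrite pr2_prod uE sE -rmorphM E.
  rewrite (llin_sum _ _ (pr2_llin _ _)) (rmorph_sum (alg_str Lam)).
  by apply: eq_bigr => i _; rewrite pr2_shift pr2_dcomul -tb_coact -tbM (tE i).2.
apply: (@sub_sum _ _ phi2 (A2 \*A Lam)^o _ _ _ _ _ (spush_sub _ _ _)) => i _; rewrite mulrC.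
exact/(isubM _ (spush_sub _ _ _))/spush_in/(tE i).1.
Qed.

Notation tv := (lval (xi tau : {linear bc phi (Lmod X) -> bc phi (AA^o : lmodType AA)})).

Lemma lval_pure (c : X) (f : mdual M0) : tv (tpure (c : M) f) = fL f (tb c).
Proof. by rewrite /lval xiE scale1r fLE. Qed.

Lemma fL_tb_lat (f : mdual M0) b t : tlat t -> sunit phi (fL f (tb b) * t).
Proof.
move=> ht; apply: sunit_test => h; have [r rE] := ht (coact (aeval f h) b).
by exists r; rewrite -rE tb_coact -actL_fL pr_act mulrC.
Qed.

Lemma lval_lat z t : tlat t -> sunit phi (tv z * t).
Proof.
move=> ht; elim/tensor_ind: z => [|c f z IH].
  by rewrite lval0 mul0r; apply: (sub0 (sunit_sub phi)).
rewrite lvalD mulrDl lval_pure; apply: (subD (sunit_sub phi)) => //.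
exact: fL_tb_lat.
Qed.

Lemma antipode_linear (t : AA) : is_integral t ->
  linear ((fun c => dtrans t (ginv G c)) : M0 -> (AA^o : lmodType AA)).
Proof.
move=> ht a x y; apply: dappP => d.
rewrite -[a *: x]/(co a x) -[co a x + y]/(co a x + y : G) mkdualE rmorphD mulrDl.
rewrite (rlinearD (dapp_rlinear t)) integral_functional // dappD mkdualE; congr (_ + _).
rewrite -[LHS]/(dapp (dtrans t (ginv G x)) (co a d)) dapp_co mulrC.
by [].
Qed.

(** A reading of [integral_counit]: evaluation of the dual of M_{pi_0} on M_{pi_0} reaches 1. *)
Lemma dual_unit : exists n (e : 'I_n -> G) (f : 'I_n -> mdual M0), \sum_i mapp (f i) (e i) = 1.
Proof.
have [n [e [phi0 dualP]]] := dual_basis G; exists n, e.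
exists (fun i => mkhom (antipode_linear (tint_integral dualP (phi0 i)))).
apply: dappP => d; rewrite dapp_sum -[RHS]/(gone G d) -(integral_counit dualP).
by [].
Qed.

(** By [mapp_swap] every tensor is sum c_i (x) f_i with fixed f_i. The value of z, acting on e_i,
    gives back tau(c_i), so a zero value forces all c_i to vanish. *)
Lemma lval_inj : injective tv.
Proof.
suff H z : tv z = 0 -> z = 0.
  move=> y z yz; apply/eqP; rewrite -subr_eq0; apply/eqP/H.
  by rewrite -scaleN1r lvalD lvalZ yz rmorphN1 mulN1r subrr.
move=> z0; have [n [e [f fe]]] := dual_unit.
have [s sE] : exists s : seq (M * mdual M0), z = \sum_(p <- s) tpure p.1 p.2.
  elim/tensor_ind: (z) => [|c g t [s ->]]; first by exists [::]; rewrite big_nil.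
  by exists ((c, g) :: s); rewrite big_cons.
have gE (g : mdual M0) : g = \sum_i (aeval g (e i) : AA) *: f i.
  apply: homP => y; rewrite -[LHS]/(mapp g y) -[RHS]/(mapp _ y) -[LHS]mulr1 -fe mulr_sumr.
  by rewrite mapp_sum; apply: eq_bigr => i _; rewrite mappZ mapp_swap.
have pE (c : M) (g : mdual M0) : tpure c g = \sum_i tpure (coact (aeval g (e i)) c : M) (f i).
  have hb := tpure_balanced M (mdual M0).
  rewrite {1}[g]gE.
  have -> : tpure c (\sum_i (aeval g (e i) : AA) *: f i) = \sum_i tpure c ((aeval g (e i) : AA) *: f i).
    apply: (big_morph (tpure c)) => [u v|]; first exact: (balancedDr hb).
    by apply: (addrI (tpure c 0)); rewrite -(balancedDr hb) !addr0.
  by apply: eq_bigr => i _; rewrite -(balancedZ hb).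
have cE i : \sum_(p <- s) coact (aeval p.2 (e i)) p.1 = 0 :> X.
  apply: tb_inj; rewrite tb0 tb_sum.
  transitivity (actL (tv z) (aT (e i) 1)); last by rewrite z0 (llin0 (actL_llinl _)).
  rewrite sE lval_sum (llin_sum _ _ (actL_llinl _)); apply: eq_bigr => p _.
  by rewrite lval_pure actL_fL tb_coact.
rewrite sE; under eq_bigr do rewrite pE.
rewrite exchange_big big1 // => i _ /=.
have hb := tpure_balanced M (mdual M0).
have t0 : tpure (0 : M) (f i) = 0.
  by apply: (addrI (tpure (0 : M) (f i))); rewrite -(balancedDl hb) !addr0.
transitivity (tpure (\sum_(p <- s) (coact (aeval p.2 (e i)) p.1 : M)) (f i)).
  apply/esym; apply: (big_morph (fun c : M => tpure c (f i))) => [u v|]; first exact: (balancedDl hb).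
  exact: t0.
by rewrite [\sum_(p <- s) _](cE i) t0.
Qed.

(** Let sum x (x) y have shear 1 (x) e_i and let nu be a retraction of R -> O_X. The vectors y (x)
    f_i and the functionals nu(x -) do it: by [shear_trace] the sum of products becomes sum f_i(e_i)
    = 1. *)
Lemma lval_one : exists n (i : 'I_n -> Lmod X) (j : 'I_n -> AL),
  (forall m, tlat (j m)) /\ \sum_m tv (i m) * j m = 1.
Proof.
have [n [e [phi0 dualP]]] := dual_basis G.
pose f i : mdual M0 := mkhom (antipode_linear (tint_integral dualP (phi0 i))).
have [nu [hnu nu1]] := torsor_retract X.
have /choice [z zE] i := atensor_sum (kap X (e i)).
have /choice [T TE] (x : X) := fun_tlat (rlinear_compose (rlinear_mull x (rlinear_id X)) hnu).
pose s := flatten [seq [seq (tpure (p.2 : M) (f i), T p.1) | p <- z i] | i <- enum 'I_n].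
exists (size s), (fun m => (tnth (in_tuple s) m).1), (fun m => (tnth (in_tuple s) m).2); split.
  move=> m; have /flatten_mapP [i _ /mapP [p _ ->]] : tnth (in_tuple s) m \in s by apply: mem_tnth.
  exact: (TE _).1.
rewrite -(big_tnth _ _ s xpredT (fun q => tv q.1 * q.2)) big_flatten big_map big_enum /=.
apply: pr_inj => h; rewrite (llin_sum _ _ (pr_llinl _)).
transitivity (\sum_i alg_str Lam (dapp (mapp (f i) (e i)) h)); last first.
  rewrite -rmorph_sum -[1]/(aT (1 : AA) (1 : Lam)) pr11; congr (alg_str Lam _).
  rewrite -[RHS]/(gone G h) -(integral_counit dualP).
  by [].
apply: eq_bigr => i _; rewrite big_map (llin_sum _ _ (pr_llinl _)).
transitivity (alg_str Lam (nu (copair (fun x : X => x) (fun y => coact (aeval (f i) h) (y * 1)) (kap X (e i))))).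
  rewrite zE copair_sum; [|exact: rlinear_id|]; last first.
    exact: (rlinear_compose (rlinear_mulr 1 (rlinear_id X)) (coact_rlinear X _)).
  rewrite (rlinear_sum _ _ hnu) rmorph_sum; apply: eq_bigr => p _.
  by rewrite mulr1 -(TE p.1).2 lval_pure mulrC -pr_act actL_fL tb_coact.
rewrite shear_trace kapE rmorph1 mulr1 copairE; [|exact: rlinear_id|exact: dstrapp_rlinear].
by rewrite mul1r (rlinear_str _ hnu) nu1 mulr1.
Qed.

Lemma tinl_inj : injective phi.
Proof.
move=> a b ab; apply: dappP => h; apply: strI.
by rewrite -!pr11 -[aT a 1]/(phi a) ab.
Qed.

Lemma class_gen : K0 (class tau).
Proof.
have [n [i [j [hj ij]]]] := lval_one.
apply: List.Forall_cons; last exact: List.Forall_nil.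
apply: (@lattice_triple _ _ _ _ _ _ i j tinl_inj lval_inj ij) => z m.
by apply: lval_lat; apply: hj.
Qed.

Lemma Phi_class : sprod phi (Phi (class tau)) tlat = sunit phi.
Proof.
have hg : K0gen (Triple (xi tau)) by have := class_gen; inversion 1.
rewrite Phi_self //; apply: pred_ext => t; split.
  apply: sprod_least; first exact: sunit_sub.
  by move=> _ b [x ->] hb; apply: lval_lat.
move=> [a ->]; rewrite -[phi a]mulr1; apply: isubM; first exact: sprod_sub.
have [n [i [j [hj ij]]]] := lval_one; rewrite -[X in sprod _ _ _ X]ij.
apply: (@sub_sum _ _ phi AL^o _ _ _ _ _ (sprod_sub _ _ _)) => m _.
by apply: sprod_in; [exists (i m)|exact: hj].
Qed.

End TorsorLattice.

Lemma sprod_cancel (S T : comPzRingType) (phi : {rmorphism S -> T}) (I I' J : T -> Prop) :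
  @is_sub _ _ phi T^o I -> @is_sub _ _ phi T^o I' ->
  sprod phi I J = sunit phi -> sprod phi I' J = sunit phi -> I = I'.
Proof.
by rewrite ![sprod _ _ J]sprodC => hI hI' /(sdual_uniq hI) -> /(sdual_uniq hI') ->.
Qed.

Lemma spush_comp (T S' T' S'' T'' : comPzRingType) (phi' : {rmorphism S' -> T'})
  (phi'' : {rmorphism S'' -> T''}) (f : {rmorphism S' -> S''}) (h : {rmorphism T -> T'})
  (h' : {rmorphism T' -> T''}) (comm : forall s, h' (phi' s) = phi'' (f s)) I :
  spush phi'' h' (spush phi' h I) = spush phi'' (h' \o h) I.
Proof.
apply: pred_ext => t; split.
  apply: spush_least; first exact: spush_sub.
  apply: spush_least; first exact: (hpre_sub comm (spush_sub _ _ _)).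
  by move=> a Ia; apply: (spush_in phi'' (h' \o h)).
apply: spush_least; first exact: spush_sub.
by move=> a Ia; apply/spush_in/spush_in.
Qed.

Lemma spush_ext (T S' T' : comPzRingType) (phi' : {rmorphism S' -> T'}) (h h' : T -> T') I :
  h =1 h' -> spush phi' h I = spush phi' h' I.
Proof. by move=> hh; congr spush; apply: funext. Qed.

Lemma amap_ext (R : comPzRingType) (A B P : algebra R) (u v : alghom (A \*A B) P) :
  (forall a b, u (aT a b) = v (aT a b)) -> u =1 v.
Proof. by apply: rlinear_ext; apply: alghom_rlinear. Qed.

Lemma spush_sprin (S T S' T' : comPzRingType) (phi : {rmorphism S -> T})
  (phi' : {rmorphism S' -> T'}) (f : {rmorphism S -> S'}) (h : {rmorphism T -> T'})
  (comm : forall s, h (phi s) = phi' (f s)) t :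
  spush phi' h (sprin phi t) = sprin phi' (h t).
Proof.
apply: pred_ext => x; split.
  apply: spush_least; first exact: sprin_sub.
  by move=> _ [s ->]; exists (f s); rewrite rmorphM comm.
move=> [s ->]; apply: isubM; first exact: spush_sub.
by apply: spush_in; exists 1; rewrite rmorph1 mul1r.
Qed.

(** * Group elements in A (x) Lam *)

Section Grouplike.
Variables (R : comPzRingType) (G : gscheme R) (Lam : algebra R).
Notation AA := (cdual G).
Notation AL := (AA \*A Lam).
Notation A2 := (AA \*A AA).
Notation i1 := (amap (tinl AA AA) (aid Lam)).
Notation i2 := (amap (tinr AA AA) (aid Lam)).
Notation dL := (amap (dcomul G) (aid Lam)).

(** Identifies A (x) Lam with the convolution algebra of functionals on O_G, in which a point of G
    is inverted by composing with the antipode. *)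
Lemma ev_mul (t u : AL) : ev (t * u) =1 cv (ev t) (ev u).
Proof.
move=> h.
have cvl (f f' : AL) g : rlinear g -> cv (ev (f + f')) g h = cv (ev f) g h + cv (ev f') g h.
  move=> hg; rewrite /cv -[RHS]/((fun z => copair (ev f) g z + copair (ev f') g z) (gmul G h)).
  move: (gmul G h); apply: rlinear_ext.
  - exact: copair_rlinear (ev_rlinear _) hg.
  - split=> [x y|r x].
      by rewrite !(rlinearD (copair_rlinear (ev_rlinear _) hg)) addrACA.
    by rewrite !(rlinearZ (copair_rlinear (ev_rlinear _) hg)) mulrDr.
  move=> x y; rewrite !copairE //; try exact: ev_rlinear.
  by rewrite (@ev_llin _ _ Lam x).1 mulrDl.
have cvZ l (f : AL) g : rlinear g -> cv (ev (aT 1 l * f)) g h = l * cv (ev f) g h.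
  move=> hg; rewrite /cv -copair_mull //; last exact: ev_rlinear.
  by apply: copair_ext => // x; rewrite (@ev_llin _ _ Lam x).2.
have hl v : rlinear (ev v) := ev_rlinear v.
move: t; apply: (@llin_ext _ _ _ _ id).
- split=> [x y|l x]; first by rewrite mulrDl (@ev_llin _ _ Lam h).1.
  by rewrite -mulrA (@ev_llin _ _ Lam h).2.
- by split=> [x y|l x]; [apply: cvl|apply: cvZ].
move=> a; move: u; apply: (@llin_ext _ _ _ _ id).
- split=> [x y|l x]; first by rewrite mulrDr (@ev_llin _ _ Lam h).1.
  by rewrite mulrCA (@ev_llin _ _ Lam h).2.
- split=> [x y|l x]; rewrite ![cv (ev (aT a 1)) _ _]cvC //; first exact: cvl.
  exact: cvZ.
move=> b; rewrite aTM mulr1 ev1 convE.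
rewrite (cv_ext (f' := fun x => astr Lam (dapp a x)) (g' := fun x => astr Lam (dapp b x))); last 2 first.
- by move=> x; rewrite ev1.
- by move=> x; rewrite ev1.
by rewrite -[RHS](cv_post (astr Lam) (dapp_rlinear a) (dapp_rlinear b)).
Qed.

Lemma ev_surj (f : G -> Lam) : rlinear f -> exists t : AL, ev t =1 f.
Proof.
move=> hf; have [t tE] := pr_surj (copair_llin (aid Lam) hf).
by exists t => h; rewrite -pr1 tE (copair1 (aid Lam) h hf).
Qed.

Lemma ev_inj (t u : AL) : ev t =1 ev u -> t = u.
Proof. by move=> E; apply: pr_inj => h; rewrite !pr1. Qed.

Lemma ev_one h : ev (1 : AL) h = ceps Lam h.
Proof. by rewrite -[1]/(aT 1 1) ev1. Qed.

Lemma Gamma_one : Gamma (G := G) (Fc := Lam) 1.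
Proof. by exists (acomp (astr Lam) (gone G)) => b; apply/esym/ev_one. Qed.

Lemma Gamma_inv t : Gamma t -> exists u : AL, t * u = 1.
Proof.
move=> [g gE]; have gE' : ev t =1 g by move=> h; rewrite gE.
have [u uE] := ev_surj (alghom_rlinear (acomp g (ginv G))).
exists u; apply: ev_inj => h; rewrite ev_mul ev_one.
rewrite (cvC (ev_rlinear t) (ev_rlinear u)) -(cvV g).
by apply: cv_ext.
Qed.

Lemma Gamma_comul t : Gamma t -> dL t = i1 t * i2 t.
Proof.
move=> [g gE]; have gE' : ev t =1 g by move=> h; rewrite gE.
apply: pr2_inj => h h'; rewrite pr2_dcomul pr2_prod aTM mulr1 !pr1 !gE'.
exact: rmorphM.
Qed.

Lemma Gamma_ev1 (t : AL) : Gamma t -> ev t 1 = 1.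
Proof. by move=> [g gE]; rewrite -[ev t 1]gE rmorph1. Qed.

End Grouplike.

(** * Primitivity in terms of lattices *)

Section PrimitiveClasses.
Variables (R : comPzRingType) (G : gscheme R) (Rc Fc : algebra R) (j : alghom Rc Fc).
Notation AA := (cdual G).
Notation A2 := (AA \*A AA).
Notation i1 := (tinl AA AA).
Notation i2 := (tinr AA AA).

Definition epush (A : algebra R) : (A \*A Rc -> Prop) -> A \*A Fc -> Prop :=
  spush (tinl A Fc) (amap (aid A) j).
Definition fpush (A B Lam : algebra R) (f : alghom A B) : (A \*A Lam -> Prop) -> B \*A Lam -> Prop :=
  spush (tinl B Lam) (amap f (aid Lam)).

Lemma fpush_comm (A B Lam : algebra R) (f : alghom A B) s :
  amap f (aid Lam) (tinl A Lam s) = tinl B Lam (f s).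
Proof. exact: fstar_comm. Qed.

Lemma Phi_ext (A : algebra R) (x : fsum (tinl A Rc)) : K0 x -> Phi (ext j x) = epush (Phi x).
Proof. exact: (Phi_push (ext_comm j (A := A))). Qed.

Lemma K0_ext (A : algebra R) (x : fsum (tinl A Rc)) : K0 x -> K0 (ext j x).
Proof. exact: (K0_push (ext_comm j (A := A))). Qed.

Lemma Phi_fstar (A B : algebra R) (f : alghom A B) (x : fsum (tinl A Rc)) :
  K0 x -> Phi (fstar f x) = fpush f (Phi x).
Proof. exact: (Phi_push (fstar_comm Rc f)). Qed.

Lemma K0_fstar (A B : algebra R) (f : alghom A B) (x : fsum (tinl A Rc)) :
  K0 x -> K0 (fstar f x).
Proof. exact: (K0_push (fstar_comm Rc f)). Qed.

Lemma fpush_prod (A B Lam : algebra R) (f : alghom A B) I J :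
  fpush f (sprod (tinl A Lam) I J) = sprod (tinl B Lam) (fpush f I) (fpush f J).
Proof. exact: (spush_sprod (fpush_comm Lam f)). Qed.

Lemma fpush_unit (A B Lam : algebra R) (f : alghom A B) :
  fpush f (sunit (tinl A Lam)) = sunit (tinl B Lam).
Proof. exact: (spush_sunit (fpush_comm Lam f)). Qed.

Lemma fpush_prin (A B Lam : algebra R) (f : alghom A B) t :
  fpush f (sprin (tinl A Lam) t) = sprin (tinl B Lam) (amap f (aid Lam) t).
Proof. exact: (spush_sprin (fpush_comm Lam f)). Qed.

Lemma fpush_sub (A B Lam : algebra R) (f : alghom A B) I :
  @is_sub _ _ (tinl B Lam) (B \*A Lam)^o (fpush f I).
Proof. exact: spush_sub. Qed.

Lemma epush_prod (A : algebra R) I J :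
  epush (sprod (tinl A Rc) I J) = sprod (tinl A Fc) (epush I) (epush J).
Proof. exact: (spush_sprod (ext_comm j (A := A))). Qed.

Lemma epush_unit (A : algebra R) : epush (sunit (tinl A Rc)) = sunit (tinl A Fc).
Proof. exact: (spush_sunit (ext_comm j (A := A))). Qed.

Lemma fpush_comp (A B C Lam : algebra R) (f : alghom A B) (g : alghom B C) (h : alghom A C) I :
  (forall a, g (f a) = h a) -> fpush g (fpush f I) = fpush (Lam := Lam) h I.
Proof.
move=> E; rewrite /fpush (spush_comp _ (fpush_comm Lam g)); apply: spush_ext.
apply: (amap_ext (u := acomp (amap g (aid Lam)) (amap f (aid Lam)))) => a b.
by rewrite -[LHS]/(amap g (aid Lam) (amap f (aid Lam) (aT a b))) !amapE E.
Qed.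

Lemma epush_fpush (A B : algebra R) (f : alghom A B) I :
  epush (fpush f I) = fpush f (epush I).
Proof.
rewrite /fpush /epush (spush_comp _ (ext_comm j (A := B))) (spush_comp _ (fpush_comm Fc f)).
apply: spush_ext.
apply: (amap_ext (u := acomp (amap (aid B) j) (amap f (aid Rc)))
  (v := acomp (amap f (aid Fc)) (amap (aid A) j))) => a b.
rewrite -[LHS]/(amap (aid B) j (amap f (aid Rc) (aT a b))).
by rewrite -[RHS]/(amap f (aid Fc) (amap (aid A) j (aT a b))) !amapE.
Qed.

Lemma fpush_id (A Lam : algebra R) (f : alghom A A) I : f =1 id ->
  @is_sub _ _ (tinl A Lam) (A \*A Lam)^o I -> fpush f I = I.
Proof.
move=> E hI; have E' z : amap f (aid Lam) z = z.
  move: z; apply: (amap_ext (v := aid (A \*A Lam))) => a b.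
  by rewrite amapE E.
apply: pred_ext => t; split.
  by apply: spush_least => // a Ia; rewrite E'.
by move=> It; rewrite -[t]E'; apply: spush_in.
Qed.

Hypothesis inj1 : forall x y : fsum (tinl AA Fc), K0 x -> K0 y -> Phi x = Phi y -> K0eq x y.
Hypothesis inj2 : forall x y : fsum (tinl A2 Fc), K0 x -> K0 y -> Phi x = Phi y -> K0eq x y.

(** Injectivity of [Phi] turns equality of classes into equality of ideals; a group element is a
    unit, so it contributes its principal ideal. *)
Lemma K0bar_eqP (x y : fsum (tinl AA Rc)) : K0 x -> K0 y ->
  K0bar_eq j (Gamma (Fc := Fc) (G := G)) x y <->
  exists2 t, Gamma t & epush (Phi x) = sprod (tinl AA Fc) (epush (Phi y)) (sprin (tinl AA Fc) t).
Proof.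
move=> hx hy; split=> [[t [ht /Phi_K0eq E]]|[t ht E]]; exists t => //.
  have [u tu] := Gamma_inv ht; move: E.
  by rewrite Phi_cat (Phi_unit _ tu) !Phi_ext.
have [u tu] := Gamma_inv ht; split=> //; apply: inj1.
- exact: K0_ext.
- apply/List.Forall_app; split; first exact: K0_ext.
  by apply: List.Forall_cons; [exact: (unit_triple_gen _ tu)|exact: List.Forall_nil].
by rewrite Phi_cat (Phi_unit _ tu) !Phi_ext.
Qed.

Lemma Gamma2_inv (t : A2 \*A Fc) : Gamma2 t -> exists u, t * u = 1.
Proof.
move=> [t1 [t2 [/Gamma_inv [u1 h1] /Gamma_inv [u2 h2] ->]]].
exists (amap i1 (aid Fc) u1 * amap i2 (aid Fc) u2).
by rewrite mulrACA -!rmorphM h1 h2 !rmorph1 mulr1.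
Qed.

Lemma primitiveP (x : fsum (tinl AA Rc)) : K0 x ->
  primitive j x <->
  exists2 t, Gamma2 t & fpush (dcomul G) (epush (Phi x)) =
    sprod (tinl A2 Fc) (sprod (tinl A2 Fc) (fpush i1 (epush (Phi x))) (fpush i2 (epush (Phi x))))
      (sprin (tinl A2 Fc) t).
Proof.
move=> hx; have hf (f : alghom AA A2) : K0 (fstar f x) := K0_fstar f hx.
have hc : K0 (fstar i1 x ++ fstar i2 x) by apply/List.Forall_app; split; apply: hf.
have E1 : Phi (ext j (fstar (dcomul G) x)) = fpush (dcomul G) (epush (Phi x)).
  by rewrite Phi_ext // Phi_fstar // epush_fpush.
have E2 : Phi (ext j (fstar i1 x ++ fstar i2 x)) =
    sprod (tinl A2 Fc) (fpush i1 (epush (Phi x))) (fpush i2 (epush (Phi x))).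
  by rewrite Phi_ext // Phi_cat epush_prod !Phi_fstar // !epush_fpush.
split=> [[_ [t [ht /Phi_K0eq E]]]|[t ht E]].
  exists t => //; have [u tu] := Gamma2_inv ht.
  by move: E; rewrite Phi_cat (Phi_unit _ tu) E1 E2.
split=> //; have [u tu] := Gamma2_inv ht; exists t; split=> //; apply: inj2.
- exact: K0_ext.
- apply/List.Forall_app; split; first exact: K0_ext.
  by apply: List.Forall_cons; [exact: (unit_triple_gen _ tu)|exact: List.Forall_nil].
by rewrite Phi_cat (Phi_unit _ tu) E1 E2.
Qed.

Lemma Gamma2_one : Gamma2 (G := G) (Fc := Fc) 1.
Proof. by exists 1, 1; split; try exact: Gamma_one; rewrite !rmorph1 mulr1. Qed.

Hypothesis strI : injective (alg_str Rc).

(** The ideal of the class is inverse to [tlat tau]; inverses being unique, [tlat_comul] passes to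
    it. *)
Lemma class_comul (X : torsor G) (tau : trivialisation X Rc) :
  fpush (dcomul G) (Phi (class tau)) =
  sprod (tinl A2 Rc) (fpush i1 (Phi (class tau))) (fpush i2 (Phi (class tau))).
Proof.
apply: (@sprod_cancel _ _ (tinl A2 Rc) _ _ (fpush (dcomul G) (tlat tau))).
- exact: fpush_sub.
- exact: sprod_sub.
- by rewrite -fpush_prod (Phi_class tau strI) fpush_unit.
have -> : fpush (dcomul G) (tlat tau) =
  sprod (tinl A2 Rc) (fpush i1 (tlat tau)) (fpush i2 (tlat tau)) := tlat_comul tau strI.
rewrite sprodACA -!fpush_prod (Phi_class tau strI) !fpush_unit.
by rewrite sprod1 //; apply: sunit_sub.
Qed.

Lemma class_primitive (X : torsor G) (tau : trivialisation X Rc) : primitive j (class tau).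
Proof.
apply/primitiveP; first exact: class_gen.
exists 1; first exact: Gamma2_one.
rewrite sprin1 sprodr1; last exact: sprod_sub.
by rewrite -!epush_fpush class_comul epush_prod.
Qed.

(** The factor by which the ideals of x and of [class tau] differ is generated by a group element t,
    and Delta(t) = (t (x) 1)(1 (x) t) makes its ideal multiplicative as well. *)
Lemma class_image_primitive (x : fsum (tinl AA Rc)) (X : torsor G) (tau : trivialisation X Rc) :
  K0 x -> K0bar_eq j (Gamma (Fc := Fc) (G := G)) x (class tau) -> primitive j x.
Proof.
move=> hx /K0bar_eqP [//||t ht E]; first exact: class_gen.
apply/primitiveP => //; exists 1; first exact: Gamma2_one.
rewrite sprin1 sprodr1; last exact: sprod_sub.
rewrite E !fpush_prod -!epush_fpush class_comul epush_prod !fpush_prin Gamma_comul //.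
by rewrite -sprinM sprodACA.
Qed.

End PrimitiveClasses.

(** * The torsor of a lattice *)

Section ContractDual.
Variables (R : comPzRingType) (G : gscheme R) (X : algebra R).
Notation AA := (cdual G).

(** The second factor is evaluated at the functional a. These contractions separate elements
    ([contr_inj]), so a coaction can be handled as an action of the dual. *)
Definition contr (a : AA) : X \*A G -> X := copair (fun x : X => x) (dstrapp X a).

Lemma contr_rlinear a : rlinear (contr a).
Proof. exact: (copair_rlinear (rlinear_id X) (dstrapp_rlinear X a)). Qed.

Lemma contrE a x g : contr a (aT x g) = x * alg_str X (dapp a g).
Proof. exact: (copairE _ _ (rlinear_id X) (dstrapp_rlinear X a)). Qed.

Variables (n : nat) (e : 'I_n -> G) (phi : 'I_n -> AA).
Hypothesis dualP : forall b, b = \sum_i alg_str G (dapp (phi i) b) * e i.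

Lemma contr_expand w : w = \sum_m aT (contr (phi m) w) (e m).
Proof.
move: w; apply: rlinear_ext; first exact: rlinear_id.
  split=> [x y|r x].
    rewrite -big_split; apply: eq_bigr => m _.
    by rewrite (rlinearD (contr_rlinear _)) (balancedDl (@aT_balanced R X G)).
  rewrite mulr_sumr; apply: eq_bigr => m _.
  by rewrite (rlinearZ (contr_rlinear _)) -[alg_str (X \*A G) r]/(aT _ 1) aTM mul1r.
move=> x g; transitivity (tinl X G x * tinr X G (\sum_i alg_str G (dapp (phi i) g) * e i)).
  by rewrite -dualP -[RHS]/(aT x 1 * aT 1 g) aTM mulr1 mul1r.
rewrite rmorph_sum mulr_sumr; apply: eq_bigr => m _.
rewrite contrE rmorphM alghom_str mulrCA mulrA -[alg_str (X \*A G) _]/(aT _ 1).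
by rewrite -[tinl X G x]/(aT x 1) -[tinr X G _]/(aT 1 _) !aTM !mulr1 mul1r mulrC.
Qed.

Lemma contr_inj w w' : (forall a, contr a w = contr a w') -> w = w'.
Proof. by move=> E; rewrite [w]contr_expand [w']contr_expand; apply: eq_bigr => m _; rewrite E. Qed.

Lemma contrl_rlinear w : rlinear (fun a => contr a w).
Proof.
split=> [a b|r a].
  move: w; apply: rlinear_ext; first exact: contr_rlinear.
    have [ha hb] := (contr_rlinear a, contr_rlinear b).
    split=> [x y|r x]; first by rewrite (rlinearD ha) (rlinearD hb) addrACA.
    by rewrite (rlinearZ ha) (rlinearZ hb) mulrDr.
  by move=> x g; rewrite !contrE dappD rmorphD mulrDr.
move: w; apply: rlinear_ext; first exact: contr_rlinear.
  exact/rlinear_mull/contr_rlinear.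
by move=> x g; rewrite !contrE dstrM dappZ rmorphM mulrCA.
Qed.

Lemma contr_mul a w w' : contr a (w * w') =
  copair (fun b => contr b w) (fun b => contr b w') (dcomul G a).
Proof.
move: w; apply: rlinear_ext.
- exact: (rlinear_compose (rlinear_mulr _ (rlinear_id (X \*A G))) (contr_rlinear a)).
- elim/atensor_ind: (dcomul G a) => [|b c t [IH1 IH2]].
    by split=> *; rewrite !copair0 ?addr0 ?mulr0 //; apply: contrl_rlinear.
  have E w : copair (fun b => contr b w) (fun b => contr b w') (aT b c + t) =
      contr b w * contr c w' + copair (fun b => contr b w) (fun b => contr b w') t.
    by rewrite copairD ?copairE //; apply: contrl_rlinear.
  split=> [x y|r x]; rewrite !E.
    by rewrite IH1 (rlinearD (contr_rlinear b)) mulrDl addrACA.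
  by rewrite IH2 (rlinearZ (contr_rlinear b)) -mulrA mulrDr.
move=> x g; move: w'; apply: rlinear_ext.
- exact: (rlinear_compose (rlinear_mull _ (rlinear_id (X \*A G))) (contr_rlinear a)).
- elim/atensor_ind: (dcomul G a) => [|b c t [IH1 IH2]].
    by split=> *; rewrite !copair0 ?addr0 ?mulr0 //; apply: contrl_rlinear.
  have E w : copair (fun b => contr b (aT x g)) (fun b => contr b w) (aT b c + t) =
      contr b (aT x g) * contr c w + copair (fun b => contr b (aT x g)) (fun b => contr b w) t.
    by rewrite copairD ?copairE //; apply: contrl_rlinear.
  split=> [y z|r y]; rewrite !E.
    by rewrite IH1 (rlinearD (contr_rlinear c)) mulrDr addrACA.
  by rewrite IH2 (rlinearZ (contr_rlinear c)) mulrDr mulrCA.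
move=> y h; rewrite aTM contrE -[dapp a _]dcomulE -[dcomul_fun a]/(dcomul G a).
have hx w : rlinear (fun b => contr b w) := contrl_rlinear w.
elim/atensor_ind: (dcomul G a) => [|b c t IH].
  by rewrite (rlinear0 (dpair_rlinear _ _)) rmorph0 mulr0 copair0.
by rewrite dpairD rmorphD mulrDr IH copairD // copairE // dpairE !contrE rmorphM mulrACA.
Qed.

End ContractDual.

(** * From an algebra with an action of the dual to a space with an action of G *)

Section ModuleAlgebra.
Variables (R : comPzRingType) (G : gscheme R) (X : algebra R).
Notation AA := (cdual G).
Variables (n : nat) (e : 'I_n -> G) (phi : 'I_n -> AA).
Hypothesis dualP : forall b, b = \sum_i alg_str G (dapp (phi i) b) * e i.
Variable act : AA -> X -> X.
Hypothesis act_rlinear : forall a, rlinear (act a).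
Hypothesis actl_rlinear : forall x, rlinear (act^~ x).
Hypothesis actA : forall a b x, act a (act b x) = act (a * b) x.
Hypothesis act1 : forall x, act 1 x = x.
Hypothesis actM : forall a x y, act a (x * y) = copair (act^~ x) (act^~ y) (dcomul G a).
Hypothesis act_one : forall a, act a 1 = alg_str X (dapp a 1).

(** By [contr_inj], the only element whose contraction with every a is a x. *)
Definition sact_fun (x : X) : X \*A G := \sum_m aT (act (phi m) x) (e m).

Lemma act_sum a x : act a x = \sum_m alg_str X (dapp a (e m)) * act (phi m) x.
Proof.
rewrite {1}[a](dual_sum dualP) (rlinear_sum _ _ (actl_rlinear x)).
by apply: eq_bigr => m _; rewrite (rlinearZ (actl_rlinear x)).
Qed.

Lemma contr_sact a x : contr a (sact_fun x) = act a x.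
Proof.
rewrite (rlinear_sum _ _ (contr_rlinear X a)) act_sum.
by apply: eq_bigr => m _; rewrite contrE mulrC.
Qed.

Lemma sact_fun_add : zmod_morphism sact_fun.
Proof.
move=> x y; apply/eqP; rewrite eq_sym subr_eq; apply/eqP/(contr_inj dualP) => a.
by rewrite (rlinearD (contr_rlinear X a)) !contr_sact -(rlinearD (act_rlinear a)) subrK.
Qed.

Lemma sact_fun_mul : monoid_morphism sact_fun.
Proof.
split=> [|x y]; apply: (contr_inj dualP) => a.
  by rewrite contr_sact act_one -[RHS]/(contr a (aT 1 1)) contrE mul1r.
rewrite contr_sact actM contr_mul; apply: copair_ext => b; exact/esym/contr_sact.
Qed.

Definition sact_rmorph : {rmorphism X -> X \*A G} :=
  HB.pack sact_fun (GRing.isZmodMorphism.Build _ _ sact_fun sact_fun_add)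
    (GRing.isMonoidMorphism.Build _ _ sact_fun sact_fun_mul).

Lemma sact_fun_str r : sact_rmorph (alg_str X r) = alg_str (X \*A G) r.
Proof.
apply: (contr_inj dualP) => a; rewrite [LHS]contr_sact -[alg_str X r]mulr1 (rlinearZ (act_rlinear a)).
by rewrite act_one -[alg_str (X \*A G) r]/(aT (alg_str X r) 1) contrE.
Qed.

Definition sact_hom : alghom X (X \*A G) := AlgHom sact_fun_str.

(** Both sides are expanded over the basis. They agree because the coefficients of phi_m e_p on the
    e_l are the values of the products phi_l phi_m at e_p ([dapp_co]). *)
Lemma sact_hom_assoc x : aassoc X G G (amap sact_hom (aid G) (sact_hom x)) =
  amap (aid X) (gmul G) (sact_hom x).
Proof.
have E c : sact_hom c = \sum_m aT (act (phi m) c) (e m) by [].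
rewrite !E (rmorph_sum (amap sact_hom (aid G))) (rmorph_sum (aassoc X G G)).
rewrite (rmorph_sum (amap (aid X) (gmul G))).
pose iX := tinl X (G \*A G); pose i := acomp (tinr X (G \*A G)) (tinl G G).
pose i' := acomp (tinr X (G \*A G)) (tinr G G).
have iE y g g' : iX y * (i g * i' g') = aT y (aT g g' : G \*A G).
  rewrite -[iX y]/(aT y 1) -[i g]/(@aT R X (G \*A G) 1 (aT g 1)) -[i' g']/(@aT R X (G \*A G) 1 (aT 1 g')).
  by rewrite !aTM !mulr1 !mul1r.
transitivity (\sum_m (\sum_l iX (act (phi l * phi m) x) * i (e l)) * i' (e m)).
  apply: eq_bigr => m _; rewrite amapE E.
  have -> : @aT R (X \*A G) G (\sum_l aT (act (phi l) (act (phi m) x)) (e l)) (aid G (e m)) =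
    \sum_l @aT R (X \*A G) G (aT (act (phi l) (act (phi m) x)) (e l)) (e m).
    apply: (big_morph (fun z : X \*A G => @aT R (X \*A G) G z (e m))) => [u v|].
      exact: (balancedDl (@aT_balanced R (X \*A G) G)).
    exact: (balanced0l _ (@aT_balanced R (X \*A G) G)).
  rewrite (rmorph_sum (aassoc X G G)) mulr_suml; apply: eq_bigr => l _; rewrite actA.
  rewrite [LHS]acopairE acopairE.
  by [].
transitivity (\sum_m (\sum_p iX (act (phi p) x) * i (co (phi m) (e p))) * i' (e m)).
  apply: eq_bigr => m _; congr (_ * _).
  transitivity (\sum_l \sum_p alg_str _ (dapp (phi l) (co (phi m) (e p))) * (iX (act (phi p) x) * i (e l))).
    apply: eq_bigr => l _; rewrite act_sum (rmorph_sum iX) mulr_suml; apply: eq_bigr => p _.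
    by rewrite rmorphM alghom_str mulrA dapp_co.
  rewrite exchange_big; apply: eq_bigr => p _.
  rewrite [co _ _ in RHS]dualP. rewrite (rmorph_sum i) mulr_sumr; apply: eq_bigr => l _.
  by rewrite rmorphM alghom_str mulrCA.
under eq_bigr do rewrite mulr_suml.
rewrite exchange_big; apply: eq_bigr => p _.
rewrite amapE; transitivity (iX (act (phi p) x) * tinr X (G \*A G) (gmul G (e p))); last first.
  by rewrite -[iX _]/(aT _ 1) -[tinr _ _ _]/(aT 1 _) aTM mul1r mulr1.
under eq_bigr do rewrite -mulrA.
rewrite -mulr_sumr; congr (_ * _).
rewrite [gmul G (e p)](contr_expand dualP) (rmorph_sum (tinr X (G \*A G))); apply: eq_bigr => m _.
rewrite -[contr _ _]/(co (phi m) (e p)).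
rewrite -[LHS]/(tinr X (G \*A G) (aT (co (phi m) (e p)) 1) * tinr X (G \*A G) (aT 1 (e m))).
by rewrite -rmorphM aTM mulr1 mul1r.
Qed.

Lemma sact_hom_unit x : acopair (aid X) (acomp (astr X) (gone G)) (sact_hom x) = x.
Proof. by rewrite -[RHS]act1 -contr_sact; apply: copair_ext. Qed.

Definition action_space : gspace G := GSpace sact_hom_assoc sact_hom_unit.

Lemma coact_action a (x : X) : coact (X := action_space) a x = act a x.
Proof. exact: contr_sact. Qed.

End ModuleAlgebra.

(** * A criterion for faithful flatness *)

Section FlatCriterion.
Variables (R : comPzRingType) (X : algebra R).
Notation k := (base_algebra R).
Notation psi := (alg_str X).
Variables (K : finType) (x : K -> X) (nu : K -> X -> k).
Hypothesis hnu : forall i, rlinear (nu i).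
Hypothesis xE : forall b, b = \sum_i psi (nu i b) * x i.
Variable nu0 : X -> k.
Hypotheses (hnu0 : rlinear nu0) (nu01 : nu0 1 = 1).

Lemma slice_balanced (f : X -> k) (hf : rlinear f) (L : lmodType R) :
  balanced ((fun t y => f t *: y) : restr psi X^o -> L -> L).
Proof.
split=> [s t y|t y z|r t y].
- by rewrite (rlinearD hf) scalerDl.
- exact: scalerDr.
- by rewrite -[r *: t]/(psi r * t) (rlinearZ hf) -scalerA scalerA mulrC -scalerA.
Qed.

(** The map f (x) 1 from O_X (x) L to L. The slices by the nu_i recover an element and so preserve
    exactness; the slice by nu0 is a retraction of L -> O_X (x) L and so reflects it. *)
Definition slice (f : X -> k) (L : lmodType R) (z : bc psi L) : L :=
  tlift ((fun t y => f t *: y) : restr psi X^o -> L -> L) z.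

Section Slice.
Variables (f : X -> k) (hf : rlinear f).

Lemma sliceE (L : lmodType R) t (y : L) : slice f (bT psi t y) = f t *: y.
Proof. exact/tliftE/slice_balanced. Qed.

Lemma slice0 (L : lmodType R) : slice f (0 : bc psi L) = 0.
Proof. exact/tlift0/slice_balanced. Qed.

Lemma sliceD (L : lmodType R) (y z : bc psi L) : slice f (y + z) = slice f y + slice f z.
Proof. exact/tliftD/slice_balanced. Qed.

Lemma slice_map (L L' : lmodType R) (u : {linear L -> L'}) z :
  slice f (bcmap psi u z) = u (slice f z).
Proof.
elim/bc_ind: z => [|t y z IH]; first by rewrite linear0 !slice0 linear0.
by rewrite linearD !sliceD linearD IH bcmapE !sliceE linZ.
Qed.

End Slice.

Lemma slice_expand (L : lmodType R) (z : bc psi L) : z = \sum_i bT psi (x i) (slice (nu i) z).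
Proof.
elim/bc_ind: z => [|t y z IH].
  by rewrite big1 // => i _; rewrite slice0 // bT0.
transitivity (\sum_i bT psi (x i) (nu i t *: y) + \sum_i bT psi (x i) (slice (nu i) z)).
  rewrite -IH; congr (_ + _).
  rewrite {1}[t]xE.
  transitivity (\sum_i bT psi (psi (nu i t) * x i) y).
    apply: (big_morph (fun s => bT psi s y)) => [u v|]; first exact: bTDl.
    exact: (balanced0l _ (@bT_balanced _ _ psi L)).
  by apply: eq_bigr => i _; rewrite bTZ.
rewrite -big_split; apply: eq_bigr => i _; rewrite (sliceD (hnu i)) (sliceE (hnu i)).
exact/esym/bTDr.
Qed.

Lemma flat_criterion : faithfully_flat psi.
Proof.
move=> L M N u v; split=> E y; split.
- move=> vy.
  have /choice [w wE] i : exists w, u w = slice (nu i) y.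
    by apply/(E _).1; rewrite -slice_map // vy slice0.
  exists (\sum_i bT psi (x i) (w i)); rewrite linear_sum [RHS]slice_expand.
  by apply: eq_bigr => i _; rewrite bcmapE wE.
- move=> [z <-]; elim/bc_ind: z => [|t z z' IH]; first by rewrite !linear0.
  by rewrite !linearD IH !bcmapE (E _).2 ?bT0 ?addr0 //; exists z.
- move=> vy; have [|z zE] := (E (bT psi 1 y)).1; first by rewrite bcmapE vy bT0.
  by exists (slice nu0 z); rewrite -slice_map // zE sliceE // nu01 scale1r.
- move=> [z <-]; have : slice nu0 (bcmap psi v (bT psi 1 (u z))) = slice nu0 0.
    by congr slice; apply/E; exists (bT psi 1 z); rewrite bcmapE.
  by rewrite bcmapE sliceE // nu01 scale1r slice0.
Qed.

End FlatCriterion.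

(** * The counit of the dual *)

Section Counit.
Variables (R : comPzRingType) (G : gscheme R).
Notation AA := (cdual G).
Notation A2 := (AA \*A AA).
Notation k := (base_algebra R).

Definition dcounit_fun (a : AA) : R := dapp a 1.
Lemma dcounit_add : zmod_morphism dcounit_fun. Proof. by []. Qed.
Lemma dcounit_mul : monoid_morphism dcounit_fun.
Proof.
split=> [|a b]; first exact: rmorph1 (gone G).
rewrite /dcounit_fun convE rmorph1 -[1 in LHS]/(aT 1 1) copairE //; exact: dapp_rlinear.
Qed.
Definition dcounit_rmorph : {rmorphism AA -> k} :=
  HB.pack dcounit_fun (GRing.isZmodMorphism.Build _ _ dcounit_fun dcounit_add)
    (GRing.isMonoidMorphism.Build _ _ dcounit_fun dcounit_mul).
Lemma dcounit_str r : dcounit_rmorph (alg_str AA r) = alg_str k r.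
Proof. by rewrite -[LHS]/(r * gone G 1) rmorph1 mulr1. Qed.
Definition dcounit : alghom AA k := AlgHom dcounit_str.
(** The counit followed by the structure map, so that [acopair] can combine it with the identity
    into eps (x) 1 and 1 (x) eps. *)
Definition aug : alghom AA AA := acomp (astr AA) dcounit.

Lemma augE a : aug a = alg_str AA (dapp a 1). Proof. by []. Qed.

Lemma dapp_augl w h : dapp (acopair aug (aid AA) w) h = Defs.dpair w 1 h.
Proof.
elim/atensor_ind: w => [|a b w IH]; first by rewrite rmorph0 (rlinear0 (dpair_rlinear _ _)).
by rewrite rmorphD dappD dpairD IH acopairE dpairE augE dstrM dappZ.
Qed.

Lemma dapp_augr w h : dapp (acopair (aid AA) aug w) h = Defs.dpair w h 1.
Proof.
elim/atensor_ind: w => [|a b w IH]; first by rewrite rmorph0 (rlinear0 (dpair_rlinear _ _)).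
by rewrite rmorphD dappD dpairD IH acopairE dpairE augE mulrC dstrM dappZ mulrC.
Qed.

Lemma augl_comul a : acopair aug (aid AA) (dcomul G a) = a.
Proof. by apply: dappP => h; rewrite dapp_augl -[dcomul G a]/(dcomul_fun a) dcomulE mul1r. Qed.

Lemma augr_comul a : acopair (aid AA) aug (dcomul G a) = a.
Proof. by apply: dappP => h; rewrite dapp_augr -[dcomul G a]/(dcomul_fun a) dcomulE mulr1. Qed.

(* a (x) b = sum Delta(a1) (1 (x) S(a2) b) *)
Lemma comul_span (c : A2) : exists s : seq (AA * AA), c = \sum_(p <- s) dcomul G p.1 * tinr AA AA p.2.
Proof.
elim/atensor_ind: c => [|a b c [s ->]]; first by exists [::]; rewrite big_nil.
have [u uE] := atensor_sum (dcomul G a).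
exists ([seq (p.1, dS p.2 * b) | p <- u] ++ s); rewrite big_cat big_map; congr (_ + _).
suff -> : aT a b = (\sum_(p <- u) dcomul G p.1 * tinr AA AA (dS p.2)) * tinr AA AA b.
  by rewrite mulr_suml; apply: eq_bigr => p _; rewrite rmorphM mulrA.
have -> : aT a b = tinl AA AA a * tinr AA AA b by rewrite -[RHS]/(aT a 1 * aT 1 b) aTM mulr1 mul1r.
congr (_ * _); apply: dpair_inj => h h'; rewrite dpairE (rlinear_sum _ _ (dpair_rlinear h h')).
transitivity (dapp (\sum_(p <- u) dtrans p.1 h * dS p.2) h').
  by rewrite (antipode_sum uE) dapp_str.
rewrite dapp_sum; apply: eq_bigr => p _.
have sh w : Defs.dpair (w * tinr AA AA (dS p.2)) h h' = Defs.dpair w h (co (dS p.2) h').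
  elim/atensor_ind: w => [|f g w IH]; first by rewrite mul0r !(rlinear0 (dpair_rlinear _ _)).
  rewrite mulrDl !dpairD IH; congr (_ + _).
  by rewrite -[tinr _ _ _]/(aT 1 _) aTM mulr1 !dpairE dapp_co.
by rewrite sh -[dcomul G p.1]/(dcomul_fun p.1) dcomulE -dapp_co mkdualE.
Qed.

End Counit.

Lemma sprod_sum (S T : comPzRingType) (phi : {rmorphism S -> T}) (I J : T -> Prop) t :
  @is_sub _ _ phi T^o I -> sprod phi I J t -> exists n (i j : 'I_n -> T),
    [/\ forall m, I (i m), forall m, J (j m) & t = \sum_m i m * j m].
Proof.
move=> hI; elim=> [|s _ z [a [b [Ia Jb ->]]] _ [n [i [j [hi hj ->]]]]].
  by exists 0%N, (fun=> 0), (fun=> 0); split=> [[]//|[]//|]; rewrite big_ord0.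
exists n.+1, (fun m => oapp i (phi s * a) (unlift ord0 m)), (fun m => oapp j b (unlift ord0 m)).
split=> [m|m|]; try by case: unliftP => [m' _|_] //=; apply: isubM.
rewrite big_ord_recl unlift_none -[phi s *: _]/(phi s * (a * b)) mulrA; congr (_ + _).
by apply: eq_bigr => m _; rewrite liftK.
Qed.

Section TensorPairing.
Variables (R : comPzRingType) (G : gscheme R) (Lam P Q : algebra R).
Notation AA := (cdual G).
Notation A2 := (AA \*A AA).
Notation HL := (G \*A Lam).
Variables (u : P -> HL) (v : Q -> HL).

(** Extends [pr2] from pairs to tensors: elements of X (x) X or of O_G (x) O_G are thereby tested
    against A (x) A (x) Lam. *)
Definition tpr (z : A2 \*A Lam) (w : P \*A Q) : Lam :=
  tlift ((fun x y => pr2 z (u x) (v y)) : amod P -> amod Q -> Lam) w.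

Lemma tpr0 w : tpr 0 w = 0.
Proof. by rewrite /tpr /tlift /tsum big1 // => p _; rewrite (llin0 (pr2_llin _ _)). Qed.

Lemma tprD z z' w : tpr (z + z') w = tpr z w + tpr z' w.
Proof.
by rewrite /tpr /tlift /tsum -big_split; apply: eq_bigr => p _; rewrite (pr2_llin _ _).1.
Qed.

Lemma tpr_prod s t w : tpr (amap (tinl AA AA) (aid Lam) s * amap (tinr AA AA) (aid Lam) t) w =
  copair (fun x => pr s (u x)) (fun y => pr t (v y)) w.
Proof. by apply: tlift_ext => x y; apply: pr2_prod. Qed.

Lemma tpr_comul s b w : tpr (amap (dcomul G) (aid Lam) s * aT (tinr AA AA b) 1) w =
  pr s (copair u (fun y => coactL b (v y)) w).
Proof.
rewrite /tpr /copair /tlift /tsum (llin_sum _ _ (pr_llinr s)).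
by apply: eq_bigr => p _; rewrite pr2_shift pr2_dcomul.
Qed.

End TensorPairing.

(** * The torsor attached to an invertible lattice *)

Section TwistedForm.
Variables (R : comPzRingType) (G : gscheme R) (Lam : algebra R).
Hypothesis strI : injective (alg_str Lam).
Notation AA := (cdual G).
Notation A2 := (AA \*A AA).
Notation k := (base_algebra R).
Notation AL := (AA \*A Lam).
Notation HL := (G \*A Lam).
Notation str := (alg_str Lam).
Notation phi := (tinl AA Lam).
Notation phi2 := (tinl A2 Lam).
Notation i1 := (amap (tinl AA AA) (aid Lam)).
Notation i2 := (amap (tinr AA AA) (aid Lam)).
Notation dL := (amap (dcomul G) (aid Lam)).
Variables I J : AL -> Prop.
Hypothesis hI : @is_sub _ _ phi AL^o I.
Hypothesis hJ : @is_sub _ _ phi AL^o J.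
Hypothesis IJ : sprod phi I J = sunit phi.
Hypothesis comulJ : fpush (dcomul G) J =
  sprod phi2 (fpush (tinl AA AA) J) (fpush (tinr AA AA) J).

(** Applying eps (x) 1 to the identity for Delta(J) gives J = eps(J) J, and J can be cancelled. *)
Lemma fpush_aug : fpush (aug G) J = sunit phi.
Proof.
have E1 : fpush (acopair (aug G) (aid AA)) (fpush (dcomul G) J) = J.
  rewrite (@fpush_comp _ _ _ _ _ _ _ (aid AA)); last exact: augl_comul.
  exact: fpush_id.
have E2 : fpush (acopair (aug G) (aid AA)) (fpush (tinl AA AA) J) = fpush (aug G) J.
  by apply: fpush_comp => a; rewrite -[tinl _ _ a]/(aT a 1) acopairE rmorph1 mulr1.
have E3 : fpush (acopair (aug G) (aid AA)) (fpush (tinr AA AA) J) = J.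
  rewrite (@fpush_comp _ _ _ _ _ _ _ (aid AA)).
    exact: fpush_id.
  by move=> a; rewrite -[tinr _ _ a]/(aT 1 a) acopairE rmorph1 mul1r.
move: E1; rewrite comulJ fpush_prod E2 E3 => E.
rewrite -[LHS](@sprodr1 _ _ phi); last exact: fpush_sub.
by rewrite -[in LHS]IJ [sprod phi I J]sprodC sprodA E sprodC.
Qed.

Lemma ev_one1 l (t : AL) : ev (aT 1 l * t) 1 = l * ev t 1.
Proof. exact: (@ev_llin _ G Lam 1).2. Qed.

Lemma amap_aug s : amap (aug G) (aid Lam) s = aT 1 (ev s 1).
Proof.
move: s; apply: (@llin_ext _ _ _ _ (tinr AA Lam)) => [||a].
- exact: amap_llin.
- split=> [x y|l x]; rewrite ?ev_one1 ?(@ev_llin _ G Lam 1).1.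
    exact: (balancedDr (@aT_balanced R AA Lam)).
  by rewrite -[tinr _ _ l]/(aT 1 l) aTM mul1r.
by rewrite amapE ev1 -(@aT_str R AA Lam).
Qed.

Lemma ev_unit1 l : ev (aT 1 l : AL) 1 = l.
Proof. by rewrite aT_split ev_one1 ev1 -[dapp 1 1]/(gone G 1) !rmorph1 mulr1. Qed.

Lemma J_counit s : J s -> exists r, ev s 1 = str r.
Proof.
move=> Js; have : sunit phi (aT 1 (ev s 1)).
  by rewrite -amap_aug -fpush_aug; apply: (spush_in phi (amap (aug G) (aid Lam))).
by move=> [a aE]; exists (dapp a 1); rewrite -[LHS]ev_unit1 aE -ev1.
Qed.

(** Such an s is a functional with value 1 at 1; it splits R -> [twist], as faithful flatness
    requires. *)
Lemma J_counit1 : exists2 s, J s & ev s 1 = 1.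
Proof.
have : fpush (aug G) J 1 by rewrite fpush_aug; apply: sunit1.
suff H t : fpush (aug G) J t -> exists2 s, J s & ev s 1 = ev t 1.
  by move=> /H [s Js sE]; exists s => //; rewrite sE ev_one /ceps !rmorph1.
elim=> [|a _ z [s Js ->] _ [s' Js' sE']].
  by exists 0; [exact: (sub0 hJ)|].
exists (phi (alg_str AA (dapp a 1)) * s + s').
  by apply: (subD hJ) => //; apply: (subZ hJ).
have -> : phi (alg_str AA (dapp a 1)) = aT 1 (str (dapp a 1)) by exact: (@aT_str R AA Lam).
rewrite !(@ev_llin _ G Lam 1).1 ev_one1 sE'; congr (_ + _).
rewrite amap_aug -[phi a *: _]/(aT a 1 * aT 1 (ev s 1)) aTM mulr1 mul1r.
by rewrite aT_split ev_one1 ev1 mulrC.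
Qed.

(** The span of the products i1 s i2 s' is Delta(J) A2, and A2 is spanned by the Delta(a) (1 (x) b)
    by [comul_span], where the factor a is absorbed in J. The interest of the elements Delta(t) (1
    (x) b) is that pairing with them factors through the shear. *)
Lemma comul_ind (K : A2 \*A Lam -> Prop) : K 0 -> (forall z w, K z -> K w -> K (z + w)) ->
  (forall s b, J s -> K (dL s * aT (tinr AA AA b) 1)) ->
  forall s s', J s -> J s' -> K (i1 s * i2 s').
Proof.
move=> K0 KD KJ s s' Js Js'.
have : fpush (dcomul G) J (i1 s * i2 s').
  rewrite comulJ; apply: sprod_in.
    exact: (spush_in phi2 i1).
  exact: (spush_in phi2 i2).
elim=> [//|c _ z [t Jt ->] _ Kz]; apply: (KD _ _ _ Kz).
have [u uE] := comul_span c.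
rewrite -[_ *: _]/(phi2 c * dL t).
have -> : phi2 c * dL t = \sum_(p <- u) dL (phi p.1 * t) * aT (tinr AA AA p.2) 1.
  rewrite uE rmorph_sum mulr_suml; apply: eq_bigr => p _.
  by rewrite !rmorphM fpush_comm -[phi2 (tinr _ _ _)]/(aT _ 1) mulrAC.
elim: u {uE} => [|p u IH]; first by rewrite big_nil.
by rewrite big_cons; apply: (KD _ _ _ IH); apply: KJ; apply: (subZ hJ).
Qed.

Definition twist_pred : {pred HL} := fun y => `[< forall s, J s -> exists r, pr s y = str r >].

Lemma pr_one (s : AL) : pr s 1 = ev s 1. Proof. exact: pr1. Qed.

Lemma twist_coact a y : y \in twist_pred -> coactL a y \in twist_pred.
Proof.
move=> /asboolP hy; apply/asboolP => s Js; rewrite pr_coactL mulrC.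
by apply: hy; apply: (subZ hJ).
Qed.

(** The value of s at y y' is that of Delta(s) at (y, y'), and Delta(s) lies in the A2-span of the
    products of two elements of J. The coefficients in A2 may be moved onto y and y', which stay in
    the lattice. *)
Lemma twist_mul y y' : y \in twist_pred -> y' \in twist_pred -> y * y' \in twist_pred.
Proof.
move=> hy hy'; apply/asboolP => s Js; rewrite -pr2_dcomul.
have : sprod phi2 (fpush (tinl AA AA) J) (fpush (tinr AA AA) J) (dL s).
  by rewrite -comulJ; apply: (spush_in phi2 dL).
pose K z := forall y y', y \in twist_pred -> y' \in twist_pred ->
  exists r, pr2 z y y' = str r.
suff H z : sprod phi2 (fpush (tinl AA AA) J) (fpush (tinr AA AA) J) z -> K z.
  by move=> /H; apply.
have Ksub : @is_sub _ _ phi2 (A2 \*A Lam)^o K.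
  clear z; split=> [x x' hx hx'|z w Kz Kw x x' hx hx'|c z Kz x x' hx hx'].
  - by exists 0; rewrite rmorph0 (llin0 (pr2_llin _ _)).
  - have [[r rE] [r' rE']] := (Kz _ _ hx hx', Kw _ _ hx hx').
    by exists (r + r'); rewrite rmorphD (pr2_llin _ _).1 rE rE'.
  - rewrite -[phi2 c *: z]/(phi2 c * z) mulrC.
    elim/atensor_ind: c => [|a b c [r rE]].
      by exists 0; rewrite !rmorph0 mulr0 (llin0 (pr2_llin _ _)).
    have [r' rE'] := Kz _ _ (twist_coact a hx) (twist_coact b hx').
    exists (r' + r); rewrite (rmorphD phi2) mulrDr (pr2_llin _ _).1 rE (rmorphD str); congr (_ + _).
    rewrite -rE' -pr2_shift -pr2_shiftl -mulrA; congr (pr2 (z * _) _ _).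
    by rewrite -[tinr _ _ b]/(aT 1 b) -[tinl _ _ a]/(aT a 1) !aTM !mulr1 mul1r.
apply: sprod_least => // a b Ja; move: b; apply: spush_least; first exact: mul_sub.
move=> t Jt; rewrite mulrC; move: a Ja; apply: spush_least; first exact: mul_sub.
move=> u Ju; rewrite mulrC => x x' /asboolP hx /asboolP hx'.
have [[r rE] [r' rE']] := (hx _ Ju, hx' _ Jt).
by exists (r * r'); rewrite rmorphM pr2_prod rE rE'.
Qed.

Lemma twist_pred_closed : subring_closed twist_pred.
Proof.
split; last exact: twist_mul.
  by apply/asboolP => s /J_counit; rewrite pr_one.
move=> x y /asboolP hx /asboolP hy; apply/asboolP => s Js.
have [[r rE] [r' rE']] := (hx _ Js, hy _ Js).
exists (r - r'); rewrite rmorphB -rE -rE'; apply/eqP; rewrite eq_sym subr_eq.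
by rewrite -prD subrK.
Qed.

Record twist_type := TwistType { twist_val : HL; twist_valP : twist_val \in twist_pred }.
HB.instance Definition _ := [isSub for twist_val].
HB.instance Definition _ := [Choice of twist_type by <:].
HB.instance Definition _ := 
  GRing.SubChoice_isSubComPzRing.Build HL twist_pred twist_type twist_pred_closed.

Lemma twist_str_in r : alg_str HL r \in twist_pred.
Proof.
apply/asboolP => s /J_counit [r' rE]; exists (r * r').
by rewrite -[alg_str HL r]mulr1 pr_str pr_one rE rmorphM.
Qed.

Definition twist_str_fun (r : R) : twist_type := TwistType (twist_str_in r).
Lemma twist_str_add : zmod_morphism twist_str_fun.
Proof. by move=> x y; apply: val_inj; rewrite [RHS]rmorphB -[LHS]/(alg_str HL (x - y)) rmorphB. Qed.
Lemma twist_str_mul : monoid_morphism twist_str_fun.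
Proof.
split=> [|x y]; apply: val_inj.
  by rewrite [RHS]rmorph1 -[LHS]/(alg_str HL 1) rmorph1.
by rewrite [RHS]rmorphM -[LHS]/(alg_str HL (x * y)) rmorphM.
Qed.
Definition twist_str : {rmorphism R -> twist_type} :=
  HB.pack twist_str_fun (GRing.isZmodMorphism.Build _ _ twist_str_fun twist_str_add)
    (GRing.isMonoidMorphism.Build _ _ twist_str_fun twist_str_mul).

Definition twist : algebra R := Algebra twist_str.

Definition tincl : alghom twist HL :=
  AlgHom (A := twist) (B := HL) (alghom_fun := (val : {rmorphism twist_type -> HL}))
    (fun=> erefl).

Lemma tincl_inj : injective tincl. Proof. exact: val_inj. Qed.
Lemma tinclP (x : twist) s : J s -> exists r, pr s (tincl x) = str r.
Proof. by move=> Js; have /asboolP := twist_valP x; apply. Qed.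

Definition twist_act (a : AA) (x : twist) : twist := TwistType (twist_coact a (twist_valP x)).
Lemma tincl_act a x : tincl (twist_act a x) = coactL a (tincl x). Proof. by []. Qed.

Lemma coactL_mul a b (y : HL) : coactL a (coactL b y) = coactL (a * b) y.
Proof.
rewrite -!(@actL1 _ _ Lam) -actL_mul; congr (actL _ _).
by rewrite aTM mulr1.
Qed.

Lemma coactL_one a : coactL a (1 : HL) = alg_str HL (dapp a 1).
Proof.
rewrite -[1]/(@aT R G Lam 1 1) coactL1 coE /cv rmorph1 -[X in copair _ _ X]/(@aT R G G 1 1).
rewrite copairE ?mul1r //; exact: dstrapp_rlinear.
Qed.

Lemma coactL_prod a (y z : HL) :
  coactL a (y * z) = copair (fun b => coactL b y) (fun b => coactL b z) (dcomul G a).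
Proof.
have hy := coactL_rlinearl y; have hz := coactL_rlinearl z.
apply: pr_injr => t.
have E (w : A2) : pr t (copair (fun b => coactL b y) (fun b => coactL b z) w) =
    pr2 (dL t * aT w 1) y z.
  elim/atensor_ind: w => [|b c w IH].
    rewrite copair0 // (llin0 (pr_llinr _)) (balanced0l _ (@aT_balanced R A2 Lam)) mulr0.
    by rewrite (llin0 (pr2_llin _ _)).
  rewrite copairD // prD IH (balancedDl (@aT_balanced R A2 Lam)) mulrDr.
  rewrite (pr2_llin _ _).1 copairE //; congr (_ + _).
  rewrite -pr2_dcomul -pr2_shift -pr2_shiftl -mulrA; congr (pr2 (_ * _) _ _).
  rewrite -[tinr _ _ c]/(aT 1 c) -[tinl _ _ b]/(aT b 1) aTM mulr1 aTM !mulr1 mul1r.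
  by [].
by rewrite E pr_coactL -pr2_dcomul rmorphM amapE rmorph1.
Qed.

Section Basis.
Variables (n : nat) (e : 'I_n -> G) (phi0 : 'I_n -> AA).
Hypothesis dualP : forall b, b = \sum_i alg_str G (dapp (phi0 i) b) * e i.

Lemma twist_act_rlinear a : rlinear (twist_act a).
Proof.
split=> [x y|r x]; apply: tincl_inj; rewrite !tincl_act.
  by rewrite !rmorphD !tincl_act (coactL_llin Lam a).1.
by rewrite !rmorphM !alghom_str tincl_act (rlinearZ (llin_rlinear (coactL_llin Lam a))).
Qed.

Lemma twist_actl_rlinear x : rlinear (twist_act^~ x).
Proof.
have hc := coactL_rlinearl (tincl x).
split=> [a b|r a]; apply: tincl_inj; first by rewrite rmorphD !tincl_act (rlinearD hc).
by rewrite rmorphM alghom_str !tincl_act (rlinearZ hc).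
Qed.

Lemma twist_actA a b x : twist_act a (twist_act b x) = twist_act (a * b) x.
Proof. by apply: tincl_inj; rewrite !tincl_act coactL_mul. Qed.

Lemma twist_act1 x : twist_act 1 x = x.
Proof. by apply: tincl_inj; rewrite tincl_act -(@actL1 _ _ Lam) actL_1. Qed.

Lemma twist_actM a x y :
  twist_act a (x * y) = copair (twist_act^~ x) (twist_act^~ y) (dcomul G a).
Proof.
have [hx hy] := (twist_actl_rlinear x, twist_actl_rlinear y).
apply: tincl_inj; rewrite tincl_act rmorphM coactL_prod.
have [ix iy] := (coactL_rlinearl (tincl x), coactL_rlinearl (tincl y)).
elim/atensor_ind: (dcomul G a) => [|b c w IH]; first by rewrite !copair0 // rmorph0.
by rewrite !copairD // !copairE // rmorphD rmorphM IH.
Qed.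

Lemma twist_act_one a : twist_act a 1 = alg_str twist (dapp a 1).
Proof. by apply: tincl_inj; rewrite tincl_act rmorph1 coactL_one alghom_str. Qed.

Definition twist_space : gspace G :=
  action_space dualP twist_act_rlinear twist_actl_rlinear twist_actA twist_act1 twist_actM twist_act_one.

Lemma twist_fun s : J s -> exists rho : twist -> k, rlinear rho /\
  forall x, pr s (tincl x) = str (rho x).
Proof.
move=> Js; have /choice [rho rhoE] x := tinclP x Js.
exists rho; split=> //; split=> [x y|r x]; apply: strI.
  by rewrite rmorphD -!rhoE rmorphD prD.
by rewrite rmorphM -!rhoE rmorphM alghom_str pr_str.
Qed.

Lemma twist_in i h : I i -> actL i (aT h 1) \in twist_pred.
Proof.
move=> Ii; apply/asboolP => s Js; rewrite pr_act.
have [a aE] : sunit phi (s * i) by rewrite mulrC -IJ; apply: sprod_in.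
by exists (dapp a h); rewrite aE pr1 ev1.
Qed.

(** Write 1 = sum i_p j_p with i_p in I and j_p in J. Then y = sum i_p (j_p y), and expanding j_p y
    over the e_q leaves the vectors i_p e_q, which are in the lattice because I J = A. *)
Lemma twist_basis : exists (K : finType) (s : K -> AL) (x : K -> twist),
  (forall q, J (s q)) /\ forall y : HL, y = \sum_q aT 1 (pr (s q) y) * tincl (x q).
Proof.
have : sprod phi I J 1 by rewrite IJ; apply: sunit1.
move=> /(sprod_sum hI) [m [i [j [hi hj ij]]]].
exists ('I_m * 'I_n)%type, (fun q => phi (phi0 q.2) * j q.1),
  (fun q => TwistType (twist_in (e q.2) (hi q.1))).
split=> [q|y]; first by apply: (subZ hJ).
rewrite -[LHS]actL_1 ij (llin_sum _ _ (actL_llinl y)).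
rewrite -(pair_bigA _ (fun p q => aT 1 (pr (phi (phi0 q) * j p) y) * actL (i p) (aT (e q) 1))).
apply: eq_bigr => p _; rewrite actL_mul [actL (j p) y](pr_span dualP).
rewrite (llin_sum _ _ (actL_llinr _)); apply: eq_bigr => q _.
by rewrite aT_split (actL_llinr _).2 pr_act.
Qed.

Lemma twist_dual : exists (K : finType) (s : K -> AL) (x : K -> twist) (rho : K -> twist -> k),
  [/\ forall q, J (s q), forall q, rlinear (rho q),
      forall q y, pr (s q) (tincl y) = str (rho q y),
      forall y : HL, y = \sum_q aT 1 (pr (s q) y) * tincl (x q) &
      forall y, y = \sum_q alg_str twist (rho q y) * x q].
Proof.
have [K [s [x [Js xE]]]] := twist_basis.
have /choice [rho rhoE] q := twist_fun (Js q).
exists K, s, x, rho; split=> // [q|q y|y]; try exact: (rhoE q).1; try exact: (rhoE q).2.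
apply: tincl_inj; rewrite [LHS]xE rmorph_sum; apply: eq_bigr => q _.
by rewrite (rhoE q).2 -(@aT_str R G Lam) rmorphM alghom_str.
Qed.

Lemma twist_flat : faithfully_flat (alg_str twist).
Proof.
have [K [s [x [rho [Js hrho rhoE _ xE]]]]] := twist_dual.
have [s0 /twist_fun [nu [hnu nuE]] s01] := J_counit1.
apply: (flat_criterion hrho xE hnu); apply: strI.
by rewrite -nuE rmorph1 pr_one s01 rmorph1.
Qed.

Notation X := twist_space.

Lemma copair_shear b (w : X \*A X) :
  copair tincl (fun y => coactL b (tincl y)) w = tincl (contr b (shear X w)).
Proof.
have hc : rlinear (fun y : X => coactL b (tincl y)).
  exact: (rlinear_compose (alghom_rlinear tincl) (llin_rlinear (coactL_llin Lam b))).
have ht := alghom_rlinear tincl; have hb := twist_act_rlinear b.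
transitivity (tincl (copair (fun x : X => x) (twist_act b) w)).
  move: w; apply: rlinear_ext.
  - exact: copair_rlinear.
  - exact: (rlinear_compose (copair_rlinear (rlinear_id twist) hb) ht).
  by move=> x y; rewrite !copairE // rmorphM tincl_act.
congr (tincl _); have E := shear_trace w b 1; rewrite rmorph1 mulr1 in E.
apply: etrans _ E.
by apply: copair_ext => // y; rewrite mulr1 coact_action.
Qed.

(** The coefficients of w on the x_q (x) x_q' are its pairings with i1 s_q i2 s_q'. By [comul_ind]
    these vanish if the pairings with all Delta(t) (1 (x) b) do, and the latter depend only on the
    shear of w ([copair_shear]). *)
Lemma twist_shear_inj (w : X \*A X) : shear X w = 0 -> w = 0.
Proof.
move=> w0; have [K [s [x [rho [Js hrho rhoE _ xE]]]]] := twist_dual.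
have T0 q q' : tpr tincl tincl (i1 (s q) * i2 (s q')) w = 0.
  apply: (comul_ind (K := fun z => tpr tincl tincl z w = 0)) => //; first exact: tpr0.
    by move=> z z' E E'; rewrite tprD E E' addr0.
  by move=> t b _; rewrite tpr_comul copair_shear w0 /contr copair0 ?rmorph0 ?(llin0 (pr_llinr _)) //;
    apply: dstrapp_rlinear.
have R0 q q' : copair (rho q) (rho q') w = 0.
  apply: strI; rewrite rmorph0 -(T0 q q') tpr_prod.
  have hs p : rlinear (fun y => str (rho p y)) := rlinear_post (astr Lam) (hrho p).
  transitivity (copair (fun y => str (rho q y)) (fun y => str (rho q' y)) w).
    move: w {w0 T0}; apply: rlinear_ext.
    - exact: (rlinear_post (astr Lam) (copair_rlinear (hrho q) (hrho q'))).
    - exact: copair_rlinear.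
    by move=> y z; rewrite !copairE // rmorphM.
  by apply: copair_ext => y; rewrite rhoE.
have -> : w = \sum_q \sum_q' alg_str (X \*A X) (copair (rho q) (rho q') w) * aT (x q) (x q').
  move: w {w0 T0 R0}; apply: rlinear_ext; first exact: rlinear_id.
    have hc q q' := copair_rlinear (hrho q) (hrho q').
    split=> [y z|r y].
      rewrite -big_split; apply: eq_bigr => q _; rewrite -big_split; apply: eq_bigr => q' _.
      by rewrite (rlinearD (hc q q')) rmorphD mulrDl.
    rewrite mulr_sumr; apply: eq_bigr => q _; rewrite mulr_sumr; apply: eq_bigr => q' _.
    by rewrite (rlinearZ (hc q q')) rmorphM mulrA.
  move=> y z; transitivity (tinl X X y * tinr X X z).
    by rewrite -[RHS]/(aT y 1 * aT 1 z) aTM mulr1 mul1r.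
  rewrite {1}[y]xE {1}[z]xE (rmorph_sum (tinl X X)) (rmorph_sum (tinr X X)) mulr_suml.
  apply: eq_bigr => q _; rewrite mulr_sumr; apply: eq_bigr => q' _.
  rewrite !rmorphM !alghom_str mulrACA copairE // rmorphM; congr (_ * _).
  by rewrite -[LHS]/(aT (x q) 1 * aT 1 (x q')) aTM mulr1 mul1r.
by rewrite big1 // => q _; rewrite big1 // => q' _; rewrite R0 rmorph0 mul0r.
Qed.

Lemma antipode_co b h : cv (ginv G) (co b) h = alg_str G (dapp b h).
Proof.
have [hS hd] := (alghom_rlinear (ginv G), dstrapp_rlinear G b).
have hi := rlinear_id G.
transitivity (cv (cv (ginv G) id) (dstrapp G b) h); first by rewrite cvA.
rewrite (cv_ext (f' := ceps G) (g' := dstrapp G b)) //; last exact: (cvV (aid G)).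
by rewrite (cvC (ceps_rlinear G G) hd) cv1.
Qed.

Lemma copair_antipode b h :
  copair (tinl G Lam \o ginv G) (fun g => coactL b (tinl G Lam g)) (gmul G h) =
  alg_str HL (dapp b h).
Proof.
have [hS hc] := (alghom_rlinear (ginv G), co_rlinear b).
rewrite -(alghom_str (tinl G Lam)) -antipode_co (cv_post (tinl G Lam) hS hc).
by apply: copair_ext => // g; apply: coactL1.
Qed.

(** On Delta(t) (1 (x) b) the antipode collapses the expression to b(h) t(1), and t(1) is in R by
    [J_counit]; [comul_ind] extends this to products. *)
Lemma twist_coef h s s' : J s -> J s' ->
  exists r, copair (fun g => pr s (tinl G Lam (ginv G g))) (fun g => pr s' (tinl G Lam g)) (gmul G h) = str r.
Proof.
move=> Js Js'.
suff [r rE] : exists r, tpr (tinl G Lam \o ginv G) (tinl G Lam) (i1 s * i2 s') (gmul G h) = str r.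
  by exists r; rewrite -rE tpr_prod.
apply: (comul_ind (K := fun z => exists r, tpr (tinl G Lam \o ginv G) (tinl G Lam) z (gmul G h) = str r)) => //.
- by exists 0; rewrite tpr0 rmorph0.
- by move=> z w [r rE] [r' rE']; exists (r + r'); rewrite tprD rE rE' rmorphD.
move=> t b Jt; have [r rE] := J_counit Jt; exists (dapp b h * r).
by rewrite tpr_comul copair_antipode -[alg_str HL _]mulr1 pr_str pr_one rE rmorphM.
Qed.

(* The preimage of 1 (x) h is sum s_q(S h1) s_q'(h2) x_q (x) x_q'; by twist_coef its
   coefficients lie in R. *)
Lemma twist_shear_unit h : exists w : X \*A X, shear X w = aT 1 h.
Proof.
have [K [s [x [rho [Js hrho rhoE yE xE]]]]] := twist_dual.
have /choice [r rE] (q : K * K) := twist_coef h (Js q.1) (Js q.2).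
exists (\sum_q \sum_q' alg_str (X \*A X) (r (q, q')) * aT (x q) (x q')).
apply: (contr_inj dualP) => b; apply: tincl_inj; rewrite -copair_shear.
have ht := alghom_rlinear tincl.
have hb : rlinear (fun y : X => coactL b (tincl y)).
  exact: (rlinear_compose ht (llin_rlinear (coactL_llin Lam b))).
have hc := copair_rlinear ht hb.
rewrite (rlinear_sum _ _ hc); under eq_bigr do rewrite (rlinear_sum _ _ hc).
rewrite contrE mul1r alghom_str -copair_antipode.
have [u uE] := atensor_sum (gmul G h).
have hS : rlinear (tinl G Lam \o ginv G) := rlinear_post (tinl G Lam) (alghom_rlinear (ginv G)).
have hT : rlinear (fun g => coactL b (tinl G Lam g)).
  exact: (rlinear_compose (alghom_rlinear (tinl G Lam)) (llin_rlinear (coactL_llin Lam b))).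
have hp (t : AL) : rlinear (pr t) := @llin_rlinear _ _ _ _ (aid Lam) _ (pr_llinr t).
rewrite uE copair_sum //.
transitivity (\sum_q \sum_q' \sum_(p <- u)
   (aT 1 (pr (s q) (tinl G Lam (ginv G p.1))) * tincl (x q)) *
   (aT 1 (pr (s q') (tinl G Lam p.2)) * coactL b (tincl (x q')))).
  apply: eq_bigr => q _; apply: eq_bigr => q' _.
  rewrite (rlinearZ hc) copairE // (@aT_str R G Lam) -(rE (q, q')) uE copair_sum; last 2 first.
  - exact: (rlinear_compose hS (hp _)).
  - exact: (rlinear_compose (alghom_rlinear (tinl G Lam)) (hp _)).
  rewrite -[aT 1 _]/(tinr G Lam _) rmorph_sum mulr_suml; apply: eq_bigr => p _.
  by rewrite rmorphM mulrACA.
transitivity (\sum_(p <- u) \sum_q \sum_q'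
   (aT 1 (pr (s q) (tinl G Lam (ginv G p.1))) * tincl (x q)) *
   (aT 1 (pr (s q') (tinl G Lam p.2)) * coactL b (tincl (x q')))).
  by rewrite [RHS]exchange_big; apply: eq_bigr => q _; rewrite [RHS]exchange_big.
apply: eq_bigr => p _.
rewrite -[(_ \o _) p.1]/(tinl G Lam (ginv G p.1)).
rewrite [tinl G Lam (ginv G p.1) in RHS]yE mulr_suml; apply: eq_bigr => q _.
rewrite [tinl G Lam p.2 in RHS]yE (llin_sum _ _ (coactL_llin Lam b)) mulr_sumr.
by apply: eq_bigr => q' _; rewrite (coactL_llin Lam b).2.
Qed.

Lemma twist_shear_bij : bijective (acopair (tinl X G) (sact X)).
Proof.
have surj z : exists w : X \*A X, shear X w = z.
  elim/atensor_ind: z => [|x h z [w wE]]; first by exists 0; rewrite rmorph0.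
  have [v vE] := twist_shear_unit h; exists (tinl X X x * v + w).
  rewrite rmorphD rmorphM wE vE; congr (_ + _).
  rewrite -[tinl X X x]/(aT x 1) acopairE rmorph1 mulr1 -[tinl X G x]/(aT x 1).
  by rewrite aTM mulr1 mul1r.
have /choice [g gE] := surj; exists g => [w|z]; last exact: gE.
apply/eqP; rewrite -subr_eq0; apply/eqP/twist_shear_inj.
by rewrite rmorphB gE; apply/eqP; rewrite subr_eq0.
Qed.

Definition twist_torsor : torsor G := @Torsor R G X twist_flat twist_shear_bij.

Definition twist_map : alghom (X \*A Lam) HL := acopair tincl (tinr G Lam).

Lemma twist_map_base l : twist_map (aT 1 l) = aT 1 l.
Proof. by rewrite acopairE rmorph1 mul1r. Qed.

Lemma twist_map1 x : twist_map (aT x 1) = tincl x.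
Proof. by rewrite acopairE rmorph1 mulr1. Qed.

Lemma twist_map_bij : bijective twist_map.
Proof.
have [K [s [x [rho [Js hrho rhoE yE xE]]]]] := twist_dual.
pose g (y : HL) : X \*A Lam := \sum_q aT (x q) (pr (s q) y).
have gD y z : g (y + z) = g y + g z.
  rewrite -big_split; apply: eq_bigr => q _.
  by rewrite prD (balancedDr (@aT_balanced R X Lam)).
have gl l y : g (aT 1 l * y) = aT 1 l * g y.
  by rewrite mulr_sumr; apply: eq_bigr => q _; rewrite prl aTM mul1r.
have hl : llin (tinr X Lam) (fun z => g (twist_map z)).
  split=> [y z|l y]; first by rewrite rmorphD gD.
  by rewrite rmorphM twist_map_base gl.
exists g => [z|y].
  move: z; apply: (@llin_ext _ _ _ _ (tinr X Lam)) => // x0.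
  rewrite twist_map1 -[RHS]/(tinl X Lam x0) [x0 in RHS]xE rmorph_sum; apply: eq_bigr => q _.
  by rewrite rhoE aT_split -(@aT_str R X Lam) rmorphM alghom_str.
rewrite [RHS]yE rmorph_sum; apply: eq_bigr => q _.
by rewrite acopairE mulrC.
Qed.

Lemma twist_map_act c : amap (gmul G) (aid Lam) (twist_map (aT c 1)) =
  acopair (acomp (amap (tinl G G) (aid Lam)) (acomp twist_map (tinl X Lam)))
    (acomp (tinl (G \*A G) Lam) (tinr G G)) (sact X c).
Proof.
rewrite twist_map1 -[sact X c]/(\sum_m aT (twist_act (phi0 m) c) (e m)) rmorph_sum.
transitivity (\sum_m amap (tinl G G) (aid Lam) (coactL (phi0 m) (tincl c)) *
    tinl (G \*A G) Lam (tinr G G (e m))).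
  move: (tincl c); apply: (@llin_ext _ _ _ _ (tinr (G \*A G) Lam)) => [||h].
  - exact: amap_llin.
  - apply: llin_suml => m; apply: llin_mulr.
    by split=> [y z|l y]; rewrite ?(coactL_llin Lam _).1 ?rmorphD // (coactL_llin Lam _).2 amap_l.
  rewrite amapE rmorph1 [gmul G h](contr_expand dualP) -[LHS]/(tinl (G \*A G) Lam _) rmorph_sum.
  apply: eq_bigr => m _; rewrite coactL1 amapE rmorph1.
  rewrite -[aT (tinl G G _) 1]/(tinl (G \*A G) Lam (tinl G G (co (phi0 m) h))) -rmorphM.
  congr (tinl _ _ _); rewrite -[RHS]/(aT (co (phi0 m) h) 1 * aT 1 (e m)) aTM mulr1 mul1r.
  by [].
apply: eq_bigr => m _; rewrite acopairE; congr (_ * _).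
rewrite -[RHS]/(amap (tinl G G) (aid Lam) (twist_map (aT (twist_act (phi0 m) c) 1))).
by rewrite twist_map1 tincl_act.
Qed.

Definition twist_triv : trivialisation X Lam :=
  Trivialisation twist_map_base twist_map_bij twist_map_act.

(** If t takes values in R on the lattice, then t i does so on O_G for every i in I. Hence t I lies
    in A, and t in the inverse J of I. *)
Lemma twist_tlat : tlat (X := twist_torsor) twist_triv = J.
Proof.
apply: pred_ext => t; split=> [ht|Jt b]; last first.
  by rewrite /tb -[twist_triv _]/(twist_map (aT b 1)) twist_map1; apply: tinclP.
have : sprod phi I J 1 by rewrite IJ; apply: sunit1.
rewrite -[t]mulr1; apply: (@sprod_least _ _ phi I J (fun z => J (t * z))); first exact: mul_sub.
move=> i j Ii Jj; rewrite mulrA.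
have [a ->] : sunit phi (t * i).
  apply: sunit_test => h; have [r rE] := ht (TwistType (twist_in h Ii)).
  exists r; rewrite -rE -pr_act.
  by rewrite /tb -[twist_triv _]/(twist_map (aT _ 1)) twist_map1.
exact: isubM.
Qed.

End Basis.

Lemma torsor_of_lattice : exists (X : torsor G) (tau : trivialisation X Lam), tlat tau = J.
Proof.
have [n [e [phi0 dualP]]] := dual_basis G.
by exists (twist_torsor dualP), (twist_triv dualP); apply: twist_tlat.
Qed.

End TwistedForm.

(** * Primitive classes come from torsors *)

Section Descent.
Variables (R : comPzRingType) (G : gscheme R) (Rc Fc : algebra R) (j : alghom Rc Fc).
Hypothesis strI : injective (alg_str Rc).
Hypothesis jI : injective j.
Notation AA := (cdual G).
Notation A2 := (AA \*A AA).
Notation i1 := (tinl AA AA).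
Notation i2 := (tinr AA AA).
Hypothesis inj1 : forall x y : fsum (tinl AA Fc), K0 x -> K0 y -> Phi x = Phi y -> K0eq x y.
Hypothesis inj2 : forall x y : fsum (tinl A2 Fc), K0 x -> K0 y -> Phi x = Phi y -> K0eq x y.

Lemma pr2_ext (z : A2 \*A Rc) h h' :
  pr2 (amap (aid A2) j z) (aT h 1) (aT h' 1) = j (pr2 z (aT h 1) (aT h' 1)).
Proof.
move: z; apply: (@llin_ext _ _ _ _ j) => [||w].
- split=> [x y|l x]; first by rewrite rmorphD (pr2_llin _ _).1.
  by rewrite rmorphM amapE (pr2_llin _ _).2.
- split=> [x y|l x]; first by rewrite (pr2_llin _ _).1 rmorphD.
  by rewrite (pr2_llin _ _).2 rmorphM.
by rewrite amapE rmorph1 !pr21 !pr20_dpair alghom_str.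
Qed.

Lemma ext2_inj : injective (amap (aid A2) j).
Proof.
move=> z z' E; apply: pr2_inj => h h'; apply: jI.
by rewrite -!pr2_ext E.
Qed.

(** The image of an A2-submodule under the injective map A2 (x) Rc -> A2 (x) Fc is itself an
    A2-submodule, so the span adds nothing to it. *)
Lemma epush_inj (I I' : A2 \*A Rc -> Prop) :
  @is_sub _ _ (tinl A2 Rc) (A2 \*A Rc)^o I -> @is_sub _ _ (tinl A2 Rc) (A2 \*A Rc)^o I' ->
  epush j I = epush j I' -> I = I'.
Proof.
have H K : @is_sub _ _ (tinl A2 Rc) (A2 \*A Rc)^o K -> forall t, epush j K (amap (aid A2) j t) -> K t.
  move=> hK t Kt; suff [a Ka /ext2_inj ->] : exists2 a, K a & amap (aid A2) j t = amap (aid A2) j a.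
    by [].
  elim: Kt => [|s _ z [a Ka ->] _ [b Kb ->]].
    by exists 0; [exact: (sub0 hK)|rewrite rmorph0].
  exists (tinl A2 Rc s * a + b); first by apply: (subD hK) => //; apply: (subZ hK).
  by rewrite rmorphD rmorphM ext_comm.
move=> hI hI' E; apply: pred_ext => t; split=> It; apply: H => //.
  by rewrite -E; apply: (spush_in (tinl A2 Fc) (amap (aid A2) j)).
by rewrite E; apply: (spush_in (tinl A2 Fc) (amap (aid A2) j)).
Qed.

Section Cocycle.
Variable E : AA \*A Fc -> Prop.
Variable E' : AA \*A Fc -> Prop.
Notation phi := (tinl AA Fc).
Hypothesis EE' : sprod phi E E' = sunit phi.
Hypothesis hE : @is_sub _ _ phi (AA \*A Fc)^o E.

Lemma Gamma_aug t : Gamma (G := G) (Fc := Fc) t -> amap (aug G) (aid Fc) t = 1.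
Proof. by move=> ht; rewrite amap_aug (Gamma_ev1 ht). Qed.

Lemma fpush_aug_aug I : fpush (aug G) (fpush (aug G) I) = fpush (Lam := Fc) (aug G) I.
Proof. by apply: fpush_comp => a; rewrite [aug G a]augE alghom_str. Qed.

(* Two applications of the counit show that both group elements are units of A. *)
Lemma cocycle_trivial t : Gamma t -> E = sprod phi (sprod phi (fpush (aug G) E) E) (sprin phi t) ->
  sprin phi t = sunit phi.
Proof.
move=> ht EE.
have hp : sprod phi (fpush (aug G) E) (sprin phi t) = sunit phi.
  rewrite -EE' [in RHS]EE -[sprod phi (sprod phi _ E) _]sprodA [sprod phi E _]sprodC sprodA -sprodA EE'.
  by rewrite sprodr1 //; apply: sprod_sub.
have ha : fpush (aug G) E = sunit phi.
  have := congr1 (fpush (aug G)) hp.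
  rewrite fpush_prod fpush_aug_aug fpush_prin Gamma_aug // sprin1 fpush_unit.
  by rewrite sprodr1 //; apply: fpush_sub.
by move: hp; rewrite ha sprod1 //; apply: sprin_sub.
Qed.

(** The map eps (x) 1 sends t1 to 1 and leaves E = eps(E) E t2, which is the situation of
    [cocycle_trivial]; 1 (x) eps treats t1 in the same way. *)
Lemma cocycle_split t1 t2 : Gamma t1 -> Gamma t2 ->
  fpush (dcomul G) E = sprod (tinl A2 Fc) (sprod (tinl A2 Fc) (fpush i1 E) (fpush i2 E))
    (sprin (tinl A2 Fc) (amap i1 (aid Fc) t1 * amap i2 (aid Fc) t2)) ->
  fpush (dcomul G) E = sprod (tinl A2 Fc) (fpush i1 E) (fpush i2 E).
Proof.
move=> h1 h2 EE; have idE (f : alghom AA AA) : f =1 id -> fpush f E = E by move=> ?; apply: fpush_id.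
have a1 a : acopair (aug G) (aid AA) (i1 a) = aug G a.
  by rewrite -[i1 a]/(aT a 1) acopairE rmorph1 mulr1.
have a2 a : acopair (aug G) (aid AA) (i2 a) = a.
  by rewrite -[i2 a]/(aT 1 a) acopairE rmorph1 mul1r.
have b1 a : acopair (aid AA) (aug G) (i1 a) = a.
  by rewrite -[i1 a]/(aT a 1) acopairE rmorph1 mulr1.
have b2 a : acopair (aid AA) (aug G) (i2 a) = aug G a.
  by rewrite -[i2 a]/(aT 1 a) acopairE rmorph1 mul1r.
have sp t : fpush (aid AA) (sprin phi t) = sprin phi t by apply: fpush_id => //; apply: sprin_sub.
have T2 : sprin phi t2 = sunit phi.
  apply: cocycle_trivial => //; have := congr1 (fpush (acopair (aug G) (aid AA))) EE.
  rewrite -sprinM -!fpush_prin !fpush_prod (fpush_comp (h := aid AA)); last exact: augl_comul.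
  rewrite !(fpush_comp _ a1) !(fpush_comp (h := aid AA) _ a2) idE // sp.
  rewrite fpush_prin Gamma_aug // sprin1 sprod1 //; exact: sprin_sub.
have T1 : sprin phi t1 = sunit phi.
  apply: cocycle_trivial => //; have := congr1 (fpush (acopair (aid AA) (aug G))) EE.
  rewrite -sprinM -!fpush_prin !fpush_prod (fpush_comp (h := aid AA)); last exact: augr_comul.
  rewrite !(fpush_comp _ b2) !(fpush_comp (h := aid AA) _ b1) idE // sp.
  rewrite [fpush _ (sprin _ t2)]fpush_prin Gamma_aug // sprin1 [sprod _ _ (sunit _)]sprodr1; last exact: sprin_sub.
  by rewrite [sprod phi E _]sprodC.
rewrite EE -sprinM -!fpush_prin T1 T2 !fpush_unit sprod1; last exact: sunit_sub.
by rewrite sprodr1 //; apply: sprod_sub.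
Qed.

End Cocycle.

(** The torsor must have as dual lattice the inverse of [Phi x], which is [Phi] of the opposite sum.
    The comultiplication identity descends to [Rc] for [Phi x] first and then passes to the
    inverse. *)
Lemma primitive_class (x : fsum (tinl AA Rc)) : K0 x -> primitive j x ->
  exists (X : torsor G) (tau : trivialisation X Rc),
    K0bar_eq j (Gamma (Fc := Fc) (G := G)) x (class tau).
Proof.
move=> hx /(primitiveP j inj2 hx) [_ [t1 [t2 [h1 h2 ->]]] EE].
pose I := Phi x; pose J := Phi (fneg x).
have [hI hJ] : @is_sub _ _ (tinl AA Rc) (AA \*A Rc)^o I /\ @is_sub _ _ (tinl AA Rc) (AA \*A Rc)^o J.
  by split; apply: Phi_sub.
have IJ : sprod (tinl AA Rc) I J = sunit (tinl AA Rc) by apply: Phi_neg.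
have comulI : fpush (dcomul G) I = sprod (tinl A2 Rc) (fpush i1 I) (fpush i2 I).
  apply: epush_inj; [exact: fpush_sub|exact: sprod_sub|].
  rewrite epush_prod !epush_fpush; apply: (@cocycle_split _ (epush j J) _ _ t1 t2) => //.
  - by rewrite -epush_prod IJ epush_unit.
  - exact: spush_sub.
have comulJ : fpush (dcomul G) J = sprod (tinl A2 Rc) (fpush i1 J) (fpush i2 J).
  apply: (@sprod_cancel _ _ (tinl A2 Rc) _ _ (fpush (dcomul G) I)).
  - exact: fpush_sub.
  - exact: sprod_sub.
  - by rewrite -fpush_prod sprodC IJ fpush_unit.
  rewrite comulI sprodACA -!fpush_prod [sprod _ J I]sprodC IJ !fpush_unit.
  by rewrite sprod1 //; apply: sunit_sub.
have [X [tau tauJ]] := torsor_of_lattice strI hI hJ IJ comulJ.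
exists X, tau; apply/(K0bar_eqP j inj1) => //; first exact: class_gen.
exists 1; first exact: Gamma_one.
rewrite sprin1 sprodr1; last exact: spush_sub.
congr (epush j); apply: (sprod_cancel hI) IJ _; first exact: Phi_sub.
by rewrite -tauJ; apply: Phi_class.
Qed.

End Descent.

(** * Finite generation of the algebras in use *)

Section Spanning.
Variable R : comPzRingType.

Definition spanned (k S : comPzRingType) (psi : {rmorphism k -> S}) : Prop :=
  exists n (e : 'I_n -> S), forall x, exists c, x = \sum_j psi (c j) * e j.

Lemma spanned_fin (k S : comPzRingType) (psi : {rmorphism k -> S}) (K : finType) (e : K -> S) :
  (forall x, exists c, x = \sum_q psi (c q) * e q) -> spanned psi.
Proof.
move=> H; exists #|K|, (e \o enum_val) => x; have [c ->] := H x.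
exists (c \o enum_val); rewrite (reindex (enum_val : 'I_#|K| -> K)) //.
exact/onW_bij/enum_val_bij.
Qed.

Lemma spanned_ext (A Lam : algebra R) : spanned (alg_str A) -> spanned (tinr A Lam).
Proof.
move=> [n [e eE]]; exists n, (tinl A Lam \o e); elim/atensor_ind => [|a l z [c ->]].
  by exists (fun=> 0); rewrite big1 // => j _; rewrite rmorph0 mul0r.
have [d ->] := eE a; exists (fun j => l * alg_str Lam (d j) + c j).
have -> : aT (\sum_j alg_str A (d j) * e j) l = \sum_j tinr A Lam (l * alg_str Lam (d j)) * tinl A Lam (e j).
  rewrite aT_split -[aT _ 1]/(tinl A Lam _) rmorph_sum mulr_sumr; apply: eq_bigr => j _.
  by rewrite !rmorphM !alghom_str mulrA.
by rewrite -big_split; apply: eq_bigr => j _; rewrite rmorphD mulrDl.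
Qed.

Lemma spanned_tensor (A B : algebra R) :
  spanned (alg_str A) -> spanned (alg_str B) -> spanned (alg_str (A \*A B)).
Proof.
move=> /(spanned_ext B) [n [e eE]] [m [f fE]].
apply: (@spanned_fin _ _ _ ('I_n * 'I_m)%type (fun q => tinr A B (f q.2) * e q.1)) => x.
have [b ->] := eE x; have /choice [c cE] := fun j => fE (b j).
exists (fun q => c q.1 q.2).
rewrite -(pair_bigA _ (fun p q => alg_str (A \*A B) (c p q) * (tinr A B (f q) * e p))).
apply: eq_bigr => p _; rewrite [b p]cE rmorph_sum mulr_suml; apply: eq_bigr => q _.
by rewrite rmorphM alghom_str mulrA.
Qed.

Lemma spanned_dual (G : gscheme R) : spanned (alg_str (cdual G)).
Proof.
have [n [e [phi dualP]]] := dual_basis G; exists n, phi => f.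
by exists (fun i => dapp f (e i)); apply: dual_sum.
Qed.

Lemma tinl2_inj (G : gscheme R) (Lam : algebra R) : injective (alg_str Lam) ->
  injective (tinl (cdual G \*A cdual G) Lam).
Proof.
move=> strI w w' E; apply: dpair_inj => h h'; apply: strI.
rewrite -!pr20_dpair -!pr21.
by rewrite -[aT w 1]/(tinl (cdual G \*A cdual G) Lam w) E.
Qed.

End Spanning.

(** * The number field case *)

Section NumberFieldInstance.
Variables (F : fieldExtType rat) (Fc : closedFieldType) (iota : {rmorphism F -> Fc}).
Notation R := (ring_of_integers F).

Lemma R_to_Fc_inj : injective (R_to_Fc iota).
Proof. by move=> x y /fmorph_inj /val_inj. Qed.

Lemma Rc_str_inj : injective (alg_str (Rc iota)).
Proof.
move=> x y E; apply: R_to_Fc_inj.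
by rewrite -[LHS]/(val (alg_str (Rc iota) x)) E.
Qed.

Lemma Rc_to_Fc_inj : injective (Rc_to_Fc iota).
Proof. exact: val_inj. Qed.

Lemma R_integral (x : R) : integralOver (intr : {rmorphism int -> R}) x.
Proof.
have /asboolP [p pm pr] := ic_valP x; exists p => //.
apply/rootP/val_inj; rewrite rmorph0 -[RHS](rootP pr).
rewrite -[LHS]/((val : {rmorphism R -> F}) _) -horner_map; congr (_.[_]).
by rewrite -map_poly_comp; apply: eq_map_poly => c; exact: (rmorph_int (val : {rmorphism R -> F})).

Qed.

Lemma Fc_natr_neq0 n : (0 < n)%N -> (n%:R : Fc) != 0.
Proof.
move=> n0; have -> : (n%:R : Fc) = iota (in_alg F (n%:R : rat)) by rewrite !rmorph_nat.
by rewrite !fmorph_eq0 Num.Theory.pnatr_eq0 -lt0n.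
Qed.

(** Being finite over R, A is integral over Z. Being finite over the field [Fc] of characteristic 0,
    A (x) Fc is pi-regular and inverts the positive integers. *)
Lemma Phi_inj_Fc (A : algebra R) : spanned (alg_str A) -> injective (tinl A (Fc_alg iota)) ->
  forall x y : fsum (tinl A (Fc_alg iota)), K0 x -> K0 y -> Phi x = Phi y -> K0eq x y.
Proof.
move=> hA phiI; apply: Phi_inj2 => //.
- have [n [e eE]] := hA.
  exact: (span_integral_int eE R_integral).
- move=> n n0; exists (tinr A (Fc_alg iota) (n%:R^-1 : Fc)).
  by rewrite -(rmorph_nat (tinr A (Fc_alg iota))) -rmorphM -[_ * _]/((n%:R : Fc) / n%:R) divff ?rmorph1 // Fc_natr_neq0.
have [n [e eE]] := spanned_ext (Fc_alg iota) hA.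
apply: (@finite_dim_preg Fc _ (tinr A (Fc_alg iota))).
exact: (span_integral (k := Fc) eE).
Qed.

End NumberFieldInstance.

Theorem theorem6p10 (F : fieldExtType rat) (Fc : closedFieldType)
    (iota : {rmorphism F -> Fc}) (Fc_algebraic : forall z : Fc, algebraicOver iota z)
    (G : gscheme (ring_of_integers F)) :
  (forall (X : torsor G) (tau : trivialisation X (Rc iota)),
     primitive (Rc_to_Fc iota) (class tau))
  /\
  (no_local_local_at_2 G ->
   forall x : fsum (tinl (cdual G) (Rc iota)),
     primitive (Rc_to_Fc iota) x <->
     K0 x /\
     exists (X : torsor G) (tau : trivialisation X (Rc iota)),
       K0bar_eq (Rc_to_Fc iota) (Gamma (Fc := Fc_alg iota) (G := G))
         x (class tau)).
Proof.
have inj1 := Phi_inj_Fc (spanned_dual G) (tinl_inj (G := G) (Lam := Fc_alg iota) (@R_to_Fc_inj _ _ iota)).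
have inj2 := Phi_inj_Fc (spanned_tensor (spanned_dual G) (spanned_dual G))
  (tinl2_inj (G := G) (Lam := Fc_alg iota) (@R_to_Fc_inj _ _ iota)).
have strI := @Rc_str_inj _ _ iota; have jI := @Rc_to_Fc_inj _ _ iota.
split=> [X tau|_ x]; first exact: class_primitive.
split=> [px|[hx [X [tau]]]].
  by have hx := px.1; split=> //; apply: primitive_class.
exact: class_image_primitive.
Qed.
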